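(* Let $n=1$, $s=\frac12$, $N\ge2$, $\Lambda\ge1$, and let $a(x,y)=a(x-y)$ with $a$ measurable, $a(\xi)=a(-\xi)$ and $\Lambda^{-1}\le a\le\Lambda$. Let $\Omega\subset\mathbb{R}$ be open, $B_{2R}(x_0)\Subset\Omega$, and let $u$ be a weak solution of $\mathcal{L}_{1/2}u=|\mathbf{d}_{1/2,a}u|^2u+\mu$ in $\Omega$. If $\mu\in L^\gamma(B_{2R}(x_0);\mathbb{R}^N)$ with $\gamma\in(1,\infty)$, then $u\in C^{1-\frac1\gamma}(B_R(x_0);\mathbb{R}^N)$. If in addition $a\equiv1$ and $\mu\in L^2(B_{2R}(x_0);\mathbb{R}^N)$, then $u\in W^{1,2}(B_R(x_0);\mathbb{R}^N)$.
   Context: Notation with $p=2$: $d_su(x,y)=\frac{u(x)-u(y)}{|x-y|^s}$; $\mathcal{C}\Omega=(\mathbb{R}^n\times\mathbb{R}^n)\setminus(\Omega^c\times\Omega^c)$; $\widetilde{\mathcal{E}}(u;\Omega)=\iint_{\mathcal{C}\Omega}|d_su|^2\frac{dxdy}{|x-y|^n}$; $\widehat{H}^s(\Omega;\mathbb{R}^N)=\{u\in L^2(\Omega;\mathbb{R}^N):\widetilde{\mathcal{E}}(u;\Omega)<\infty\}$, $\widehat{H}^s_{00}(\Omega;\mathbb{R}^N)=\{u\in\widehat H^s(\mathbb{R}^n;\mathbb{R}^N):u\equiv0\text{ on }\mathbb{R}^n\setminus\Omega\}$; $|\mathbf{d}_{s,a}u|^2(x)=\int_{\mathbb{R}^n}\frac{|u(x)-u(y)|^2}{|x-y|^{2s}}\frac{a(x,y)}{|x-y|^n}dy$.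 A weak solution of $\mathcal{L}_su=|\mathbf{d}_{s,a}u|^2u+\mu$ in $\Omega$ (with $\mu\in L^{p_*}(\Omega;\mathbb{R}^N)$, $p_*=\max\{2n/(n+2s),1\}$) is $u\in\widehat{H}^s(\Omega;\mathbb{R}^N)$ with $|u|=1$ a.e. on $\mathbb{R}^n$ such that for all $\phi\in\widehat{H}^s_{00}(\Omega;\mathbb{R}^N)$: $\iint_{\mathcal{C}\Omega}d_su\cdot d_s\phi\frac{a(x,y)}{|x-y|^n}dxdy=\int_\Omega|\mathbf{d}_{s,a}u|^2u\cdot\phi\,dx+\int_\Omega\mu\cdot\phi\,dx$. *)

(* Defs.v *)
From HB Require Import structures.
From mathcomp Require Import all_boot all_order all_algebra.
From mathcomp Require Import all_classical all_reals all_analysis.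
Set Implicit Arguments. Unset Strict Implicit. Unset Printing Implicit Defensive.
Import Order.TTheory GRing.Theory Num.Theory.
Import numFieldNormedType.Exports.
Local Open Scope classical_set_scope.
Local Open Scope ring_scope.

Section Defs.
Variables (R : realType) (N : nat).

Definition leb := (@lebesgue_measure R).
Definition leb2 := (leb \x leb)%E.

(* R^N-valued functions are represented by their components u x i *)
Definition vdot (v w : 'I_N -> R) : R := \sum_(i < N) v i * w i.
Definition vnorm (v : 'I_N -> R) : R := Num.sqrt (vdot v v).

Definition COmega (Om : set R) : set (R * R) := ~` (~` Om `*` ~` Om).

(* |d_s u|^2 (x,y) |x-y|^{-n} with n = 1, s = 1/2 :
   |u(x)-u(y)|^2 / |x-y|^2 *)
Definition en_density (u : R -> 'I_N -> R) (z : R * R) : R :=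
  vdot (fun i => u z.1 i - u z.2 i) (fun i => u z.1 i - u z.2 i)
  / (z.1 - z.2) ^+ 2.

Definition energy (u : R -> 'I_N -> R) (Om : set R) : \bar R :=
  (\int[leb2]_(z in COmega Om) (en_density u z)%:E)%E.

Definition Lp_on (p : R) (D : set R) (f : R -> 'I_N -> R) : Prop :=
  forall i : 'I_N, measurable_fun D (fun x => f x i) /\
    (\int[leb]_(x in D) ((`|f x i| `^ p)%:E) < +oo)%E.

Definition Hhat (Om : set R) (u : R -> 'I_N -> R) : Prop :=
  (forall i : 'I_N, measurable_fun setT (fun x => u x i)) /\
  Lp_on 2 Om u /\ (energy u Om < +oo)%E.

Definition Hhat00 (Om : set R) (phi : R -> 'I_N -> R) : Prop :=
  Hhat setT phi /\ (forall x, ~ Om x -> forall i : 'I_N, phi x i = 0).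

Definition dsa2 (a : R -> R) (u : R -> 'I_N -> R) (x : R) : \bar R :=
  (\int[leb]_y ((vdot (fun i => u x i - u y i) (fun i => u x i - u y i)
                 / (x - y) ^+ 2 * a (x - y))%:E))%E.

Definition lhs_integrand a (u phi : R -> 'I_N -> R) (z : R * R) : R :=
  vdot (fun i => u z.1 i - u z.2 i) (fun i => phi z.1 i - phi z.2 i)
  * a (z.1 - z.2) / (z.1 - z.2) ^+ 2.

Definition weak_solution (a : R -> R) (Om : set R)
    (u mu : R -> 'I_N -> R) : Prop :=
  Hhat Om u /\
  {ae leb, forall x, vnorm (u x) = 1} /\
  (forall phi, Hhat00 Om phi ->
     leb2.-integrable (COmega Om) (fun z => (lhs_integrand a u phi z)%:E) ->
     leb.-integrable Om (fun x => (fine (dsa2 a u x) * vdot (u x) (phi x))%:E) ->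
     leb.-integrable Om (fun x => (vdot (mu x) (phi x))%:E) ->
     (\int[leb2]_(z in COmega Om) (lhs_integrand a u phi z)%:E =
      \int[leb]_(x in Om) (fine (dsa2 a u x) * vdot (u x) (phi x))%:E
      + \int[leb]_(x in Om) (vdot (mu x) (phi x))%:E)%E).

Definition holder_on (alpha : R) (D : set R) (u : R -> 'I_N -> R) : Prop :=
  exists v : R -> 'I_N -> R,
    {ae leb, forall x, D x -> forall i, v x i = u x i} /\
    exists C : R, forall x y, D x -> D y ->
      vnorm (fun i => v x i - v y i) <= C * (`|x - y| `^ alpha).

Definition test_fun (D : set R) (phi : R -> R) : Prop :=
  (forall (k : nat) (x : R), derivable (derive1n k phi) x 1) /\
  exists K : set R, compact K /\ K `<=` D /\ (forall x, ~ K x -> phi x = 0).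

Definition W12_on (D : set R) (u : R -> 'I_N -> R) : Prop :=
  Lp_on 2 D u /\
  exists g : R -> 'I_N -> R, Lp_on 2 D g /\
    forall (i : 'I_N) (phi : R -> R), test_fun D phi ->
      (\int[leb]_(x in D) (u x i * derive1 phi x)%:E
       = - \int[leb]_(x in D) (g x i * phi x)%:E)%E.

End Defs.

(* Main.v *)
(** Hoelder continuity. Write [du = u(x) - u(y)]. Testing the equation with [f u_j] and [f u_i] and
    using [|u| = 1] turns it into a conservation law for the antisymmetric quantities
    [u_i(x) u_j(y) - u_j(x) u_i(y)], so that the critical term [|du|^2 u] is a product of a divergence
    free quantity with [du]. For [phi], [g] of finite energy the function
    [f = sum_k (Phi_k - Phi_(k-1)) (g - G_k)], where [Phi_k], [G_k] are dyadic averages, has [df] equal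
    to [phi dg] up to an error quadratic in the energies: this paraproduct replaces the duality of the
    Hardy space and BMO. With hole filling the energy on balls decays like a power, and [u] has a
    Hoelder representative. A cut-off copy [W] of a component then solves a linear equation whose right
    hand side has a Morrey type decay; the increments [W(x + h) - W(x)] satisfy the same kind of
    equation, which gives the Hoelder exponent of the right hand side, and Caccioppoli's inequality
    doubles the decay exponent of the energy until [1 - 1/gam] is reached.

    Square integrable derivative. For [gam = 2] the same increments are shown to satisfy
    [|W(. + h) - W|_2^2 <= C h^(3/2)], so that the right hand side acts on [L^2]. Testing with
    [sum_(j < n) 2^j D_(-h_j) D_(h_j) W], [h_j = h_0 / 2^j], bounds [sum_j 4^j |D_(h_j) D_(h_j) W|_2^2],
    hence the norms of the dyadic difference quotients. A coarse quotient is an average of translates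
    of a finer one, and a variance identity bounds their distance by the difference of the squared
    norms; the quotients thus converge in [L^2], to the weak derivative. *)

Require Import Defs.
From HB Require Import structures.
From mathcomp Require Import all_boot all_order all_algebra.
From mathcomp Require Import all_classical all_reals all_analysis.
From mathcomp Require Import measurable_realfun.
From mathcomp Require Import ring lra.
Set Implicit Arguments. Unset Strict Implicit. Unset Printing Implicit Defensive.
Import Order.TTheory GRing.Theory Num.Theory.
Import numFieldNormedType.Exports.
Local Open Scope classical_set_scope.
Local Open Scope ring_scope.

(* [lra] reads every hypothesis except those of a section. Irrelevant hypotheses are replaced by [tt]
   (those of a section cannot be cleared), and the hypotheses of a section are copied as a last resort. *)
Ltac order_context := repeat match goal with x := _ |- _ => clearbody x end;
  repeat match goal with H : ?T |- _ => lazymatch T with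
    | is_true (_ <= _) => fail | is_true (_ < _) => fail | is_true (_ && _) => fail
    | is_true (~~ _) => fail | is_true (_ == _) => fail
    | _ = _ => fail | _ /\ _ => fail | unit => fail | _ => clear H; assert (H := tt) end end.
Ltac goal_context := lazymatch goal with |- ?G => repeat
  match goal with H : ?T |- _ =>
    lazymatch T with is_true _ => idtac | _ = _ => idtac end;
    match goal with v : _ |- _ =>
      lazymatch T with context [v] => lazymatch G with context [v] => fail | _ => clear H; assert (H := tt) end end
    end
  end end.
Definition copied (P : Prop) (_ : P) : Type := unit.
Ltac copy_context := repeat match goal with H : is_true _ |- _ => lazymatch goal with
  | _ : copied H |- _ => fail
  | _ => let K := fresh in assert (K := H); assert (copied H) by exact tt; assert (copied K) by exact tt
  end end.
Ltac in_order_context tac := order_context; first [goal_context; tac | tac].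
Ltac arith tac := first [in_order_context tac | tac | copy_context; in_order_context tac].
Ltac clra := arith ltac:(lra).
Ltac cnra := arith ltac:(nra).

(** * Integration with real bounds *)

Section RealInequalities.
Variable R : realType.
Implicit Types (x y : R) (b : bool).

Definition ind b : R := if b then 1 else 0.

Lemma ind_ge0 b : 0 <= ind b. Proof. by case: b. Qed.
Lemma ind_le1 b : ind b <= 1. Proof. by case: b => /=. Qed.
Lemma indT b : b -> ind b = 1. Proof. by case: b. Qed.
Lemma indF b : ~~ b -> ind b = 0. Proof. by case: b. Qed.
Lemma le_ind b1 b2 : (b1 -> b2) -> ind b1 <= ind b2.
Proof. by case: b1 => [/(_ isT) ->//|_]; exact: ind_ge0. Qed.

Lemma ind_sqr b : ind b ^+ 2 = ind b.
Proof. by case: b; rewrite /ind ?expr1n ?expr0n. Qed.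

Lemma inv_sqr_ge0 x : 0 <= (x ^+ 2)^-1. Proof. by rewrite invr_ge0 sqr_ge0. Qed.
Lemma sqr_distC x y : (x - y) ^+ 2 = (y - x) ^+ 2. Proof. by rewrite -sqrrN opprB. Qed.
Lemma sqr_gt0 x : x != 0 -> 0 < x ^+ 2. Proof. by move=> x0; rewrite exprn_even_gt0. Qed.
Lemma sqr_normr x : `|x| ^+ 2 = x ^+ 2. Proof. by rewrite real_normK ?num_real. Qed.
Lemma norm_le_sqr x y : `|x| <= y -> x ^+ 2 <= y ^+ 2.
Proof. by move=> xy; rewrite -sqr_normr lerXn2r ?nnegrE//; exact: le_trans xy. Qed.

Lemma le_sub_sqr (t x y : R) : y - x = t ^+ 2 -> x <= y.
Proof. by move=> h; rewrite -subr_ge0 h sqr_ge0. Qed.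

Lemma amgm x y (t : R) : 0 < t -> x * y <= t * x ^+ 2 + y ^+ 2 / (4 * t).
Proof.
move=> t0; have -> : t * x ^+ 2 + y ^+ 2 / (4 * t) = x * y + (2 * t * x - y) ^+ 2 / (4 * t).
  by field; exact: lt0r_neq0.
by rewrite lerDl mulr_ge0 ?sqr_ge0// invr_ge0; clra.
Qed.

Lemma amgm_norm x y (t : R) : 0 < t -> `|x * y| <= t * x ^+ 2 + y ^+ 2 / t.
Proof.
move=> t0; rewrite normrM; apply: le_trans (amgm _ _ t0) _; rewrite !sqr_normr lerD2l.
by apply: ler_wpM2l; [exact: sqr_ge0|rewrite lef_pV2 ?posrE; clra].
Qed.

Lemma sqrD2_le x y : (x + y) ^+ 2 <= 2 * (x ^+ 2 + y ^+ 2).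
Proof. by have := sqr_ge0 (x - y); clra. Qed.

Lemma sqrD3_le x y (t : R) : (x + y + t) ^+ 2 <= 3 * (x ^+ 2 + y ^+ 2 + t ^+ 2).
Proof. by have := sqr_ge0 (x - y); have := sqr_ge0 (x - t); have := sqr_ge0 (y - t); clra. Qed.

Lemma sqr_le_of_amgm x p q : 0 <= x -> 0 <= p -> 0 <= q ->
  (forall t, 0 < t -> x <= t * p + q / (4 * t)) -> x ^+ 2 <= p * q.
Proof.
move=> x0 p0 q0 h; have [->|xn] := eqVneq x 0; first by rewrite expr0n mulr_ge0.
have xp : 0 < x by rewrite lt_def xn.
have [pz|pp] := eqVneq p 0.
  have := h ((q + 1) / x) (divr_gt0 (ltr_wpDl q0 ltr01) xp); rewrite pz mulr0 add0r.
  rewrite ler_pdivlMr; last by rewrite !(mulr_gt0, invr_gt0)//; clra.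
  by rewrite (_ : x * (4 * ((q + 1) / x)) = 4 * (q + 1)); [clra|field].
have {pp}pp : 0 < p by rewrite lt_def pp.
have := h (x / (2 * p)) (divr_gt0 xp (mulr_gt0 (ltr0Sn _ 1) pp)).
rewrite (_ : x / (2 * p) * p + q / (4 * (x / (2 * p))) = (x ^+ 2 + p * q) / (2 * x)); last first.
  by field; rewrite xn lt0r_neq0.
by rewrite ler_pdivlMr; [clra|rewrite mulr_gt0].
Qed.

End RealInequalities.
Arguments ind {R}.
Arguments indT {R b}.
Arguments indF {R b}.

Lemma eqW d (T : porderType d) (x y : T) : x = y -> (x <= y)%O.
Proof. by move->. Qed.

Section L1Bound.
Context d (T : measurableType d) (R : realType).
Variable m : {measure set T -> \bar R}.
Implicit Types (F G : T -> R) (c : R).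

Definition L1le F c :=
  measurable_fun setT F /\ (\int[m]_x (`|F x|)%:E <= c%:E)%E.

Lemma measurable_EFin_norm F : measurable_fun setT F ->
  measurable_fun setT (fun x : T => (`|F x|)%:E : \bar R).
Proof. by move=> mF; apply/measurable_EFinP; exact: measurableT_comp. Qed.

Lemma L1le_measurable F c : L1le F c -> measurable_fun setT F.
Proof. by case. Qed.

Lemma L1le_integrable F c : L1le F c -> m.-integrable setT (EFin \o F).
Proof.
case=> mF Fc; apply/integrableP; split; first exact/measurable_EFinP.
by apply: le_lt_trans (ltry c); rewrite /=.
Qed.

Lemma EFin_Rintegral F c : L1le F c -> (\int[m]_x (F x)%:E = (\int[m]_x F x)%R%:E)%E.
Proof. by move=> /L1le_integrable h; rewrite /Rintegral fineK//; exact: integrable_fin_num. Qed.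

Lemma L1le_ge0 F c : L1le F c -> 0 <= c.
Proof.
by case=> _ Fc; rewrite -lee_fin; apply: le_trans Fc; apply: integral_ge0.
Qed.

Lemma L1leW F c c' : c <= c' -> L1le F c -> L1le F c'.
Proof. by move=> cc' [mF Fc]; split => //; apply: le_trans Fc _; rewrite lee_fin. Qed.

Lemma L1le_ae_dom F G c : measurable_fun setT F -> {ae m, forall x, `|F x| <= G x} ->
  L1le G c -> L1le F c.
Proof.
move=> mF FG [mG Gc]; split => //; apply: le_trans Gc; apply: ae_ge0_le_integral => //.
- exact: measurable_EFin_norm.
- exact: measurable_EFin_norm.
- by apply: filterS FG => x e _; rewrite lee_fin; apply: le_trans e (ler_norm _).
Qed.

Lemma L1le_dom F G c : measurable_fun setT F -> (forall x, `|F x| <= G x) ->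
  L1le G c -> L1le F c.
Proof. by move=> mF FG; apply: L1le_ae_dom => //; exact: aeW. Qed.

Lemma L1le_domW F G c c' : L1le G c -> c <= c' -> measurable_fun setT F ->
  (forall x, `|F x| <= G x) -> L1le F c'.
Proof. by move=> hG cc' mF FG; apply: (L1leW cc'); exact: L1le_dom hG. Qed.

Lemma L1le_ind (b : T -> bool) F c : measurable_fun setT b -> (forall x, 0 <= F x) ->
  L1le F c -> L1le (fun x => ind (b x) * F x) c.
Proof.
move=> mb F0 [mF Fc]; apply: (@L1le_dom _ F) => // [|x].
  by apply: measurable_funM mF; exact: measurable_fun_ifT.
by rewrite ger0_norm ?mulr_ge0 ?ind_ge0// ler_piMl ?ind_le1.
Qed.

Lemma L1le_subind (b b' : T -> bool) F c : measurable_fun setT b -> measurable_fun setT F ->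
  (forall x, 0 <= F x) -> (forall x, b x -> b' x) ->
  L1le (fun x => ind (b' x) * F x) c -> L1le (fun x => ind (b x) * F x) c.
Proof.
move=> mb mF F0 bb; apply: L1le_dom => [|x].
  by apply: measurable_funM mF; exact: measurable_fun_ifT.
by rewrite ger0_norm ?mulr_ge0 ?ind_ge0// ler_wpM2r// le_ind//; exact: bb.
Qed.

Lemma L1le_norm F c : L1le F c -> L1le (fun x => `|F x|) c.
Proof.
move=> [mF Fc]; split; first exact: measurableT_comp.
by under eq_integral do rewrite normr_id.
Qed.

Lemma eq_L1le F G c : F =1 G -> L1le F c -> L1le G c.
Proof. by move=> /funext ->. Qed.

Lemma L1leD F G c c' : L1le F c -> L1le G c' -> L1le (fun x => F x + G x) (c + c').
Proof.
move=> [mF Fc] [mG Gc]; split; first exact: measurable_funD.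
apply: (@le_trans _ _ (\int[m]_x ((`|F x|)%:E + (`|G x|)%:E))%E).
  apply: ge0_le_integral => //.
  - by apply: measurable_EFin_norm; exact: measurable_funD.
  - by apply: emeasurable_funD; exact: measurable_EFin_norm.
  - by move=> x _; rewrite -EFinD lee_fin ler_normD.
by rewrite ge0_integralD//; [rewrite EFinD leeD|exact: measurable_EFin_norm|exact: measurable_EFin_norm].
Qed.

Lemma L1leZ k F c : L1le F c -> L1le (fun x => k * F x) (`|k| * c).
Proof.
move=> [mF Fc]; split; first exact: measurable_funM.
under eq_integral do rewrite normrM EFinM.
rewrite ge0_integralZl//; [|exact: measurable_EFin_norm].
by rewrite EFinM lee_pmul// integral_ge0.
Qed.

Lemma L1leN F c : L1le F c -> L1le (fun x => - F x) c.
Proof.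
by move=> h; apply: L1le_dom (L1le_norm h) => [|x]; [exact: measurable_funN h.1|rewrite normrN].
Qed.

Lemma L1leB F G c c' : L1le F c -> L1le G c' -> L1le (fun x => F x - G x) (c + c').
Proof. by move=> h1 /L1leN; exact: L1leD. Qed.

Lemma L1le0 : L1le (fun=> 0) 0.
Proof.
split; first exact: measurable_cst.
by under eq_integral do rewrite normr0; rewrite integral0.
Qed.

Lemma L1le_sum (I : Type) (s : seq I) (P : pred I) (F : I -> T -> R) (c : I -> R) :
  (forall i, P i -> L1le (F i) (c i)) ->
  L1le (fun x => \sum_(i <- s | P i) F i x) (\sum_(i <- s | P i) c i).
Proof.
move=> h; elim: s => [|i s ih].
  by rewrite big_nil; apply: eq_L1le L1le0 => x; rewrite big_nil.
rewrite big_cons; case: ifPn => Pi.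
  by apply: eq_L1le (L1leD (h _ Pi) ih) => x; rewrite big_cons Pi.
by apply: eq_L1le ih => x; rewrite big_cons (negbTE Pi).
Qed.

Lemma normr_Rint_le F c : L1le F c -> `|\int[m]_x F x| <= c.
Proof.
move=> h; apply: le_trans (le_normr_Rintegral _ (L1le_integrable h)) _ => //.
have [_ hc] := L1le_norm h; rewrite -lee_fin -(EFin_Rintegral (L1le_norm h)).
by apply: le_trans hc; apply: eqW; apply: eq_integral => x _; rewrite normr_id.
Qed.

Lemma Rint_le_bound F c : L1le F c -> \int[m]_x F x <= c.
Proof. by move/normr_Rint_le; apply: le_trans; exact: ler_norm. Qed.

Lemma L1le_Rint F c : L1le F c -> (forall x, 0 <= F x) -> L1le F (\int[m]_x F x).
Proof.
move=> h F0; split; first exact: h.1.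
by rewrite -(EFin_Rintegral h); under eq_integral do rewrite ger0_norm//.
Qed.

Lemma le_Rint F G c c' : L1le F c -> L1le G c' -> (forall x, F x <= G x) ->
  \int[m]_x F x <= \int[m]_x G x.
Proof. by move=> /L1le_integrable h1 /L1le_integrable h2 h; exact: le_Rintegral. Qed.

Lemma RintD F G c c' : L1le F c -> L1le G c' ->
  \int[m]_x (F x + G x) = \int[m]_x F x + \int[m]_x G x.
Proof. by move=> /L1le_integrable h1 /L1le_integrable h2; exact: RintegralD. Qed.

Lemma RintB F G c c' : L1le F c -> L1le G c' ->
  \int[m]_x (F x - G x) = \int[m]_x F x - \int[m]_x G x.
Proof. by move=> /L1le_integrable h1 /L1le_integrable h2; exact: RintegralB. Qed.

Lemma RintZ k F c : L1le F c -> \int[m]_x (k * F x) = k * \int[m]_x F x.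
Proof. by move=> /L1le_integrable h1; exact: RintegralZl. Qed.

Lemma eq_Rint F G : F =1 G -> \int[m]_x F x = \int[m]_x G x.
Proof. by move=> /funext ->. Qed.

Lemma Rint_sum (I : Type) (s : seq I) (F : I -> T -> R) (c : I -> R) :
  (forall i, L1le (F i) (c i)) ->
  \int[m]_x (\sum_(i <- s) F i x) = \sum_(i <- s) \int[m]_x F i x.
Proof.
move=> h; elim: s => [|i s ih].
  rewrite big_nil (_ : (fun x => _) = (fun=> 0)).
    by rewrite /Rintegral integral0.
  by apply/funext => x; rewrite big_nil.
rewrite big_cons -ih -(RintD (h i) (L1le_sum s (P := xpredT) (fun i _ => h i))).
by apply: eq_Rint => x; rewrite big_cons.
Qed.

Lemma L1le_cauchy_schwarz F G (p q c : R) : measurable_fun setT F -> measurable_fun setT G ->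
  0 <= c -> p * q <= c ^+ 2 -> L1le (fun x => F x ^+ 2) p -> L1le (fun x => G x ^+ 2) q ->
  L1le (fun x => F x * G x) c.
Proof.
move=> mF mG c0 pq hF hG.
have bound t : 0 < t -> L1le (fun x => F x * G x) (t * p + q / (4 * t)).
  move=> t0; have t4 : 0 <= (4 * t)^-1 by rewrite invr_ge0; clra.
  have := L1leD (L1leZ t hF) (L1leZ (4 * t)^-1 hG); rewrite !ger0_norm ?(ltW t0)// [_ * q]mulrC.
  apply: L1le_dom => [|x]; first exact: measurable_funM.
  by rewrite normrM [_ * G x ^+ 2]mulrC -(sqr_normr (F x)) -(sqr_normr (G x)); exact: amgm.
have h1 := L1le_norm (bound 1 ltr01); have I0 : 0 <= \int[m]_x `|F x * G x| by exact: Rintegral_ge0.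
suff : \int[m]_x `|F x * G x| <= c.
  move=> Ic; apply: L1leW Ic _; split; first exact: measurable_funM.
  by rewrite -(EFin_Rintegral h1).
rewrite -(ler_pXn2r (_ : 0 < 2)%N) ?nnegrE//; apply: le_trans pq.
apply: sqr_le_of_amgm; [by []|exact: L1le_ge0 hF|exact: L1le_ge0 hG|move=> t t0].
by apply: Rint_le_bound; exact: L1le_norm (bound t t0).
Qed.

Lemma L1le_exists F : measurable_fun setT F ->
  (\int[m]_x (`|F x|)%:E < +oo)%E -> exists c, L1le F c.
Proof.
move=> mF h; exists (fine (\int[m]_x (`|F x|)%:E)); split => //.
by rewrite fineK// ge0_fin_numE// integral_ge0.
Qed.

Lemma ge0_integral_attains (A : set T) (G : T -> \bar R) (L c : R) : measurable A ->
  measurable_fun setT G -> (forall x, 0 <= G x)%E -> 0 < L -> (L%:E <= m A)%E ->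
  (\int[m]_(x in A) G x <= c%:E)%E -> exists2 x, A x & (G x <= (c / L)%:E)%E.
Proof.
move=> mA mG G0 L0 LA Gc; apply: contrapT => noG.
have c0 : 0 <= c by rewrite -lee_fin; apply: le_trans Gc; exact: integral_ge0.
have GA x : A x -> ((c / L)%:E < G x)%E.
  by move=> Ax; rewrite ltNge; apply/negP => Gx; apply: noG; exists x.
have mGc : measurable_fun setT (fun x => G x - (c / L)%:E)%E by apply: emeasurable_funB.
have excess0 : (\int[m]_(x in A) `|(G x - (c / L)%:E)| = 0)%E.
  have le_c : (\int[m]_(x in A) `|(G x - (c / L)%:E)| + (c / L)%:E * m A <= c%:E)%E.
    rewrite -integral_cst// -ge0_integralD//.
    + apply: le_trans Gc; apply: eqW.
      apply: eq_integral => x; rewrite inE => /GA h.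
      by rewrite gee0_abs ?subeK// sube_ge0// ltW.
    + by apply: measurable_funTS; apply: measurableT_comp.
    + by move=> x _ /=; rewrite lee_fin divr_ge0// ltW.
  have c_le : (c%:E <= (c / L)%:E * m A)%E.
    apply: (@le_trans _ _ ((c / L)%:E * L%:E)%E); last by apply: lee_wpmul2l => //; rewrite lee_fin divr_ge0// ltW.
    by rewrite -EFinM divfK// gt_eqF.
  apply/eqP; rewrite eq_le integral_ge0// andbT.
  have := le_trans (leeD2l (\int[m]_(x in A) `|(G x - (c / L)%:E)|) c_le) le_c.
  by rewrite -[leRHS]add0e leeD2rE.
have [N [mN N0 AN]] := (@ae_eq_integral_abs _ _ _ m A mA _ (measurable_funTS mGc)).1 excess0.
have : (m A <= m N)%E.
  apply: le_measure; rewrite ?inE// => x Ax; apply: AN => /= /(_ Ax) h.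
  by have := GA x Ax; rewrite -sube_gt0 h ltxx.
by rewrite N0 => h; have := le_trans LA h; rewrite lee_fin; clra.
Qed.

End L1Bound.

Lemma measurable_fun_inv d (T : measurableType d) (R : realType) (f : T -> R) :
  measurable_fun setT f -> measurable_fun setT (fun x => (f x)^-1).
Proof.
move=> mf; rewrite (_ : (fun x => _) = (fun x => f x * (f x ^+ 2) `^ (-1))).
  apply: measurable_funM => //; apply: (measurableT_comp (measurable_powR _)); exact: measurable_funX.
apply/funext => x; rewrite powR_inv1 ?sqr_ge0//.
have [->|f0] := eqVneq (f x) 0; first by rewrite invr0 mul0r.
by rewrite expr2 invfM mulrA mulfV// mul1r.
Qed.

Lemma measurable_fun_ind d (T : measurableType d) (R : realType) (b : T -> bool) :
  measurable_fun setT b -> measurable_fun setT (fun x => ind (b x) : R).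
Proof. by move=> mb; exact: measurable_fun_ifT. Qed.

Ltac mes1 := first
  [ match goal with H : measurable_fun _ ?f |- measurable_fun _ ?f => exact H end
  | lazymatch goal with
    | |- measurable_fun _ (fun x => x) => exact: measurable_id
    | |- measurable_fun _ fst => exact: measurable_fst
    | |- measurable_fun _ snd => exact: measurable_snd
    | |- measurable_fun _ (fun z => z.1) => exact: measurable_fst
    | |- measurable_fun _ (fun z => z.2) => exact: measurable_snd
    | |- measurable_fun _ (fun=> ?c) => exact: measurable_cst
    | |- measurable_fun _ (fun x => _ - _) => apply: measurable_funB
    | |- measurable_fun _ (fun x => _ + _) => apply: measurable_funD
    | |- measurable_fun _ (fun x => - _) => apply: measurable_funN
    | |- measurable_fun _ (fun x => _ / _) => apply: measurable_funM
    | |- measurable_fun _ (fun x => _ * _) => apply: measurable_funM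
    | |- measurable_fun _ (fun x => _^-1) => apply: measurable_fun_inv
    | |- measurable_fun _ (fun x => _ ^+ _) => apply: measurable_funX
    | |- measurable_fun _ (fun x => `|_|) => apply: (measurableT_comp (@normr_measurable _ _))
    | |- measurable_fun _ (fun x => _ `^ _) => apply: (measurableT_comp (measurable_powR _))
    | |- measurable_fun _ (fun x => ind _) => apply: measurable_fun_ind
    | |- measurable_fun _ (fun x => _ <= _) => apply: measurable_fun_ler
    | |- measurable_fun _ (fun x => _ < _) => apply: measurable_fun_ltr
    | |- measurable_fun _ (fun x => _ && _) => apply: measurable_and
    | |- measurable_fun _ (fun x => Num.max _ _) => apply: measurable_maxr
    | |- measurable_fun _ (fun x => Num.min _ _) => apply: measurable_minr
    | |- measurable_fun _ (fun x => \sum_(i <- _) _) => apply: measurable_sum; intro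
    end
  | assumption
  | match goal with H : measurable_fun _ ?f |- measurable_fun _ (fun x => ?f _) =>
      apply: (measurableT_comp H) end
  | apply: measurable_fun_inv | apply: measurable_funB | apply: measurable_funD | apply: measurable_funM
  | apply: measurable_fun_ler | apply: measurable_fun_ltr | apply: measurable_and | apply: measurable_funX ].
Ltac mes := repeat mes1.

Section MeasurePreserving.
Context d (T : measurableType d) (R : realType) (m : {measure set T -> \bar R}) (phi : T -> T).
Hypothesis mphi : measurable_fun setT phi.
Hypothesis inv : forall f : T -> \bar R, measurable_fun setT f -> (forall x, 0 <= f x)%E ->
  (\int[m]_x f (phi x) = \int[m]_x f x)%E.

Lemma L1le_comp_preserving F c : L1le m F c -> L1le m (fun x => F (phi x)) c.
Proof.
move=> [mF Fc]; split; first exact: (measurableT_comp mF).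
by rewrite (inv (f := fun x => (`|F x|)%:E))//; exact: measurable_EFin_norm.
Qed.

Lemma Rint_comp_preserving (F : T -> R) : measurable_fun setT F ->
  \int[m]_x F (phi x) = \int[m]_x F x.
Proof.
move=> mF; rewrite /Rintegral integralE [in RHS]integralE.
have mE : measurable_fun setT (EFin \o F) by exact/measurable_EFinP.
congr (fine (_ - _)%E).
  have := inv (measurable_funepos mE) (fun x => funepos_ge0 _ x).
  by move=> <-; apply: eq_integral => x _; rewrite !funeposE.
have := inv (measurable_funeneg mE) (fun x => funeneg_ge0 _ x).
by move=> <-; apply: eq_integral => x _; rewrite !funenegE.
Qed.
End MeasurePreserving.

Lemma ge0_integral_comp_preserving d (T : measurableType d) (R : realType)
    (m : {measure set T -> \bar R}) (phi : T -> T) (f : T -> \bar R) :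
  measurable_fun setT phi -> (forall A, measurable A -> pushforward m phi A = m A) ->
  measurable_fun setT f -> (forall x, 0 <= f x)%E -> (\int[m]_x f (phi x) = \int[m]_x f x)%E.
Proof.
move=> mphi inv mf f0.
have := @ge0_integral_pushforward _ _ T T R _ mphi m setT f measurableT mf (fun y _ => f0 y).
rewrite preimage_setT => <-.
by apply: eq_measure_integral => //= A mA _; exact: inv.
Qed.

Section Convergence.
Context d (T : measurableType d) (R : realType) (m : {measure set T -> \bar R}).

Lemma L1le_cvg0 (Fn : nat -> T -> R) (H : T -> R) c e :
  (forall n, measurable_fun setT (Fn n)) -> (forall n x, `|Fn n x| <= H x) -> L1le m H c ->
  (forall x, (fun n => Fn n x) @ \oo --> (0 : R)) -> 0 < e ->
  exists n0, forall n, (n0 <= n)%N -> L1le m (Fn n) e.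
Proof.
move=> mFn FH hH F0 e0.
have norm_cvg : (\int[m]_x (`|Fn n x|)%:E @[n --> \oo] --> \int[m]_x (cst 0%E) x)%E.
  apply: (@dominated_cvg _ _ _ m setT measurableT (fun n x => (`|Fn n x|)%:E) (cst 0%E) (EFin \o H)) => //.
  - by move=> n; exact: measurable_EFin_norm.
  - move=> x _; apply: cvg_EFin; first by near=> n.
    by rewrite /= -(normr0 R); apply: cvg_norm; exact: F0.
  - exact: L1le_integrable hH.
  - by move=> n x _ /=; rewrite normr_id lee_fin.
move: norm_cvg; rewrite integral0 => /fine_cvgP[_ /cvgrPdist_le/(_ e e0) [n0 _ hn]].
exists n0 => n nn0; split => //.
have fn : (\int[m]_x (`|Fn n x|)%:E)%E \is a fin_num.
  rewrite ge0_fin_numE; last exact: integral_ge0.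
  by have [_ h] := L1le_dom (mFn n) (FH n) hH; apply: le_lt_trans h _; rewrite ltry.
have := hn n nn0; rewrite /= sub0r normrN ger0_norm; last by apply: fine_ge0; exact: integral_ge0.
by rewrite -lee_fin fineK.
Unshelve. all: by end_near. Qed.

Lemma L1le_levi (Fn : nat -> T -> R) c : (forall n, L1le m (Fn n) c) -> (forall n x, 0 <= Fn n x) ->
  (forall n x, Fn n x <= Fn n.+1 x) ->
  exists F, [/\ L1le m F c, forall x, 0 <= F x & {ae m, forall x, forall n, Fn n x <= F x}].
Proof.
move=> hF F0 Fi; pose g n x := (Fn n x)%:E.
have mg n : measurable_fun setT (g n) by apply/measurable_EFinP; exact: (hF n).1.
have gi x : {homo g^~ x : n p / (n <= p)%N >-> (n <= p)%E}.
  move=> n p /subnK <-; elim: (p - n)%N => // k ih; apply: le_trans ih _.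
  by rewrite lee_fin addSn.
pose G x := limn (g^~ x).
have mG : measurable_fun setT G.
  by apply: (emeasurable_fun_cvg g) => // x _; exact: ereal_nondecreasing_is_cvgn.
have gG n x : (g n x <= G x)%E by rewrite /G (cvg_lim _ (ereal_nondecreasing_cvgn (gi x)))//;
  apply: ereal_sup_ubound; exists n.
have G0 x : (0 <= G x)%E by apply: le_trans (gG 0%N x); rewrite lee_fin.
have Gc : (\int[m]_x G x <= c%:E)%E.
  have h := @cvg_monotone_convergence _ _ _ m setT measurableT g mg (fun n x _ => F0 n x) (fun x _ => gi x).
  rewrite -(cvg_lim _ h)//; apply: lime_le; first exact: cvgP h.
  apply: nearW => n; have [_] := hF n; apply: le_trans; apply: eqW.
  by apply: eq_integral => x _; rewrite ger0_norm.
have iG : m.-integrable setT G.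
  apply/integrableP; split => //; apply: le_lt_trans (ltry c); apply: le_trans Gc.
  by apply: eqW; apply: eq_integral => x _; rewrite gee0_abs.
exists (fun x => fine (G x)); split.
- split; first exact: (measurableT_comp (fine_measurable _)).
  apply: le_trans Gc; apply: ge0_le_integral => //.
    by apply: measurable_EFin_norm; exact: (measurableT_comp (fine_measurable _)).
  move=> x _; rewrite ger0_norm ?fine_ge0//.
  by case: (G x) (G0 x) => [r| |]//=; rewrite leey.
- by move=> x; exact: fine_ge0.
- have := integrable_ae measurableT iG; apply: filterS => x /(_ Logic.I) fx n.
  by rewrite -lee_fin fineK//; exact: gG.
Qed.

Lemma L1le_monotone_limit (Fn : nat -> T -> R) F c : measurable_fun setT F -> (forall n, L1le m (Fn n) c) ->
  (forall n x, 0 <= Fn n x) -> (forall n x, Fn n x <= Fn n.+1 x) ->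
  (forall x, exists n, Fn n x = F x) -> L1le m F c.
Proof.
move=> mF hF F0 Fi e; have [G [hG _ GF]] := L1le_levi hF F0 Fi.
apply: L1le_ae_dom hG => //; apply: filterS GF => x h; have [n <-] := e x.
by rewrite ger0_norm.
Qed.

End Convergence.

Section AlmostEverywhere.
Context d (T : measurableType d) (R : realType) (m : {measure set T -> \bar R}).

Lemma ae_imp (P Q : T -> Prop) : (forall x, P x -> Q x) -> {ae m, forall x, P x} -> {ae m, forall x, Q x}.
Proof. by move=> h; apply: filterS. Qed.

Lemma ae_and (P Q : T -> Prop) : {ae m, forall x, P x} -> {ae m, forall x, Q x} ->
  {ae m, forall x, P x /\ Q x}.
Proof. by apply: filterS2 => x. Qed.

Lemma ae_forall (I : finType) (P : I -> T -> Prop) : (forall i, {ae m, forall x, P i x}) ->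
  {ae m, forall x, forall i, P i x}.
Proof. by move=> h; apply: filter_forall. Qed.

Lemma ae_eq_L1le (F G : T -> R) c : measurable_fun setT G -> {ae m, forall x, F x = G x} ->
  L1le m F c -> L1le m G c.
Proof.
by move=> mG h /L1le_norm; apply: L1le_ae_dom => //; apply: filterS h => x ->.
Qed.

Lemma ae_eq_Rint (F G : T -> R) : measurable_fun setT F -> measurable_fun setT G ->
  {ae m, forall x, F x = G x} -> \int[m]_x F x = \int[m]_x G x.
Proof.
move=> mF mG h; congr fine; apply: ae_eq_integral => //; [exact/measurable_EFinP|exact/measurable_EFinP|].
by apply: filterS h => x e _; rewrite /= e.
Qed.

Lemma integral_supp (D : set T) (f : T -> \bar R) : (forall x, ~ D x -> f x = 0%E) ->
  (\int[m]_(x in D) f x = \int[m]_x f x)%E.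
Proof.
move=> h; rewrite integral_mkcond; apply: eq_integral => x _; rewrite patchE.
by case: ifPn => // /negP hx; rewrite h// => Dx; apply: hx; rewrite inE.
Qed.

Lemma ge0_RintZr (G : T -> R) (c : R) : measurable_fun setT G -> (forall x, 0 <= G x) ->
  \int[m]_x (G x * c) = fine (\int[m]_x (G x)%:E)%E * c.
Proof.
move=> mG G0; have pos (k : R) : 0 <= k ->
    (\int[m]_x (G x * k)%:E = (\int[m]_x (G x)%:E) * k%:E)%E.
  move=> k0; rewrite -ge0_integralZr//; last by move=> *; rewrite lee_fin.
  exact/measurable_EFinP.
have fM (x : \bar R) (k : R) : fine (x * k%:E)%E = fine x * k.
  by case: x => [s||]//=; rewrite mul0r ?mulNyr ?mulyr; case: (sgrP k) => //= _; rewrite ?mul0e ?mul1e ?mulN1e.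
rewrite /Rintegral; have [c0|c0] := leP 0 c; first by rewrite pos// fM.
have -> : (fun x => (G x * c)%:E) = (fun x => - (G x * (- c))%:E)%E.
  by apply/funext => x; rewrite -EFinN mulrN opprK.
rewrite integral_ge0N; last by move=> x _; rewrite lee_fin mulr_ge0// oppr_ge0 ltW.
by rewrite pos ?oppr_ge0 1?ltW// fineN fM mulrN opprK.
Qed.

End AlmostEverywhere.

Section LebesgueLine.
Variable R : realType.
Local Notation mu := (@lebesgue_measure R).
Implicit Types (x h d c : R) (F : R -> R).

Lemma lebesgue_measure_shift h (A : set R) : measurable A ->
  pushforward mu ((fun x => x + h) : _ -> measurableTypeR R) A = mu A.
Proof.
move=> mA; apply/esym/lebesgue_measure_unique => //.
  exact: measurable_funD.
move=> m' _ [[a b]] _ <-.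
change (mu `]a, b] = mu ((fun x : R => x + h) @^-1` `]a, b])).
rewrite (_ : (fun x : R => x + h) @^-1` `]a, b] = `]a - h, b - h]%classic).
  rewrite !lebesgue_measure_itv/= !lte_fin ltrD2r.
  by case: ifP => // _; rewrite -!EFinB; congr EFin; ring.
by apply/seteqP; split => x /=; rewrite !in_itv/= ltrBlDr lerBrDr.
Qed.

Lemma ge0_integral_shift h (f : R -> \bar R) : measurable_fun setT f ->
  (forall x, 0 <= f x)%E -> (\int[mu]_x f (x + h)%R = \int[mu]_x f x)%E.
Proof.
by move=> mf f0; apply: (@ge0_integral_comp_preserving _ (measurableTypeR R) R mu (fun x => x + h)) => //;
  [mes|exact: lebesgue_measure_shift].
Qed.

Lemma ge0_integral_opp (f : R -> \bar R) : measurable_fun setT f ->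
  (forall x, 0 <= f x)%E -> (\int[mu]_x f (- x)%R = \int[mu]_x f x)%E.
Proof.
by move=> mf f0; apply: (@ge0_integral_comp_preserving _ (measurableTypeR R) R mu (fun x => - x)) => //;
  [mes|exact: lebesgue_measureN].
Qed.

Lemma L1le_shift h F c : L1le mu F c -> L1le mu (fun x => F (x + h)) c.
Proof.
move=> hF; have mh : measurable_fun setT (fun x : R => x + h) by mes.
exact: (@L1le_comp_preserving _ _ _ mu (fun x : measurableTypeR R => x + h) mh (ge0_integral_shift h) F c hF).
Qed.

Lemma Rint_shift h F : measurable_fun setT F -> \int[mu]_x F (x + h) = \int[mu]_x F x.
Proof. exact: (@Rint_comp_preserving _ _ _ mu (fun x : measurableTypeR R => x + h) (ge0_integral_shift h)). Qed.

Lemma L1le_opp F c : L1le mu F c -> L1le mu (fun x => F (- x)) c.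
Proof.
move=> hF; have mN : measurable_fun setT (fun x : R => - x) by mes.
exact: (@L1le_comp_preserving _ _ R mu (fun x : measurableTypeR R => - x) mN (@ge0_integral_opp) F c hF).
Qed.

Lemma integral_ind_ball x d : 0 <= d -> (\int[mu]_y (ind (`|x - y| <= d))%:E = (2 * d)%:E)%E.
Proof.
move=> d0; rewrite (_ : (fun y => _) = (fun y => (\1_(`[x - d, x + d]) y)%:E)).
  rewrite integral_indic// setIT; transitivity (mu [set` `[x - d, x + d]%R]); first by [].
  rewrite lebesgue_measure_itv/= lte_fin; case: ifPn => h.
    by rewrite -EFinB; congr EFin; ring.
  by congr EFin; move: h; rewrite -leNgt; clra.
apply/funext => y; rewrite indicE /ind; congr EFin.
have -> : (y \in `[x - d, x + d]%classic) = (`|x - y| <= d).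
  by apply/idP/idP; rewrite inE/= in_itv/= ler_norml => h; apply/andP; split; move: h => /andP[]; clra.
by case: ifP.
Qed.

Lemma L1le_ball x d : 0 <= d -> L1le mu (fun y => ind (`|x - y| <= d)) (2 * d).
Proof.
move=> d0; split; first by mes.
by rewrite -(integral_ind_ball x d0); apply: eqW; apply: eq_integral => y _; rewrite ger0_norm ?ind_ge0.
Qed.

Lemma Rint_ball x d : 0 <= d -> \int[mu]_y ind (`|x - y| <= d) = 2 * d.
Proof. by move=> d0; rewrite /Rintegral integral_ind_ball. Qed.

Lemma L1le_inv_sqr_ge d : 0 < d -> L1le mu (fun y => ind (d <= y) / y ^+ 2) (d^-1).
Proof.
move=> d0; split; first by mes.
have -> : (\int[mu]_x (`|ind (d <= x) / x ^+ 2|)%:E = \int[mu]_(x in `[d, +oo[) ((x ^+ 2)^-1)%:E)%E.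
  rewrite [RHS]integral_mkcond; apply: eq_integral => y _.
  rewrite /patch; have -> : (y \in `[d, +oo[%classic) = (d <= y).
    by apply/idP/idP; rewrite inE/= in_itv/= andbT.
  rewrite /ind; case: ifP => _; last by rewrite mul0r normr0.
  by rewrite mul1r ger0_norm// inv_sqr_ge0.
rewrite (@ge0_continuous_FTC2y _ _ (fun x => - x^-1) d 0).
- by rewrite sub0e -EFinN opprK.
- by move=> x _; exact: inv_sqr_ge0.
- apply: continuous_in_subspaceT => x; rewrite inE/= in_itv/= andbT => dx.
  have x0 : x != 0 by clra.
  apply: cvgV; first by rewrite sqrf_eq0.
  exact: exprn_continuous.
- rewrite -[X in _ --> X]oppr0; apply: cvgN.
  have h : \forall x \near +oo, 0 < (x : R) by exact: nbhs_pinfty_gt.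
  exact: ((gtr0_cvgV0 h).2 cvg_id).
- by move=> x dx; apply: derivableN; apply: derivableV => //; clra.
- apply: cvgN; apply: cvgV; first by clra.
  exact: cvg_at_right_filter.
- move=> x; rewrite in_itv/= andbT => dx.
  have x0 : x != 0 by clra.
  rewrite derive1E deriveN; last by apply: derivableV.
  rewrite deriveV// derive_id scaleNr opprK /GRing.scale/= mulr1.
  by rewrite -exprVn exprVn.
Qed.

Lemma L1le_inv_sqr_far x d : 0 < d ->
  L1le mu (fun y => ind (d <= `|x - y|) / (x - y) ^+ 2) (2 / d).
Proof.
move=> d0; have h1 := L1le_shift (- x) (L1le_inv_sqr_ge d0).
have h2 := L1le_shift (- x) (L1le_opp (L1le_inv_sqr_ge d0)).
apply: L1le_domW (L1leD h1 h2) _ _ _; [by clra|by mes|move=> y].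
rewrite ger0_norm; last by rewrite mulr_ge0 ?ind_ge0 ?inv_sqr_ge0.
rewrite sqr_distC sqrrN; have := inv_sqr_ge0 (y - x).
rewrite /ind; case: (leP d `|x - y|) => h; case: (leP d (y - x)) => h';
  case: (leP d (- (y - x))) => h''; rewrite ?mul1r ?mul0r => p; try clra.
by exfalso; move: h; case: (lerP x y) => ? ?; clra.
Qed.

End LebesgueLine.

Section LebesguePlane.
Variable R : realType.
Local Notation mu := (@lebesgue_measure R).
Local Notation mu2 := (mu \x mu)%E.
Implicit Types (F : R * R -> R) (h c : R).

Lemma tonelli_fst (f : R * R -> \bar R) : measurable_fun setT f -> (forall z, 0 <= f z)%E ->
  (\int[mu2]_z f z = \int[mu]_x \int[mu]_y f (x, y))%E.
Proof. by move=> mf f0; rewrite fubini_tonelli1. Qed.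

Lemma tonelli_snd (f : R * R -> \bar R) : measurable_fun setT f -> (forall z, 0 <= f z)%E ->
  (\int[mu2]_z f z = \int[mu]_y \int[mu]_x f (x, y))%E.
Proof. by move=> mf f0; rewrite fubini_tonelli2. Qed.

Lemma measurable_integral_snd (f : R * R -> \bar R) : measurable_fun setT f -> (forall z, 0 <= f z)%E ->
  measurable_fun setT (fun x => \int[mu]_y f (x, y))%E.
Proof. by move=> mf f0; exact: measurable_fun_fubini_tonelli_F. Qed.

Lemma measurable_section d (U : measurableType d) (f : R * R -> U) x :
  measurable_fun setT f -> measurable_fun setT (fun y => f (x, y)).
Proof. by move=> h; apply: (measurableT_comp h); exact: measurable_fun_pair. Qed.

Lemma measurable_swap : measurable_fun setT (fun z : R * R => (z.2, z.1)).
Proof. exact: measurable_fun_pair. Qed.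

Lemma ge0_integral_swap (f : R * R -> \bar R) : measurable_fun setT f ->
  (forall z, 0 <= f z)%E -> (\int[mu2]_z f (z.2, z.1) = \int[mu2]_z f z)%E.
Proof.
move=> mf f0; rewrite (tonelli_fst (f := fun z => f (z.2, z.1)))//.
  by rewrite tonelli_snd.
exact: (measurableT_comp mf measurable_swap).
Qed.

Lemma L1le_swap F c : L1le mu2 F c -> L1le mu2 (fun z => F (z.2, z.1)) c.
Proof.
by apply: (@L1le_comp_preserving _ _ _ _ (fun z => (z.2, z.1))); [exact: measurable_swap|exact: ge0_integral_swap].
Qed.

Lemma Rint_swap F : measurable_fun setT F -> \int[mu2]_z F (z.2, z.1) = \int[mu2]_z F z.
Proof. exact: (@Rint_comp_preserving _ _ _ mu2 (fun z => (z.2, z.1)) ge0_integral_swap). Qed.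

Lemma ge0_integral_fibrewise (psi : R -> R -> R) (f : R * R -> \bar R) :
  measurable_fun setT (fun z : R * R => psi z.1 z.2) ->
  (forall x (g : R -> \bar R), measurable_fun setT g -> (forall y, 0 <= g y)%E ->
    (\int[mu]_y g (psi x y) = \int[mu]_y g y)%E) ->
  measurable_fun setT f -> (forall z, 0 <= f z)%E ->
  (\int[mu2]_z f (z.1, psi z.1 z.2) = \int[mu2]_z f z)%E.
Proof.
move=> mpsi inv mf f0; rewrite (tonelli_fst (f := fun z => f (z.1, psi z.1 z.2)))//; last first.
  by apply: (measurableT_comp mf); apply: measurable_fun_pair.
rewrite (tonelli_fst mf f0); apply: eq_integral => x _.
by apply: (inv x (fun y => f (x, y))) => //; exact: measurable_section.
Qed.

Lemma ge0_integral_shear (k : R -> R) (f : R * R -> \bar R) : measurable_fun setT k ->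
  measurable_fun setT f -> (forall z, 0 <= f z)%E ->
  (\int[mu2]_z f (z.1, (z.2 + k z.1)%R) = \int[mu2]_z f z)%E.
Proof.
move=> mk; apply: (ge0_integral_fibrewise (psi := fun x y => y + k x)); first by mes.
by move=> x g; exact: ge0_integral_shift.
Qed.

Lemma L1le_shearE F c : measurable_fun setT F ->
  L1le mu2 (fun z => F (z.1, z.2 + z.1)) c -> L1le mu2 F c.
Proof.
move=> mF [_ Fc]; split => //; apply: le_trans Fc; apply: eqW.
by rewrite -(ge0_integral_shear (@measurable_id _ _ setT) (measurable_EFin_norm mF)).
Qed.

Lemma ge0_integral_reflect (f : R * R -> \bar R) : measurable_fun setT f ->
  (forall z, 0 <= f z)%E -> (\int[mu2]_z f (z.1, (2 * z.1 - z.2)%R) = \int[mu2]_z f z)%E.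
Proof.
apply: (ge0_integral_fibrewise (psi := fun x y => 2 * x - y)); first by mes.
move=> x g mg g0; rewrite -[RHS](ge0_integral_shift (2 * x))// -[RHS]ge0_integral_opp//.
  by apply: eq_integral => y _; rewrite addrC.
by apply: (measurableT_comp mg); mes.
Qed.

Lemma measurable_reflect : measurable_fun setT (fun z : R * R => (z.1, 2 * z.1 - z.2)).
Proof. by apply: measurable_fun_pair; mes. Qed.

Lemma L1le_reflect F c : L1le mu2 F c -> L1le mu2 (fun z => F (z.1, 2 * z.1 - z.2)) c.
Proof.
exact: (@L1le_comp_preserving _ _ _ mu2 (fun z => (z.1, 2 * z.1 - z.2)) measurable_reflect ge0_integral_reflect).
Qed.

Lemma Rint_reflect F : measurable_fun setT F ->
  \int[mu2]_z F (z.1, 2 * z.1 - z.2) = \int[mu2]_z F z.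
Proof. exact: (@Rint_comp_preserving _ _ R mu2 (fun z => (z.1, 2 * z.1 - z.2)) ge0_integral_reflect). Qed.

Lemma ge0_integral_shift_fst h (f : R * R -> \bar R) : measurable_fun setT f ->
  (forall z, 0 <= f z)%E -> (\int[mu2]_z f ((z.1 + h)%R, z.2) = \int[mu2]_z f z)%E.
Proof.
move=> mf f0; have mfs := measurableT_comp mf measurable_swap.
rewrite -[RHS]ge0_integral_swap// -[RHS](ge0_integral_shear (k := cst h))//.
rewrite -[RHS]ge0_integral_swap//; apply: (measurableT_comp mf).
by apply: measurable_fun_pair => /=; mes.
Qed.

Lemma L1le_shift_fst h F c : L1le mu2 F c -> L1le mu2 (fun z => F (z.1 + h, z.2)) c.
Proof.
apply: (@L1le_comp_preserving _ _ _ mu2 (fun z => (z.1 + h, z.2))); last exact: ge0_integral_shift_fst.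
by apply: measurable_fun_pair; mes.
Qed.

Lemma measurable_shift2 h : measurable_fun setT (fun z : R * R => (z.1 + h, z.2 + h)).
Proof. by apply: measurable_fun_pair; mes. Qed.

Lemma ge0_integral_shift2 h (f : R * R -> \bar R) : measurable_fun setT f ->
  (forall z, 0 <= f z)%E -> (\int[mu2]_z f ((z.1 + h)%R, (z.2 + h)%R) = \int[mu2]_z f z)%E.
Proof.
move=> mf f0; rewrite -[RHS](ge0_integral_shift_fst h)// -[RHS](ge0_integral_shear (k := cst h))//.
by apply: (measurableT_comp mf); apply: measurable_fun_pair; mes.
Qed.

Lemma L1le_shift2 h F c : L1le mu2 F c -> L1le mu2 (fun z => F (z.1 + h, z.2 + h)) c.
Proof.
exact: (@L1le_comp_preserving _ _ _ mu2 (fun z => (z.1 + h, z.2 + h)) (measurable_shift2 h) (ge0_integral_shift2 h)).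
Qed.

Lemma Rint_shift2 h F : measurable_fun setT F ->
  \int[mu2]_z F (z.1 + h, z.2 + h) = \int[mu2]_z F z.
Proof. exact: (@Rint_comp_preserving _ _ _ mu2 (fun z => (z.1 + h, z.2 + h)) (ge0_integral_shift2 h)). Qed.

Lemma L1le_dom2 F G c : measurable_fun setT F -> (forall x y, `|F (x, y)| <= G (x, y)) ->
  L1le mu2 G c -> L1le mu2 F c.
Proof. by move=> mF h; apply: L1le_dom => // -[x y]; exact: h. Qed.

Lemma L1le_domW2 F G c c' : L1le mu2 G c -> c <= c' -> measurable_fun setT F ->
  (forall x y, `|F (x, y)| <= G (x, y)) -> L1le mu2 F c'.
Proof. by move=> hG cc' mF FG; apply: (L1leW cc'); exact: L1le_dom2 hG. Qed.

Lemma L1le_tonelli_fst F (g : R -> R) c : measurable_fun setT F ->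
  (forall x, \int[mu]_y (`|F (x, y)|)%:E <= (g x)%:E)%E ->
  L1le mu g c -> L1le mu2 F c.
Proof.
move=> mF Fg [mg gc]; split => //.
rewrite tonelli_fst//; last exact: measurable_EFin_norm.
apply: le_trans gc; apply: ge0_le_integral => //.
- by move=> x _; exact: integral_ge0.
- apply: (measurable_integral_snd (f := fun z : R * R => (`|F z|)%:E)) => //.
  exact: measurable_EFin_norm.
- exact: measurable_EFin_norm.
- by move=> x _; apply: le_trans (Fg x) _; rewrite lee_fin ler_norm.
Qed.

Lemma L1le_tonelli_snd F (g : R -> R) c : measurable_fun setT F ->
  (forall y, \int[mu]_x (`|F (x, y)|)%:E <= (g y)%:E)%E ->
  L1le mu g c -> L1le mu2 F c.
Proof.
move=> mF Fg gc.
have := @L1le_tonelli_fst (fun z => F (z.2, z.1)) g c (measurableT_comp mF measurable_swap) Fg gc.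
by move/L1le_swap; apply: eq_L1le => -[].
Qed.

Lemma measurable_Rint_snd F : measurable_fun setT F -> (forall z, 0 <= F z) ->
  measurable_fun setT (fun x => \int[mu]_y F (x, y)).
Proof.
move=> mF F0; rewrite /Rintegral.
apply: (measurableT_comp (f := fine)); first exact: fine_measurable.
apply: (measurable_integral_snd (f := fun z => (F z)%:E)) => //.
exact/measurable_EFinP.
Qed.

Lemma L1le_Rint_snd F c : measurable_fun setT F -> (forall z, 0 <= F z) ->
  (forall x, exists b, L1le mu (fun y => F (x, y)) b) ->
  L1le mu2 F c -> L1le mu (fun x => \int[mu]_y F (x, y)) c.
Proof.
move=> mF F0 hb [_ hF]; split; first exact: measurable_Rint_snd.
apply: le_trans hF; rewrite tonelli_fst//; last exact: measurable_EFin_norm.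
apply: eqW; apply: eq_integral => x _; have [b hx] := hb x.
rewrite ger0_norm; last by apply: Rintegral_ge0.
by rewrite -(EFin_Rintegral hx); apply: eq_integral => y _; rewrite ger0_norm.
Qed.

Lemma exists_section (b : R -> bool) F (L c : R) :
  measurable_fun setT b -> measurable_fun setT F -> (forall z, 0 <= F z) -> 0 < L ->
  (L%:E <= mu [set x | b x])%E ->
  L1le mu2 (fun z => ind (b z.1) * F z) c ->
  exists y0, b y0 /\ L1le mu (fun x => F (y0, x)) (c / L).
Proof.
move=> mb mF F0 L0 Lb [mbF bFc]; pose A := [set x | b x].
have mA : measurable A.
  by rewrite -[A]setTI (_ : A = b @^-1` [set true])//; exact: mb.
pose G (x : R) := (\int[mu]_y (F (x, y))%:E)%E.
have mFx x : measurable_fun setT (fun y => F (x, y)) := measurable_section x mF.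
have mG : measurable_fun setT G.
  by apply: (measurable_integral_snd (f := fun z : R * R => (F z)%:E)) => //; exact/measurable_EFinP.
have G0 x : (0 <= G x)%E by apply: integral_ge0 => y _; rewrite lee_fin.
have GA : (\int[mu]_(x in A) G x <= c%:E)%E.
  apply: le_trans bFc; rewrite tonelli_fst//; last exact: measurable_EFin_norm.
  rewrite integral_mkcond; apply: ge0_le_integral => //.
  - by move=> x _; rewrite /patch; case: ifP.
  - by apply/(measurable_restrictT G mA)/measurable_funTS.
  - apply: (measurable_integral_snd (f := fun z : R * R => (`|ind (b z.1) * F z|)%:E)) => //.
    exact: measurable_EFin_norm.
  - move=> x _; rewrite /patch; case: ifPn => xA; last exact: integral_ge0.
    rewrite inE in xA; apply: eqW; apply: eq_integral => y _.
    by rewrite indT//= mul1r ger0_norm.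
have [y0 by0 Gy] := @ge0_integral_attains _ _ _ mu _ _ _ _ mA mG G0 L0 Lb GA.
exists y0; split => //; split; first exact: mFx.
apply: le_trans Gy.
by apply: eqW; apply: eq_integral => y _; rewrite ger0_norm.
Qed.

Lemma ae_fst (P : R -> Prop) : {ae mu, forall x, P x} -> {ae mu2, forall z, P z.1}.
Proof.
case=> A [mA A0 sub]; exists (A `*` setT); split.
- exact: measurableX.
- by apply: (eq_trans (product_measure1E mu mu mA measurableT)); move: A0 => /= ->; rewrite mul0e.
- by move=> z /= h; split => //; exact: sub.
Qed.

Lemma ae_snd (P : R -> Prop) : {ae mu, forall x, P x} -> {ae mu2, forall z, P z.2}.
Proof.
case=> A [mA A0 sub]; exists (setT `*` A); split.
- exact: measurableX.
- by apply: (eq_trans (product_measure1E mu mu measurableT mA)); move: A0 => /= ->; rewrite mule0.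
- by move=> z /= h; split => //; exact: sub.
Qed.

Lemma ae_eq_pair (I : finType) (u v : I -> R -> R) : (forall i, {ae mu, forall x, u i x = v i x}) ->
  {ae mu2, forall z, forall i, u i z.1 = v i z.1 /\ u i z.2 = v i z.2}.
Proof.
move=> uv; apply: filter_forall => i.
exact: ae_and (ae_fst (uv i)) (ae_snd (uv i)).
Qed.

Lemma ge0_fubiniZr (G : R * R -> R) (p : R -> R) c : measurable_fun setT G -> (forall z, 0 <= G z) ->
  measurable_fun setT p -> L1le mu2 (fun z => G z * p z.1) c ->
  [/\ mu.-integrable setT (fun x => (fine (\int[mu]_y (G (x, y))%:E)%E * p x)%:E) &
   (\int[mu]_x (fine (\int[mu]_y (G (x, y))%:E) * p x)%:E = (\int[mu2]_z (G z * p z.1))%:E)%E].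
Proof.
move=> mG G0 mp h; have ih := L1le_integrable h.
pose F (x : R) : \bar R := (\int[mu]_y (G (x, y) * p x)%:E)%E.
have iF : mu.-integrable setT F := @integrable_fubini_F _ _ _ _ _ mu mu _ ih.
have eF : (\int[mu]_x F x = \int[mu2]_z (G z * p z.1)%:E)%E := @integral12_prod_meas1 _ _ _ _ _ mu mu _ ih.
have fF : {ae mu, forall x, F x = (fine (\int[mu]_y (G (x, y))%:E)%E * p x)%:E}.
  have := @integrable_ae _ _ _ mu _ measurableT F iF; apply: ae_imp => x /(_ I) fx.
  by rewrite -(ge0_RintZr mu (p x) (measurable_section x mG))// /Rintegral fineK.
have mH : measurable_fun setT (fun x => (fine (\int[mu]_y (G (x, y))%:E)%E * p x)).
  by apply: measurable_funM => //; exact: measurable_Rint_snd.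
split; last first.
  rewrite -(@ae_eq_integral _ _ _ mu setT _ F) ?eF ?(EFin_Rintegral h)//.
  - by case/integrableP: iF.
  - exact/measurable_EFinP.
  - by apply: (ae_imp _ fF) => x e _.
apply/integrableP; split; first exact/measurable_EFinP.
case/integrableP: iF => mF; apply: le_lt_trans; apply: eqW; apply: ae_eq_integral => //.
- by apply: measurableT_comp => //; exact/measurable_EFinP.
- by apply: measurableT_comp.
- by apply: (ae_imp _ fF) => x e _; rewrite e.
Qed.

End LebesguePlane.
(** * Energy and hole filling *)

Section Positivity.
Variable R : realType.
Local Notation mu := (@lebesgue_measure R).
Local Notation mu2 := (mu \x mu)%E.
Implicit Types (w phi v f : R -> R) (x y c s : R).

Definition en w (z : R * R) : R := (w z.1 - w z.2) ^+ 2 / (z.1 - z.2) ^+ 2.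

Lemma en_ge0 w z : 0 <= en w z.
Proof. by rewrite mulr_ge0 ?invr_ge0 ?sqr_ge0. Qed.

Lemma en_swap w x y : en w (y, x) = en w (x, y).
Proof. by rewrite /en/= sqr_distC (sqr_distC y). Qed.

Lemma measurable_en w : measurable_fun setT w -> measurable_fun setT (en w).
Proof. by move=> mw; rewrite /en; mes. Qed.

End Positivity.

Ltac nneg1 := first
  [ lazymatch goal with
    | |- is_true (_ <= _ ^+ 2) => exact: sqr_ge0
    | |- is_true (_ <= (_ ^+ 2)^-1) => exact: inv_sqr_ge0
    | |- is_true (_ <= ind _) => exact: ind_ge0
    | |- is_true (_ <= `|_|) => exact: normr_ge0
    | |- is_true (_ <= en _ _) => exact: en_ge0
    | |- is_true (_ <= _%:R) => exact: ler0n
    | |- is_true (_ <= 1) => exact: ler01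
    | |- is_true (_ <= _ * _) =>
        first [ match goal with H : is_true ?P |- is_true ?P => exact H end | apply: mulr_ge0 ]
    | |- is_true (_ <= _ + _) =>
        first [ match goal with H : is_true ?P |- is_true ?P => exact H end | apply: addr_ge0 ]
    | |- is_true (_ <= _ ^+ _) =>
        first [ match goal with H : is_true ?P |- is_true ?P => exact H end | apply: exprn_ge0 ]
    end
  | assumption | (by apply: ltW)
  | exact: sqr_ge0 | exact: inv_sqr_ge0 | exact: ind_ge0 ].
Ltac nneg := repeat nneg1.

Section CutOffEnergy.
Variable R : realType.
Local Notation mu := (@lebesgue_measure R).
Local Notation mu2 := (mu \x mu)%E.
Implicit Types (w phi v f : R -> R) (x y c s : R).

Lemma inv_sqr_le (K b c : R) : 0 < K -> b != 0 -> `|b| <= K * `|c| ->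
  (c ^+ 2)^-1 <= K ^+ 2 * (b ^+ 2)^-1.
Proof.
move=> K0 b0 h.
have c0 : c != 0 by apply: contraNneq b0 => c0; move: h; rewrite c0 normr0 mulr0 normr_le0.
have K2 : 0 < K ^+ 2 by rewrite exprn_gt0.
have b2 := sqr_gt0 b0; rewrite -ler_pdivrMl// -invfM lef_pV2 ?posrE//; last by rewrite mulr_gt0 ?(sqr_gt0 c0).
by rewrite -(sqr_normr c) -exprMn; exact: norm_le_sqr.
Qed.

Lemma L1le_kernel_fst (J : R * R -> R) f c j : measurable_fun setT J ->
  (forall x, L1le mu (fun y => J (x, y)) j) -> L1le mu f c ->
  L1le mu2 (fun z => f z.1 * J z) (c * j).
Proof.
move=> mJ hJ hf; have mf := L1le_measurable hf.
have j0 := L1le_ge0 (hJ 0).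
apply: (@L1le_tonelli_fst _ _ (fun x => `|f x| * j)); first by mes.
  move=> x /=; have /(_ (f x)) := L1leZ _ (hJ x).
  by case.
have := L1leZ j (L1le_norm hf); rewrite ger0_norm// mulrC; apply: eq_L1le => x.
by rewrite mulrC.
Qed.

Lemma L1le_kernel_snd (J : R * R -> R) f c j : measurable_fun setT J ->
  (forall x y, J (x, y) = J (y, x)) ->
  (forall x, L1le mu (fun y => J (x, y)) j) -> L1le mu f c ->
  L1le mu2 (fun z => f z.2 * J z) (c * j).
Proof.
move=> mJ sJ hJ hf; have := L1le_swap (L1le_kernel_fst mJ hJ hf).
by apply: eq_L1le => -[x y] /=; rewrite sJ.
Qed.

Lemma L1le_kernel_both (J : R * R -> R) f c j : measurable_fun setT J ->
  (forall x y, J (x, y) = J (y, x)) ->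
  (forall x, L1le mu (fun y => J (x, y)) j) -> L1le mu f c ->
  L1le mu2 (fun z => (f z.1 + f z.2) * J z) (2 * (c * j)).
Proof.
move=> mJ sJ hJ hf; have := L1leD (L1le_kernel_fst mJ hJ hf) (L1le_kernel_snd mJ sJ hJ hf).
rewrite (_ : c * j + c * j = 2 * (c * j)); last by ring.
by apply: eq_L1le => z; ring.
Qed.

Lemma L1le_supported (F J : R * R -> R) c r j : measurable_fun setT F -> measurable_fun setT J ->
  (forall x y, J (x, y) = J (y, x)) -> (forall x, L1le mu (fun y => J (x, y)) j) -> 0 <= r ->
  (forall x y, `|F (x, y)| <= J (x, y)) -> (forall x y, r < `|x - c| -> r < `|y - c| -> F (x, y) = 0) ->
  L1le mu2 F (2 * (2 * r * j)).
Proof.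
move=> mF mJ sJ hJ r0 FJ F0; apply: L1le_dom2 (L1le_kernel_both mJ sJ hJ (L1le_ball c r0)) => // x y /=.
have J0 : 0 <= J (x, y) := le_trans (normr_ge0 _) (FJ x y).
rewrite !(distrC c); have [hx|hx] := leP `|x - c| r.
  by apply: le_trans (FJ x y) _; rewrite ler_peMl// lerDl ind_ge0.
have [hy|hy] := leP `|y - c| r; last by rewrite F0// normr0 mulr_ge0// addr_ge0// ind_ge0.
by apply: le_trans (FJ x y) _; rewrite ler_peMl// lerDr ind_ge0.
Qed.

Definition Jfar s (z : R * R) : R := ind (s <= `|z.1 - z.2|) / (z.1 - z.2) ^+ 2.
Definition Jnear s (z : R * R) : R := ind (`|z.1 - z.2| <= s).
Definition Jmix s (z : R * R) : R := Jnear s z / s ^+ 2 + Jfar s z.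

Lemma measurable_Jfar s : measurable_fun setT (Jfar s). Proof. by rewrite /Jfar; mes. Qed.
Lemma measurable_Jnear s : measurable_fun setT (Jnear s). Proof. by rewrite /Jnear; mes. Qed.
Lemma measurable_Jmix s : measurable_fun setT (Jmix s).
Proof. by rewrite /Jmix /Jfar /Jnear; mes. Qed.

Lemma Jfar_sym s x y : Jfar s (x, y) = Jfar s (y, x).
Proof. by rewrite /Jfar/= distrC -sqrrN opprB. Qed.

Lemma Jnear_sym s x y : Jnear s (x, y) = Jnear s (y, x).
Proof. by rewrite /Jnear/= distrC. Qed.

Lemma Jmix_sym s x y : Jmix s (x, y) = Jmix s (y, x).
Proof. by rewrite /Jmix Jfar_sym Jnear_sym. Qed.

Lemma Jfar_ge0 s z : 0 <= Jfar s z. Proof. by rewrite mulr_ge0 ?ind_ge0 ?inv_sqr_ge0. Qed.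
Lemma Jnear_ge0 s z : 0 <= Jnear s z. Proof. exact: ind_ge0. Qed.
Lemma Jmix_ge0 s z : 0 <= Jmix s z.
Proof. by rewrite addr_ge0 ?Jfar_ge0// mulr_ge0 ?Jnear_ge0 ?inv_sqr_ge0. Qed.

Lemma L1le_Jfar s x : 0 < s -> L1le mu (fun y => Jfar s (x, y)) (2 / s).
Proof. exact: L1le_inv_sqr_far. Qed.

Lemma L1le_Jnear s x : 0 < s -> L1le mu (fun y => Jnear s (x, y)) (2 * s).
Proof. by move=> /ltW; exact: L1le_ball. Qed.

Lemma L1le_Jmix s x : 0 < s -> L1le mu (fun y => Jmix s (x, y)) (4 / s).
Proof.
move=> s0; have h1 := L1leZ (s ^+ 2)^-1 (L1le_Jnear x s0).
have := L1leD h1 (L1le_Jfar x s0).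
rewrite (_ : _ + _ = 4 / s).
  by apply: eq_L1le => y; rewrite /Jmix mulrC.
by rewrite ger0_norm ?inv_sqr_ge0//; field; rewrite gt_eqF.
Qed.

Definition eta (c s x : R) : R := Num.max 0 (Num.min 1 (2 - `|x - c| / s)).

Lemma measurable_eta c s : measurable_fun setT (eta c s). Proof. by rewrite /eta; mes. Qed.

Lemma clamp_cases (t : R) : let m := Num.max 0 (Num.min 1 t) in
  [\/ t <= 0 /\ m = 0, 0 <= t <= 1 /\ m = t | 1 <= t /\ m = 1].
Proof.
rewrite /Order.max /Order.min; case: (ltP 1 t) => h1.
  by rewrite ltr01; constructor 3; rewrite ltW.
by case: (ltP 0 t) => h2; [constructor 2; rewrite ltW|constructor 1].
Qed.

Lemma eta_itv c s x : 0 <= eta c s x <= 1.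
Proof. by rewrite /eta; case: (clamp_cases (2 - `|x - c| / s)) => -[? ->]; clra. Qed.

Lemma eta_eq1 c s x : 0 < s -> `|x - c| <= s -> eta c s x = 1.
Proof.
move=> s0 h; have : `|x - c| / s <= 1 by rewrite ler_pdivrMr// mul1r.
by rewrite /eta; case: (clamp_cases (2 - `|x - c| / s)) => -[? ->]; clra.
Qed.

Lemma eta_eq0 c s x : 0 < s -> 2 * s <= `|x - c| -> eta c s x = 0.
Proof.
move=> s0 h; have : 2 <= `|x - c| / s by rewrite ler_pdivlMr.
by rewrite /eta; case: (clamp_cases (2 - `|x - c| / s)) => -[? ->]; clra.
Qed.

Lemma eta_lipschitz c s x y : 0 < s -> `|eta c s x - eta c s y| <= `|x - y| / s.
Proof.
move=> s0; have h : `| `|x - c| / s - `|y - c| / s| <= `|x - y| / s.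
  rewrite -mulrBl normrM (gtr0_norm (_ : 0 < s^-1)) ?invr_gt0// ler_pM2r ?invr_gt0//.
  by apply: le_trans (ler_dist_dist _ _) _; rewrite opprB addrA subrK.
move: h; rewrite /eta; set p := `|x - c| / s; set q := `|y - c| / s; set D := _ / s.
rewrite !ler_norml => /andP[h1 h2].
by case: (clamp_cases (2 - p)) => -[? ->]; case: (clamp_cases (2 - q)) => -[? ->]; apply/andP; split; clra.
Qed.

Lemma quotient_sqr_le (L B s x y t : R) : `|t| <= L * `|x - y| -> `|t| <= B ->
  t ^+ 2 / (x - y) ^+ 2 <= L ^+ 2 * Jnear s (x, y) + B ^+ 2 * Jfar s (x, y).
Proof.
move=> tL tB; have J0 := Jfar_ge0 s (x, y); have N0 := Jnear_ge0 s (x, y).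
have [xy|xy] := eqVneq x y.
  by rewrite -xy in J0 N0 *; rewrite subrr expr0n/= invr0 mulr0; nneg.
have [h|h] := leP `|x - y| s.
  apply: (@le_trans _ _ (L ^+ 2)); last by rewrite /Jnear indT//= mulr1 lerDl; nneg.
  by rewrite ler_pdivrMr ?sqr_gt0 ?subr_eq0// -(sqr_normr (x - y)) -exprMn norm_le_sqr.
apply: ler_wpDl; first by nneg.
by rewrite /Jfar/= (indT (ltW h)) mul1r; apply: ler_wpM2r (norm_le_sqr tB); exact: inv_sqr_ge0.
Qed.

Lemma eta_increment_le c s x y : 0 < s ->
  (eta c s x - eta c s y) ^+ 2 / (x - y) ^+ 2 <= Jmix s (x, y).
Proof.
move=> s0; have -> : Jmix s (x, y) = s^-1 ^+ 2 * Jnear s (x, y) + 1 ^+ 2 * Jfar s (x, y).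
  by rewrite expr1n mul1r exprVn mulrC.
apply: quotient_sqr_le; first by rewrite mulrC; exact: eta_lipschitz.
by have := eta_itv c s x; have := eta_itv c s y; rewrite ler_norml; clra.
Qed.

Definition annulus c s x := (s < `|x - c|) && (`|x - c| <= 2 * s).

Lemma measurable_annulus c s : measurable_fun setT (annulus c s).
Proof. by rewrite /annulus; mes. Qed.

Variant eta_spec c s x : R -> R -> R -> R -> Prop :=
  | EtaBall : eta_spec c s x 1 0 0 1
  | EtaAnnulus t : 0 <= t <= 1 -> eta_spec c s x 0 1 0 t
  | EtaFar : eta_spec c s x 0 0 1 0.

Lemma etaP c s x : 0 < s -> eta_spec c s x
  (ind (`|x - c| <= s)) (ind (annulus c s x)) (ind (2 * s < `|x - c|)) (eta c s x).
Proof.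
move=> s0; rewrite /annulus; have [h|h] := leP `|x - c| s.
  by rewrite eta_eq1// /ind [2 * s < _]ltNge (_ : `|x - c| <= 2 * s); [constructor|clra].
have [h'|h'] := leP `|x - c| (2 * s); last by rewrite eta_eq0 ?(ltW h')//; constructor.
by constructor; exact: eta_itv.
Qed.

Section HoleFilling.
Variables (w : R -> R) (c s y0 eA : R).
Hypotheses (mw : measurable_fun setT w)
  (hA : L1le mu (fun x => (w x - w y0) ^+ 2 / (x - y0) ^+ 2) eA).
Local Notation v x := (w x - w y0).

Lemma increment_L2_local (b : R -> bool) (K : R) : measurable_fun setT b -> 0 < K ->
  (forall x, b x -> `|x - y0| <= K) -> L1le mu (fun x => ind (b x) * v x ^+ 2) (K ^+ 2 * eA).
Proof.
move=> mb K0 hb; have := L1leZ (K ^+ 2) hA; rewrite ger0_norm ?sqr_ge0//; apply: L1le_dom; first by mes.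
move=> x; rewrite ger0_norm; last by nneg.
have [bx|bx] := boolP (b x); last by rewrite indF// mul0r; nneg.
rewrite indT// mul1r; have [->|xy] := eqVneq x y0; first by rewrite !subrr expr0n/= mul0r mulr0.
rewrite mulrCA ler_peMr ?sqr_ge0// ler_pdivlMr ?sqr_gt0 ?subr_eq0// mul1r.
by apply: norm_le_sqr; exact: hb.
Qed.

Hypotheses (s0 : 0 < s) (hy0 : `|y0 - c| <= 2 * s).

Lemma increment_far_le r x y : s <= r -> `|x - c| <= r -> 2 * r < `|y - c| ->
  v y ^+ 2 / (x - y) ^+ 2 <= 16 * (v y ^+ 2 / (y - y0) ^+ 2).
Proof.
move=> sr hx hy; rewrite mulrCA ler_wpM2l ?sqr_ge0// (_ : 16 = 4 ^+ 2); last by ring.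
apply: inv_sqr_le => //; first by rewrite subr_eq0; apply: contraTneq hy => ->; rewrite -leNgt; clra.
have := ler_distD c y y0; have := ler_distD x y c; rewrite (distrC c) (distrC y x); clra.
Qed.

Lemma L1le_ball_increment r : 0 <= r ->
  L1le mu2 (fun z => ind (`|z.1 - c| <= r) * (v z.2 ^+ 2 / (z.2 - y0) ^+ 2)) (2 * r * eA).
Proof.
move=> r0; have := @L1le_kernel_fst (fun z => v z.2 ^+ 2 / (z.2 - y0) ^+ 2) _ _ eA _ (fun=> hA) (L1le_ball c r0).
move=> H; apply: (eq_L1le _ (H _)) => [z|]; last by mes.
by rewrite distrC.
Qed.

Lemma en_cutoff_increment_le x y : en (fun x => eta c s x * v x) (x, y) <=
  2 * (ind (`|x - c| <= 2 * s) * en w (x, y)) +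
  (2 * (ind (`|y - c| <= 4 * s) * v y ^+ 2 * Jmix s (x, y)) +
   32 * (ind (`|x - c| <= 2 * s) * (v y ^+ 2 / (y - y0) ^+ 2))).
Proof.
rewrite /en/=; have /andP[p0 p1] := eta_itv c s x; have hd := eta_increment_le c x y s0.
set p := eta c s x in p0 p1 hd *; set q := eta c s y in hd *.
have k0 := inv_sqr_ge0 (x - y); set k := ((x - y) ^+ 2)^-1 in hd k0 *.
apply: (@le_trans _ _ (2 * (p ^+ 2 * ((w x - w y) ^+ 2 * k)) + 2 * (v y ^+ 2 * ((p - q) ^+ 2 * k)))).
  have -> : 2 * (p ^+ 2 * ((w x - w y) ^+ 2 * k)) + 2 * (v y ^+ 2 * ((p - q) ^+ 2 * k)) =
    (2 * (p ^+ 2 * (w x - w y) ^+ 2) + 2 * (v y ^+ 2 * (p - q) ^+ 2)) * k by ring.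
  apply: (ler_wpM2r k0); apply: (@le_sub_sqr _ (p * (w x - w y) - v y * (p - q))); ring.
apply: lerD.
  rewrite ler_pM2l//; apply: ler_wpM2r; first by nneg.
  have [h|h] := leP `|x - c| (2 * s); first by rewrite indT// expr_le1.
  by rewrite /p eta_eq0 ?(ltW h)// expr0n.
have [h|h] := leP `|y - c| (4 * s).
  rewrite indT// mul1r; apply: ler_wpDr; first by nneg.
  by rewrite ler_pM2l// ler_wpM2l ?sqr_ge0.
rewrite (indF (b := false))// !mul0r mulr0 add0r /q eta_eq0 ?subr0; [|by []|by clra].
have [hx|hx] := leP `|x - c| (2 * s); last first.
  by rewrite /p eta_eq0 ?(ltW hx)// expr0n/= mul0r !mulr0; nneg.
have hf : v y ^+ 2 * k <= 16 * (v y ^+ 2 / (y - y0) ^+ 2).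
  by apply: (increment_far_le _ hx); clra.
have : p ^+ 2 * (v y ^+ 2 * k) <= v y ^+ 2 * k by rewrite ler_piMl ?expr_le1//; nneg.
by rewrite indT// mul1r mulrCA; clra.
Qed.

Lemma L1le_en_cutoff_increment E2 : L1le mu2 (fun z => ind (`|z.1 - c| <= 2 * s) * en w z) E2 ->
  L1le mu2 (en (fun x => eta c s x * v x)) (2 * E2 + 416 * s * eA).
Proof.
move=> h2; have mb4 : measurable_fun setT (fun y : R => `|y - c| <= 4 * s) by mes.
have hV : L1le mu (fun y => ind (`|y - c| <= 4 * s) * v y ^+ 2) ((6 * s) ^+ 2 * eA).
  apply: increment_L2_local => // [|y hy]; first by clra.
  by have := ler_distD c y y0; rewrite (distrC c); clra.
have k1 := L1le_kernel_snd (measurable_Jmix s) (Jmix_sym s) (fun x => L1le_Jmix x s0) hV.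
have k2 := L1le_ball_increment (mulr_ge0 (ler0n _ 2) (ltW s0)).
have := L1leD (L1leZ 2 h2) (L1leD (L1leZ 2 k1) (L1leZ 32 k2)); rewrite !ger0_norm// => H.
apply: L1le_domW2 H _ _ _.
- apply: eqW; field; exact: lt0r_neq0.
- by apply: measurable_en; have me := measurable_eta c s; mes.
- by move=> x y; rewrite ger0_norm ?en_ge0//; exact: en_cutoff_increment_le.
Qed.

Definition hole_loss x y : R := 2 * (ind (annulus c s x) * (w x - w y) ^+ 2)
  + ind (annulus c s x) * v x ^+ 2 * (eta c s x - eta c s y) ^+ 2
  + ind (`|x - c| <= s) * ind (2 * s < `|y - c|) * v y ^+ 2.

Definition hole_error (z : R * R) : R := 2 * (ind (annulus c s z.1) * en w z)
  + ind (annulus c s z.1) * v z.1 ^+ 2 * Jmix s z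
  + 16 * (ind (`|z.1 - c| <= s) * (v z.2 ^+ 2 / (z.2 - y0) ^+ 2)).

Lemma hole_filling_pointwise x y :
  4^-1 * (ind (`|x - c| <= s) * (w x - w y) ^+ 2) - (hole_loss x y + hole_loss y x)
  <= (w x - w y) * (eta c s x * v x - eta c s y * v y).
Proof.
rewrite /hole_loss (_ : w x - w y = v x - v y); last by ring.
rewrite (_ : w y - w x = v y - v x); last by ring.
set X := v x; set Y := v y.
case: (etaP c x s0) => [|p /andP[p0 p1]|]; case: (etaP c y s0) => [|q /andP[q0 q1]|];
  have X2 := sqr_ge0 X; have Y2 := sqr_ge0 Y; have XY := sqr_ge0 (X + Y); have XY' := sqr_ge0 (X - Y); try clra.
- have := sqr_ge0 (Y * (1 - q)); have := sqr_ge0 ((X - Y) + Y * (1 - q)); clra.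
- have := sqr_ge0 (X * (p - 1)); have := sqr_ge0 ((X - Y) + X * (p - 1)); clra.
- have := sqr_ge0 (X * (p - q)); have := sqr_ge0 ((X - Y) + X * (p - q)).
  have := sqr_ge0 (Y * (p - q)); have := mulr_ge0 q0 XY'; clra.
- have := sqr_ge0 (X * (p - 0)); have := sqr_ge0 ((X - Y) + X * (p - 0)); clra.
- have := sqr_ge0 (Y * (0 - q)); have := sqr_ge0 ((X - Y) + Y * (0 - q)); clra.
Qed.

Lemma hole_loss_le x y : hole_loss x y / (x - y) ^+ 2 <= hole_error (x, y).
Proof.
rewrite /hole_loss /hole_error 2!mulrDl; apply: lerD; first apply: lerD.
- by rewrite /en -2!mulrA.
- by rewrite -mulrA; apply: ler_wpM2l; [nneg|exact: eta_increment_le].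
have [hx|hx] := leP `|x - c| s; last by rewrite /ind !mul0r mulr0.
have [hy|hy] := ltP (2 * s) `|y - c|; last by rewrite /ind mulr0 !mul0r mul1r; nneg.
by rewrite /ind !mul1r; exact: increment_far_le hx hy.
Qed.

Lemma L1le_hole_error nA : L1le mu2 (fun z => ind (annulus c s z.1) * en w z) nA ->
  L1le mu2 hole_error (2 * nA + 96 * (s * eA)).
Proof.
move=> hn; have V : L1le mu (fun x => ind (annulus c s x) * v x ^+ 2) ((4 * s) ^+ 2 * eA).
  apply: increment_L2_local; [exact: measurable_annulus|by clra|move=> x /andP[_ hx]].
  by have := ler_distD c x y0; rewrite (distrC c); clra.
have T2 := L1le_kernel_fst (measurable_Jmix s) (fun x => L1le_Jmix x s0) V.
have := L1leD (L1leD (L1leZ 2 hn) T2) (L1leZ 16 (L1le_ball_increment (ltW s0))).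
by rewrite !ger0_norm//; apply: L1leW; apply: eqW; field; exact: lt0r_neq0.
Qed.

End HoleFilling.
End CutOffEnergy.

Section Form.
Variable R : realType.
Local Notation mu := (@lebesgue_measure R).
Local Notation mu2 := (mu \x mu)%E.
Implicit Types (a w phi v f : R -> R) (x y c s : R).

Definition elliptic_kernel a (Lam : R) := [/\ measurable_fun setT a, 1 <= Lam,
  forall x, a x = a (- x) & forall x, Lam^-1 <= a x <= Lam].

Definition kern a (z : R * R) : R := a (z.1 - z.2) / (z.1 - z.2) ^+ 2.

Definition form a w phi : R :=
  \int[mu2]_z ((w z.1 - w z.2) * (phi z.1 - phi z.2) * kern a z).

Definition energy_over w (b : R -> bool) : R := \int[mu2]_z (ind (b z.1) * en w z).

Lemma measurable_kern a Lam : elliptic_kernel a Lam -> measurable_fun setT (kern a).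
Proof. by case=> ma _ _ _; rewrite /kern; mes. Qed.

Lemma kern_bounds a Lam x y : elliptic_kernel a Lam ->
  Lam^-1 / (x - y) ^+ 2 <= kern a (x, y) <= Lam / (x - y) ^+ 2.
Proof.
by case=> _ _ _ /(_ (x - y)) /andP[h1 h2]; rewrite /kern/=; apply/andP; split;
  apply: ler_wpM2r => //; exact: inv_sqr_ge0.
Qed.

Lemma kern_ge0 a Lam z : elliptic_kernel a Lam -> 0 <= kern a z.
Proof.
case: z => x y h; case: (h) => _ L1 _ _; have /andP[+ _] := kern_bounds x y h; apply: le_trans.
by apply: mulr_ge0; [rewrite invr_ge0; clra|exact: inv_sqr_ge0].
Qed.

Lemma kern_sym a Lam x y : elliptic_kernel a Lam -> kern a (x, y) = kern a (y, x).
Proof. by case=> _ _ sa _; rewrite /kern/= sa opprB -sqrrN opprB. Qed.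

Lemma L1le_form a Lam w phi (b : R -> bool) E P : elliptic_kernel a Lam ->
  measurable_fun setT w -> measurable_fun setT phi -> measurable_fun setT b ->
  (forall x, ~~ b x -> phi x = 0) ->
  L1le mu2 (fun z => ind (b z.1) * en w z) E -> L1le mu2 (en phi) P ->
  L1le mu2 (fun z => (w z.1 - w z.2) * (phi z.1 - phi z.2) * kern a z) (Lam * (E + P / 2)).
Proof.
move=> ok mw mp mb b0 hE hP; have [ma L1 sa ba] := ok; have mk := measurable_kern ok.
have H := L1leZ Lam (L1leD (L1leZ 2^-1 (L1leD hE (L1le_swap hE))) (L1leZ 2^-1 hP)).
apply: L1le_domW2 H _ _ _.
- by rewrite !ger0_norm//; clra.
- by mes.
move=> x y /=; rewrite /en/= -(sqrrN (y - x)) opprB -(sqrrN (w y - w x)) opprB.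
rewrite normrM [`|kern a _|]ger0_norm; last exact: kern_ge0 ok.
set d := w x - w y; set e := phi x - phi y; set k := ((x - y) ^+ 2)^-1.
have k0 : 0 <= k := inv_sqr_ge0 _.
have /andP[_ hk] := kern_bounds x y ok.
have e0 : ind (b x) + ind (b y) < 1 :> R -> e = 0.
  rewrite /e /ind; case: ifPn => bx; case: ifPn => bY; try clra.
  by move=> _; rewrite !b0// subrr.
have young : `|d * e| <= 2^-1 * (ind (b x) * d ^+ 2 + ind (b y) * d ^+ 2) + 2^-1 * e ^+ 2.
  have [/e0 ->|h] := ltP (ind (b x) + ind (b y)) (1 : R).
    rewrite mulr0 normr0 expr0n/= mulr0 addr0; apply: mulr_ge0 => //.
    by apply: addr_ge0; nneg.
  have d2 : d ^+ 2 <= ind (b x) * d ^+ 2 + ind (b y) * d ^+ 2.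
    by rewrite -mulrDl ler_peMl ?sqr_ge0.
  rewrite normrM; have := sqr_ge0 (`|d| - `|e|); rewrite sqrrB !real_normK ?num_real//.
  by move: d2; clra.
apply: le_trans (ler_wpM2l (normr_ge0 _) hk) _.
have := ler_wpM2r (mulr_ge0 (le_trans ler01 L1) k0) young.
by rewrite -/k; clra.
Qed.

Lemma hole_filling_kern a Lam w c s y0 x y : elliptic_kernel a Lam -> 0 < s -> `|y0 - c| <= 2 * s ->
  (4 * Lam)^-1 * (ind (`|x - c| <= s) * en w (x, y))
    - Lam * (hole_error w c s y0 (x, y) + hole_error w c s y0 (y, x))
  <= (w x - w y) * (eta c s x * (w x - w y0) - eta c s y * (w y - w y0)) * kern a (x, y).
Proof.
move=> ok s0 hy0; have [ma L1 _ _] := ok; have k0 := kern_ge0 (x, y) ok.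
have /andP[hk1 hk2] := kern_bounds x y ok.
apply: le_trans _ (ler_wpM2r k0 (hole_filling_pointwise w c y0 s0 x y)); rewrite mulrBl; apply: lerB.
  rewrite invfM -!(mulrA 4^-1) ler_pM2l// mulrCA -mulrA /en/=; apply: ler_wpM2l; first by nneg.
  by rewrite mulrCA; apply: ler_wpM2l => //; nneg.
have loss0 u t : 0 <= hole_loss w c s y0 u t by rewrite /hole_loss; nneg.
apply: le_trans (ler_wpM2l (addr_ge0 (loss0 x y) (loss0 y x)) hk2) _.
rewrite mulrCA; apply: ler_wpM2l; first by clra.
by rewrite mulrDl lerD//; [|rewrite sqr_distC]; exact: hole_loss_le.
Qed.

Lemma hole_filling a Lam w c s y0 eA E2 : elliptic_kernel a Lam ->
  measurable_fun setT w -> 0 < s -> annulus c s y0 ->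
  L1le mu (fun x => (w x - w y0) ^+ 2 / (x - y0) ^+ 2) eA ->
  L1le mu2 (fun z => ind (`|z.1 - c| <= 2 * s) * en w z) E2 ->
  (4 * Lam)^-1 * energy_over w (fun x => `|x - c| <= s)
    - Lam * (4 * energy_over w (annulus c s) + 192 * (s * eA))
  <= form a w (fun x => eta c s x * (w x - w y0)).
Proof.
move=> ok mw s0 /andP[_ hy0] hA h2; have [ma L1 sa ba] := ok; have me := measurable_eta c s.
have sub (b : R -> bool) : measurable_fun setT b -> (forall x, b x -> `|x - c| <= 2 * s) ->
    L1le mu2 (fun z => ind (b z.1) * en w z) (energy_over w b).
  move=> mb hb; apply: L1le_Rint => [|z]; last by nneg.
  apply: L1le_subind h2; [by mes|exact: measurable_en|exact: en_ge0|by move=> z; exact: hb].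
have T1 : L1le mu2 (fun z => ind (`|z.1 - c| <= s) * en w z) (energy_over w (fun x => `|x - c| <= s)).
  by apply: (sub (fun x => `|x - c| <= s)) => [|x]; [mes|clra].
have TA := sub _ (measurable_annulus c s) (fun x => @proj2 _ _ \o andP).
have S := L1le_hole_error mw hA s0 hy0 TA.
have {}S := L1leD S (L1le_swap S).
have m2 : measurable_fun setT (fun x : R => `|x - c| <= 2 * s) by mes.
have phi0 x : ~~ (`|x - c| <= 2 * s) -> eta c s x * (w x - w y0) = 0.
  by rewrite -ltNge => h; rewrite eta_eq0 ?mul0r// ltW.
have mphi : measurable_fun setT (fun x => eta c s x * (w x - w y0)) by mes.
have FL := L1le_form ok mw mphi m2 phi0 h2 (L1le_en_cutoff_increment mw hA s0 hy0 h2).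
apply: le_trans (le_Rint (L1leB (L1leZ (4 * Lam)^-1 T1) (L1leZ Lam S)) FL _); last first.
  by move=> [x y]; exact: hole_filling_kern.
rewrite (RintB (L1leZ _ T1) (L1leZ _ S)) (RintZ _ T1) (RintZ _ S); apply: lerB => //.
apply: ler_wpM2l; first by clra.
by apply: le_trans (Rint_le_bound S) _; apply: eqW; ring.
Qed.

Lemma exists_annulus_section (F : R * R -> R) c s E : 0 < s -> measurable_fun setT F ->
  (forall z, 0 <= F z) -> L1le mu2 (fun z => ind (annulus c s z.1) * F z) E ->
  exists y0, annulus c s y0 /\ L1le mu (fun x => F (y0, x)) (E / s).
Proof.
move=> s0 mF F0; have mA := measurable_annulus c s; apply: exists_section => //.
have <- : mu [set` `]c + s, c + 2 * s]%R] = s%:E.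
  by rewrite lebesgue_measure_itv/= lte_fin ifT ?ltrD2l -?EFinB; [congr EFin; ring|clra].
apply: le_measure; rewrite ?inE//; first by have := mA measurableT [set true] I; rewrite setTI.
move=> x /=; rewrite in_itv/= => /andP[h1 h2].
by rewrite /annulus ger0_norm; [apply/andP; split; clra|clra].
Qed.

Lemma exists_annulus_increment w c s E : measurable_fun setT w -> 0 < s ->
  L1le mu2 (fun z => ind (annulus c s z.1) * en w z) E ->
  exists y0, annulus c s y0 /\ L1le mu (fun x => (w x - w y0) ^+ 2 / (x - y0) ^+ 2) (E / s).
Proof.
move=> mw s0 h; have [y0 [Ay hy]] := exists_annulus_section s0 (measurable_en mw) (en_ge0 w) h.
exists y0; split => //; apply: eq_L1le hy => x.
by rewrite /en/= sqr_distC (sqr_distC y0).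
Qed.
End Form.
(** * Dyadic averages and compensated products *)

Section Avg.
Variable R : realType.
Local Notation mu := (@lebesgue_measure R).
Local Notation mu2 := (mu \x mu)%E.
Implicit Types (w phi v f : R -> R) (x y c s : R).

Lemma lipschitz_measurable (K : R) f : (forall x y, `|f x - f y| <= K * `|x - y|) -> measurable_fun setT f.
Proof.
move=> h; apply: continuous_measurable_fun => x.
apply/cvgrPdist_le => e e0.
have [K0|K0] := leP K 0.
  near=> y; apply: le_trans (h x y) _.
  by apply: le_trans (ltW e0); apply: mulr_le0_ge0.
have e1 : 0 < K^-1 * e by rewrite mulr_gt0// invr_gt0.
apply/nbhs_ballP; exists (K^-1 * e); first exact: e1.
move=> y; rewrite /ball/= => /ltW hy; apply: le_trans (h x y) _.
by rewrite -ler_pdivlMl.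
Unshelve. all: by end_near. Qed.

Lemma etaC x d y : eta x d y = eta y d x.
Proof. by rewrite /eta distrC. Qed.

Lemma eta_lipschitz_center x y d z : 0 < d -> `|eta x d z - eta y d z| <= `|x - y| / d.
Proof. by rewrite (etaC x) (etaC y); exact: eta_lipschitz. Qed.

Lemma eta_le_ind x d z : 0 < d -> eta x d z <= ind (`|x - z| <= 2 * d).
Proof.
move=> d0; have [h|h] := leP `|x - z| (2 * d).
  by rewrite indT//; case/andP: (eta_itv x d z).
by rewrite eta_eq0// distrC ltW.
Qed.

Definition eta_mass (d : R) : R := \int[mu]_z eta 0 d z.
Definition avg (d : R) w x : R := (eta_mass d)^-1 * \int[mu]_z (w z * eta x d z).

Lemma L1le_eta x d : 0 < d -> L1le mu (fun z => eta x d z) (4 * d).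
Proof.
move=> d0; have h0 : 0 <= 2 * d by clra.
have := L1le_ball x h0; rewrite mulrA => h.
have -> : 4 * d = 2 * 2 * d by ring.
apply: L1le_dom h; first exact: measurable_eta.
by move=> z; rewrite ger0_norm ?eta_le_ind//; case/andP: (eta_itv x d z).
Qed.

Lemma eta_mass_ge d : 0 < d -> 2 * d <= eta_mass d.
Proof.
move=> d0; rewrite -(Rint_ball 0 (ltW d0)) /eta_mass.
apply: (le_Rint (L1le_ball 0 (ltW d0)) (L1le_eta 0 d0)) => z.
rewrite /ind; case: (leP `|0 - z| d) => h; last by case/andP: (eta_itv 0 d z).
by rewrite eta_eq1// distrC.
Qed.

Lemma Rint_eta x d : \int[mu]_z eta x d z = eta_mass d.
Proof.
rewrite /eta_mass -(Rint_shift (- x) (measurable_eta 0 d)); apply: eq_Rint => z.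
by rewrite /eta subr0.
Qed.

Section bounded.
Variables (w : R -> R) (M d : R).
Hypotheses (mw : measurable_fun setT w) (wM : forall x, `|w x| <= M) (d0 : 0 < d).

Lemma L1le_mul_eta x : L1le mu (fun z => w z * eta x d z) (M * (4 * d)).
Proof.
have M0 : 0 <= M := le_trans (normr_ge0 _) (wM 0).
have := L1leZ M (L1le_eta x d0); rewrite (ger0_norm M0); apply: L1le_dom.
  by have me := measurable_eta x d; mes.
move=> z; rewrite normrM [`|eta _ _ _|]ger0_norm; last by case/andP: (eta_itv x d z).
by apply: ler_wpM2r => //; case/andP: (eta_itv x d z).
Qed.

Lemma normr_mean_le (F : R -> R) D : L1le mu F D -> `|(eta_mass d)^-1 * \int[mu]_z F z| <= D / (2 * d).
Proof.
move=> hF; have mg := eta_mass_ge d0; have m0 : 0 < eta_mass d by clra.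
rewrite normrM gtr0_norm ?invr_gt0// mulrC; apply: ler_pM => //; first by rewrite invr_ge0 ltW.
  exact: normr_Rint_le.
by rewrite lef_pV2// posrE; clra.
Qed.

Lemma avg_sub x c : avg d w x - c = (eta_mass d)^-1 * \int[mu]_z ((w z - c) * eta x d z).
Proof.
have m0 : 0 < eta_mass d by have := eta_mass_ge d0; clra.
have -> : \int[mu]_z ((w z - c) * eta x d z) = \int[mu]_z (w z * eta x d z) - c * eta_mass d.
  rewrite -(Rint_eta x) -(RintZ c (L1le_eta x d0)) -(RintB (L1le_mul_eta x) (L1leZ c (L1le_eta x d0))).
  by apply: eq_Rint => z; ring.
by rewrite /avg; field; exact: lt0r_neq0.
Qed.

Lemma avg_sub_le x c D : L1le mu (fun z => ind (`|z - x| <= 2 * d) * `|w z - c|) D ->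
  `|avg d w x - c| <= D / (2 * d).
Proof.
move=> hD; rewrite avg_sub; apply: normr_mean_le; apply: L1le_dom hD.
  by have me := measurable_eta x d; mes.
move=> z; have /andP[e0 _] := eta_itv x d z; rewrite normrM (ger0_norm e0) mulrC.
by apply: ler_wpM2r => //; rewrite (distrC z); exact: eta_le_ind.
Qed.

Lemma avg_sub_avg x y c : avg d w x - avg d w y =
  (eta_mass d)^-1 * \int[mu]_z ((w z - c) * (eta x d z - eta y d z)).
Proof.
have -> : avg d w x - avg d w y = (avg d w x - c) - (avg d w y - c) by ring.
rewrite !avg_sub -mulrBr; congr (_ * _).
have h u : L1le mu (fun z => (w z - c) * eta u d z) (M * (4 * d) + `|c| * (4 * d)).
  by apply: eq_L1le (L1leB (L1le_mul_eta u) (L1leZ c (L1le_eta u d0))) => z; ring.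
by rewrite -(RintB (h x) (h y)); apply: eq_Rint => z; ring.
Qed.

Lemma avg_lipschitz_of_kernel x y c (J : R -> R) D : L1le mu (fun z => J z * `|w z - c|) D ->
  (forall z, `|eta x d z - eta y d z| <= `|x - y| / d * J z) ->
  `|avg d w x - avg d w y| <= `|x - y| / d * (D / (2 * d)).
Proof.
move=> hD hJ; rewrite (avg_sub_avg x y c) mulrA; apply: normr_mean_le.
have l0 : 0 <= `|x - y| / d by rewrite divr_ge0// ltW.
have := L1leZ (`|x - y| / d) hD; rewrite (ger0_norm l0); apply: L1le_dom => [|z].
  by have me := measurable_eta x d; have me' := measurable_eta y d; mes.
by rewrite normrM mulrC mulrA; apply: ler_wpM2r.
Qed.

Lemma avg_lipschitz_local x y c D : L1le mu (fun z => ind (`|z - x| <= 3 * d) * `|w z - c|) D ->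
  `|x - y| <= d -> `|avg d w x - avg d w y| <= `|x - y| / d * (D / (2 * d)).
Proof.
move=> hD xy; apply: avg_lipschitz_of_kernel hD _ => z.
have [hz|hz] := leP `|z - x| (3 * d); first by rewrite indT// mulr1 eta_lipschitz_center.
rewrite !eta_eq0//; [by rewrite subrr normr0 indF// mulr0| |by clra].
by have := ler_distD y z x; rewrite (distrC y x); clra.
Qed.

Lemma avg_lipschitz x y : `|avg d w x - avg d w y| <= 4 * M / d * `|x - y|.
Proof.
have h20 : 0 <= 2 * d by clra.
pose J z : R := ind (`|x - z| <= 2 * d) + ind (`|y - z| <= 2 * d).
have hJ : L1le mu (fun z => J z * `|w z - 0|) (M * (8 * d)).
  have := L1leZ M (L1leD (L1le_ball x h20) (L1le_ball y h20)); rewrite (ger0_norm (le_trans (normr_ge0 _) (wM 0))).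
  rewrite (_ : 2 * (2 * d) + 2 * (2 * d) = 8 * d); last by ring.
  apply: L1le_dom => [|z]; first by rewrite /J; mes.
  have J0 : 0 <= J z by rewrite /J; nneg.
  by rewrite ger0_norm ?mulr_ge0// mulrC subr0; apply: ler_wpM2r.
apply: le_trans (avg_lipschitz_of_kernel hJ _) _; last by apply: eqW; field; exact: lt0r_neq0.
move=> z; rewrite /J; have l0 : 0 <= `|x - y| / d by rewrite divr_ge0// ltW.
have [hx|hx] := leP `|x - z| (2 * d).
  by apply: le_trans (eta_lipschitz_center _ _ _ d0) _; rewrite ler_peMr// indT// lerDl ind_ge0.
have [hy|hy] := leP `|y - z| (2 * d).
  by apply: le_trans (eta_lipschitz_center _ _ _ d0) _; rewrite ler_peMr// [ind true]indT// lerDr ind_ge0.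
by rewrite !eta_eq0 1?distrC ?(ltW hx) ?(ltW hy)// subrr normr0 mulr_ge0// addr_ge0// ind_ge0.
Qed.

Lemma measurable_avg : measurable_fun setT (avg d w).
Proof. exact: lipschitz_measurable avg_lipschitz. Qed.

Lemma avg_le x : `|avg d w x| <= 2 * M.
Proof.
have M0 : 0 <= M := le_trans (normr_ge0 _) (wM 0).
have h20 : 0 <= 2 * d by clra.
rewrite -[avg d w x]subr0; apply: (le_trans (@avg_sub_le x 0 (M * (2 * (2 * d))) _)).
  have := L1leZ M (L1le_ball x h20); rewrite (ger0_norm M0); apply: L1le_dom.
    by mes.
  move=> z; rewrite subr0 normrM normr_id ger0_norm ?ind_ge0// (distrC z) mulrC.
  by apply: ler_wpM2r => //; exact: ind_ge0.
by apply: eqW; field; exact: lt0r_neq0.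
Qed.

Lemma avg_eq0 x c r : (forall z, r < `|z - c| -> w z = 0) -> r + 2 * d < `|x - c| -> avg d w x = 0.
Proof.
move=> h hx; rewrite /avg (_ : (fun z => _) = fun=> 0).
  by rewrite /Rintegral integral0 mulr0.
apply/funext => z; have [hz|hz] := leP `|z - x| (2 * d).
  rewrite h ?mul0r//; have := ler_normD (x - z) (z - c).
  by rewrite addrA subrK (distrC x z); clra.
by rewrite eta_eq0 ?mulr0// ltW.
Qed.

End bounded.

Lemma exists_local_mean w d x sg : measurable_fun setT w -> 0 < d -> 0 <= sg ->
  L1le mu2 (fun z => ind (`|z.1 - x| <= 3 * d) * en w z) (sg ^+ 2) ->
  exists c, L1le mu (fun z => ind (`|z - x| <= 3 * d) * `|w z - c|) (12 * (d * sg)).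
Proof.
move=> mw d0 s0 hE; have hs : 0 < 3 / 2 * d by clra.
have [|y0 [/andP[_ Ay0] hy]] := @exists_annulus_increment _ w x _ (sg ^+ 2) mw hs.
  apply: L1le_subind hE; [|exact: measurable_en|exact: en_ge0|move=> z /andP[_]; clra].
  by have mA := measurable_annulus x (3 / 2 * d); mes.
exists (w y0); have mb : measurable_fun setT (fun z : R => `|z - x| <= 3 * d) by mes.
have hv : L1le mu (fun z => (ind (`|z - x| <= 3 * d) * `|w z - w y0|) ^+ 2) ((6 * d) ^+ 2 * (sg ^+ 2 / (3 / 2 * d))).
  apply: eq_L1le (increment_L2_local mw hy mb _ _) => [z||z hz]; [|by clra|].
    by rewrite exprMn sqr_normr ind_sqr.
  by have := ler_distD x z y0; rewrite (distrC x); clra.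
have hb : L1le mu (fun z => ind (`|z - x| <= 3 * d) ^+ 2) (2 * (3 * d)).
  by apply: eq_L1le (L1le_ball x (mulr_ge0 (ler0n _ 3) (ltW d0))) => z; rewrite ind_sqr distrC.
apply: eq_L1le (L1le_cauchy_schwarz _ _ _ _ hb hv) => [z||||]; [by rewrite mulrA -expr2 ind_sqr|by mes|by mes| |].
  by rewrite !mulr_ge0// ltW.
by apply: eqW; field; exact: lt0r_neq0.
Qed.

Lemma avg_oscillation w M d x sg : measurable_fun setT w -> (forall x, `|w x| <= M) -> 0 < d -> 0 <= sg ->
  L1le mu2 (fun z => ind (`|z.1 - x| <= 3 * d) * en w z) (sg ^+ 2) ->
  [/\ `|avg d w x - avg (d / 2) w x| <= 18 * sg &
     forall y, `|x - y| <= d -> `|avg d w x - avg d w y| <= 6 * sg * (`|x - y| / d)].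
Proof.
move=> mw wM d0 s0 hE; have [c hc] := exists_local_mean mw d0 s0 hE.
have sub r : r <= 3 * d -> L1le mu (fun z => ind (`|z - x| <= r) * `|w z - c|) (12 * (d * sg)).
  by move=> hr; apply: L1le_subind hc => // [||z]; [by mes|by mes|clra].
have d20 : 0 < d / 2 by clra.
split=> [|y xy].
  have n1 := avg_sub_le mw wM d0 (sub (2 * d) _); have n2 := avg_sub_le mw wM d20 (sub (2 * (d / 2)) _).
  rewrite (_ : 12 * (d * sg) / (2 * d) = 6 * sg) in n1; last by field; exact: lt0r_neq0.
  rewrite (_ : 12 * (d * sg) / (2 * (d / 2)) = 12 * sg) in n2; last by field; exact: lt0r_neq0.
  by have := ler_distD c (avg d w x) (avg (d / 2) w x); rewrite (distrC c); clra.
have := avg_lipschitz_local mw wM d0 hc xy.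
by rewrite (_ : 12 * (d * sg) / (2 * d) = 6 * sg) 1?mulrC//; field; exact: lt0r_neq0.
Qed.

Lemma poincare w c r E : measurable_fun setT w -> 0 < r ->
  (forall x, r < `|x - c| -> w x = 0) -> L1le mu2 (en w) E ->
  L1le mu (fun x => w x ^+ 2) (9 * (r * E)).
Proof.
move=> mw r0 w0 hE; have [|y0 [/andP[Ay0 Ay1] hy]] := @exists_annulus_increment _ w c r E mw r0.
  by apply: L1le_ind hE; [have mA := measurable_annulus c r; mes|exact: en_ge0].
have mb : measurable_fun setT (fun z : R => `|z - c| <= r) by mes.
have : L1le mu (fun z => ind (`|z - c| <= r) * (w z - w y0) ^+ 2) ((3 * r) ^+ 2 * (E / r)).
  apply: (increment_L2_local mw hy mb) => [|z hz]; first by clra.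
  by have := ler_distD c z y0; rewrite (distrC c); clra.
rewrite (_ : (3 * r) ^+ 2 * (E / r) = 9 * (r * E)); last by field; exact: lt0r_neq0.
apply: eq_L1le => x; rewrite (w0 y0)// subr0.
by have [h|h] := leP `|x - c| r; rewrite /ind ?mul1r// w0// expr0n/= mulr0.
Qed.
End Avg.

Section Dyadic.
Variable R : realType.
Local Notation mu := (@lebesgue_measure R).
Local Notation mu2 := (mu \x mu)%E.
Implicit Types (g w phi v f : R -> R) (x y c s : R).

Definition dyad (r : R) (k : nat) : R := r / 2 ^+ k.

Lemma dyad0 r : dyad r 0 = r. Proof. by rewrite /dyad expr0 divr1. Qed.
Lemma dyadS r k : dyad r k.+1 = dyad r k / 2.
Proof. by rewrite /dyad exprS; field; rewrite expf_neq0. Qed.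

Lemma dyad_gt0 r k : 0 < r -> 0 < dyad r k.
Proof. by move=> r0; rewrite divr_gt0// exprn_gt0. Qed.

Lemma dyad_le r k : 0 < r -> dyad r k <= r.
Proof.
move=> r0; elim: k => [|k ih]; first by rewrite dyad0.
by rewrite dyadS; have := dyad_gt0 k r0; clra.
Qed.

Lemma sum_nat_shift (X : nat -> R) K :
  \sum_(0 <= m < K) X m.+1 = \sum_(0 <= m < K) X m + X K - X 0%N.
Proof.
elim: K => [|K ih]; first by rewrite !big_geq//; ring.
by rewrite !big_nat_recr//= ih; ring.
Qed.

Lemma sum_le_descending (X Y : nat -> R) K : (forall m, 0 <= X m) ->
  (forall m, (m < K)%N -> X m <= 3 / 4 * X m.+1 + Y m) ->
  \sum_(0 <= m < K) X m <= 4 * \sum_(0 <= m < K) Y m + 3 * X K.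
Proof.
move=> X0 h; have : \sum_(0 <= m < K) X m <= \sum_(0 <= m < K) (3 / 4 * X m.+1 + Y m).
  by rewrite big_nat [leRHS]big_nat; apply: ler_sum => m /andP[_ /h].
rewrite big_split/= -mulr_sumr sum_nat_shift; have := X0 0%N; clra.
Qed.

Lemma sum_le_ascending (X Y : nat -> R) K : (forall m, 0 <= X m) ->
  (forall m, (m < K)%N -> X m.+1 <= 3 / 4 * X m + Y m) ->
  \sum_(0 <= m < K) X m.+1 <= 4 * \sum_(0 <= m < K) Y m + 3 * X 0%N.
Proof.
move=> X0 h; have : \sum_(0 <= m < K) X m.+1 <= \sum_(0 <= m < K) (3 / 4 * X m + Y m).
  by rewrite big_nat [leRHS]big_nat; apply: ler_sum => m /andP[_ /h].
rewrite big_split/= -mulr_sumr sum_nat_shift; have := X0 K; have := X0 0%N; clra.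
Qed.

Lemma exists_small_term (X : nat -> R) S (e : R) K0 : (forall m, 0 <= X m) ->
  (forall K, \sum_(0 <= m < K) X m <= S) -> 0 < e -> exists K, (K0 <= K)%N /\ X K <= e.
Proof.
move=> X0 hS e0; apply: contrapT => /forallNP H.
have hX K : (K0 <= K)%N -> e <= X K.
  by move=> hK; rewrite leNgt; apply/negP => h; apply: (H K); rewrite hK ltW.
have [n hn] : exists n, S < n%:R * e.
  exists (Num.truncn (S / e)).+1; rewrite -ltr_pdivrMr//.
  exact: truncnS_gt.
have := hS (K0 + n)%N; rewrite (@big_cat_nat _ _ _ K0) ?leq_addr//=.
have h1 : 0 <= \sum_(0 <= m < K0) X m by exact: sumr_ge0.
have h2 : n%:R * e <= \sum_(K0 <= m < K0 + n) X m.
  apply: (@le_trans _ _ (\sum_(K0 <= m < K0 + n) e)).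
    by rewrite sumr_const_nat addKn mulr_natl.
  by rewrite big_nat [leRHS]big_nat; apply: ler_sum => m /andP[/hX].
clra.
Qed.

Lemma sum_dyad_ratio_sqr_le (t r : R) (K : nat) : 0 < r -> 0 <= t ->
  \sum_(0 <= k < K) ind (t <= 3 * dyad r k) * (t / dyad r k) ^+ 2 <= 12.
Proof.
move=> r0 t0.
have h n : \sum_(0 <= k < n) ind (t <= 3 * dyad r k) * (t / dyad r k) ^+ 2 <= 3^-1 * (t / dyad r n) ^+ 2.
  elim: n => [|n ih]; first by rewrite big_geq//; nneg; rewrite invr_ge0.
  rewrite big_nat_recr//= dyadS; have dn := dyad_gt0 n r0.
  have -> : 3^-1 * (t / (dyad r n / 2)) ^+ 2 = 3^-1 * (t / dyad r n) ^+ 2 + (t / dyad r n) ^+ 2.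
    by field; exact: lt0r_neq0.
  by apply: lerD => //; apply: ler_piMl; [exact: sqr_ge0|exact: ind_le1].
elim: K => [|n ih]; first by rewrite big_geq.
have [hn|hn] := boolP (t <= 3 * dyad r n).
  apply: le_trans (h n.+1) _; rewrite dyadS; have dn := dyad_gt0 n r0.
  have -> : 3^-1 * (t / (dyad r n / 2)) ^+ 2 = 4 / 3 * (t / dyad r n) ^+ 2.
    by field; exact: lt0r_neq0.
  have : t / dyad r n <= 3 by rewrite ler_pdivrMr.
  have : 0 <= t / dyad r n by rewrite divr_ge0// ltW.
  by cnra.
by rewrite big_nat_recr//= (indF hn) mul0r addr0.
Qed.

Section Oscillation.
Variables (g : R -> R) (M : R).
Hypotheses (mg : measurable_fun setT g) (gM : forall x, `|g x| <= M).

Definition near_sqr d (z : R * R) : R := ind (`|z.1 - z.2| <= 3 * d) * (g z.1 - g z.2) ^+ 2.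
Definition osc d x : R := \int[mu]_z (ind (`|x - z| <= 3 * d) * `|g x - g z|).

Lemma near_sqr_ge0 d z : 0 <= near_sqr d z. Proof. by rewrite /near_sqr; nneg. Qed.

Lemma measurable_near_sqr d : measurable_fun setT (near_sqr d).
Proof. by rewrite /near_sqr; mes. Qed.

Lemma L1le_near (f : R -> R) B d x : 0 <= d -> measurable_fun setT f -> (forall z, 0 <= f z <= B) ->
  L1le mu (fun z => ind (`|x - z| <= 3 * d) * f z) (B * (2 * (3 * d))).
Proof.
move=> d0 mf fB; have B0 : 0 <= B by case/andP: (fB 0); exact: le_trans.
have := L1leZ B (L1le_ball x (mulr_ge0 (ler0n _ 3) d0)); rewrite (ger0_norm B0).
apply: L1le_dom => [|z]; first by mes.
have /andP[f0 f1] := fB z; rewrite ger0_norm ?mulr_ge0 ?ind_ge0// mulrC.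
by apply: ler_wpM2r => //; exact: ind_ge0.
Qed.

Lemma increment_le_twice x z : 0 <= `|g x - g z| <= 2 * M.
Proof. by have := ler_normB (g x) (g z); have := gM x; have := gM z; rewrite normr_ge0/=; clra. Qed.

Lemma L1le_osc d x : 0 <= d ->
  L1le mu (fun z => ind (`|x - z| <= 3 * d) * `|g x - g z|) (osc d x).
Proof.
move=> d0; apply: L1le_Rint => [|z]; last by nneg.
by apply: L1le_near (increment_le_twice x) => //; mes.
Qed.

Lemma L1le_near_sqr_section d x : 0 <= d ->
  L1le mu (fun z => near_sqr d (x, z)) ((2 * M) ^+ 2 * (2 * (3 * d))).
Proof.
move=> d0; apply: L1le_near => // [|z]; first by mes.
by have /andP[_] := increment_le_twice x z; rewrite sqr_ge0; exact: norm_le_sqr.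
Qed.

Lemma measurable_osc d : measurable_fun setT (osc d).
Proof.
apply: (measurable_Rint_snd (F := fun z => ind (`|z.1 - z.2| <= 3 * d) * `|g z.1 - g z.2|)); first by mes.
by move=> z; nneg.
Qed.

Lemma osc_sqr_le d x : 0 <= d -> osc d x ^+ 2 <= 6 * d * \int[mu]_z near_sqr d (x, z).
Proof.
move=> d0; set I := \int[mu]_z _.
have I0 : 0 <= I by apply: Rintegral_ge0 => z _; exact: near_sqr_ge0.
have hI : L1le mu (fun z => (ind (`|x - z| <= 3 * d) * `|g x - g z|) ^+ 2) I.
  apply: eq_L1le (L1le_Rint (L1le_near_sqr_section x d0) (fun z => near_sqr_ge0 _ _)) => z.
  by rewrite exprMn sqr_normr ind_sqr.
have hb : L1le mu (fun z => ind (`|x - z| <= 3 * d) ^+ 2) (6 * d).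
  apply: eq_L1le (_ : L1le mu _ _) => [z|]; first by rewrite ind_sqr.
  by have := L1le_ball x (mulr_ge0 (ler0n _ 3) d0); rewrite mulrA -natrM.
have c0 : 0 <= 6 * d * I by rewrite !mulr_ge0.
have osc_le : osc d x <= Num.sqrt (6 * d * I).
  apply: Rint_le_bound; apply: eq_L1le (L1le_cauchy_schwarz _ _ (sqrtr_ge0 _) _ hb hI) => [z|||].
  - by rewrite mulrA -expr2 ind_sqr.
  - by mes.
  - by mes.
  - by rewrite sqr_sqrtr.
by rewrite -(sqr_sqrtr c0); apply: norm_le_sqr; rewrite ger0_norm//; apply: Rintegral_ge0 => z _; nneg.
Qed.

Lemma near_sqr_le_en d z : 0 <= d -> near_sqr d z <= (3 * d) ^+ 2 * en g z.
Proof.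
move=> d0; rewrite /near_sqr /en; have [h|h] := leP `|z.1 - z.2| (3 * d); last by rewrite indF// mul0r; nneg.
rewrite indT// mul1r; have [->|xy] := eqVneq z.1 z.2; first by rewrite !subrr expr0n/= mul0r mulr0.
by rewrite mulrCA ler_peMr ?sqr_ge0// ler_pdivlMr ?sqr_gt0 ?subr_eq0// mul1r norm_le_sqr.
Qed.

Lemma avg_error d x : 0 < d -> `|g x - avg d g x| <= (2 * d)^-1 * osc d x.
Proof.
move=> d0; rewrite distrC mulrC; apply: (avg_sub_le mg gM d0); apply: L1le_dom (L1le_osc x (ltW d0)) => [|z].
  by mes.
rewrite ger0_norm; last by nneg.
by rewrite (distrC (g z)) (distrC z); apply: ler_wpM2r => //; apply: le_ind; clra.
Qed.

Lemma avg_lipschitz_osc d x y : 0 < d -> `|x - y| <= d ->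
  `|avg d g x - avg d g y| <= (2 * d)^-1 * osc d x * (`|x - y| / d).
Proof.
move=> d0 xy; rewrite mulrC [_^-1 * _]mulrC; apply: (avg_lipschitz_local (c := g x) mg gM d0) xy.
by apply: eq_L1le (L1le_osc x (ltW d0)) => z; rewrite (distrC (g z)) (distrC z).
Qed.

Section Energy.
Variable E : R.
Hypothesis hE : L1le mu2 (en g) E.
Local Notation sum_near d := (\int[mu2]_z near_sqr d z).

Lemma L1le_near_sqr d : 0 <= d -> L1le mu2 (near_sqr d) (sum_near d).
Proof.
move=> d0; apply: L1le_Rint => [|z]; last exact: near_sqr_ge0.
apply: L1le_dom (L1leZ ((3 * d) ^+ 2) hE); first exact: measurable_near_sqr.
by move=> z; rewrite ger0_norm ?near_sqr_ge0// near_sqr_le_en.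
Qed.

Lemma L1le_osc_sqr d : 0 < d ->
  L1le mu (fun x => ((2 * d)^-1 * osc d x) ^+ 2) (3 / (2 * d) * sum_near d).
Proof.
move=> d0; have hI : L1le mu (fun x => \int[mu]_z near_sqr d (x, z)) (sum_near d).
  apply: L1le_Rint_snd (L1le_near_sqr (ltW d0)) => [||x]; [exact: measurable_near_sqr|exact: near_sqr_ge0|].
  by eexists; exact: L1le_near_sqr_section (ltW d0).
have := L1leZ (3 / (2 * d)) hI; rewrite ger0_norm; last by apply: divr_ge0; clra.
apply: L1le_dom => [|x]; first by have mo := measurable_osc d; mes.
rewrite ger0_norm ?sqr_ge0// exprMn; apply: le_trans (ler_wpM2l (sqr_ge0 _) (osc_sqr_le x (ltW d0))) _.
by apply: eqW; field; exact: lt0r_neq0.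
Qed.

Lemma sum_near_sqr_le r K z : 0 < r ->
  \sum_(0 <= k < K) 3 / 2 / (dyad r k.+1) ^+ 2 * near_sqr (dyad r k.+1) z <= 18 * en g z.
Proof.
move=> r0; have E0 : 0 <= 3 / 2 * en g z by rewrite mulr_ge0 ?en_ge0// divr_ge0.
have := ler_wpM2l E0 (sum_dyad_ratio_sqr_le K (dyad_gt0 1 r0) (normr_ge0 (z.1 - z.2))).
rewrite (_ : 3 / 2 * en g z * 12 = 18 * en g z); last by field.
apply: le_trans; rewrite mulr_sumr; apply: ler_sum => k _; apply: eqW; have dk := dyad_gt0 k.+1 r0.
have -> : dyad (dyad r 1) k = dyad r k.+1 by rewrite /dyad expr1 exprS; field; rewrite expf_neq0.
rewrite [in RHS]exprMn exprVn sqr_normr /near_sqr /en.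
have [->|xy] := eqVneq z.1 z.2; first by rewrite !subrr expr0n/= !(mul0r, mulr0).
by field; rewrite lt0r_neq0//= subr_eq0.
Qed.

Lemma sum_osc_bound_le r K : 0 < r ->
  \sum_(0 <= k < K) 3 / (2 * dyad r k.+1) * sum_near (dyad r k.+1) / dyad r k.+1 <= 18 * E.
Proof.
move=> r0; have hJ k := L1le_near_sqr (ltW (dyad_gt0 k.+1 r0)).
have -> : \sum_(0 <= k < K) 3 / (2 * dyad r k.+1) * sum_near (dyad r k.+1) / dyad r k.+1 =
    \int[mu2]_z (\sum_(0 <= k < K) 3 / 2 / (dyad r k.+1) ^+ 2 * near_sqr (dyad r k.+1) z).
  rewrite (Rint_sum _ (fun k => L1leZ (3 / 2 / (dyad r k.+1) ^+ 2) (hJ k))).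
  by apply: eq_bigr => k _; rewrite (RintZ _ (hJ k)); have dk := dyad_gt0 k.+1 r0; field; exact: lt0r_neq0.
have := L1leZ 18 hE; rewrite ger0_norm// => H; apply: Rint_le_bound; apply: L1le_dom H => [|z].
  by apply: measurable_sum => k; have mk := measurable_near_sqr (dyad r k.+1); mes.
rewrite ger0_norm ?sum_near_sqr_le//; apply: sumr_ge0 => k _.
by rewrite mulr_ge0 ?near_sqr_ge0// divr_ge0 ?sqr_ge0.
Qed.

End Energy.
End Oscillation.

Record dyadic_levels g (G b : nat -> R -> R) (beta : nat -> R) (rho sg M S2 : R) : Prop := DyadicLevels {
  lev_measurable : measurable_fun setT g;
  lev_approx_measurable : forall k, measurable_fun setT (G k);
  lev_err_measurable : forall k, measurable_fun setT (b k);
  lev_bound : forall x, `|g x| <= M;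
  lev_approx_bound : forall k x, `|G k x| <= 2 * M;
  lev_approx0 : forall x, G 0%N x = 0;
  lev_error : forall k x, `|g x - G k x| <= b k x;
  lev_lipschitz_err : forall k x y, (0 < k)%N -> `|x - y| <= dyad rho k ->
    `|G k x - G k y| <= b k x * (`|x - y| / dyad rho k);
  lev_lipschitz : forall k x y, (0 < k)%N -> `|x - y| <= dyad rho k ->
    `|G k x - G k y| <= 6 * sg * (`|x - y| / dyad rho k);
  lev_step : forall k x, `|G k.+1 x - G k x| <= 68 * sg;
  lev_err_L2 : forall k, L1le mu (fun x => b k x ^+ 2) (beta k);
  lev_err_sum : forall K, \sum_(0 <= k < K) beta k / dyad rho k <= S2 }.

Definition level g rho k : R -> R := if k is 0%N then (fun=> 0) else avg (dyad rho k) g.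
Definition level_err g rho k : R -> R :=
  if k is 0%N then (fun x => `|g x|) else (fun x => (2 * dyad rho k)^-1 * osc g (dyad rho k) x).
Definition level_err_bound g rho sg k : R := if k is 0%N then 9 * (16 * rho * sg ^+ 2)
  else 3 / (2 * dyad rho k) * \int[mu2]_z near_sqr g (dyad rho k) z.

Section Levels.
Variables (g : R -> R) (c rho sg M : R).
Hypotheses (mg : measurable_fun setT g) (gM : forall x, `|g x| <= M) (r0 : 0 < rho) (s0 : 0 < sg)
  (g0 : forall x, 16 * rho < `|x - c| -> g x = 0) (hE : L1le mu2 (en g) (sg ^+ 2)).

Lemma level_bound k x : `|level g rho k x| <= 2 * M.
Proof.
case: k => [|k]; last exact: avg_le mg gM (dyad_gt0 k.+1 r0) x.
by rewrite normr0; have := le_trans (normr_ge0 _) (gM x); clra.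
Qed.

Lemma level_oscillation k x : [/\ `|level g rho k.+1 x - avg (dyad rho k.+1 / 2) g x| <= 18 * sg &
  forall y, `|x - y| <= dyad rho k.+1 ->
    `|level g rho k.+1 x - level g rho k.+1 y| <= 6 * sg * (`|x - y| / dyad rho k.+1)].
Proof.
apply: avg_oscillation mg gM (dyad_gt0 k.+1 r0) (ltW s0) _.
by apply: L1le_ind hE; [by mes|exact: en_ge0].
Qed.

Lemma level1_le x : `|level g rho 1 x| <= 68 * sg.
Proof.
have r16 : 0 < 16 * rho by clra.
have P := poincare mg r16 g0 hE.
have hb : L1le mu (fun z => ind (`|c - z| <= 16 * rho) ^+ 2) (2 * (16 * rho)).
  by apply: eq_L1le (L1le_ball c (ltW r16)) => z; rewrite ind_sqr.
have hg : L1le mu (fun z => `|g z| ^+ 2) (9 * (16 * rho * sg ^+ 2)).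
  by apply: eq_L1le P => z; rewrite sqr_normr.
have Q : L1le mu (fun z => ind (`|z - x| <= 2 * dyad rho 1) * `|g z - 0|) (68 * (rho * sg)).
  apply: L1le_dom (L1le_cauchy_schwarz _ _ _ _ hb hg) => [|z||||]; [by mes| |by mes|by mes| |].
  - rewrite subr0 ger0_norm; last by nneg.
    have [hz|hz] := leP `|c - z| (16 * rho); first by rewrite ler_wpM2r// ind_le1.
    by rewrite g0 1?distrC// normr0 !mulr0.
  - by rewrite !mulr_ge0// ltW.
  - by have := sqr_ge0 (rho * sg); rewrite exprMn => h; clra.
have := avg_sub_le mg gM (dyad_gt0 1 r0) Q; rewrite subr0.
rewrite (_ : 68 * (rho * sg) / (2 * dyad rho 1) = 68 * sg)//.
by rewrite dyadS dyad0; field; exact: lt0r_neq0.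
Qed.

Lemma level_eq0 r k x : (forall x, r < `|x - c| -> g x = 0) -> r + rho < `|x - c| -> level g rho k x = 0.
Proof.
case: k => [|k]// hr hx; apply: (avg_eq0 (dyad_gt0 k.+1 r0) hr).
by rewrite dyadS; have := dyad_le k r0; clra.
Qed.

Lemma level_lipschitz k : exists L, forall x y, `|level g rho k x - level g rho k y| <= L * `|x - y|.
Proof.
case: k => [|k]; first by exists 0 => x y; rewrite subrr normr0 mul0r.
by eexists; exact: (avg_lipschitz mg gM (dyad_gt0 k.+1 r0)).
Qed.

Lemma L1le_level_err k : L1le mu (fun x => level_err g rho k x ^+ 2) (level_err_bound g rho sg k).
Proof.
case: k => [|k]; last exact: (L1le_osc_sqr mg gM hE (dyad_gt0 k.+1 r0)).
have r16 : 0 < 16 * rho by clra.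
by apply: eq_L1le (poincare mg r16 g0 hE) => x; rewrite /level_err sqr_normr.
Qed.

Lemma sum_level_err_bound K :
  \sum_(0 <= k < K) level_err_bound g rho sg k / dyad rho k <= 200 * sg ^+ 2.
Proof.
case: K => [|K]; first by rewrite big_geq// mulr_ge0// sqr_ge0.
rewrite big_nat_recl//= dyad0 (_ : 9 * (16 * rho * sg ^+ 2) / rho = 144 * sg ^+ 2); last first.
  by field; exact: lt0r_neq0.
by have := sum_osc_bound_le mg hE K r0; have := sqr_ge0 sg; clra.
Qed.

Lemma dyadic_levels_exist : exists G b beta, [/\ dyadic_levels g G b beta rho sg M (200 * sg ^+ 2),
    forall r, (forall x, r < `|x - c| -> g x = 0) -> forall k x, r + rho < `|x - c| -> G k x = 0 &
    forall k, exists L, forall x y, `|G k x - G k y| <= L * `|x - y| ].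
Proof.
exists (level g rho), (level_err g rho), (level_err_bound g rho sg); split; last exact: level_lipschitz.
  split => //.
  - by case=> [|k]; [exact: measurable_cst|exact: (measurable_avg mg gM (dyad_gt0 k.+1 r0))].
  - by case=> [|k]; rewrite /level_err; [mes|have mo := measurable_osc mg (dyad rho k.+1); mes].
  - exact: level_bound.
  - by case=> [|k] x; [rewrite subr0|exact: (avg_error mg gM x (dyad_gt0 k.+1 r0))].
  - by case=> [|k] x y// _; exact: (avg_lipschitz_osc mg gM (dyad_gt0 k.+1 r0)).
  - by case=> [|k] x y// _; have [_] := level_oscillation k x; apply.
  - case=> [|k] x; first by rewrite subr0; exact: level1_le.
    by have [+ _] := level_oscillation k x; rewrite distrC -dyadS; clra.
  - exact: L1le_level_err.
  - exact: sum_level_err_bound.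
by move=> r hr k x; exact: level_eq0.
Qed.

End Levels.

End Dyadic.
Section DyadicSums.
Variable R : realType.
Local Notation mu := (@lebesgue_measure R).
Local Notation mu2 := (mu \x mu)%E.
Implicit Types (g w phi v f : R -> R) (x y c s : R).

Lemma dyad_small (rho t : R) : 0 < rho -> 0 < t -> exists n0, forall n, (n0 <= n)%N -> dyad rho n < t.
Proof.
move=> r0 t0; exists (Num.truncn (rho / t)).+1 => n hn.
rewrite /dyad ltr_pdivrMr ?exprn_gt0// -ltr_pdivrMl// mulrC.
apply: (lt_le_trans (truncnS_gt _)).
apply: le_trans (_ : n%:R <= _); first by rewrite ler_nat.
by rewrite -natrX ler_nat ltnW// ltn_expl.
Qed.

Lemma le_dyad (r : R) i j : 0 < r -> (i <= j)%N -> dyad r j <= dyad r i.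
Proof.
move=> r0; elim: j => [|j ih]; first by rewrite leqn0 => /eqP ->.
rewrite leq_eqVlt => /orP[/eqP -> //|/ih h].
by apply: le_trans h; rewrite dyadS; have := dyad_gt0 j r0; clra.
Qed.

Lemma near_diagonal_energy_small g E rho e : measurable_fun setT g -> L1le mu2 (en g) E -> 0 < rho -> 0 < e ->
  exists n0, forall n, (n0 <= n)%N ->
    L1le mu2 (fun z => ind (`|z.1 - z.2| <= dyad rho n) * en g z) e.
Proof.
move=> mg hE r0 e0; have me := measurable_en mg.
apply: (@L1le_cvg0 _ _ _ mu2 (fun n z => ind (`|z.1 - z.2| <= dyad rho n) * en g z) (en g) E e) => //.
- by move=> n; mes.
- move=> n z; rewrite ger0_norm; last by nneg.
  by apply: ler_piMl; [exact: en_ge0|exact: ind_le1].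
move=> [x y]; have [->|xy] := eqVneq x y.
  rewrite (_ : (fun n => _) = fun=> 0); first exact: cvg_cst.
  by apply/funext => n; rewrite /en/= !subrr expr0n/= invr0 !mulr0.
have xy0 : 0 < `|x - y| by rewrite normr_gt0 subr_eq0.
have [n0 hn0] := dyad_small r0 xy0.
apply/cvgrPdist_le => t t0; exists n0 => // n /= nn0.
have far : ~~ (`|x - y| <= dyad rho n) by rewrite -ltNge hn0.
by rewrite (indF far) mul0r subrr normr0 ltW.
Qed.

Lemma term_le_sum (F : nat -> R) m K : (forall k, 0 <= F k) -> (m < K)%N -> F m <= \sum_(0 <= k < K) F k.
Proof.
move=> F0; elim: K => // K ih; rewrite ltnS leq_eqVlt => /orP[/eqP ->|/ih h];
  rewrite big_nat_recr//=; first by rewrite lerDr sumr_ge0.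
by apply: le_trans h _; rewrite lerDl.
Qed.

(* The bounds [Q m] are built downwards from level [K]; dividing by [dyad rho m] turns the factor [3 / 2]
   of a step into [3 / 4]. *)
Lemma exists_descending_bounds (P : nat -> R -> Prop) (Y : nat -> R) rho K q0 : 0 < rho ->
  (forall m q, P m q -> 0 <= q) -> P K q0 ->
  (forall m q, (m < K)%N -> P m.+1 q -> P m (3 / 2 * q + Y m)) ->
  exists Q, (forall m, (m <= K)%N -> P m (Q m)) /\
    \sum_(0 <= m < K) Q m / dyad rho m <= 4 * \sum_(0 <= m < K) Y m / dyad rho m + 3 * (q0 / dyad rho K).
Proof.
move=> r0 P0 PK hP; pose q := fix q j := if j is j'.+1 then 3 / 2 * q j' + Y (K - j)%N else q0.
pose Q m := q (K - m)%N.
have PQ m : (m <= K)%N -> P m (Q m).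
  have h j : (j <= K)%N -> P (K - j)%N (q j).
    elim: j => [|j ih] jK; first by rewrite subn0.
    rewrite /=; apply: hP; first by rewrite ltn_subrL/= (leq_trans _ jK).
    by rewrite subnSK//; apply: ih; exact: ltnW.
  by move=> mK; have := h _ (leq_subr m K); rewrite subKn.
have QK : Q K = q0 by rewrite /Q subnn.
exists Q; split => //.
have := @sum_le_descending _ (fun m => if (m <= K)%N then Q m / dyad rho m else 0) (fun m => Y m / dyad rho m) K.
rewrite leqnn QK => H; apply: le_trans (H _ _).
- by apply: eqW; apply: eq_big_nat => m /andP[_ /ltnW ->].
- by move=> m; case: ifP => // /PQ/P0 h; rewrite divr_ge0// ltW// dyad_gt0.
- move=> m mK; rewrite (ltnW mK) mK /Q -subnSK//= subnSK// subKn 1?ltnW// dyadS; apply: eqW.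
  by have := dyad_gt0 m r0 => h; field; exact: lt0r_neq0.
Qed.

Lemma sqrD_step_le (a b : R) : (a + b) ^+ 2 <= 3 / 2 * a ^+ 2 + 3 * b ^+ 2.
Proof. by have := sqr_ge0 (a - 2 * b); clra. Qed.

Section ErrorSums.
Variables (b : nat -> R -> R) (beta : nat -> R) (rho : R).
Hypotheses (r0 : 0 < rho) (mb : forall k, measurable_fun setT (b k))
  (hb : forall k, L1le mu (fun x => b k x ^+ 2) (beta k)).

Definition tail_err K m x : R := \sum_(m <= k < K) b k.+1 x.
Definition weighted_err m x : R := \sum_(0 <= k < m) b k.+1 x / dyad rho k.+1.

Lemma tail_err_L2 K : exists t, (forall m, (m <= K)%N -> L1le mu (fun x => tail_err K m x ^+ 2) (t m)) /\
  \sum_(0 <= m < K) t m / dyad rho m <= 6 * \sum_(0 <= m < K) beta m.+1 / dyad rho m.+1.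
Proof.
have [|||t [ht st]] := @exists_descending_bounds
  (fun m q => L1le mu (fun x => tail_err K m x ^+ 2) q) (fun m => 3 * beta m.+1) rho K 0 r0.
- by move=> m q; exact: L1le_ge0.
- by apply: eq_L1le (L1le0 _) => x; rewrite /tail_err big_geq// expr0n.
- move=> m q mK hq; have := L1leD (L1leZ (3 / 2) hq) (L1leZ 3 (hb m.+1)); rewrite !ger0_norm//.
  apply: L1le_dom => [|x]; first by apply: measurable_funX; apply: measurable_sum => k; exact: mb.
  by rewrite ger0_norm ?sqr_ge0// /tail_err big_ltn// addrC sqrD_step_le.
exists t; split => //; apply: le_trans st _; rewrite mul0r mulr0 addr0 !mulr_sumr; apply: eqW.
by apply: eq_bigr => m _; rewrite dyadS; have := dyad_gt0 m r0 => h; field; exact: lt0r_neq0.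
Qed.

Lemma weighted_err_L2 : exists t, (forall m, L1le mu (fun x => weighted_err m x ^+ 2) (t m)) /\
  forall K, \sum_(0 <= m < K) dyad rho m.+1 * t m.+1 <= 12 * \sum_(0 <= m < K) beta m.+1 / dyad rho m.+1.
Proof.
pose t := fix t m := if m is m'.+1 then 3 / 2 * t m' + 3 * ((dyad rho m) ^+ 2)^-1 * beta m else 0.
have ht m : L1le mu (fun x => weighted_err m x ^+ 2) (t m).
  elim: m => [|m ih]; first by apply: eq_L1le (L1le0 _) => x; rewrite /weighted_err big_geq// expr0n.
  have := L1leD (L1leZ (3 / 2) ih) (L1leZ (3 * ((dyad rho m.+1) ^+ 2)^-1) (hb m.+1)).
  rewrite !ger0_norm//; last by rewrite mulr_ge0// inv_sqr_ge0.
  apply: L1le_dom => [|x].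
    by apply: measurable_funX; apply: measurable_sum => k; apply: measurable_funM; [exact: mb|exact: measurable_cst].
  rewrite ger0_norm ?sqr_ge0// /weighted_err big_nat_recr//=.
  have -> : 3 * ((dyad rho m.+1) ^+ 2)^-1 * b m.+1 x ^+ 2 = 3 * (b m.+1 x / dyad rho m.+1) ^+ 2.
    by field; exact: lt0r_neq0 (dyad_gt0 _ r0).
  exact: sqrD_step_le.
exists t; split => // K.
have := @sum_le_ascending _ (fun m => dyad rho m * t m) (fun m => 3 * (beta m.+1 / dyad rho m.+1)) K.
rewrite mulr0 mulr0 addr0 -mulr_sumr => H.
apply: le_trans (H _ _) _; last by apply: eqW; ring.
- by move=> m; rewrite mulr_ge0 ?(L1le_ge0 (ht m))// ltW// dyad_gt0.
- move=> m mK; rewrite [t m.+1]/= dyadS; apply: eqW.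
  by have := dyad_gt0 m r0 => h; field; exact: lt0r_neq0.
Qed.

End ErrorSums.

Lemma quartic_step_le (a t B C sg : R) : `|t| <= 68 * sg -> `|t| <= B + C ->
  (a + t) ^+ 4 <= 3 / 2 * a ^+ 4 + 10 ^+ 7 * sg ^+ 2 * (B ^+ 2 + C ^+ 2).
Proof.
move=> /norm_le_sqr ts /norm_le_sqr tBC.
have even4 (u : R) : u ^+ 4 = u ^+ 2 * u ^+ 2 by rewrite -exprD.
have t4 : t ^+ 4 <= 9248 * (sg ^+ 2 * (B ^+ 2 + C ^+ 2)).
  have tBC2 : t ^+ 2 <= 2 * (B ^+ 2 + C ^+ 2) by have := sqr_ge0 (B - C); clra.
  by rewrite even4; have := ler_pM (sqr_ge0 t) (sqr_ge0 t) ts tBC2; clra.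
have at2 : (a + t) ^+ 2 <= 6 / 5 * a ^+ 2 + 6 * t ^+ 2 by have := sqr_ge0 (a - 5 * t); clra.
have at4 : (a + t) ^+ 4 <= 3 / 2 * a ^+ 4 + 900 * t ^+ 4.
  have := ler_pM (sqr_ge0 _) (sqr_ge0 _) at2 at2; have := sqr_ge0 (a ^+ 2 - 120 * t ^+ 2).
  have := sqr_ge0 (a ^+ 2); have := sqr_ge0 (t ^+ 2).
  by rewrite -!even4; clra.
rewrite -(mulrA (10 ^+ 7)); move: (sg ^+ 2 * _) (mulr_ge0 (sqr_ge0 sg) (addr_ge0 (sqr_ge0 B) (sqr_ge0 C))) t4
  => X X0 t4.
have : 900 * 9248 * X <= 10 ^+ 7 * X by apply: ler_wpM2r => //; clra.
by move: at4 t4; clra.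
Qed.

End DyadicSums.

Section LevelErrors.
Variable R : realType.
Local Notation mu := (@lebesgue_measure R).
Local Notation mu2 := (mu \x mu)%E.
Implicit Types (g w phi v f : R -> R) (x y c s : R).

Variables (g : R -> R) (G b : nat -> R -> R) (beta : nat -> R) (rho sg M S2 : R).
Hypotheses (L : dyadic_levels g G b beta rho sg M S2) (r0 : 0 < rho).

Lemma measurable_lev_error k : measurable_fun setT (fun x => g x - G k x).
Proof. by have mg := lev_measurable L; have mG := lev_approx_measurable L k; mes. Qed.

Lemma lev_err_ratio_ge0 k : 0 <= beta k / dyad rho k.
Proof. by rewrite divr_ge0 ?(L1le_ge0 (lev_err_L2 L k))// ltW// dyad_gt0. Qed.

Lemma lev_err_total_ge0 : 0 <= S2.
Proof. by have := lev_err_sum L 0%N; rewrite big_geq. Qed.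

Lemma lev_err_sum_succ K : \sum_(0 <= m < K) beta m.+1 / dyad rho m.+1 <= S2.
Proof. by have := lev_err_sum L K.+1; rewrite big_nat_recl//=; have := lev_err_ratio_ge0 0; clra. Qed.

Lemma lev_error_le3 k x : `|g x - G k x| <= 3 * M.
Proof.
have := ler_normB (g x) (G k x); have := lev_bound L x; have := lev_approx_bound L k x; clra.
Qed.

Lemma lev_error_L2 k : L1le mu (fun x => (g x - G k x) ^+ 2) (beta k).
Proof.
apply: L1le_dom (lev_err_L2 L k) => [|x]; first by have mh := measurable_lev_error k; mes.
by rewrite ger0_norm ?sqr_ge0//; exact: norm_le_sqr (lev_error L k x).
Qed.

Lemma lev_error_L4_top k : L1le mu (fun x => (g x - G k x) ^+ 4) (9 * M ^+ 2 * beta k).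
Proof.
have := L1leZ (9 * M ^+ 2) (lev_err_L2 L k); rewrite ger0_norm; last by rewrite mulr_ge0// sqr_ge0.
apply: L1le_dom => [|x]; first by have mh := measurable_lev_error k; mes.
rewrite ger0_norm ?exprn_even_ge0// (_ : _ ^+ 4 = (g x - G k x) ^+ 2 * (g x - G k x) ^+ 2); last by rewrite -exprD.
apply: ler_pM; rewrite ?sqr_ge0//; last exact: norm_le_sqr (lev_error L k x).
by rewrite (_ : 9 * M ^+ 2 = (3 * M) ^+ 2); [exact: norm_le_sqr (lev_error_le3 k x)|ring].
Qed.

Lemma lev_error_L4_step k q : L1le mu (fun x => (g x - G k.+1 x) ^+ 4) q ->
  L1le mu (fun x => (g x - G k x) ^+ 4) (3 / 2 * q + 10 ^+ 7 * sg ^+ 2 * (beta k + beta k.+1)).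
Proof.
move=> hq; have := L1leD (L1leZ (3 / 2) hq) (L1leZ (10 ^+ 7 * sg ^+ 2) (L1leD (lev_err_L2 L k) (lev_err_L2 L k.+1))).
rewrite !ger0_norm//; last by rewrite mulr_ge0// sqr_ge0.
apply: L1le_dom => [|x]; first by have mh := measurable_lev_error k; mes.
rewrite ger0_norm ?exprn_even_ge0// (_ : g x - G k x = (g x - G k.+1 x) + (G k.+1 x - G k x)); last by ring.
apply: quartic_step_le; first exact: lev_step L k x.
rewrite (_ : G k.+1 x - G k x = (g x - G k x) - (g x - G k.+1 x)); last by ring.
by apply: le_trans (ler_normB _ _) _; apply: lerD; exact: lev_error L _ _.
Qed.

Lemma error_L4_sum K : exists Q, (forall m, (m <= K)%N -> L1le mu (fun x => (g x - G m x) ^+ 4) (Q m)) /\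
    \sum_(0 <= m < K) Q m / dyad rho m <= 10 ^+ 8 * (sg ^+ 2 * S2) + 27 * M ^+ 2 * (beta K / dyad rho K).
Proof.
have [|||Q [hQ sQ]] := @exists_descending_bounds _ (fun m q => L1le mu (fun x => (g x - G m x) ^+ 4) q)
  (fun m => 10 ^+ 7 * sg ^+ 2 * (beta m + beta m.+1)) rho K (9 * M ^+ 2 * beta K) r0.
- by move=> m q; exact: L1le_ge0.
- exact: lev_error_L4_top.
- by move=> m q _; exact: lev_error_L4_step.
exists Q; split => //; apply: le_trans sQ _; apply: lerD; last by apply: eqW; ring.
have -> : \sum_(0 <= m < K) 10 ^+ 7 * sg ^+ 2 * (beta m + beta m.+1) / dyad rho m =
    10 ^+ 7 * sg ^+ 2 * (\sum_(0 <= m < K) beta m / dyad rho m + 2^-1 * \sum_(0 <= m < K) beta m.+1 / dyad rho m.+1).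
  rewrite mulr_sumr -big_split/= mulr_sumr; apply: eq_bigr => m _; rewrite dyadS.
  by have := dyad_gt0 m r0 => h; field; exact: lt0r_neq0.
have s7 : 0 <= 10 ^+ 7 * sg ^+ 2 by rewrite mulr_ge0 ?sqr_ge0// exprn_ge0.
have := ler_wpM2l s7 (lev_err_sum L K); have := ler_wpM2l s7 (lev_err_sum_succ K).
have -> : 10 ^+ 8 * (sg ^+ 2 * S2) = 10 * (10 ^+ 7 * sg ^+ 2 * S2) by ring.
by have := mulr_ge0 s7 lev_err_total_ge0; clra.
Qed.

End LevelErrors.

Section DyadicShells.
Variable R : realType.
Local Notation mu := (@lebesgue_measure R).
Local Notation mu2 := (mu \x mu)%E.
Implicit Types (g w phi v f : R -> R) (x y c s : R).

Definition within_level rho m x y := (0 < m)%N -> `|x - y| <= dyad rho m.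

Lemma within_level_le rho m k x y : 0 < rho -> within_level rho m x y -> (k < m)%N -> `|x - y| <= dyad rho k.+1.
Proof. by move=> r0 h km; apply: le_trans (h (leq_ltn_trans _ km)) (le_dyad r0 km). Qed.

Lemma dyadic_shell rho K x y : `|x - y| <= dyad rho K.+1 \/
  exists m, [/\ (m < K.+1)%N, dyad rho m.+1 < `|x - y| & within_level rho m x y].
Proof.
elim: K => [|K [ih|[m [mK h hm]]]]; last by right; exists m; split => //; exact: ltnW.
  by have [h|h] := leP `|x - y| (dyad rho 1); [left|right; exists 0%N; split].
by have [h|h] := leP `|x - y| (dyad rho K.+2); [left|right; exists K.+1; split].
Qed.

Lemma L1le_dyadic_shells rho K (F H : R * R -> R) (U : nat -> R -> R) (u : nat -> R) h : 0 < rho ->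
  measurable_fun setT F -> (forall z, 0 <= F z) -> (forall m x, 0 <= U m x) ->
  (forall m, (m <= K.+1)%N -> L1le mu (U m) (u m)) -> L1le mu2 H h ->
  (forall x y, `|x - y| <= dyad rho K.+1 -> F (x, y) <= H (x, y)) ->
  (forall x y m, (m <= K.+1)%N -> within_level rho m x y ->
    F (x, y) <= (U m x + U m y) / (x - y) ^+ 2 + H (x, y)) ->
  L1le mu2 F (8 * (\sum_(0 <= m < K.+1) u m / dyad rho m) + h).
Proof.
move=> r0 mF F0 U0 hU hH near shell.
pose Uf m z := (U m z.1 + U m z.2) * Jfar (dyad rho m.+1) z.
have Uf0 m z : 0 <= Uf m z by rewrite mulr_ge0 ?Jfar_ge0// addr_ge0.
have hUf m : (m < K.+1)%N -> L1le mu2 (Uf m) (8 * (u m / dyad rho m)).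
  move=> mK; have := L1le_kernel_both (measurable_Jfar (dyad rho m.+1)) (Jfar_sym _)
    (fun x => L1le_Jfar x (dyad_gt0 m.+1 r0)) (hU m (ltnW mK)).
  rewrite (_ : 2 * (u m * (2 / dyad rho m.+1)) = 8 * (u m / dyad rho m))//.
  by rewrite dyadS; have := dyad_gt0 m r0 => d0; field; exact: lt0r_neq0.
have nat_cond (f : nat -> R) : \sum_(0 <= i < K.+1 | (i < K.+1)%N) f i = \sum_(0 <= i < K.+1) f i.
  by rewrite big_nat_cond [RHS]big_nat_cond; apply: eq_bigl => i; rewrite leq0n/= andbb andbT.
have sU := @L1le_sum _ _ _ mu2 _ (index_iota 0 K.+1) (fun m => (m < K.+1)%N) Uf _ hUf.
have {}sU : L1le mu2 (fun z => \sum_(0 <= m < K.+1) Uf m z) (8 * \sum_(0 <= m < K.+1) u m / dyad rho m).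
  by rewrite nat_cond -mulr_sumr in sU; apply: eq_L1le sU => z; exact: nat_cond.
apply: L1le_dom2 (L1leD sU hH) => // x y; rewrite ger0_norm//.
have [hK|[m [mK far hm]]] := dyadic_shell rho K x y.
  by apply: le_trans (near x y hK) _; rewrite lerDr sumr_ge0.
apply: le_trans (shell x y m (ltnW mK) hm) _; rewrite lerD2r.
apply: le_trans (term_le_sum (fun k => Uf0 k (x, y)) mK).
by rewrite /Uf /Jfar/= (indT (ltW far)) mul1r.
Qed.

End DyadicShells.

Section Paraproduct.
Variable R : realType.
Local Notation mu := (@lebesgue_measure R).
Local Notation mu2 := (mu \x mu)%E.
Implicit Types (g w phi v f : R -> R) (x y c s : R).

Variables (phi g : R -> R) (Ph p : nat -> R -> R) (pib : nat -> R) (G b : nat -> R -> R)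
  (beta : nat -> R) (rho sg M S2 : R).
Hypotheses (Lp : dyadic_levels phi Ph p pib rho sg M S2) (Lg : dyadic_levels g G b beta rho sg M S2).
Hypotheses (r0 : 0 < rho) (s0 : 0 < sg).
Local Notation S := (68 * sg).
Local Notation C := (weighted_err b rho).
Local Notation T := (tail_err b).

Definition paraproduct K x : R := \sum_(0 <= k < K) (Ph k.+1 x - Ph k x) * (g x - G k.+1 x).

Lemma lev_step_lipschitz k x y : `|x - y| <= dyad rho k.+1 ->
  `|(Ph k.+1 x - Ph k x) - (Ph k.+1 y - Ph k y)| <= S * (`|x - y| / dyad rho k.+1).
Proof.
move=> hk; have q0 : 0 <= `|x - y| / dyad rho k.+1 by rewrite divr_ge0// ltW// dyad_gt0.
have h1 := lev_lipschitz Lp (ltn0Sn k) hk.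
have h2 : `|Ph k x - Ph k y| <= 6 * sg * (`|x - y| / dyad rho k.+1).
  case: k hk q0 {h1} => [|k] hk q0.
    by rewrite !(lev_approx0 Lp) subrr normr0 mulr_ge0//; clra.
  have hk' : `|x - y| <= dyad rho k.+1 by apply: le_trans hk (le_dyad r0 (leqnSn _)).
  apply: le_trans (lev_lipschitz Lp (ltn0Sn k) hk') _; apply: ler_wpM2l; first by clra.
  by apply: ler_wpM2l => //; rewrite lef_pV2 ?posrE ?dyad_gt0//; exact: le_dyad.
rewrite (_ : _ - _ = (Ph k.+1 x - Ph k.+1 y) - (Ph k x - Ph k y)); last by ring.
by apply: le_trans (ler_normB _ _) _; have := mulr_ge0 (ltW s0) q0; clra.
Qed.

Lemma coarse_term_le k x y : `|x - y| <= dyad rho k.+1 ->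
  `|(g y - G k.+1 y) * ((Ph k.+1 x - Ph k x) - (Ph k.+1 y - Ph k y)) - (Ph k.+1 x - Ph k x) * (G k.+1 x - G k.+1 y)|
  <= S * `|x - y| * (b k.+1 x / dyad rho k.+1 + b k.+1 y / dyad rho k.+1).
Proof.
move=> hk; apply: le_trans (ler_normB _ _) _; rewrite !normrM.
have := ler_pM (normr_ge0 _) (normr_ge0 _) (lev_error Lg k.+1 y) (lev_step_lipschitz hk).
have := ler_pM (normr_ge0 _) (normr_ge0 _) (lev_step Lp k x) (lev_lipschitz_err Lg (ltn0Sn k) hk).
have -> : S * `|x - y| * (b k.+1 x / dyad rho k.+1 + b k.+1 y / dyad rho k.+1) =
  b k.+1 y * (S * (`|x - y| / dyad rho k.+1)) + S * (b k.+1 x * (`|x - y| / dyad rho k.+1)) by ring.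
by clra.
Qed.

Lemma fine_term_le k x y :
  `|(Ph k.+1 x - Ph k x) * (g x - G k.+1 x) - (Ph k.+1 y - Ph k y) * (g y - G k.+1 y)|
  <= S * b k.+1 x + S * b k.+1 y.
Proof.
apply: le_trans (ler_normB _ _) _; rewrite !normrM.
by apply: lerD; apply: ler_pM => //; by [exact: lev_step Lp _ _|exact: lev_error Lg _ _].
Qed.

(* Below level [m] the increments of the paraproduct telescope to [Ph m x * (g x - g y)]. *)
Lemma paraproduct_increment_le K m x y : (m <= K)%N -> within_level rho m x y ->
  `|(phi x + phi y) / 2 * (g x - g y) - (paraproduct K x - paraproduct K y)| <=
  `|(phi x + phi y) / 2 - Ph m x| * `|g x - g y| + S * `|x - y| * (C m x + C m y) + S * (T K m x + T K m y).
Proof.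
move=> mK hm; pose psi k x := Ph k.+1 x - Ph k x.
have coarse : \sum_(0 <= k < m) (psi k x * (g x - G k.+1 x) - psi k y * (g y - G k.+1 y)) =
    Ph m x * (g x - g y) + \sum_(0 <= k < m) ((g y - G k.+1 y) * (psi k x - psi k y) - psi k x * (G k.+1 x - G k.+1 y)).
  have <- : \sum_(0 <= k < m) psi k x = Ph m x by rewrite telescope_sumr// (lev_approx0 Lp) subr0.
  by rewrite mulr_suml -big_split/=; apply: eq_bigr => k _; ring.
have -> : (phi x + phi y) / 2 * (g x - g y) - (paraproduct K x - paraproduct K y) =
   ((phi x + phi y) / 2 - Ph m x) * (g x - g y)
   - \sum_(0 <= k < m) ((g y - G k.+1 y) * (psi k x - psi k y) - psi k x * (G k.+1 x - G k.+1 y))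
   - \sum_(m <= k < K) (psi k x * (g x - G k.+1 x) - psi k y * (g y - G k.+1 y)).
  by rewrite /paraproduct -sumrB (@big_cat_nat _ _ _ m)//= coarse; ring.
apply: le_trans (ler_normB _ _) _; apply: lerD.
  apply: le_trans (ler_normB _ _) _; rewrite normrM; apply: lerD => //.
  apply: le_trans (ler_norm_sum _ _ _) _; rewrite -big_split/= mulr_sumr big_nat [leRHS]big_nat.
  by apply: ler_sum => k /andP[_ km]; apply: coarse_term_le; exact: within_level_le hm km.
apply: le_trans (ler_norm_sum _ _ _) _; rewrite -big_split/= mulr_sumr.
by apply: ler_sum => k _; rewrite [leRHS]mulrDr; exact: fine_term_le.
Qed.

Definition defect f (z : R * R) : R :=
  ((phi z.1 + phi z.2) / 2 * (g z.1 - g z.2) - (f z.1 - f z.2)) ^+ 2 / (z.1 - z.2) ^+ 2.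
Definition near_weight m x : R := 6 * S ^+ 2 * C m x ^+ 2.
Definition near_term m z : R := (near_weight m.+1 z.1 + near_weight m.+1 z.2) * Jnear (dyad rho m.+1) z.
Definition shell_weight K m x : R := 9 * ((phi x - Ph m x) ^+ 4 + (g x - G m x) ^+ 4)
   + 9 * S ^+ 2 * (phi x - Ph m x) ^+ 2 + 6 * S ^+ 2 * T K m x ^+ 2.

Lemma near_weight_ge0 m x : 0 <= near_weight m x. Proof. by rewrite /near_weight; nneg. Qed.

Lemma near_term_ge0 m z : 0 <= near_term m z.
Proof. by rewrite mulr_ge0 ?Jnear_ge0// addr_ge0 ?near_weight_ge0. Qed.

Lemma shell_weight_ge0 K m x : 0 <= shell_weight K m x.
Proof.
apply: addr_ge0; last by nneg.
by apply: addr_ge0; [rewrite mulr_ge0 ?addr_ge0 ?exprn_even_ge0|nneg].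
Qed.

Lemma defect_le K m x y : (m <= K)%N -> within_level rho m x y ->
  defect (paraproduct K) (x, y) <=
  3 * (((phi x + phi y) / 2 - Ph m x) ^+ 2 * (g x - g y) ^+ 2) / (x - y) ^+ 2
    + (near_weight m x + near_weight m y) + (6 * S ^+ 2 * T K m x ^+ 2 + 6 * S ^+ 2 * T K m y ^+ 2) / (x - y) ^+ 2.
Proof.
move=> mK hm; have h := le_trans (norm_le_sqr (paraproduct_increment_le mK hm)) (sqrD3_le _ _ _).
have k0 := inv_sqr_ge0 (x - y); apply: le_trans (ler_wpM2r k0 h) _.
rewrite [(`|_| * `|g x - g y|) ^+ 2]exprMn [(_ * `|x - y| * _) ^+ 2]exprMn [(S * `|x - y|) ^+ 2]exprMn !sqr_normr.
rewrite [(S * (T K m x + _)) ^+ 2]exprMn /near_weight.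
move: (S ^+ 2) (sqr_ge0 S) => s2 s20.
have xy1 : (x - y) ^+ 2 * ((x - y) ^+ 2)^-1 <= 1.
  by have [->|xy] := eqVneq x y; rewrite ?subrr ?expr0n/= ?mul0r// mulfV// sqrf_eq0 subr_eq0.
have nearC := ler_wpM2l s20 (sqrD2_le (C m x) (C m y)).
have fineT := ler_wpM2r k0 (ler_wpM2l s20 (sqrD2_le (T K m x) (T K m y))).
have := ler_wpM2l (mulr_ge0 s20 (sqr_ge0 (C m x + C m y))) xy1.
move: nearC fineT; set A := _ ^+ 2 * (g x - g y) ^+ 2; set k := ((x - y) ^+ 2)^-1; clra.
Qed.

Lemma near_terms_ge K m x y : (m <= K)%N -> within_level rho m x y ->
  near_weight m x + near_weight m y <= \sum_(0 <= k < K) near_term k (x, y).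
Proof.
case: m => [|m] mK hm.
  rewrite /near_weight /weighted_err !(@big_geq _ _ _ 0 0)// expr0n/= mulr0 addr0.
  by apply: sumr_ge0 => k _; exact: near_term_ge0.
apply: le_trans (term_le_sum (fun k => near_term_ge0 k (x, y)) mK).
by rewrite /near_term /Jnear/= hm// mulr1.
Qed.

Lemma defect_near K x y : `|x - y| <= dyad rho K ->
  defect (paraproduct K) (x, y) <= 27 * M ^+ 2 * en g (x, y) + \sum_(0 <= k < K) near_term k (x, y).
Proof.
move=> hK; have hm : within_level rho K x y by move=> _.
apply: le_trans (defect_le (leqnn K) hm) _; rewrite /tail_err !(@big_geq _ _ _ K K)// expr0n/= !mulr0 addr0 mul0r addr0.
apply: lerD (near_terms_ge (leqnn K) hm).
have : ((phi x + phi y) / 2 - Ph K x) ^+ 2 <= (3 * M) ^+ 2.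
  apply: norm_le_sqr; have := lev_approx_bound Lp K x; have := lev_bound Lp x; have := lev_bound Lp y.
  by rewrite !ler_norml; move=> /andP[? ?] /andP[? ?] /andP[? ?]; apply/andP; split; clra.
by move=> /(ler_wpM2r (en_ge0 g (x, y))); rewrite /en/= exprMn !mulrA; clra.
Qed.

Lemma level_increment_le (w : R -> R) Gw bw bt m x y : dyadic_levels w Gw bw bt rho sg M S2 ->
  within_level rho m x y -> `|Gw m x - Gw m y| <= S.
Proof.
move=> L; case: m => [_|m /(_ isT) h]; first by rewrite !(lev_approx0 L) subrr normr0; clra.
apply: le_trans (lev_lipschitz L (ltn0Sn m) h) _.
have : `|x - y| / dyad rho m.+1 <= 1 by rewrite ler_pdivrMr ?mul1r// dyad_gt0.
by move=> /(ler_wpM2l (ltW s0)); clra.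
Qed.

Lemma increment_sqr_le_level (w : R -> R) Gw bw bt m x y : dyadic_levels w Gw bw bt rho sg M S2 ->
  within_level rho m x y ->
  (w x - w y) ^+ 2 <= 3 * ((w x - Gw m x) ^+ 2 + (w y - Gw m y) ^+ 2 + S ^+ 2).
Proof.
move=> L hm; have q2 := norm_le_sqr (level_increment_le L hm).
have -> : w x - w y = (w x - Gw m x) + (- (w y - Gw m y)) + (Gw m x - Gw m y) by ring.
by apply: le_trans (sqrD3_le _ _ _) _; rewrite sqrrN ler_pM2l// lerD2l.
Qed.

Lemma mean_error_sqr_le m x y : within_level rho m x y ->
  ((phi x + phi y) / 2 - Ph m x) ^+ 2 * (g x - g y) ^+ 2 <=
  3 * ((phi x - Ph m x) ^+ 4 + (phi y - Ph m y) ^+ 4 + ((g x - G m x) ^+ 4 + (g y - G m y) ^+ 4))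
  + 3 * S ^+ 2 * ((phi x - Ph m x) ^+ 2 + (phi y - Ph m y) ^+ 2) + S ^+ 2 * (g x - g y) ^+ 2.
Proof.
move=> hm; have e2 := norm_le_sqr (level_increment_le Lp hm); have := increment_sqr_le_level Lg hm.
have -> : (phi x + phi y) / 2 - Ph m x = ((phi x - Ph m x) + (phi y - Ph m y) - (Ph m x - Ph m y)) / 2 by field.
move: e2 (sqr_ge0 (g x - g y)); move: ((g x - g y) ^+ 2) (S ^+ 2) (sqr_ge0 S) => D s2 s20.
move: (phi x - Ph m x) (phi y - Ph m y) (Ph m x - Ph m y) (g x - G m x) (g y - G m y) => a c e h k e2 D0 d2.
have mid_le : ((a + c - e) / 2) ^+ 2 <= (a ^+ 2 + c ^+ 2) + s2.
  by have := sqr_ge0 (a - c); have := sqr_ge0 (a + c + e); have := sqr_ge0 (a + c); have := sqr_ge0 e; move: e2; clra.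
apply: le_trans (ler_wpM2r D0 mid_le) _; rewrite mulrDl; apply: lerD => //.
apply: le_trans (ler_wpM2l (addr_ge0 (sqr_ge0 a) (sqr_ge0 c)) d2) _.
have := sqr_ge0 (a ^+ 2 - h ^+ 2); have := sqr_ge0 (a ^+ 2 - k ^+ 2);
have := sqr_ge0 (c ^+ 2 - h ^+ 2); have := sqr_ge0 (c ^+ 2 - k ^+ 2); clra.
Qed.

Lemma defect_shell K m x y : (m <= K)%N -> within_level rho m x y ->
  defect (paraproduct K) (x, y) <= (shell_weight K m x + shell_weight K m y) / (x - y) ^+ 2 +
    (3 * S ^+ 2 * en g (x, y) + \sum_(0 <= k < K) near_term k (x, y)).
Proof.
move=> mK hm; apply: le_trans (defect_le mK hm) _.
have := near_terms_ge mK hm; have := ler_wpM2r (inv_sqr_ge0 (x - y)) (mean_error_sqr_le hm).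
by rewrite /shell_weight /en/=; clra.
Qed.

Section Energy.
Variables (K : nat) (th : R).
Hypotheses (hE : L1le mu2 (en g) (sg ^+ 2)) (mpara : measurable_fun setT (paraproduct K.+1))
  (hth : L1le mu2 (fun z => ind (`|z.1 - z.2| <= dyad rho K.+1) * en g z) th).

Lemma L1le_defect Qp Qg t C2 :
  (forall m, (m <= K.+1)%N -> L1le mu (fun x => (phi x - Ph m x) ^+ 4) (Qp m)) ->
  (forall m, (m <= K.+1)%N -> L1le mu (fun x => (g x - G m x) ^+ 4) (Qg m)) ->
  (forall m, (m <= K.+1)%N -> L1le mu (fun x => T K.+1 m x ^+ 2) (t m)) ->
  (forall m, L1le mu (fun x => C m x ^+ 2) (C2 m)) ->
  L1le mu2 (defect (paraproduct K.+1))
    (8 * (\sum_(0 <= m < K.+1) (9 * (Qp m + Qg m) + 9 * S ^+ 2 * pib m + 6 * S ^+ 2 * t m) / dyad rho m) +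
     (3 * S ^+ 2 * sg ^+ 2 + 27 * M ^+ 2 * th + 24 * S ^+ 2 * \sum_(0 <= m < K.+1) dyad rho m.+1 * C2 m.+1)).
Proof.
move=> hQp hQg ht hC; have mphi := lev_measurable Lp; have mg := lev_measurable Lg.
have hU m : (m <= K.+1)%N ->
    L1le mu (shell_weight K.+1 m) (9 * (Qp m + Qg m) + 9 * S ^+ 2 * pib m + 6 * S ^+ 2 * t m).
  move=> mK; have := L1leD (L1leD (L1leZ 9 (L1leD (hQp m mK) (hQg m mK)))
    (L1leZ (9 * S ^+ 2) (lev_error_L2 Lp m))) (L1leZ (6 * S ^+ 2) (ht m mK)).
  by rewrite !ger0_norm//; nneg.
have hV m : L1le mu2 (near_term m) (24 * S ^+ 2 * (dyad rho m.+1 * C2 m.+1)).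
  have := L1leZ (6 * S ^+ 2) (hC m.+1); rewrite ger0_norm; last by nneg.
  move=> /(L1le_kernel_both (measurable_Jnear (dyad rho m.+1)) (Jnear_sym _)
    (fun x => L1le_Jnear x (dyad_gt0 m.+1 r0))).
  by rewrite (_ : 2 * (_ * _) = 24 * S ^+ 2 * (dyad rho m.+1 * C2 m.+1))//; ring.
have hVs := @L1le_sum _ _ _ mu2 _ (index_iota 0 K.+1) xpredT near_term _ (fun m _ => hV m).
have := L1leD (L1leD (L1leZ (3 * S ^+ 2) hE) (L1leZ (27 * M ^+ 2) hth)) hVs.
rewrite !ger0_norm; [|by nneg|by nneg]; rewrite -mulr_sumr => hH.
apply: L1le_dyadic_shells hU hH _ _ => //.
- by rewrite /defect; move: mpara; move: (paraproduct _) => f mf; mes.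
- by move=> z; rewrite /defect; nneg.
- by move=> m x; exact: shell_weight_ge0.
- move=> x y hK; rewrite indT// mul1r; apply: le_trans (defect_near hK) _; rewrite lerD2r lerDr.
  by nneg.
- move=> x y m mK hm; apply: le_trans (defect_shell mK hm) _; rewrite lerD2l lerD2r lerDl.
  by nneg.
Qed.

Lemma compensated_product_le : L1le mu2 (defect (paraproduct K.+1))
    (2 * 10 ^+ 10 * (sg ^+ 2 * S2) + 13872 * sg ^+ 4
      + 4000 * M ^+ 2 * (pib K.+1 / dyad rho K.+1 + beta K.+1 / dyad rho K.+1 + th)).
Proof.
have [Qp [hQp sQp]] := error_L4_sum Lp r0 K.+1.
have [Qg [hQg sQg]] := error_L4_sum Lg r0 K.+1.
have [t [ht st]] := tail_err_L2 r0 (lev_err_measurable Lg) (lev_err_L2 Lg) K.+1.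
have [C2 [hC sC]] := weighted_err_L2 r0 (lev_err_measurable Lg) (lev_err_L2 Lg).
apply: L1leW (L1le_defect hQp hQg ht hC).
have -> : \sum_(0 <= m < K.+1) (9 * (Qp m + Qg m) + 9 * S ^+ 2 * pib m + 6 * S ^+ 2 * t m) / dyad rho m =
   9 * (\sum_(0 <= m < K.+1) Qp m / dyad rho m) + 9 * (\sum_(0 <= m < K.+1) Qg m / dyad rho m)
   + 9 * S ^+ 2 * (\sum_(0 <= m < K.+1) pib m / dyad rho m) + 6 * S ^+ 2 * (\sum_(0 <= m < K.+1) t m / dyad rho m).
  by rewrite !mulr_sumr -!big_split/=; apply: eq_bigr => m _; ring.
have := lev_err_ratio_ge0 Lp r0 K.+1; have := lev_err_ratio_ge0 Lg r0 K.+1.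
have := lev_err_sum_succ Lg r0 K.+1; have := lev_err_sum Lp K.+1; have := sC K.+1; move: st sQp sQg.
move: (\sum_(0 <= m < K.+1) Qp m / _) (\sum_(0 <= m < K.+1) Qg m / _) (\sum_(0 <= m < K.+1) pib m / _)
  (\sum_(0 <= m < K.+1) t m / _) (\sum_(0 <= m < K.+1) dyad rho m.+1 * C2 m.+1)
  (\sum_(0 <= m < K.+1) beta m.+1 / dyad rho m.+1) (pib K.+1 / _) (beta K.+1 / _)
  => q1 q2 q3 q4 q5 q6 pp bb st sQp sQg sCK hp hg /(mulr_ge0 (sqr_ge0 M)) bb0 /(mulr_ge0 (sqr_ge0 M)) pp0.
have w3 := ler_wpM2l (sqr_ge0 sg) hp; have w6 := ler_wpM2l (sqr_ge0 sg) hg.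
have w4 := ler_wpM2l (sqr_ge0 sg) st; have w5 := ler_wpM2l (sqr_ge0 sg) sCK.
have th0 := mulr_ge0 (sqr_ge0 M) (L1le_ge0 hth).
have S20 := mulr_ge0 (sqr_ge0 sg) (lev_err_total_ge0 Lp).
have big : 2 * 10 ^+ 10 * (sg ^+ 2 * S2) = 200 * (10 ^+ 8 * (sg ^+ 2 * S2)) by ring.
have : 5000 * 5000 * (sg ^+ 2 * S2) <= 10 ^+ 8 * (sg ^+ 2 * S2) by apply: ler_wpM2r; [exact: S20|clra].
by rewrite big (_ : sg ^+ 4 = sg ^+ 2 * sg ^+ 2); [move: sQp sQg; move: (10 ^+ 8 * _) => X; clra|ring].
Qed.

End Energy.
End Paraproduct.

Section Admissible.
Variable R : realType.
Local Notation mu := (@lebesgue_measure R).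
Local Notation mu2 := (mu \x mu)%E.
Implicit Types (g w phi v f : R -> R) (x y c s : R).

Definition admissible f := [/\ measurable_fun setT f, exists M, forall x, `|f x| <= M &
  exists P, L1le mu2 (en f) P].

Lemma admissible_lipschitz f (L M c r : R) : (forall x y, `|f x - f y| <= L * `|x - y|) ->
  (forall x, `|f x| <= M) -> 0 < r -> (forall x, r < `|x - c| -> f x = 0) -> admissible f.
Proof.
move=> hL hM r0 f0; have mf := lipschitz_measurable hL; split => //; first by exists M.
pose J z := L ^+ 2 * Jnear 1 z + (M + M) ^+ 2 * Jfar 1 z : R.
have mJ : measurable_fun setT J.
  by have := measurable_Jnear (1 : R) => m1; have := measurable_Jfar (1 : R) => m2; rewrite /J; mes.
have hJ x : L1le mu (fun y => J (x, y)) (`|L ^+ 2| * (2 * 1) + `|(M + M) ^+ 2| * (2 / 1)).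
  exact: L1leD (L1leZ _ (L1le_Jnear x ltr01)) (L1leZ _ (L1le_Jfar x ltr01)).
eexists; apply: (L1le_supported (c := c) (measurable_en mf) mJ _ hJ (ltW r0)) => x y.
- by rewrite /J Jnear_sym Jfar_sym.
- rewrite ger0_norm ?en_ge0//; apply: quotient_sqr_le (hL x y) _.
  by apply: le_trans (ler_normB _ _) (lerD _ _).
- by move=> hx hy; rewrite /en/= !f0// subrr expr0n/= mul0r.
Qed.

Lemma admissible_eta c s : 0 < s -> admissible (eta c s).
Proof.
move=> s0; apply: (@admissible_lipschitz _ s^-1 1 c (2 * s)).
- by move=> x y; rewrite mulrC; exact: eta_lipschitz.
- by move=> x; rewrite ger0_norm; case/andP: (eta_itv c s x).
- by clra.
- by move=> x h; apply: eta_eq0 => //; exact: ltW.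
Qed.

Lemma admissibleD f g : admissible f -> admissible g -> admissible (fun x => f x + g x).
Proof.
case=> mf [M1 h1] [P1 e1] [mg [M2 h2] [P2 e2]]; split; first by mes.
  by exists (M1 + M2) => x; apply: le_trans (ler_normD _ _) _; exact: lerD.
eexists; apply: L1le_dom2 (L1leZ 2 (L1leD e1 e2)); first by apply: measurable_en; mes.
move=> x y; rewrite ger0_norm ?en_ge0// /en/= -mulrDl mulrA; apply: ler_wpM2r; first exact: inv_sqr_ge0.
by rewrite opprD addrACA; exact: sqrD2_le.
Qed.

Lemma admissibleM f g : admissible f -> admissible g -> admissible (fun x => f x * g x).
Proof.
case=> mf [M1 h1] [P1 e1] [mg [M2 h2] [P2 e2]]; split; first by mes.
  by exists (M1 * M2) => x; rewrite normrM; exact: ler_pM.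
eexists; apply: L1le_dom2 (L1leD (L1leZ (2 * M2 ^+ 2) e1) (L1leZ (2 * M1 ^+ 2) e2)); first by apply: measurable_en; mes.
move=> x y; rewrite ger0_norm ?en_ge0// /en/=.
set k := (_ ^+ 2)^-1; have -> : 2 * M2 ^+ 2 * ((f x - f y) ^+ 2 * k) + 2 * M1 ^+ 2 * ((g x - g y) ^+ 2 * k) =
  2 * (M2 ^+ 2 * (f x - f y) ^+ 2 + M1 ^+ 2 * (g x - g y) ^+ 2) * k by ring.
apply: ler_wpM2r; first exact: inv_sqr_ge0.
have -> : f x * g x - f y * g y = g y * (f x - f y) + f x * (g x - g y) by ring.
apply: le_trans (sqrD2_le _ _) _; rewrite ler_pM2l// !exprMn.
by apply: lerD; apply: ler_wpM2r; rewrite ?sqr_ge0 ?norm_le_sqr.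
Qed.

Lemma admissibleZ (k : R) f : admissible f -> admissible (fun x => k * f x).
Proof.
case=> mf [M1 h1] [P1 e1]; split; first by mes.
  by exists (`|k| * M1) => x; rewrite normrM; exact: ler_wpM2l.
eexists; apply: L1le_dom2 (L1leZ (k ^+ 2) e1); first by apply: measurable_en; mes.
by move=> x y; rewrite ger0_norm ?en_ge0// /en/= mulrA -mulrBr exprMn.
Qed.

Lemma admissible0 : admissible (fun=> 0).
Proof.
split; [exact: measurable_cst|by exists 0 => x; rewrite normr0|].
by exists 0; apply: eq_L1le (L1le0 mu2) => z; rewrite /en subrr expr0n/= mul0r.
Qed.

Lemma admissible_sum (s : seq nat) (F : nat -> R -> R) : (forall k, admissible (F k)) ->
  admissible (fun x => \sum_(k <- s) F k x).
Proof.
move=> h; elim: s => [|k s ih].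
  by rewrite (_ : (fun x => _) = fun=> 0); [exact: admissible0|apply/funext => x; rewrite big_nil].
rewrite (_ : (fun x => _) = (fun x => F k x + \sum_(i <- s) F i x)); first exact: admissibleD.
by apply/funext => x; rewrite big_cons.
Qed.

Lemma admissibleB f g : admissible f -> admissible g -> admissible (fun x => f x - g x).
Proof.
move=> hf /(admissibleZ (-1)) hg; have := admissibleD hf hg.
by rewrite (_ : (fun x => f x + _) = (fun x => f x - g x))//; apply/funext => x; rewrite mulN1r.
Qed.

Section FineScale.
Variables (g : R -> R) (G b : nat -> R -> R) (beta : nat -> R) (rho sg M S2 : R).
Hypotheses (Lg : dyadic_levels g G b beta rho sg M S2) (r0 : 0 < rho).

Lemma admissible_level c r k : 0 < r -> (forall x, r < `|x - c| -> G k x = 0) ->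
  (exists L, forall x y, `|G k x - G k y| <= L * `|x - y|) -> admissible (G k).
Proof.
move=> rp supG [L hL]; apply: (admissible_lipschitz hL _ rp supG) => x; exact: lev_approx_bound Lg k x.
Qed.

Lemma exists_pos_mul_le (A e : R) : 0 <= A -> 0 < e -> exists2 t, 0 < t & A * t <= e.
Proof.
move=> A0 e0; have A1 : 0 < A + 1 by clra.
exists (e / (A + 1)); first exact: divr_gt0.
by rewrite mulrA ler_pdivrMr//; clra.
Qed.

Lemma exists_fine_scale phi Ph p pib E e : dyadic_levels phi Ph p pib rho sg M S2 ->
  L1le mu2 (en g) E -> 0 < e -> exists K, pib K.+1 / dyad rho K.+1 + beta K.+1 / dyad rho K.+1 <= e /\
    L1le mu2 (fun z => ind (`|z.1 - z.2| <= dyad rho K.+1) * en g z) e.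
Proof.
move=> Lp hE e0; have [n0 near] := near_diagonal_energy_small (lev_measurable Lg) hE r0 e0.
have [|K|[|K] [hK small]] :=
  @exists_small_term _ (fun k => pib k / dyad rho k + beta k / dyad rho k) (S2 + S2) e n0.+1 _ _ e0.
- by move=> m; rewrite addr_ge0 ?(lev_err_ratio_ge0 Lp)// (lev_err_ratio_ge0 Lg).
- by rewrite big_split/=; apply: lerD; [exact: lev_err_sum Lp K|exact: lev_err_sum Lg K].
- by [].
by exists K; split => //; apply: near; exact: ltnW.
Qed.

Lemma increment_L4_shell m x y : 0 < sg -> within_level rho m x y ->
  (g x - g y) ^+ 4 <= 18 * (g x - G m x) ^+ 4 + 9 * (68 * sg) ^+ 2 * (g x - G m x) ^+ 2
    + (18 * (g y - G m y) ^+ 4 + 9 * (68 * sg) ^+ 2 * (g y - G m y) ^+ 2) + 3 * (68 * sg) ^+ 2 * (g x - g y) ^+ 2.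
Proof.
move=> s0 hm; have := increment_sqr_le_level r0 s0 Lg hm.
rewrite (_ : (g x - g y) ^+ 4 = (g x - g y) ^+ 2 * (g x - g y) ^+ 2); last by rewrite -exprD.
move: (g x - G m x) (g y - G m y) ((68 * sg) ^+ 2) ((g x - g y) ^+ 2) (sqr_ge0 (g x - g y)) => h k s2 D D0 d2.
apply: le_trans (ler_wpM2r D0 d2) _.
have := ler_wpM2l (addr_ge0 (sqr_ge0 h) (sqr_ge0 k)) d2; have := sqr_ge0 (h ^+ 2 - k ^+ 2); clra.
Qed.

End FineScale.

Lemma paraproduct_exists phi g c rho sg M e : measurable_fun setT phi -> measurable_fun setT g ->
  (forall x, `|phi x| <= M) -> (forall x, `|g x| <= M) -> 0 < rho -> 0 < sg ->
  (forall x, 2 * rho < `|x - c| -> phi x = 0) -> (forall x, 16 * rho < `|x - c| -> g x = 0) ->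
  L1le mu2 (en phi) (sg ^+ 2) -> L1le mu2 (en g) (sg ^+ 2) -> 0 < e ->
  exists f K (h : nat -> R -> R), [/\ admissible f, forall x, 3 * rho < `|x - c| -> f x = 0,
    L1le mu2 (defect phi g f) (10 ^+ 13 * sg ^+ 4 + e),
    (forall x, `|f x| <= 68 * sg * \sum_(0 <= k < K) `|h k x|) &
    (forall k, [/\ measurable_fun setT (h k), forall x, `|h k x| <= 3 * M &
       L1le mu (fun x => h k x ^+ 2) (200 * sg ^+ 2 * dyad rho k.+1)])].
Proof.
move=> mp mg pM gM r0 s0 p0 g0 hp hg e0.
have p0' x : 16 * rho < `|x - c| -> phi x = 0 by move=> h; apply: p0; clra.
have [Ph [p [pib [Lp supP lipP]]]] := dyadic_levels_exist mp pM r0 s0 p0' hp.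
have [G [b [beta [Lg supG lipG]]]] := dyadic_levels_exist mg gM r0 s0 g0 hg.
have [t t0 te] := exists_pos_mul_le (mulr_ge0 (ler0n _ 8000) (sqr_ge0 M)) e0.
have [K [hs near]] := exists_fine_scale Lg r0 Lp hg t0.
have supP3 k x : 3 * rho < `|x - c| -> Ph k x = 0 by move=> hx; apply: (supP _ p0); clra.
have supG17 k x : 17 * rho < `|x - c| -> G k x = 0 by move=> hx; apply: (supG _ g0); clra.
have Gp k : admissible (fun x => Ph k.+1 x - Ph k x).
  have r3 : 0 < 3 * rho by clra.
  by apply: admissibleB;
    [exact: (admissible_level Lp r3 (supP3 _) (lipP _))|exact: (admissible_level Lp r3 (supP3 _) (lipP _))].
have Gh k : admissible (fun x => g x - G k.+1 x).
  apply: admissibleB; first by split => //; [exists M|exists (sg ^+ 2)].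
  by apply: (admissible_level Lg _ (supG17 _) (lipG _)); clra.
have Gf : admissible (paraproduct g Ph G K.+1) by apply: admissible_sum => k; exact: admissibleM.
exists (paraproduct g Ph G K.+1), K.+1, (fun k x => g x - G k.+1 x); split => //.
- by move=> x hx; rewrite /paraproduct big1// => k _; rewrite !supP3// subrr mul0r.
- have [mf _ _] := Gf; apply: L1leW (compensated_product_le Lp Lg r0 s0 hg mf near).
  have := ler_wpM2l (sqr_ge0 M) hs; have s4 : 0 <= sg ^+ 4 by rewrite exprn_even_ge0.
  have -> : 2 * 10 ^+ 10 * (sg ^+ 2 * (200 * sg ^+ 2)) = 400 * (10 ^+ 10 * sg ^+ 4) by ring.
  have -> : 10 ^+ 13 * sg ^+ 4 = 1000 * (10 ^+ 10 * sg ^+ 4) by ring.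
  have : 13872 * sg ^+ 4 <= 10 ^+ 10 * sg ^+ 4 by apply: ler_wpM2r; [exact: s4|clra].
  by move: te; move: (10 ^+ 10 * sg ^+ 4) (mulr_ge0 (exprn_ge0 10 (ler0n R 10)) s4) => X X0; clra.
- move=> x; rewrite /paraproduct mulr_sumr; apply: le_trans (ler_norm_sum _ _ _) _.
  by apply: ler_sum => k _; rewrite normrM; apply: ler_wpM2r => //; exact: lev_step Lp k x.
- move=> k; split; [by case: (Gh k)|by move=> x; exact: lev_error_le3 Lg _ _|].
  apply: L1leW (lev_error_L2 Lg k.+1); rewrite -ler_pdivrMr ?dyad_gt0//.
  exact: le_trans (term_le_sum (lev_err_ratio_ge0 Lg r0) (ltnSn _)) (lev_err_sum Lg k.+2).
Qed.

Lemma increment_L4_le g c rho sg M e : measurable_fun setT g -> (forall x, `|g x| <= M) -> 0 < rho -> 0 < sg ->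
  (forall x, 16 * rho < `|x - c| -> g x = 0) -> L1le mu2 (en g) (sg ^+ 2) -> 0 < e ->
  L1le mu2 (fun z => (g z.1 - g z.2) ^+ 4 / (z.1 - z.2) ^+ 2) (10 ^+ 13 * sg ^+ 4 + e).
Proof.
move=> mg gM r0 s0 g0 hg e0.
have [G [b [beta [Lg _ _]]]] := dyadic_levels_exist mg gM r0 s0 g0 hg.
have [t t0 te] := exists_pos_mul_le (mulr_ge0 (ler0n _ 8000) (sqr_ge0 M)) e0.
have [K [hs near]] := exists_fine_scale Lg r0 Lg hg t0.
have [Q [hQ sQ]] := error_L4_sum Lg r0 K.+1.
pose S := 68 * sg.
have q4 (a : R) : 0 <= a ^+ 4 by rewrite exprn_even_ge0.
have hU m : (m <= K.+1)%N ->
    L1le mu (fun x => 18 * (g x - G m x) ^+ 4 + 9 * S ^+ 2 * (g x - G m x) ^+ 2) (18 * Q m + 9 * S ^+ 2 * beta m).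
  move=> mK; have := L1leD (L1leZ 18 (hQ m mK)) (L1leZ (9 * S ^+ 2) (lev_error_L2 Lg m)).
  by rewrite !ger0_norm//; nneg.
have := L1leD (L1leZ (3 * S ^+ 2) hg) (L1leZ (4 * M ^+ 2) near); rewrite !ger0_norm; [|by nneg|by nneg] => hH.
apply: L1leW (L1le_dyadic_shells r0 _ _ _ hU hH _ _); first last.
- move=> x y m mK hm; apply: le_trans (ler_wpM2r (inv_sqr_ge0 (x - y)) (increment_L4_shell Lg r0 s0 hm)) _.
  by rewrite -/S mulrDl lerD2l -(mulrA (3 * S ^+ 2)) /en/= lerDl; nneg.
- move=> x y hK; rewrite indT// mul1r; apply: ler_wpDl; first by nneg.
  have dgM : (g x - g y) ^+ 2 <= (M + M) ^+ 2 by apply/norm_le_sqr/(le_trans (ler_normB _ _))/lerD.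
  have -> : (g x - g y) ^+ 4 / (x - y) ^+ 2 = (g x - g y) ^+ 2 * en g (x, y) by rewrite /en/=; ring.
  by apply: le_trans (ler_wpM2r (en_ge0 g (x, y)) dgM) _; apply: eqW; ring.
- by move=> m x; apply: addr_ge0; [rewrite mulr_ge0|nneg].
- by move=> z; apply: mulr_ge0; [exact: q4|exact: inv_sqr_ge0].
- by mes.
have -> : \sum_(0 <= m < K.+1) (18 * Q m + 9 * S ^+ 2 * beta m) / dyad rho m =
   18 * (\sum_(0 <= m < K.+1) Q m / dyad rho m) + 9 * S ^+ 2 * (\sum_(0 <= m < K.+1) beta m / dyad rho m).
  by rewrite !mulr_sumr -!big_split/=; apply: eq_bigr => m _; ring.
have := ler_wpM2l (sqr_ge0 M) hs; have := ler_wpM2l (sqr_ge0 sg) (lev_err_sum Lg K.+1); move: te sQ.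
move: (\sum_(0 <= m < K.+1) Q m / _) (\sum_(0 <= m < K.+1) beta m / _) (beta K.+1 / _)
  (mulr_ge0 (sqr_ge0 M) (lev_err_ratio_ge0 Lg r0 K.+1)) => q1 q2 bb bb0 te sQ w2 hs2.
have b1 : 10 ^+ 8 * (sg ^+ 2 * (200 * sg ^+ 2)) = 200 * (10 ^+ 8 * sg ^+ 4) by ring.
have b2 : 10 ^+ 13 * sg ^+ 4 = 300 * 333 * (10 ^+ 8 * sg ^+ 4) + 100 * (10 ^+ 8 * sg ^+ 4) by ring.
have b3 : 5000 * 5000 * sg ^+ 4 <= 10 ^+ 8 * sg ^+ 4 by apply: ler_wpM2r; [exact: q4|clra].
have b4 : sg ^+ 2 * (200 * sg ^+ 2) = 200 * sg ^+ 4 by ring.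
rewrite b1 in sQ; rewrite b2; rewrite b4 in w2; move: sQ b3; move: (10 ^+ 8 * sg ^+ 4) => X sQ b3.
have -> : 3 * S ^+ 2 * sg ^+ 2 = 13872 * sg ^+ 4 by rewrite /S; ring.
by have := q4 sg; rewrite /S; clra.
Qed.
End Admissible.
(** * Solutions and the conservation law *)

Section Solution.
Variables (R : realType) (N : nat).
Local Notation mu := (@lebesgue_measure R).
Local Notation mu2 := (mu \x mu)%E.
Implicit Types (a : R -> R) (u v m : 'I_N -> R -> R).

Definition sqdist u (z : R * R) : R := \sum_(i < N) (u i z.1 - u i z.2) ^+ 2.

Record solution a (Lam : R) u m (x0 r0 : R) : Prop := Solution {
  sol_kernel : elliptic_kernel a Lam;
  sol_measurable : forall i, measurable_fun setT (u i);
  sol_le1 : forall i x, `|u i x| <= 1;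
  sol_energy : exists E, forall i, L1le mu2 (fun z => ind (`|z.1 - x0| < r0) * en (u i) z) E;
  sol_source : forall i, exists c, L1le mu (m i) c;
  sol_weak : forall i phi, admissible phi -> (forall x, r0 <= `|x - x0| -> phi x = 0) ->
    form a (u i) phi = \int[mu2]_z (sqdist u z * kern a z * (u i z.1 * phi z.1))
       + \int[mu]_x (m i x * phi x) }.

Lemma sqdist_ge0 u z : 0 <= sqdist u z.
Proof. by apply: sumr_ge0 => i _; exact: sqr_ge0. Qed.

Lemma measurable_sqdist u : (forall i, measurable_fun setT (u i)) -> measurable_fun setT (sqdist u).
Proof. by move=> h; rewrite /sqdist; apply: measurable_sum => i; have := h i => ?; mes. Qed.

Lemma L1le_sqdist_form a Lam u x0 r0 : elliptic_kernel a Lam -> (forall i, measurable_fun setT (u i)) ->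
  (exists E, forall i, L1le mu2 (fun z => ind (`|z.1 - x0| < r0) * en (u i) z) E) ->
  (forall i x, `|u i x| <= 1) ->
  forall i phi, admissible phi -> (forall x, r0 <= `|x - x0| -> phi x = 0) ->
  exists c, L1le mu2 (fun z => sqdist u z * kern a z * (u i z.1 * phi z.1)) c.
Proof.
move=> ok mu_ [E hE] u1 i phi [mp [M hM] [P hP]] p0; have mk := measurable_kern ok.
have mD := measurable_sqdist mu_; have mui := mu_ i.
have H := L1leZ (Lam * M) (L1le_sum (index_enum 'I_N) (P := xpredT) (fun j _ => hE j)).
eexists; apply: L1le_dom2 H; first by mes.
move=> x y /=; have M0 : 0 <= M := le_trans (normr_ge0 _) (hM 0).
have [_ L1 _ _] := ok; have /andP[_ k2] := kern_bounds x y ok; have k0 := kern_ge0 (x, y) ok.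
have -> : \sum_(j < N) ind (`|x - x0| < r0) * en (u j) (x, y) =
   ind (`|x - x0| < r0) * (sqdist u (x, y) / (x - y) ^+ 2).
  by rewrite -mulr_sumr; congr (_ * _); rewrite /sqdist mulr_suml.
rewrite normrM (ger0_norm (mulr_ge0 (sqdist_ge0 u (x, y)) k0)).
have [hx|hx] := ltP `|x - x0| r0; last first.
  by rewrite p0// !mulr0 normr0 mulr0 /ind mul0r mulr0.
rewrite [ind true]/ind mul1r.
have D0 := sqdist_ge0 u (x, y).
apply: (@le_trans _ _ (sqdist u (x, y) * (Lam / (x - y) ^+ 2) * M)); last by apply: eqW; ring.
apply: ler_pM; [exact: mulr_ge0|by []|exact: ler_wpM2l|].
by rewrite normrM -(mul1r M); apply: ler_pM.
Qed.

Section AeEqual.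
Variables (a : R -> R) (Lam : R) (u v : 'I_N -> R -> R) (i : 'I_N) (phi : R -> R).
Hypotheses (ok : elliptic_kernel a Lam) (mu_ : forall i, measurable_fun setT (u i))
  (mv : forall i, measurable_fun setT (v i)) (uv : forall i, {ae mu, forall x, u i x = v i x})
  (mphi : measurable_fun setT phi).

Lemma ae_eq_en : {ae mu2, forall z, en (u i) z = en (v i) z}.
Proof. by apply: (ae_imp _ (ae_eq_pair uv)) => z /(_ i)[e1 e2]; rewrite /en e1 e2. Qed.

Lemma ae_eq_form_integrand : {ae mu2, forall z,
  (u i z.1 - u i z.2) * (phi z.1 - phi z.2) * kern a z = (v i z.1 - v i z.2) * (phi z.1 - phi z.2) * kern a z}.
Proof. by apply: (ae_imp _ (ae_eq_pair uv)) => z /(_ i)[-> ->]. Qed.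

Lemma ae_eq_sqdist_integrand : {ae mu2, forall z,
  sqdist u z * kern a z * (u i z.1 * phi z.1) = sqdist v z * kern a z * (v i z.1 * phi z.1)}.
Proof.
apply: (ae_imp _ (ae_eq_pair uv)) => z h; rewrite (proj1 (h i)); congr (_ * _ * _).
by apply: eq_bigr => j _; rewrite (proj1 (h j)) (proj2 (h j)).
Qed.

Lemma ae_eq_form : form a (u i) phi = form a (v i) phi.
Proof.
have mk := measurable_kern ok; have mui := mu_ i; have mvi := mv i.
by apply: ae_eq_Rint ae_eq_form_integrand; mes.
Qed.

Lemma ae_eq_sqdist_form : \int[mu2]_z (sqdist u z * kern a z * (u i z.1 * phi z.1)) =
  \int[mu2]_z (sqdist v z * kern a z * (v i z.1 * phi z.1)).
Proof.
have mk := measurable_kern ok; have mui := mu_ i; have mvi := mv i.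
have mDu := measurable_sqdist mu_; have mDv := measurable_sqdist mv.
by apply: ae_eq_Rint ae_eq_sqdist_integrand; mes.
Qed.

End AeEqual.

Lemma ae_eq_solution a Lam u v m x0 r0 : solution a Lam u m x0 r0 ->
  (forall i, measurable_fun setT (v i)) -> (forall i x, `|v i x| <= 1) ->
  (forall i, {ae mu, forall x, u i x = v i x}) -> solution a Lam v m x0 r0.
Proof.
case=> ok mu_ u1 [E hE] mm we mv v1 uv; split => //.
- exists E => i; apply: ae_eq_L1le (hE i); first by have := measurable_en (mv i) => ?; mes.
  by apply: (ae_imp _ (ae_eq_en i uv)) => z ->.
- move=> i phi gp p0; have [mp _ _] := gp.
  by rewrite -(ae_eq_form i ok mu_ mv uv mp) -(ae_eq_sqdist_form i ok mu_ mv uv mp) we.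
Qed.
End Solution.

Section WeakToSol.
Variables (R : realType) (N : nat).
Local Notation mu := (@lebesgue_measure R).
Local Notation mu2 := (mu \x mu)%E.
Variables (Lam : R) (a : R -> R) (Om : set R) (x0 r : R) (u m : R -> 'I_N -> R).
Hypotheses (N2 : (2 <= N)%N) (ok : elliptic_kernel a Lam) (oOm : open Om) (r0 : 0 < r)
  (sOm : closure (ball x0 (2 * r)) `<=` Om) (hm : Lp_on 1 Om m) (hw : weak_solution a Om u m).

Definition ucomp (i : 'I_N) x := u x i.
Definition source (i : 'I_N) x := ind (`|x - x0| < 2 * r) * m x i.
Definition unit_rep (i : 'I_N) x := if vnorm (u x) == 1 then u x i else if val i == 0%N then 1 else 0.

Lemma ball_sub x : `|x - x0| < 2 * r -> Om x.
Proof. by move=> h; apply: sOm; apply: subset_closure; rewrite -ball_normE /ball_/= distrC. Qed.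

Lemma measurable_domain : measurable Om.
Proof. exact: open_measurable. Qed.

Lemma measurable_ucomp i : measurable_fun setT (ucomp i).
Proof. by case: hw => [[h _] _]; exact: h. Qed.

Lemma sum_unit_rep_sqr x : \sum_(i < N) unit_rep i x ^+ 2 = 1.
Proof.
rewrite /unit_rep; case: eqP => [h|_].
  have d0 : 0 <= vdot (u x) (u x) by apply: sumr_ge0 => i _; rewrite -expr2 sqr_ge0.
  have : vnorm (u x) ^+ 2 = 1 by rewrite h expr1n.
  by rewrite /vnorm sqr_sqrtr// /vdot => <-; apply: eq_bigr => i _; rewrite expr2.
case: N N2 => // n _; rewrite big_ord_recl/= expr1n big1 ?addr0// => i _.
by rewrite /bump/= expr0n.
Qed.

Lemma measurable_unit_rep i : measurable_fun setT (unit_rep i).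
Proof.
have mu_ j : measurable_fun setT (fun x => u x j) := measurable_ucomp j.
have hv x : unit_rep i x = if (vdot (u x) (u x) <= 1) && (1 <= vdot (u x) (u x)) then u x i
   else if val i == 0%N then 1 else 0.
  rewrite /unit_rep -eq_le; congr (if _ then _ else _).
  have d0 : 0 <= vdot (u x) (u x) by apply: sumr_ge0 => j _; rewrite -expr2 sqr_ge0.
  apply/eqP/eqP => [h|h]; last by rewrite /vnorm h sqrtr1.
  by rewrite -(sqr_sqrtr d0) -/(vnorm (u x)) h expr1n.
rewrite (funext hv) /vdot; have mui := mu_ i; apply: measurable_fun_ifT; [|by []|exact: measurable_cst].
have ms : measurable_fun setT (fun x => \sum_(j < N) u x j * u x j).
  by apply: measurable_sum => j; have := mu_ j => ?; mes.
by apply: measurable_and; apply: measurable_fun_ler => //; exact: measurable_cst.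
Qed.

Lemma unit_rep_le1 i x : `|unit_rep i x| <= 1.
Proof.
rewrite -(@ler_pXn2r _ 2)// ?nnegrE// expr1n real_normK ?num_real// -(sum_unit_rep_sqr x) (bigD1 i)//= lerDl.
by apply: sumr_ge0 => j _; exact: sqr_ge0.
Qed.

Lemma unit_rep_ae i : {ae mu, forall x, u x i = unit_rep i x}.
Proof.
case: hw => _ [h _]; have h' : {ae mu, forall x, vnorm (u x) = 1} by exact: h.
by apply: (ae_imp _ h') => x e; rewrite /unit_rep e eqxx.
Qed.

Lemma ucomp_ae i : {ae mu, forall x, ucomp i x = unit_rep i x}. Proof. exact: unit_rep_ae. Qed.

Lemma measurable_COmega : measurable (COmega Om : set (measurableTypeR R * measurableTypeR R)).
Proof.
by rewrite /COmega; apply: measurableC; apply: measurableX; apply: measurableC; exact: measurable_domain.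
Qed.

Lemma en_density_ge0 z : 0 <= en_density u z.
Proof. by apply: mulr_ge0; [apply: sumr_ge0 => j _; rewrite -expr2 sqr_ge0|exact: inv_sqr_ge0]. Qed.

Lemma measurable_en_density : measurable_fun setT (en_density u).
Proof.
rewrite /en_density /vdot; apply: measurable_funM; last by mes.
by apply: measurable_sum => j; have mj := measurable_ucomp j; rewrite /ucomp in mj;
  apply: measurable_funM; apply: measurable_funB;
  by [exact: (measurableT_comp mj measurable_fst)|exact: (measurableT_comp mj measurable_snd)].
Qed.

Lemma en_ucomp_le i z : ind (`|z.1 - x0| < 2 * r) * en (ucomp i) z <= ind (z \in COmega Om) * en_density u z.
Proof.
have [h|h] := ltP `|z.1 - x0| (2 * r); last by rewrite indF// mul0r mulr_ge0 ?ind_ge0 ?en_density_ge0.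
rewrite [ind (z \in _)]indT; last by rewrite inE => -[+ _]; apply; exact: ball_sub.
rewrite ler_wpM2l ?ind_ge0// ler_wpM2r ?inv_sqr_ge0// /vdot (bigD1 i)//= -expr2 lerDl.
by apply: sumr_ge0 => j _; rewrite -expr2 sqr_ge0.
Qed.

Lemma unit_rep_energy : exists E, forall i, L1le mu2 (fun z => ind (`|z.1 - x0| < 2 * r) * en (unit_rep i) z) E.
Proof.
case: hw => [[_ [_ hE]] _]; rewrite /energy in hE; have mC := measurable_COmega.
exists (fine (\int[@leb2 R]_(z in COmega Om) (en_density u z)%:E)) => i.
have md := measurable_en_density; have men := measurable_en (measurable_ucomp i).
have menv := measurable_en (measurable_unit_rep i).
suff H : L1le mu2 (fun z => ind (`|z.1 - x0| < 2 * r) * en (ucomp i) z)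
    (fine (\int[@leb2 R]_(z in COmega Om) (en_density u z)%:E)).
  apply: ae_eq_L1le H; first by mes.
  by apply: (ae_imp _ (ae_eq_en i ucomp_ae)) => z ->.
split; first by mes.
rewrite fineK; last first.
  by rewrite ge0_fin_numE//; apply: integral_ge0 => z _; rewrite lee_fin en_density_ge0.
rewrite [leRHS]integral_mkcond; apply: ge0_le_integral => //.
- by apply: measurable_EFin_norm; mes.
- apply/(measurable_restrictT _ mC)%R; apply: measurable_funTS; exact/measurable_EFinP.
- move=> z _; rewrite patchE ger0_norm; last by nneg.
  have := en_ucomp_le i z; case: ifP => _; first by rewrite [ind true]/ind mul1r lee_fin.
  by rewrite [ind false]/ind mul0r => h; exact: h.
Qed.

Lemma L1le_domain_source i : exists c, L1le mu (fun x => ind (x \in Om) * m x i) c.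
Proof.
have [mm fm] := hm i; have mO := measurable_domain.
have mF : measurable_fun setT (fun x => ind (x \in Om) * m x i).
  rewrite (_ : (fun x => _) = ((fun x => m x i) \_ Om)).
    exact/(measurable_restrictT _ mO).
  by apply/funext => x; rewrite patchE /ind; case: ifP; rewrite ?mul1r ?mul0r.
apply: L1le_exists => //; apply: le_lt_trans fm; rewrite [leRHS]integral_mkcond.
apply: ge0_le_integral => //.
- exact: measurable_EFin_norm.
- apply/(measurable_restrictT _ mO); apply/measurable_EFinP.
  by apply: (measurableT_comp (measurable_powR 1)); exact: measurableT_comp.
- move=> x _; rewrite patchE /ind; case: ifP => _; rewrite ?mul1r ?mul0r ?normr0//.
  by rewrite powRr1.
Qed.

Lemma L1le_source i : exists c, L1le mu (source i) c.
Proof.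
have [c hc] := L1le_domain_source i; exists c.
have mm : measurable_fun setT (source i).
  rewrite (_ : source i = fun x => ind (`|x - x0| < 2 * r) * (ind (x \in Om) * m x i)).
    by apply: measurable_funM; [mes|exact: L1le_measurable hc].
  apply/funext => x; rewrite /source; have [h|h] := ltP `|x - x0| (2 * r); last by rewrite /ind !mul0r.
  by rewrite [ind (_ \in _)]indT ?mul1r// inE; exact: ball_sub.
apply: L1le_dom (L1le_norm hc) => // x; rewrite /source !normrM.
have [h|h] := ltP `|x - x0| (2 * r); last by rewrite {1}/ind normr0 mul0r mulr_ge0.
by rewrite [ind (_ \in _)]indT// inE; exact: ball_sub.
Qed.

Lemma vdot_delta (f : 'I_N -> R) i t : vdot f (fun j => if j == i then t else 0) = f i * t.
Proof. by rewrite /vdot (bigD1 i)//= eqxx big1 ?addr0// => j /negPf ->; rewrite mulr0. Qed.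

Definition test_field i (phi : R -> R) (x : R) (j : 'I_N) := if j == i then phi x else 0.

Section TestField.
Variables (i : 'I_N) (phi : R -> R).
Hypotheses (gp : admissible phi) (p0 : forall x, 2 * r <= `|x - x0| -> phi x = 0).
Local Notation Phi := (test_field i phi).

Lemma supp_domain x : ~ Om x -> phi x = 0.
Proof. by move=> hx; apply: p0; rewrite leNgt; apply/negP => /ball_sub. Qed.

Lemma test_fieldB (z : R * R) : (fun j => Phi z.1 j - Phi z.2 j) = fun j => if j == i then phi z.1 - phi z.2 else 0.
Proof. by apply/funext => j; rewrite /test_field; case: ifP; rewrite ?subrr. Qed.

Lemma en_density_test_field z : en_density Phi z = en phi z.
Proof. by rewrite /en_density test_fieldB vdot_delta eqxx -expr2. Qed.

Lemma lhs_integrand_test_field z :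
  lhs_integrand a u Phi z = (ucomp i z.1 - ucomp i z.2) * (phi z.1 - phi z.2) * kern a z.
Proof. by rewrite /lhs_integrand test_fieldB vdot_delta /kern mulrA. Qed.

Lemma dsa2E x : dsa2 a u x = (\int[mu]_y (sqdist ucomp (x, y) * kern a (x, y))%:E)%E.
Proof.
apply: eq_integral => y _; congr EFin; rewrite /kern/= /sqdist/= /vdot.
rewrite (_ : \sum_(j < N) (u x j - u y j) * (u x j - u y j) = \sum_(j < N) (ucomp j x - ucomp j y) ^+ 2).
  by ring.
by apply: eq_bigr => j _; rewrite expr2.
Qed.

Lemma source_mulE x : source i x * phi x = ind (x \in Om) * m x i * phi x.
Proof.
have [hx|hx] := ltP `|x - x0| (2 * r); last by rewrite p0 ?mulr0.
by rewrite /source hx [ind (_ \in _)]indT ?[ind true]indT// inE; exact: ball_sub.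
Qed.

Lemma L1le_source_mul : exists c, L1le mu (fun x => source i x * phi x) c.
Proof.
have [mp [M hM] _] := gp; have [c hc] := L1le_source i; exists (`|M| * c).
apply: L1le_dom (L1leZ M (L1le_norm hc)) => [|x]; first by have := L1le_measurable hc => ?; mes.
by rewrite normrM mulrC; apply: ler_wpM2r.
Qed.

Lemma test_field_L2 j : (\int[@leb R]_(x in setT) (`|Phi x j| `^ 2)%:E < +oo)%E.
Proof.
have [mp [M hM] _] := gp; have r2 : 0 <= 2 * r by clra.
have mPhi : measurable_fun setT (Phi ^~ j) by rewrite /test_field; case: (j == i) => //; exact: measurable_cst.
have hx : L1le mu (fun x => `|Phi x j| `^ 2) (`|M ^+ 2| * (2 * (2 * r))).
  apply: L1le_dom (L1leZ (M ^+ 2) (L1le_ball x0 r2)) => [|x]; first by mes.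
  rewrite ger0_norm ?powR_ge0// powR_mulrn// sqr_normr /test_field.
  case: ifP => _; last by rewrite expr0n/=; nneg.
  have [hx|hx] := ltP `|x - x0| (2 * r); last by rewrite p0// expr0n/=; nneg.
  by rewrite indT ?mulr1 ?norm_le_sqr// distrC ltW.
apply: le_lt_trans (ltry (`|M ^+ 2| * (2 * (2 * r)))); apply: le_trans hx.2.
by apply: eqW; apply: eq_integral => x _; rewrite [in RHS]ger0_norm// powR_ge0.
Qed.

Lemma Hhat00_test_field : Hhat00 Om Phi.
Proof.
have [mp _ [P [_ hP]]] := gp.
have mPhi j : measurable_fun setT (Phi ^~ j).
  by rewrite /test_field; case: (j == i) => //; exact: measurable_cst.
split; last by move=> x hx j; rewrite /test_field supp_domain ?if_same.
split => //; split; first by move=> j; split; [exact: mPhi|exact: test_field_L2].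
rewrite /energy integral_supp; last by move=> z; rewrite /COmega/= => h; exfalso; apply: h => -[[]].
apply: le_lt_trans (ltry P); apply: le_trans hP.
by apply: eqW; apply: eq_integral => z _; rewrite en_density_test_field ger0_norm ?en_ge0.
Qed.

Lemma vdot_source x : Om x -> (vdot (m x) (Phi x))%:E = (source i x * phi x)%:E.
Proof. by move=> hx; rewrite vdot_delta source_mulE indT ?mul1r// inE. Qed.

Lemma integrable_source_test_field : (@leb R).-integrable Om (fun x => (vdot (m x) (Phi x))%:E).
Proof.
have [c hc] := L1le_source_mul; have mO := measurable_domain.
have h : (@leb R).-integrable Om (fun x => (source i x * phi x)%:E).
  by apply: (@integrableS _ _ _ _ setT) => //; exact: L1le_integrable hc.
by apply: (eq_integrable _ _ _ _ h) => [|x /set_mem hx]; [exact: mO|rewrite vdot_source].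
Qed.

Lemma integral_source_test_field :
  (\int[@leb R]_(x in Om) (vdot (m x) (Phi x))%:E = (\int[mu]_x (source i x * phi x))%:E)%E.
Proof.
have [c hc] := L1le_source_mul; rewrite -(EFin_Rintegral hc).
transitivity (\int[@leb R]_(x in Om) (source i x * phi x)%:E)%E.
  by apply: eq_integral => x /set_mem hx; rewrite vdot_source.
by apply: integral_supp => x hx; rewrite supp_domain ?mulr0.
Qed.

Lemma weak_equation :
  (exists c, L1le mu2 (fun z => sqdist ucomp z * kern a z * (ucomp i z.1 * phi z.1)) c) ->
  (exists c, L1le mu2 (fun z => (ucomp i z.1 - ucomp i z.2) * (phi z.1 - phi z.2) * kern a z) c) ->
  form a (ucomp i) phi = \int[mu2]_z (sqdist ucomp z * kern a z * (ucomp i z.1 * phi z.1))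
       + \int[mu]_x (source i x * phi x).
Proof.
move=> [c1 h1] [c2 h2]; have [mp _ _] := gp; have mO := measurable_domain; have mC := measurable_COmega.
have mui := measurable_ucomp i; have mk := measurable_kern ok; have mD := measurable_sqdist measurable_ucomp.
have [i1 e1] := @ge0_fubiniZr R (fun z => sqdist ucomp z * kern a z) (fun x => ucomp i x * phi x) c1
  (measurable_funM mD mk) (fun z => mulr_ge0 (sqdist_ge0 _ _) (kern_ge0 _ ok)) (measurable_funM mui mp) h1.
have dsaE x : (fine (dsa2 a u x) * vdot (u x) (Phi x))%:E =
   ((fine (\int[mu]_y (sqdist ucomp (x, y) * kern a (x, y))%:E)%E * (ucomp i x * phi x)))%:E.
  by rewrite dsa2E vdot_delta.
have int_lhs : (@leb2 R).-integrable (COmega Om) (fun z => (lhs_integrand a u Phi z)%:E).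
  apply: (@integrableS _ _ _ _ setT) => //.
  by apply: (eq_integrable measurableT) (L1le_integrable h2) => // z _ /=; rewrite lhs_integrand_test_field.
have int_dsa : (@leb R).-integrable Om (fun x => (fine (dsa2 a u x) * vdot (u x) (Phi x))%:E).
  apply: (@integrableS _ _ _ _ setT) => //.
  by apply: (eq_integrable measurableT) i1 => // x _; rewrite -dsaE.
have dsaI : (\int[@leb R]_(x in Om) (fine (dsa2 a u x) * vdot (u x) (Phi x))%:E =
    (\int[mu2]_z (sqdist ucomp z * kern a z * (ucomp i z.1 * phi z.1)))%:E)%E.
  rewrite integral_supp -?e1; last by move=> x hx; rewrite dsaE supp_domain// !mulr0.
  by apply: eq_integral => x _; rewrite dsaE.
case: hw => _ [_ /(_ Phi Hhat00_test_field int_lhs int_dsa integrable_source_test_field)].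
rewrite integral_source_test_field integral_supp; last first.
  move=> z; rewrite lhs_integrand_test_field /COmega/= => /contrapT[z1 z2].
  by rewrite !supp_domain// subrr mulr0 mul0r.
under eq_integral do rewrite lhs_integrand_test_field.
by rewrite dsaI (EFin_Rintegral h2) -EFinD => -[].
Qed.

End TestField.
Lemma weak_solution_unit_rep : solution a Lam unit_rep source x0 (2 * r).
Proof.
have mk := measurable_kern ok; have mDu := measurable_sqdist measurable_ucomp.
split => //; [exact: measurable_unit_rep|exact: unit_rep_le1|exact: unit_rep_energy|exact: L1le_source|].
move=> i phi gp p0; have [mp _ [P hP]] := gp; have [E hE] := unit_rep_energy.
have unit_ucomp j : {ae mu, forall x, unit_rep j x = ucomp j x} by apply: (ae_imp _ (ucomp_ae j)) => x ->.
have mui := measurable_ucomp i.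
rewrite (ae_eq_form i ok measurable_unit_rep measurable_ucomp unit_ucomp mp).
rewrite (ae_eq_sqdist_form i ok measurable_unit_rep measurable_ucomp unit_ucomp mp).
apply: weak_equation => //.
- have [c hc] := L1le_sqdist_form ok measurable_unit_rep unit_rep_energy unit_rep_le1 i gp p0.
  by exists c; apply: ae_eq_L1le hc; [mes|exact: ae_eq_sqdist_integrand].
- eexists; apply: ae_eq_L1le (ae_eq_form_integrand a i phi unit_ucomp) _; first by mes.
  apply: (L1le_form (b := fun x => `|x - x0| < 2 * r) ok (measurable_unit_rep i) mp _ _ (hE i) hP); first by mes.
  by move=> x; rewrite -leNgt; exact: p0.
Qed.
End WeakToSol.

Section ConservationLaw.
Variables (R : realType) (N : nat).
Local Notation mu := (@lebesgue_measure R).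
Local Notation mu2 := (mu \x mu)%E.
Variables (a : R -> R) (Lam : R) (u m : 'I_N -> R -> R) (x0 r0 : R).
Hypotheses (HS : solution a Lam u m x0 r0) (S1 : forall x, \sum_(i < N) u i x ^+ 2 = 1).

Definition wedge i j (z : R * R) := u i z.1 * u j z.2 - u j z.1 * u i z.2.

Lemma sum_wedge i x y : \sum_(j < N) wedge i j (x, y) * (u j x - u j y) =
  - sqdist u (x, y) * ((u i x + u i y) / 2).
Proof.
pose p := \sum_(j < N) u j x * u j y.
have E1 : sqdist u (x, y) = 2 - 2 * p.
  rewrite /sqdist/= (eq_bigr (fun j => u j x ^+ 2 + u j y ^+ 2 - 2 * (u j x * u j y))); last first.
    by move=> j _; ring.
  by rewrite big_split/= sumrN -mulr_sumr big_split/= !S1 -/p; ring.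
have -> : \sum_(j < N) wedge i j (x, y) * (u j x - u j y) =
   u i x * (p - \sum_(j < N) u j y ^+ 2) - u i y * (\sum_(j < N) u j x ^+ 2 - p).
  rewrite /p -!sumrB !mulr_sumr -sumrB; apply: eq_bigr => j _; rewrite /wedge/=; ring.
by rewrite !S1 E1; field.
Qed.

Lemma wedge_le i j x y : `|wedge i j (x, y)| <= `|u i x - u i y| + `|u j x - u j y|.
Proof.
have -> : wedge i j (x, y) = u j x * (u i x - u i y) - u i x * (u j x - u j y).
  by rewrite /wedge/=; ring.
apply: le_trans (ler_normB _ _) _; rewrite !normrM; apply: lerD;
  apply: ler_piMl => //; exact: sol_le1 HS _ _.
Qed.

Lemma admissible_mul_solution i f : admissible f -> (forall x, r0 <= `|x - x0| -> f x = 0) ->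
  admissible (fun x => f x * u i x).
Proof.
move=> [mf [M hM] [P hP]] f0; have mui := sol_measurable HS i; have [E hE] := sol_energy HS.
have M0 : 0 <= M := le_trans (normr_ge0 _) (hM 0).
split; first by mes.
  by exists (M * 1) => x; rewrite normrM; apply: ler_pM => //; exact: sol_le1 HS _ _.
eexists; apply: L1le_dom2 (L1leD (L1leZ (2 * M ^+ 2) (hE i)) (L1leZ 2 hP)); first by apply: measurable_en; mes.
move=> x y; rewrite ger0_norm ?en_ge0// /en/= !mulrA -mulrDl; apply: ler_wpM2r; first exact: inv_sqr_ge0.
have -> : f x * u i x - f y * u i y = f x * (u i x - u i y) + u i y * (f x - f y) by ring.
have u2 : u i y ^+ 2 <= 1.
  by rewrite -(sqr_normr ((u i y))) expr_le1//; exact: sol_le1 HS _ _.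
have f2 : f x ^+ 2 <= M ^+ 2 * ind (`|x - x0| < r0).
  have [h|h] := ltP `|x - x0| r0; last by rewrite f0// expr0n/= mulr0.
  rewrite /ind mulr1 -(sqr_normr ((f x))) lerXn2r ?nnegrE//; exact: hM.
have := ler_wpM2r (sqr_ge0 (u i x - u i y)) f2; have := ler_wpM2r (sqr_ge0 (f x - f y)) u2.
by have := sqr_ge0 (f x * (u i x - u i y) - u i y * (f x - f y)); clra.
Qed.

Lemma exists_L1le_form i f : admissible f -> (forall x, r0 <= `|x - x0| -> f x = 0) ->
  exists c, L1le mu2 (fun z => (u i z.1 - u i z.2) * (f z.1 - f z.2) * kern a z) c.
Proof.
move=> [mf _ [P hP]] f0; have [E hE] := sol_energy HS.
eexists; apply: (L1le_form (b := fun x => `|x - x0| < r0) (sol_kernel HS) (sol_measurable HS i) mf _ _ (hE i) hP).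
  by mes.
by move=> x; rewrite -leNgt; exact: f0.
Qed.

Lemma exists_L1le_source i f : admissible f -> exists c, L1le mu (fun x => m i x * f x) c.
Proof.
move=> [mf [M hM] _]; have [c hc] := sol_source HS i; exists (`|M| * c).
apply: L1le_dom (L1leZ M (L1le_norm hc)); first by have := L1le_measurable hc => ?; mes.
by move=> x; rewrite normrM mulrC; apply: ler_wpM2r.
Qed.

Lemma conservation i j f : admissible f -> (forall x, r0 <= `|x - x0| -> f x = 0) ->
  \int[mu2]_z (wedge i j z * (f z.1 - f z.2) * kern a z) =
  \int[mu]_x (m i x * (f x * u j x)) - \int[mu]_x (m j x * (f x * u i x)).
Proof.
move=> gf f0.
have z0 k x : r0 <= `|x - x0| -> f x * u k x = 0 by move=> h; rewrite f0// mul0r.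
have g1 := admissible_mul_solution i gf f0; have g2 := admissible_mul_solution j gf f0.
have E1 := sol_weak HS j g1 (z0 i); have E2 := sol_weak HS i g2 (z0 j).
have [c1 h1] := exists_L1le_form j g1 (z0 i); have [c2 h2] := exists_L1le_form i g2 (z0 j).
have -> : \int[mu2]_z (wedge i j z * (f z.1 - f z.2) * kern a z) =
   form a (u i) (fun x => f x * u j x) - form a (u j) (fun x => f x * u i x).
  rewrite /form -(RintB h2 h1); apply: eq_Rint => z; rewrite /wedge; ring.
rewrite E1 E2 (_ : \int[mu2]_z (sqdist u z * kern a z * (u i z.1 * (f z.1 * u j z.1))) =
   \int[mu2]_z (sqdist u z * kern a z * (u j z.1 * (f z.1 * u i z.1)))); first by ring.
by apply: eq_Rint => z; ring.
Qed.

Lemma L1le_wedge_form i j f : admissible f -> (forall x, r0 <= `|x - x0| -> f x = 0) ->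
  exists c, L1le mu2 (fun z => wedge i j z * (f z.1 - f z.2) * kern a z) c.
Proof.
move=> gf f0.
have z0 k x : r0 <= `|x - x0| -> f x * u k x = 0 by move=> h; rewrite f0// mul0r.
have g1 := admissible_mul_solution i gf f0; have g2 := admissible_mul_solution j gf f0.
have [c1 h1] := exists_L1le_form j g1 (z0 i); have [c2 h2] := exists_L1le_form i g2 (z0 j).
eexists; apply: eq_L1le (L1leB h2 h1) => z /=; rewrite /wedge; ring.
Qed.

Lemma sqdistC x y : sqdist u (x, y) = sqdist u (y, x).
Proof. by apply: eq_bigr => i _ /=; rewrite -sqrrN opprB. Qed.

(* The antisymmetric potential [wedge] absorbs the quadratic term up to [df] and a quartic remainder. *)
Lemma equation_split i phi (f : 'I_N -> R -> R) : admissible phi -> (forall x, r0 <= `|x - x0| -> phi x = 0) ->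
  (forall j, admissible (f j)) -> (forall j x, r0 <= `|x - x0| -> f j x = 0) ->
  form a (u i) phi =
    \int[mu2]_z ((4^-1 * sqdist u z * (u i z.1 - u i z.2) * (phi z.1 - phi z.2)
      - \sum_(j < N) wedge i j z * ((phi z.1 + phi z.2) / 2 * (u j z.1 - u j z.2) - (f j z.1 - f j z.2))) * kern a z)
    + \sum_(j < N) (\int[mu]_x (m j x * (f j x * u i x)) - \int[mu]_x (m i x * (f j x * u j x)))
    + \int[mu]_x (m i x * phi x).
Proof.
move=> gp p0 gf f0; rewrite (sol_weak HS)//; congr (_ + _).
have [mp _ _] := gp; have mk := measurable_kern (sol_kernel HS); have mD := measurable_sqdist (sol_measurable HS).
have mui := sol_measurable HS i.
have [c1 h1] := L1le_sqdist_form (sol_kernel HS) (sol_measurable HS) (sol_energy HS) (sol_le1 HS) i gp p0.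
pose F z := sqdist u z * kern a z * (u i z.1 * phi z.1).
have mF : measurable_fun setT F := L1le_measurable h1.
have e1 : \int[mu2]_z F z = \int[mu2]_z (2^-1 * (F z + F (z.2, z.1))).
  rewrite (RintZ _ (L1leD h1 (L1le_swap h1))) (RintD h1 (L1le_swap h1)) -/F.
  rewrite (_ : \int[mu2]_z F (z.2, z.1) = \int[mu2]_z F z); [by field|exact: Rint_swap].
have [c2 h2] : exists c, forall j, L1le mu2 (fun z => wedge i j z * (f j z.1 - f j z.2) * kern a z) c.
  have [c hc] := choice (fun j => L1le_wedge_form i j (gf j) (f0 j)).
  exists (\sum_(j < N) c j) => j; apply: L1leW (hc j); rewrite (bigD1 j)//= lerDl.
  by apply: sumr_ge0 => k _; exact: L1le_ge0 (hc k).
have hs := L1le_sum (index_enum 'I_N) (P := xpredT) (fun j _ => h2 j).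
have e2 : \sum_(j < N) (\int[mu]_x (m j x * (f j x * u i x)) - \int[mu]_x (m i x * (f j x * u j x))) =
   - \int[mu2]_z (\sum_(j < N) wedge i j z * (f j z.1 - f j z.2) * kern a z).
  rewrite (Rint_sum _ h2) -sumrN; apply: eq_bigr => j _; rewrite (conservation i j (gf j) (f0 j)); ring.
rewrite -/F e1 e2.
have hF := L1leZ 2^-1 (L1leD h1 (L1le_swap h1)).
rewrite (_ : \int[mu2]_z (_ * kern a z) = \int[mu2]_z
  (2^-1 * (F z + F (z.2, z.1)) + \sum_(j < N) wedge i j z * (f j z.1 - f j z.2) * kern a z)).
  by rewrite (RintD hF hs) addrK.
apply: eq_Rint => -[x y] /=; rewrite /F/= -(sqdistC x y) -(kern_sym x y (sol_kernel HS)).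
have -> : \sum_(j < N) wedge i j (x, y) * ((phi x + phi y) / 2 * (u j x - u j y) - (f j x - f j y)) =
  (phi x + phi y) / 2 * (\sum_(j < N) wedge i j (x, y) * (u j x - u j y))
  - \sum_(j < N) wedge i j (x, y) * (f j x - f j y).
  by rewrite mulr_sumr -sumrB; apply: eq_bigr => j _; ring.
by rewrite sum_wedge -mulr_suml; field.
Qed.

End ConservationLaw.

Section Pointwise.
Variable R : realType.

(* Near pairs: the increments of [u] are those of the cut-off functions. *)
Lemma near_pair_le (di dj dp e w t : R) : 0 < t -> `|w| <= `|di| + `|dj| ->
  `|4^-1 * dj ^+ 2 * di * dp| + `|w * e| <=
  dj ^+ 4 + di ^+ 4 + dp ^+ 4 + e ^+ 2 / t + 4 * t * (di ^+ 2 + dj ^+ 2).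
Proof.
move=> t0 /norm_le_sqr w2; have {w2} := le_trans w2 (sqrD2_le _ _); rewrite !sqr_normr => w2.
have cubic : `|4^-1 * dj ^+ 2 * di * dp| <= dj ^+ 4 + di ^+ 4 + dp ^+ 4.
  rewrite -mulrA normrM ger0_norm; last by apply: mulr_ge0; [rewrite invr_ge0|exact: sqr_ge0].
  have := ler_wpM2l (sqr_ge0 dj) (amgm_norm di dp ltr01).
  have := sqr_ge0 (dj ^+ 2 - di ^+ 2); have := sqr_ge0 (dj ^+ 2 - dp ^+ 2).
  have := sqr_ge0 (dj ^+ 2); have := sqr_ge0 (di ^+ 2); have := sqr_ge0 (dp ^+ 2); rewrite divr1 !mul1r; clra.
have := amgm_norm w e t0; have := ler_wpM2l (ltW t0) w2.
by have := mulr_ge0 (ltW t0) (sqr_ge0 di); have := mulr_ge0 (ltW t0) (sqr_ge0 dj); clra.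
Qed.

(* Far pairs: one point carries all of [phi], and the increments are merely bounded. *)
Lemma far_pair_le (di dj p dg e w t : R) : 0 < t -> `|w| <= `|di| + `|dj| ->
  `|dj| <= 2 -> `|dg| <= 4 ->
  `|4^-1 * dj ^+ 2 * di * p| + `|w * (e + p / 2 * (dj - dg))| <=
  e ^+ 2 / t + 8 * t * (di ^+ 2 + dj ^+ 2) + 10 * (p ^+ 2 / t).
Proof.
move=> t0 /norm_le_sqr w2 hj hg; have {w2} := le_trans w2 (sqrD2_le _ _); rewrite !sqr_normr => w2.
have cubic : `|4^-1 * dj ^+ 2 * di * p| <= t * di ^+ 2 + p ^+ 2 / t.
  apply: le_trans (amgm_norm di p t0); rewrite -mulrA normrM ger0_norm; last first.
    by apply: mulr_ge0; [rewrite invr_ge0|exact: sqr_ge0].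
  by have j2 := norm_le_sqr hj; rewrite ler_piMl//; clra.
have far : `|w * (p / 2 * (dj - dg))| <= t * w ^+ 2 + 9 * (p ^+ 2 / t).
  apply: le_trans (amgm_norm w _ t0) _; rewrite lerD2l mulrA; apply: ler_wpM2r; first by rewrite invr_ge0 ltW.
  rewrite (_ : 9 * p ^+ 2 = (3 * `|p|) ^+ 2); last by rewrite exprMn sqr_normr; ring.
  apply: norm_le_sqr; rewrite !normrM (ger0_norm (_ : 0 <= 2^-1)) ?invr_ge0//.
  have := ler_wpM2l (normr_ge0 p) (le_trans (ler_normB dj dg) (lerD hj hg)); clra.
rewrite mulrDr; have := ler_normD (w * e) (w * (p / 2 * (dj - dg))).
have := amgm_norm w e t0; have := ler_wpM2l (ltW t0) w2.
by have := mulr_ge0 (ltW t0) (sqr_ge0 di); have := mulr_ge0 (ltW t0) (sqr_ge0 dj); clra.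
Qed.
End Pointwise.

Section PairEstimate.
Variable R : realType.

Lemma off_support_pair_le (di dj px py f dg w t : R) : 0 < t -> px * py = 0 -> `|w| <= `|di| + `|dj| ->
  `|dj| <= 2 -> `|dg| <= 4 ->
  `|4^-1 * dj ^+ 2 * di * (px - py)| + `|w * ((px + py) / 2 * dj - f)| <=
  t^-1 * ((px + py) / 2 * dg - f) ^+ 2 + 8 * t * (di ^+ 2 + dj ^+ 2) + 10 / t * (px ^+ 2 + py ^+ 2).
Proof.
move=> t0 pxy hw hj hg; have := far_pair_le (px + py) ((px + py) / 2 * dg - f) t0 hw hj hg.
have -> : `|4^-1 * dj ^+ 2 * di * (px - py)| = `|4^-1 * dj ^+ 2 * di * (px + py)|.
  rewrite !(normrM (_ * di)); congr (_ * _); move/eqP: pxy; rewrite mulf_eq0 => /orP[]/eqP->.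
    by rewrite sub0r add0r normrN.
  by rewrite subr0 addr0.
have -> : (px + py) / 2 * dg - f + (px + py) / 2 * (dj - dg) = (px + py) / 2 * dj - f by ring.
have -> : (px + py) ^+ 2 = px ^+ 2 + py ^+ 2 by rewrite sqrrD pxy mul0rn addr0.
by rewrite (mulrC (_ ^+ 2)); clra.
Qed.

Lemma pair_le (c rho t x y uix uiy ujx ujy gix giy gjx gjy px py fx fy w : R) :
  let e := (px + py) / 2 * (gjx - gjy) - (fx - fy) in
  let iV := ind (`|x - c| <= 16 * rho) + ind (`|y - c| <= 16 * rho) : R in
  let fp := (px ^+ 2 + py ^+ 2) * ind (rho <= `|x - y|) in
  0 < rho -> 0 < t -> `|w| <= `|uix - uiy| + `|ujx - ujy| -> `|ujx - ujy| <= 2 -> `|gjx - gjy| <= 4 ->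
  (`|x - c| <= 8 * rho -> `|y - c| <= 8 * rho -> gix - giy = uix - uiy /\ gjx - gjy = ujx - ujy) ->
  (2 * rho < `|x - c| -> px = 0) -> (2 * rho < `|y - c| -> py = 0) ->
  (3 * rho < `|x - c| -> fx = 0) -> (3 * rho < `|y - c| -> fy = 0) ->
  `|4^-1 * (ujx - ujy) ^+ 2 * (uix - uiy) * (px - py)|
   + `|w * ((px + py) / 2 * (ujx - ujy) - (fx - fy))| <=
   (gjx - gjy) ^+ 4 + (gix - giy) ^+ 4 + (px - py) ^+ 4 + t^-1 * e ^+ 2
   + 8 * t * (iV * (uix - uiy) ^+ 2 + iV * (ujx - ujy) ^+ 2) + 10 / t * fp.
Proof.
move=> e iV fp r' t0 hw dj2 dg4 gE hpx hpy hfx hfy.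
have iV0 : 0 <= iV by apply: addr_ge0; exact: ind_ge0.
have fp0 : 0 <= fp by apply: mulr_ge0; [apply: addr_ge0; exact: sqr_ge0|exact: ind_ge0].
have tfp0 : 0 <= 10 / t * fp by rewrite mulr_ge0// divr_ge0// ltW.
have te : 0 <= t^-1 * e ^+ 2 by rewrite mulr_ge0 ?sqr_ge0// invr_ge0 ltW.
have gg0 : 0 <= (gjx - gjy) ^+ 4 + (gix - giy) ^+ 4 + (px - py) ^+ 4 by rewrite !addr_ge0 ?exprn_even_ge0.
have td0 := mulr_ge0 (ltW t0) (addr_ge0 (sqr_ge0 (uix - uiy)) (sqr_ge0 (ujx - ujy))).
have tiV b : 1 <= iV -> b <= t * ((uix - uiy) ^+ 2 + (ujx - ujy) ^+ 2) ->
    b <= t * (iV * (uix - uiy) ^+ 2 + iV * (ujx - ujy) ^+ 2).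
  move=> i1 /le_trans; apply; apply: ler_wpM2l; first exact: ltW.
  by rewrite -mulrDr ler_peMl// addr_ge0 ?sqr_ge0.
have [/andP[hx hy]|nb] := boolP ((`|x - c| <= 8 * rho) && (`|y - c| <= 8 * rho)).
  have [gi gj] := gE hx hy; have i1 : 1 <= iV by rewrite /iV !indT; [rewrite lerDl|clra|clra].
  have := near_pair_le (px - py) e t0 hw; have := tiV _ i1 (lexx _).
  have -> : (px + py) / 2 * (ujx - ujy) - (fx - fy) = e by rewrite /e gj.
  by rewrite gi gj (mulrC (e ^+ 2)); move: td0 tfp0; clra.
have far : 1 <= iV -> px * py = 0 -> rho <= `|x - y| ->
    `|4^-1 * (ujx - ujy) ^+ 2 * (uix - uiy) * (px - py)| + `|w * ((px + py) / 2 * (ujx - ujy) - (fx - fy))| <=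
    t^-1 * e ^+ 2 + 8 * t * (iV * (uix - uiy) ^+ 2 + iV * (ujx - ujy) ^+ 2) + 10 / t * fp.
  move=> i1 pxy xy; rewrite /fp indT// mulr1.
  have := off_support_pair_le (fx - fy) t0 pxy hw dj2 dg4; rewrite -/e.
  by have := tiV _ i1 (lexx _); clra.
have apart x' y' : `|x' - c| <= 3 * rho -> 8 * rho < `|y' - c| -> rho <= `|x' - y'|.
  by have := ler_distD x' y' c; rewrite (distrC y' x'); clra.
have [hx|hx] := leP `|x - c| (3 * rho).
  have hy : 8 * rho < `|y - c| by rewrite ltNge; apply: contraNN nb => ->; rewrite andbT; clra.
  have i1 : 1 <= iV by rewrite /iV (indT (b := `|x - c| <= _)); [rewrite lerDl ind_ge0|clra].
  have pxy : px * py = 0 by rewrite hpy ?mulr0//; clra.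
  by have := far i1 pxy (apart _ _ hx hy); clra.
have [hy|hy] := leP `|y - c| (3 * rho).
  have hx8 : 8 * rho < `|x - c| by rewrite ltNge; apply: contraNN nb => ->; rewrite andTb; clra.
  have i1 : 1 <= iV by rewrite /iV (indT (b := `|y - c| <= _)); [rewrite lerDr ind_ge0|clra].
  have pxy : px * py = 0 by rewrite hpx ?mul0r//; clra.
  by have := apart _ _ hy hx8; rewrite distrC => /(far i1 pxy); clra.
have [px0 py0] : px = 0 /\ py = 0 by split; [apply: hpx; clra|apply: hpy; clra].
have pp0 : px - py = 0 by rewrite px0 py0 subrr.
have -> : (px + py) / 2 * (ujx - ujy) - (fx - fy) = 0 by rewrite px0 py0 hfx// hfy// addr0 !mul0r !subr0.
have iVt0 : 0 <= t * (iV * (uix - uiy) ^+ 2 + iV * (ujx - ujy) ^+ 2).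
  by rewrite mulr_ge0 ?(ltW t0)// addr_ge0// mulr_ge0// sqr_ge0.
by rewrite pp0 in gg0 *; rewrite !mulr0 normr0 addr0; move: gg0; clra.
Qed.

Lemma pair_integral_le (X V t rho eA : R) : 0 < t -> 0 < rho -> 0 <= X ->
  X + X + X + t^-1 * X + 8 * t * (V + V + (V + V)) + 10 / t * (2 * (16 * rho ^+ 2 * eA * (2 / rho)))
  <= 4 * X + X / t + 32 * t * V + 640 * (rho * eA) / t.
Proof.
move=> t0 r0 X0; have -> : 10 / t * (2 * (16 * rho ^+ 2 * eA * (2 / rho))) = 640 * (rho * eA) / t.
  by field; rewrite !lt0r_neq0.
by move: (640 * (rho * eA) / t) => Y; rewrite (mulrC t^-1); clra.
Qed.

End PairEstimate.
(** * Decay of the energy *)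

Section Step.
Variables (R : realType) (N : nat).
Local Notation mu := (@lebesgue_measure R).
Local Notation mu2 := (mu \x mu)%E.
Variables (a : R -> R) (Lam : R) (u m : 'I_N -> R -> R) (x0 r0 : R).
Hypothesis HS : solution a Lam u m x0 r0.

Implicit Types (f phi : R -> R) (c sg : R) (i : 'I_N).

(* The form in which [m] in [L^gam] is used: [B = rho `^ (1 - 1/gam)], [Mg] is [|m|^gam], and [k]
   indexes the height [B / (rho s^k)] at which [m] is truncated. *)
Definition truncation_bound (Mg : R -> R) (s p rho B : R) := forall (k : nat) i x,
  `|m i x| <= B / (rho * s ^+ k) + B * p ^+ k * Mg x.

Lemma geometric_sum_le (q : R) K : 0 <= q -> q < 1 -> \sum_(0 <= k < K) q ^+ k <= (1 - q)^-1.
Proof.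
move=> q0 q1; have q1' : 0 < 1 - q by rewrite subr_gt0.
have h : \sum_(0 <= k < K) q ^+ k * (1 - q) = 1 - q ^+ K.
  elim: K => [|K ih]; first by rewrite big_nil expr0 subrr.
  by rewrite big_nat_recr//= ih exprSr; ring.
rewrite -[leRHS]mul1r ler_pdivlMr// mulr_suml h lerBlDr lerDl; exact: exprn_ge0.
Qed.

Section TruncatedSource.
Variables (Mg : R -> R) (s p rho B G c sg : R).
Hypotheses (hM : truncation_bound Mg s p rho B) (s0 : 0 < s) (s1 : s < 1) (s4 : s ^+ 4 = 2^-1) (p0 : 0 <= p)
  (p1 : p < 1) (rho0 : 0 < rho) (B0 : 0 <= B) (sg0 : 0 < sg) (Mg0 : forall x, 0 <= Mg x) (hG : L1le mu Mg G).

Definition level_majorant (h : R -> R) k x : R :=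
  B / (rho * s ^+ k) * (s ^+ (2 * k) * ind (`|c - x| <= 3 * rho) + (s ^+ (2 * k))^-1 * h x ^+ 2)
  + B * p ^+ k * (6 * Mg x).

Lemma level_height_ge0 k : 0 <= B / (rho * s ^+ k).
Proof. by rewrite divr_ge0// mulr_ge0// ltW// exprn_gt0. Qed.

Lemma level_majorant_ge0 h k x : 0 <= level_majorant h k x.
Proof.
have sk := exprn_ge0 (2 * k) (ltW s0); apply: addr_ge0; last by rewrite !mulr_ge0 ?exprn_ge0.
have ik : 0 <= (s ^+ (2 * k))^-1 by rewrite invr_ge0.
by apply: mulr_ge0; [exact: level_height_ge0|nneg].
Qed.

Lemma L1le_level_majorant h k : L1le mu (fun x => h x ^+ 2) (200 * sg ^+ 2 * dyad rho k.+1) ->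
  L1le mu (level_majorant h k) (B * ((6 + 100 * sg ^+ 2) * s ^+ k + 6 * G * p ^+ k)).
Proof.
move=> h2; have r3 : 0 <= 3 * rho by clra.
have := L1leD (L1leZ (B / (rho * s ^+ k)) (L1leD (L1leZ (s ^+ (2 * k)) (L1le_ball c r3)) (L1leZ (s ^+ (2 * k))^-1 h2)))
   (L1leZ (B * p ^+ k) (L1leZ 6 hG)).
have sk := exprn_gt0 k s0; have s2k := exprn_gt0 (2 * k) s0; have pk := exprn_ge0 k p0.
rewrite !ger0_norm ?level_height_ge0 ?mulr_ge0 ?invr_ge0 ?(ltW s2k)//; apply: L1leW.
have -> : dyad rho k.+1 = rho * (s ^+ k) ^+ 4 / 2.
  by rewrite dyadS /dyad -exprM mulnC exprM s4 exprVn; ring.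
by rewrite mul2n -addnn exprD; apply: eqW; field; rewrite !lt0r_neq0.
Qed.

Lemma level_majorant_ge h i k x : `|c - x| <= 3 * rho -> `|h x| <= 6 -> `|m i x| * `|h x| <= level_majorant h k x.
Proof.
move=> hx h6; have s2k := exprn_gt0 (2 * k) s0; rewrite /level_majorant indT// mulr1.
apply: le_trans (ler_wpM2r (normr_ge0 _) (hM k i x)) _; rewrite mulrDl; apply: lerD.
  apply: ler_wpM2l; first exact: level_height_ge0.
  have := amgm_norm 1 `|h x| s2k; rewrite mul1r normr_id expr1n mulr1 sqr_normr.
  by rewrite (mulrC (h x ^+ 2)).
rewrite -(mulrA (B * p ^+ k)); apply: ler_wpM2l; first by rewrite mulr_ge0// exprn_ge0.
by rewrite mulrC; exact: ler_wpM2r.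
Qed.

Lemma source_paraproduct_le i f (h : nat -> R -> R) K : measurable_fun setT f ->
  (forall x, 3 * rho < `|x - c| -> f x = 0) ->
  (forall x, `|f x| <= 68 * sg * \sum_(0 <= k < K) `|h k x|) ->
  (forall k, [/\ measurable_fun setT (h k), forall x, `|h k x| <= 3 * 2 &
       L1le mu (fun x => h k x ^+ 2) (200 * sg ^+ 2 * dyad rho k.+1)]) ->
  L1le mu (fun x => m i x * f x) (68 * sg * (B * ((6 + 100 * sg ^+ 2) / (1 - s) + 6 * G / (1 - p)))).
Proof.
move=> mf f0 hf hh; have [cm hm] := sol_source HS i; have mm := L1le_measurable hm.
have T k : L1le mu (level_majorant (h k) k) (B * ((6 + 100 * sg ^+ 2) * s ^+ k + 6 * G * p ^+ k)).
  by have [_ _] := hh k; exact: L1le_level_majorant.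
have sT := L1leZ (68 * sg) (@L1le_sum _ _ _ mu _ (index_iota 0 K) xpredT _ _ (fun k _ => T k)).
have sg68 : 0 <= 68 * sg by apply: mulr_ge0 => //; exact: ltW.
apply: L1le_domW sT _ _ _.
- rewrite ger0_norm//; apply: ler_wpM2l => //; rewrite -mulr_sumr; apply: ler_wpM2l => //.
  rewrite big_split/= -!mulr_sumr; apply: lerD; apply: ler_wpM2l.
  + by nneg.
  + by apply: geometric_sum_le => //; exact: ltW.
  + by rewrite mulr_ge0// (L1le_ge0 hG).
  + exact: geometric_sum_le.
- by mes.
move=> x; rewrite normrM; have [hx|hx] := leP `|c - x| (3 * rho); last first.
  by rewrite f0 1?distrC// normr0 mulr0 mulr_ge0// sumr_ge0// => k _; exact: level_majorant_ge0.
apply: le_trans (ler_wpM2l (normr_ge0 _) (hf x)) _; rewrite mulrCA; apply: ler_wpM2l => //.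
rewrite mulr_sumr; apply: ler_sum => k _; apply: level_majorant_ge => //.
by have [_ h6 _] := hh k; have := h6 x; clra.
Qed.

Lemma L1le_source_test i phi M r : measurable_fun setT phi -> 0 <= r -> (forall x, `|phi x| <= M) ->
  (forall x, r < `|x - c| -> phi x = 0) -> L1le mu (fun x => m i x * phi x) (M * (B * (2 * (r / rho) + G))).
Proof.
move=> mp r0' pM phi0; have [cm hm] := sol_source HS i; have mm := L1le_measurable hm.
have M0 : 0 <= M := le_trans (normr_ge0 _) (pM 0); have b0 : 0 <= B / rho by rewrite divr_ge0// ltW.
apply: L1le_domW (L1leZ M (L1leD (L1leZ (B / rho) (L1le_ball c r0')) (L1leZ B hG))) _ _ _ => [||x].
- by rewrite !ger0_norm//; apply: eqW; ring.
- by mes.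
rewrite normrM mulrC; have [hx|hx] := leP `|c - x| r; last first.
  by rewrite phi0 1?distrC// normr0 mul0r mulr_ge0// addr_ge0// mulr_ge0// ind_ge0.
rewrite [ind _]indT// mulr1; have := hM 0%N i x; rewrite !expr0 !mulr1; exact: ler_pM.
Qed.
End TruncatedSource.
Section OneBall.
Variables (c rho V t eA : R) (y0 : R) (i : 'I_N).
Hypotheses (rho0 : 0 < rho) (V0 : 0 < V) (t0 : 0 < t) (hc : `|c - x0| + 16 * rho < r0)
  (hV : forall j, L1le mu2 (fun z => ind (`|z.1 - c| <= 16 * rho) * en (u j) z) V)
  (Ay : annulus c rho y0) (eAV : rho * eA <= V)
  (hA : forall j, L1le mu (fun x => (u j x - u j y0) ^+ 2 / (x - y0) ^+ 2) eA).

Let phi x := eta c rho x * (u i x - u i y0).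
Let g j x := eta c (8 * rho) x * (u j x - u j y0).
Let sg := Num.sqrt (10 ^+ 4 * V).

Lemma sg_sqr : sg ^+ 2 = 10 ^+ 4 * V.
Proof. by rewrite /sg sqr_sqrtr//; apply: mulr_ge0; [exact: exprn_ge0|exact: ltW]. Qed.

Lemma sg_gt0 : 0 < sg.
Proof. by rewrite sqrtr_gt0; apply: mulr_gt0; [exact: exprn_gt0|exact: V0]. Qed.

Lemma cutoff_increment_le2 j s x : `|eta c s x * (u j x - u j y0)| <= 2.
Proof.
rewrite normrM -[leRHS]mul1r; have /andP[e0 e1] := eta_itv c s x.
apply: ler_pM => //; first by rewrite ger0_norm.
by apply: le_trans (ler_normB _ _) _; have := sol_le1 HS j x; have := sol_le1 HS j y0; clra.
Qed.

Lemma measurable_cutoff_increment j s : measurable_fun setT (fun x => eta c s x * (u j x - u j y0)).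
Proof. by have := sol_measurable HS j => ?; have := measurable_eta c s => ?; mes. Qed.

Lemma cutoff_increment_en j s : 0 < s -> rho <= s -> s <= 8 * rho ->
  L1le mu2 (en (fun x => eta c s x * (u j x - u j y0))) (sg ^+ 2).
Proof.
move=> sp rs s8; have mui := sol_measurable HS j.
have hs : L1le mu2 (fun z => ind (`|z.1 - c| <= 2 * s) * en (u j) z) V.
  apply: L1le_subind (hV j) => [|||z]; [by mes|exact: measurable_en|exact: en_ge0|clra].
have y2 : `|y0 - c| <= 2 * s by case/andP: Ay => _ h; clra.
apply: L1leW (L1le_en_cutoff_increment mui (hA j) sp y2 hs).
rewrite sg_sqr; have := ler_wpM2r (L1le_ge0 (hA j)) s8; have := eAV; have := V0.
by rewrite -(mulrA 8) -(mulrA 416); clra.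
Qed.

Lemma cutoff_increment_eq0 j s x : 0 < s -> 2 * s < `|x - c| -> eta c s x * (u j x - u j y0) = 0.
Proof. by move=> s0 h; rewrite eta_eq0 ?mul0r// ltW. Qed.

Lemma cutoff_increment_L2 : L1le mu (fun x => phi x ^+ 2) (16 * rho ^+ 2 * eA).
Proof.
have hv : L1le mu (fun x => ind (`|x - c| <= 2 * rho) * (u i x - u i y0) ^+ 2) ((4 * rho) ^+ 2 * eA).
  apply: (increment_L2_local (sol_measurable HS i) (hA i)) => [||x hx]; [by mes|by clra|].
  by have := ler_distD c x y0; rewrite (distrC c); case/andP: Ay => _; clra.
apply: L1le_domW hv _ _ _ => [||x].
- by apply: eqW; ring.
- by have := measurable_cutoff_increment i rho; rewrite -/phi => ?; mes.
- rewrite ger0_norm ?sqr_ge0// /phi exprMn.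
  have [h|h] := leP `|x - c| (2 * rho); last by rewrite eta_eq0 ?expr0n ?mul0r ?mulr_ge0 ?ind_ge0 ?sqr_ge0// ltW.
  apply: ler_wpM2r; first exact: sqr_ge0.
  by have /andP[e0 e1] := eta_itv c rho x; rewrite indT// expr_le1.
Qed.

Definition pair_bound : R := N%:R * (4 * (10 ^+ 22 * V ^+ 2) + 10 ^+ 22 * V ^+ 2 / t + 32 * t * V
  + 640 * (rho * eA) / t).

Definition pair_majorant (f : R -> R) j (z : R * R) : R :=
  (g j z.1 - g j z.2) ^+ 4 / (z.1 - z.2) ^+ 2 + (g i z.1 - g i z.2) ^+ 4 / (z.1 - z.2) ^+ 2
  + (phi z.1 - phi z.2) ^+ 4 / (z.1 - z.2) ^+ 2 + t^-1 * defect phi (g j) f z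
  + 8 * t * ((ind (`|z.1 - c| <= 16 * rho) + ind (`|z.2 - c| <= 16 * rho)) * (en (u i) z + en (u j) z))
  + 10 / t * ((phi z.1 ^+ 2 + phi z.2 ^+ 2) * Jfar rho z).

Lemma cutoff_L4 j s : 0 < s -> rho <= s -> s <= 8 * rho ->
  L1le mu2 (fun z => (eta c s z.1 * (u j z.1 - u j y0) - eta c s z.2 * (u j z.2 - u j y0)) ^+ 4 / (z.1 - z.2) ^+ 2)
    (10 ^+ 13 * sg ^+ 4 + V ^+ 2).
Proof.
move=> sp rs s8; apply: (increment_L4_le (c := c) (measurable_cutoff_increment j s) (cutoff_increment_le2 j s) rho0
  sg_gt0 _
  (cutoff_increment_en j sp rs s8) (exprn_gt0 2 V0)).
by move=> x hx; apply: cutoff_increment_eq0 => //; clra.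
Qed.

Lemma quartic_const_le : 10 ^+ 13 * sg ^+ 4 + V ^+ 2 <= 10 ^+ 22 * V ^+ 2.
Proof.
have -> : sg ^+ 4 = (10 ^+ 4 * V) ^+ 2 by rewrite -sg_sqr -exprM.
rewrite exprMn mulrA -exprM -exprD -[X in _ + X]mul1r -mulrDl; apply: ler_wpM2r; first exact: sqr_ge0.
rewrite exprSr; have : 1 <= 10 ^+ 21 :> R by apply: exprn_ege1; clra.
by rewrite (_ : (13 + 4 * 2 = 21)%N)//; move: (10 ^+ 21 : R) => X; clra.
Qed.

Lemma L1le_pair_majorant f j : L1le mu2 (defect phi (g j) f) (10 ^+ 13 * sg ^+ 4 + V ^+ 2) ->
  L1le mu2 (pair_majorant f j)
    (4 * (10 ^+ 22 * V ^+ 2) + 10 ^+ 22 * V ^+ 2 / t + 32 * t * V + 640 * (rho * eA) / t).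
Proof.
move=> hd; have r8 : 0 < 8 * rho by clra.
have L4g k : L1le mu2 (fun z => (g k z.1 - g k z.2) ^+ 4 / (z.1 - z.2) ^+ 2) (10 ^+ 22 * V ^+ 2).
  by apply: L1leW quartic_const_le (cutoff_L4 k r8 _ _); clra.
have L4p : L1le mu2 (fun z => (phi z.1 - phi z.2) ^+ 4 / (z.1 - z.2) ^+ 2) (10 ^+ 22 * V ^+ 2).
  by apply: L1leW quartic_const_le (cutoff_L4 i rho0 _ _); clra.
have LF := L1le_kernel_both (measurable_Jfar rho) (Jfar_sym _) (fun x => L1le_Jfar x rho0) cutoff_increment_L2.
have LV k : L1le mu2 (fun z => (ind (`|z.1 - c| <= 16 * rho) + ind (`|z.2 - c| <= 16 * rho)) * en (u k) z) (V + V).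
  apply: eq_L1le (L1leD (hV k) (L1le_swap (hV k))) => -[x y] /=.
  by rewrite (en_swap _ x y) -mulrDl.
have := L1leD (L1leD (L1leD (L1leD (L1leD (L4g j) (L4g i)) L4p) (L1leZ t^-1 (L1leW quartic_const_le hd)))
   (L1leZ (8 * t) (L1leD (LV i) (LV j)))) (L1leZ (10 / t) LF).
have ti : 0 <= t^-1 by rewrite invr_ge0 ltW.
rewrite !ger0_norm ?mulr_ge0 ?(ltW t0)// => H; apply: L1leW (eq_L1le _ H).
  by apply: pair_integral_le => //; exact: L1le_ge0 L4p.
by move=> z; rewrite /pair_majorant -mulrDr.
Qed.

Lemma pair_majorant_ge f j x y : (forall x, 3 * rho < `|x - c| -> f x = 0) ->
  (`|4^-1 * (u j x - u j y) ^+ 2 * (u i x - u i y) * (phi x - phi y)|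
   + `|wedge u i j (x, y) * ((phi x + phi y) / 2 * (u j x - u j y) - (f x - f y))|) / (x - y) ^+ 2
  <= pair_majorant f j (x, y).
Proof.
move=> f3; have phi0 z : 2 * rho < `|z - c| -> phi z = 0 by exact: cutoff_increment_eq0.
apply: le_trans (ler_wpM2r (inv_sqr_ge0 _) (@pair_le R c rho t x y (u i x) (u i y) (u j x) (u j y)
  (g i x) (g i y) (g j x) (g j y) (phi x) (phi y) (f x) (f y) (wedge u i j (x, y)) rho0 t0 _ _ _ _ _ _ _ _)) _ => //.
- exact: wedge_le HS i j x y.
- by apply: le_trans (ler_normB _ _) _; have := lerD (sol_le1 HS j x) (sol_le1 HS j y); clra.
- by apply: le_trans (ler_normB _ _) _;
  have := lerD (cutoff_increment_le2 j (8 * rho) x) (cutoff_increment_le2 j (8 * rho) y); rewrite -!/(g j _); clra.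
- by move=> hx hy; rewrite /g !eta_eq1//; [split; ring|clra..].
- exact: phi0.
- exact: phi0.
- exact: f3.
- exact: f3.
by apply: eqW; rewrite /pair_majorant /defect /Jfar /en/=; ring.
Qed.

Lemma conserved_integrand_le (f : 'I_N -> R -> R) x y : (forall j x, 3 * rho < `|x - c| -> f j x = 0) ->
  `|(4^-1 * sqdist u (x, y) * (u i x - u i y) * (phi x - phi y)
      - \sum_(j < N) wedge u i j (x, y) * ((phi x + phi y) / 2 * (u j x - u j y) - (f j x - f j y))) * kern a (x, y)|
  <= Lam * \sum_(j < N) pair_majorant (f j) j (x, y).
Proof.
move=> f3; have ok := sol_kernel HS; have [_ L1 _ _] := ok.
have /andP[_ k2] := kern_bounds x y ok; rewrite normrM (ger0_norm (kern_ge0 (x, y) ok)).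
apply: le_trans (ler_wpM2l (normr_ge0 _) k2) _; rewrite mulrCA; apply: ler_wpM2l; first by clra.
have -> : 4^-1 * sqdist u (x, y) * (u i x - u i y) * (phi x - phi y) =
   \sum_(j < N) 4^-1 * (u j x - u j y) ^+ 2 * (u i x - u i y) * (phi x - phi y).
  by rewrite /sqdist/= mulr_sumr !mulr_suml.
rewrite -sumrB; apply: le_trans (ler_wpM2r (inv_sqr_ge0 _) (ler_norm_sum _ _ _)) _.
rewrite mulr_suml; apply: ler_sum => j _; apply: le_trans (pair_majorant_ge j x y (f3 j)).
by apply: ler_wpM2r; [exact: inv_sqr_ge0|exact: ler_normB].
Qed.

Lemma ball_estimate : exists (f : 'I_N -> R -> R) (K : 'I_N -> nat) (h : 'I_N -> nat -> R -> R),
  [/\ forall j, admissible (f j), forall j x, 3 * rho < `|x - c| -> f j x = 0,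
    forall j x, `|f j x| <= 68 * sg * \sum_(0 <= k < K j) `|h j k x|,
    forall j k, [/\ measurable_fun setT (h j k), forall x, `|h j k x| <= 3 * 2 &
       L1le mu (fun x => h j k x ^+ 2) (200 * sg ^+ 2 * dyad rho k.+1)] &
    L1le mu2 (fun z => (4^-1 * sqdist u z * (u i z.1 - u i z.2) * (phi z.1 - phi z.2)
      - \sum_(j < N) wedge u i j z * ((phi z.1 + phi z.2) / 2 * (u j z.1 - u j z.2) - (f j z.1 - f j z.2))) * kern a z)
      (Lam * pair_bound)].
Proof.
have r8 : 0 < 8 * rho by clra.
have ep : L1le mu2 (en phi) (sg ^+ 2) by apply: cutoff_increment_en => //; clra.
have eg j : L1le mu2 (en (g j)) (sg ^+ 2) by apply: cutoff_increment_en => //; clra.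
have phi0 x : 2 * rho < `|x - c| -> phi x = 0 by exact: cutoff_increment_eq0.
have g0 j x : 16 * rho < `|x - c| -> g j x = 0 by move=> hx; apply: cutoff_increment_eq0 => //; clra.
have mp : measurable_fun setT phi := measurable_cutoff_increment i rho.
have mg j : measurable_fun setT (g j) := measurable_cutoff_increment j (8 * rho).
have [f hf] := choice (fun j => paraproduct_exists mp (mg j) (cutoff_increment_le2 i rho)
  (cutoff_increment_le2 j (8 * rho)) rho0 sg_gt0 phi0 (g0 j) ep (eg j) (exprn_gt0 2 V0)).
have [K hK] := choice hf; have [h hh] := choice hK.
exists f, K, h; have f3 j x : 3 * rho < `|x - c| -> f j x = 0 by case: (hh j) => _ + _ _ _; exact.
split => //; [by move=> j; case: (hh j)|by move=> j; case: (hh j)|by move=> j; case: (hh j)|].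
have T j : L1le mu2 (pair_majorant (f j) j) _ := L1le_pair_majorant (let: And5 _ _ hd _ _ := hh j in hd).
have ok := sol_kernel HS; have [_ L1 _ _] := ok; have mk := measurable_kern ok.
have mui j : measurable_fun setT (u j) := sol_measurable HS j; have mui_i := mui i.
have mf j : measurable_fun setT (f j) by case: (hh j) => -[].
apply: L1le_domW2 (L1leZ Lam (@L1le_sum _ _ _ mu2 _ (index_enum 'I_N) xpredT _ _ (fun j _ => T j))) _ _ _ => [||x y].
- by rewrite sumr_const card_ord -(mulr_natl _ N) ger0_norm; [exact: lexx|clra].
- have mD := measurable_sqdist mui; apply: measurable_funM => //; apply: measurable_funB; first by mes.
  by apply: measurable_sum => j; have := mui j => ?; have := mf j => ?; rewrite /wedge; mes.
- exact: conserved_integrand_le.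
Qed.
End OneBall.

End Step.

Section Absorption.
Variable R : realType.
Local Notation mu2 := ((@lebesgue_measure R) \x (@lebesgue_measure R))%E.

Lemma Rint_ball_annulus (F : R * R -> R) c s E1 E2 E3 : 0 < s -> (forall z, 0 <= F z) ->
  L1le mu2 (fun z => ind (`|z.1 - c| <= s) * F z) E1 -> L1le mu2 (fun z => ind (annulus c s z.1) * F z) E2 ->
  L1le mu2 (fun z => ind (`|z.1 - c| <= 2 * s) * F z) E3 ->
  \int[mu2]_z (ind (`|z.1 - c| <= s) * F z) + \int[mu2]_z (ind (annulus c s z.1) * F z)
    <= \int[mu2]_z (ind (`|z.1 - c| <= 2 * s) * F z).
Proof.
move=> s0 F0 h1 h2 h3; rewrite -(RintD h1 h2); apply: le_Rint (L1leD h1 h2) h3 _ => z.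
rewrite -mulrDl; apply: ler_wpM2r; first exact: F0.
rewrite /annulus; have [h|h] := leP `|z.1 - c| s; last by rewrite andTb {1}/ind add0r.
by rewrite (indT (b := _ <= 2 * s)) /ind/= ?addr0//; clra.
Qed.

Lemma absorb_annulus (K E A V D : R) : 0 <= K -> E + A <= V -> E <= K * A + D -> E <= (K * V + D) / (1 + K).
Proof.
move=> K0 sum H; have K1 : 0 < 1 + K by clra.
have KA : K * A <= K * (V - E) by apply: ler_wpM2l => //; clra.
by rewrite ler_pdivlMr//; move: H KA; rewrite mulrBr mulrDr mulr1 (mulrC E); clra.
Qed.

End Absorption.

Section StepIneq.
Variables (R : realType) (N : nat).
Local Notation mu := (@lebesgue_measure R).
Local Notation mu2 := (mu \x mu)%E.
Variables (a : R -> R) (Lam : R) (u m : 'I_N -> R -> R) (x0 r0 : R).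
Hypotheses (HS : solution a Lam u m x0 r0) (S1 : forall x, \sum_(i < N) u i x ^+ 2 = 1).
Variables (Mg : R -> R) (s p G : R).
Hypotheses (s0 : 0 < s) (s1 : s < 1) (s4 : s ^+ 4 = 2^-1) (p0 : 0 <= p) (p1 : p < 1)
  (Mg0 : forall x, 0 <= Mg x) (hG : L1le mu Mg G).
Implicit Types (c rho V t B : R).

Definition en_total (z : R * R) : R := \sum_(j < N) en (u j) z.
Definition ball_energy c rho : R := \int[mu2]_z (ind (`|z.1 - c| <= rho) * en_total z).

Lemma en_total_ge0 z : 0 <= en_total z. Proof. by apply: sumr_ge0 => j _; exact: en_ge0. Qed.

Lemma measurable_en_total : measurable_fun setT en_total.
Proof. by apply: measurable_sum => j; apply: measurable_en; exact: sol_measurable HS j. Qed.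

Lemma L1le_en_total : exists E, L1le mu2 (fun z => ind (`|z.1 - x0| < r0) * en_total z) E.
Proof.
have [E hE] := sol_energy HS.
eexists; apply: eq_L1le (L1le_sum (index_enum 'I_N) (P := xpredT) (fun j _ => hE j)) => z.
by rewrite -mulr_sumr.
Qed.

Lemma L1le_en_total_over (b : R -> bool) : measurable_fun setT b -> (forall x, b x -> `|x - x0| < r0) ->
  L1le mu2 (fun z => ind (b z.1) * en_total z) (\int[mu2]_z (ind (b z.1) * en_total z)).
Proof.
move=> mb hb; have [E hE] := L1le_en_total; have me := measurable_en_total.
apply: (@L1le_Rint _ _ _ _ _ E) => [|z]; last by apply: mulr_ge0; [exact: ind_ge0|exact: en_total_ge0].
by apply: L1le_subind hE => // [||z]; [mes|exact: en_total_ge0|exact: hb].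
Qed.

Lemma sum_energy_over (b : R -> bool) : measurable_fun setT b -> (forall x, b x -> `|x - x0| < r0) ->
  \sum_(i < N) energy_over (u i) b = \int[mu2]_z (ind (b z.1) * en_total z).
Proof.
move=> mb hb; have [E hE] := sol_energy HS.
have h i : L1le mu2 (fun z => ind (b z.1) * en (u i) z) E.
  apply: L1le_subind (hE i) => [|||z]; [by mes|exact: measurable_en (sol_measurable HS i)|exact: en_ge0|exact: hb].
by rewrite /energy_over -(Rint_sum _ h); apply: eq_Rint => z; rewrite -mulr_sumr.
Qed.

Lemma ball_sub_ball c rho x : `|c - x0| + rho < r0 -> `|x - c| <= rho -> `|x - x0| < r0.
Proof. by have := ler_distD c x x0; clra. Qed.

Lemma L1le_ball_energy c rho : `|c - x0| + rho < r0 ->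
  L1le mu2 (fun z => ind (`|z.1 - c| <= rho) * en_total z) (ball_energy c rho).
Proof.
by move=> h; apply: (L1le_en_total_over (b := fun x => `|x - c| <= rho)) => [|x]; [mes|exact: ball_sub_ball].
Qed.

Lemma le_ball_energy c c' rho rho' : `|c - c'| + rho <= rho' -> `|c' - x0| + rho' < r0 ->
  ball_energy c rho <= ball_energy c' rho'.
Proof.
move=> h h'; apply: le_Rint (L1le_ball_energy _) (L1le_ball_energy h') _ => [|z].
  by have := ler_distD c' c x0; clra.
apply: ler_wpM2r; first exact: en_total_ge0.
by apply: le_ind => hz; have := ler_distD c z.1 c'; clra.
Qed.

Lemma ball_energy_ge0 c rho : `|c - x0| + rho < r0 -> 0 <= ball_energy c rho.
Proof. by move=> h; exact: L1le_ge0 (L1le_ball_energy h). Qed.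

Definition source_const : R := 68 * 100 * ((6 + 10 ^+ 6) / (1 - s) + 6 * G / (1 - p)).

Definition annulus_energy c rho : R := \int[mu2]_z (ind (annulus c rho z.1) * en_total z).

Lemma annulus_sub c rho x : `|c - x0| + 2 * rho < r0 -> annulus c rho x -> `|x - x0| < r0.
Proof. by move=> h /andP[_]; exact: ball_sub_ball. Qed.

Lemma L1le_annulus_energy c rho : `|c - x0| + 2 * rho < r0 ->
  L1le mu2 (fun z => ind (annulus c rho z.1) * en_total z) (annulus_energy c rho).
Proof.
by move=> h; apply: L1le_en_total_over => [|x]; [exact: measurable_annulus|exact: annulus_sub].
Qed.

Lemma en_le_total j z : en (u j) z <= en_total z.
Proof. by rewrite /en_total (bigD1 j)//= lerDl; apply: sumr_ge0 => k _; exact: en_ge0. Qed.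

Lemma exists_annulus_center c rho : 0 < rho -> `|c - x0| + 2 * rho < r0 ->
  exists y0, annulus c rho y0 /\
    forall j, L1le mu (fun x => (u j x - u j y0) ^+ 2 / (x - y0) ^+ 2) (annulus_energy c rho / rho).
Proof.
move=> rho0 hc.
have [y0 [Ay hy]] := exists_annulus_section rho0 measurable_en_total en_total_ge0 (L1le_annulus_energy hc).
exists y0; split => // j; have muj := sol_measurable HS j; apply: L1le_dom hy => [|x]; first by mes.
by rewrite ger0_norm; [rewrite sqr_distC (sqr_distC x); exact: (en_le_total j (y0, x))|nneg].
Qed.

Section BallStep.
Variables (c rho V t B : R).
Hypotheses (rho0 : 0 < rho) (V0 : 0 < V) (V1 : V <= 1) (t0 : 0 < t) (hc : `|c - x0| + 16 * rho < r0)
  (hM : truncation_bound m Mg s p rho B) (B0 : 0 <= B)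
  (hV : L1le mu2 (fun z => ind (`|z.1 - c| <= 16 * rho) * en_total z) V).
Local Notation nA := (annulus_energy c rho).
Local Notation sg := (Num.sqrt (10 ^+ 4 * V)).
Local Notation pair_const :=
  (N%:R * (4 * (10 ^+ 22 * V ^+ 2) + 10 ^+ 22 * V ^+ 2 / t + 32 * t * V + 640 * nA / t)).

Lemma annulus_energy_le : nA <= V.
Proof.
apply: Rint_le_bound; apply: L1le_subind hV => [|||z /andP[_]].
- by have mA := measurable_annulus c rho; mes.
- exact: measurable_en_total.
- exact: en_total_ge0.
- by clra.
Qed.

Lemma L1le_en_ball j : L1le mu2 (fun z => ind (`|z.1 - c| <= 16 * rho) * en (u j) z) V.
Proof.
apply: L1le_dom hV => [|z]; first by have := measurable_en (sol_measurable HS j) => ?; mes.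
by rewrite ger0_norm; [apply: ler_wpM2l; [exact: ind_ge0|exact: en_le_total]|nneg].
Qed.

Lemma source_paraproduct_const_le :
  68 * sg * (B * ((6 + 100 * sg ^+ 2) / (1 - s) + 6 * G / (1 - p))) <= source_const * B.
Proof.
have [i1 i2] : 0 <= (1 - s)^-1 /\ 0 <= (1 - p)^-1 by rewrite !invr_ge0 !subr_ge0 !ltW.
have G0 := L1le_ge0 hG; have s100 : sg ^+ 2 <= 100 ^+ 2.
  by rewrite (sg_sqr V0) (_ : 100 ^+ 2 = 10 ^+ 4); [rewrite ler_piMr// exprn_ge0|ring].
have sg100 : sg <= 100 by rewrite -(@ler_pXn2r _ 2) ?nnegrE.
rewrite /source_const -[leRHS]mulrA [X in _ <= _ * X]mulrC; apply: ler_pM.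
- by rewrite mulr_ge0.
- by rewrite mulr_ge0// addr_ge0// mulr_ge0// ?addr_ge0 ?mulr_ge0 ?sqr_ge0.
- exact: ler_wpM2l.
- apply: ler_wpM2l => //; rewrite lerD2r; apply: ler_wpM2r => //.
  by rewrite lerD2l (_ : 10 ^+ 6 = 100 * 100 ^+ 2); [exact: ler_wpM2l|ring].
Qed.

Lemma component_form_le i y0 : annulus c rho y0 ->
  (forall j, L1le mu (fun x => (u j x - u j y0) ^+ 2 / (x - y0) ^+ 2) (nA / rho)) ->
  form a (u i) (fun x => eta c rho x * (u i x - u i y0)) <=
    Lam * pair_const + (2 * N%:R * source_const + 8 + 2 * G) * B.
Proof.
move=> Ay hy; have eE : rho * (nA / rho) = nA by rewrite mulrC divfK// lt0r_neq0.
have eAV : rho * (nA / rho) <= V by rewrite eE; exact: annulus_energy_le.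
pose phi x := eta c rho x * (u i x - u i y0).
have gphi : admissible phi.
  split; [exact: measurable_cutoff_increment HS c y0 i rho|by exists 2 => x;
    exact: cutoff_increment_le2 HS c y0 i rho x|].
  by exists (sg ^+ 2); apply: (cutoff_increment_en HS V0 L1le_en_ball Ay eAV hy) => //; clra.
have [f [K [h [Gf f3 fb fh TT]]]] := ball_estimate HS i rho0 V0 t0 hc L1le_en_ball Ay eAV hy.
have out x : r0 <= `|x - x0| -> 3 * rho < `|x - c| by have := ler_distD c x x0; clra.
have ph0 x : 2 * rho < `|x - c| -> phi x = 0 by exact: cutoff_increment_eq0.
have phi0 x : r0 <= `|x - x0| -> phi x = 0 by move=> /out hx; apply: ph0; clra.
have f0 j x : r0 <= `|x - x0| -> f j x = 0 by move=> /out; exact: f3.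
have mt k j l : `|\int[mu]_x (m k x * (f j x * u l x))| <= source_const * B.
  have mfj : measurable_fun setT (f j) by case: (Gf j).
  have mul := sol_measurable HS l; apply: le_trans (normr_Rint_le _) source_paraproduct_const_le.
  apply: (source_paraproduct_le HS (c := c) hM s0 s1 s4 p0 p1 rho0 B0 (sg_gt0 V0) Mg0 hG k _ _ _ (fh j)).
  - by mes.
  - by move=> x hx; rewrite f3// mul0r.
  - by move=> x; apply: le_trans (fb j x); rewrite normrM ler_piMr//; exact: sol_le1 HS _ _.
have mp : `|\int[mu]_x (m i x * phi x)| <= B * (8 + 2 * G).
  have rho2 : 0 <= 2 * rho by clra.
  rewrite (_ : B * (8 + 2 * G) = 2 * (B * (2 * (2 * rho / rho) + G))); last by field; exact: lt0r_neq0.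
  apply: normr_Rint_le; apply: (L1le_source_test HS hM rho0 B0 Mg0 hG i _ rho2 _ ph0); first by case: gphi.
  by move=> x; exact: cutoff_increment_le2 HS c y0 i rho x.
have Q := normr_Rint_le TT; rewrite /pair_bound eE in Q.
have Sm : \sum_(j < N) (\int[mu]_x (m j x * (f j x * u i x)) - \int[mu]_x (m i x * (f j x * u j x))) <=
    N%:R * (2 * (source_const * B)).
  rewrite -[in leRHS](card_ord N) mulrC mulr_natr -sumr_const; apply: ler_sum => j _.
  by have := mt j j i; have := mt i j j; rewrite !ler_norml => /andP[? ?] /andP[? ?]; clra.
rewrite (equation_split HS S1 i gphi phi0 Gf f0) -/phi -addrA.
have -> : (2 * N%:R * source_const + 8 + 2 * G) * B = N%:R * (2 * (source_const * B)) + B * (8 + 2 * G) by ring.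
by apply: lerD (le_trans (ler_norm _) Q) (lerD Sm (le_trans (ler_norm _) mp)).
Qed.

Lemma ball_energy_step : (4 * Lam)^-1 * ball_energy c rho <= Lam * (4 + 192 * N%:R) * nA
    + N%:R * (Lam * pair_const) + N%:R * (2 * N%:R * source_const + 8 + 2 * G) * B.
Proof.
have hc2 : `|c - x0| + 2 * rho < r0 by clra.
have [y0 [Ay hy]] := exists_annulus_center rho0 hc2.
have per i : (4 * Lam)^-1 * energy_over (u i) (fun x => `|x - c| <= rho) <=
    Lam * (4 * energy_over (u i) (annulus c rho) + 192 * nA) +
    (Lam * pair_const + (2 * N%:R * source_const + 8 + 2 * G) * B).
  have h2 : L1le mu2 (fun z => ind (`|z.1 - c| <= 2 * rho) * en (u i) z) V.
    apply: L1le_subind (L1le_en_ball i) => [|||z];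
      [by mes|exact: measurable_en (sol_measurable HS i)|exact: en_ge0|clra].
  have := hole_filling (sol_kernel HS) (sol_measurable HS i) rho0 Ay (hy i) h2.
  have -> : rho * (nA / rho) = nA by rewrite mulrC divfK// lt0r_neq0.
  by rewrite lerBlDl => /le_trans; apply; rewrite lerD2l component_form_le.
have mB : measurable_fun setT (fun x : R => `|x - c| <= rho) by mes.
have hB x : `|x - c| <= rho -> `|x - x0| < r0 by apply: ball_sub_ball; clra.
rewrite /ball_energy -(sum_energy_over mB hB) mulr_sumr; apply: le_trans (ler_sum _ (fun i _ => per i)) _.
rewrite big_split/= sumr_const card_ord -mulr_sumr big_split/= -mulr_sumr sumr_const card_ord.
rewrite (sum_energy_over (measurable_annulus c rho) (fun x => annulus_sub (x := x) hc2)) -/nA.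
by rewrite -(mulr_natr (192 * nA)) -(mulr_natr (_ + _ * B)); apply: eqW; ring.
Qed.

End BallStep.

Lemma ball_energy_annulus c rho : `|c - x0| + 2 * rho < r0 -> 0 < rho ->
  ball_energy c rho + annulus_energy c rho <= ball_energy c (2 * rho).
Proof.
move=> h rho0; have h1 : `|c - x0| + rho < r0 by clra.
exact: Rint_ball_annulus rho0 en_total_ge0 (L1le_ball_energy h1) (L1le_annulus_energy h) (L1le_ball_energy h).
Qed.

Lemma ball_energy_le_annulus : (0 < N)%N -> exists K1 K3 C, [/\ 0 <= K1, 0 < K3, 0 <= C &
  forall c rho B, 0 < rho -> `|c - x0| + 16 * rho < r0 -> truncation_bound m Mg s p rho B -> 0 <= B ->
    let V := ball_energy c (16 * rho) in 0 < V -> V <= 1 ->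
    ball_energy c rho <= K1 * annulus_energy c rho + K3 * V * V + 4^-1 * V + C * B].
Proof.
move=> N0; have [_ L1 _ _] := sol_kernel HS; have Lp : 0 < Lam by clra.
have Np : 0 < N%:R :> R by rewrite ltr0n.
have G0 := L1le_ge0 hG.
pose K2 := 4 * Lam ^+ 2 * N%:R ^+ 2; have K2p : 0 < K2 by rewrite !mulr_gt0 ?exprn_gt0.
pose t := (128 * K2)^-1; have t0 : 0 < t by rewrite invr_gt0 mulr_gt0.
have const0 : 0 <= source_const.
  have [i1 i2] : 0 <= (1 - s)^-1 /\ 0 <= (1 - p)^-1 by rewrite !invr_ge0 !subr_ge0 !ltW.
  by rewrite mulr_ge0// addr_ge0// mulr_ge0// ?addr_ge0 ?mulr_ge0 ?exprn_ge0.
exists (4 * Lam ^+ 2 * (4 + 192 * N%:R) + K2 * 640 / t), (K2 * (10 ^+ 22 * (4 + t^-1))),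
  (4 * Lam * (N%:R * (2 * N%:R * source_const + 8 + 2 * G))); split.
- have LN : 0 <= Lam ^+ 2 * N%:R := mulr_ge0 (sqr_ge0 Lam) (ltW Np).
  by have L2 := sqr_ge0 Lam; have K2t : 0 <= K2 / t := divr_ge0 (ltW K2p) (ltW t0); clra.
- by have K2t : 0 < K2 / t := divr_gt0 K2p t0; rewrite mulrCA pmulr_rgt0 ?exprn_gt0// mulrDr; clra.
- have cN := mulr_ge0 (ltW Np) const0; apply: mulr_ge0; first by clra.
  by apply: mulr_ge0; [exact: ltW|clra].
move=> c rho B rho0 hc hM B0 V V0 V1.
have L4 : 0 < 4 * Lam by rewrite mulr_gt0.
have := ball_energy_step rho0 V0 V1 t0 hc hM B0 (L1le_ball_energy hc).
rewrite mulrC ler_pdivrMr// => /le_trans; apply; apply: eqW.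
have -> : 4^-1 * V = K2 * 32 * t * V by rewrite /t; field; exact: lt0r_neq0.
by rewrite /K2; ring.
Qed.

Lemma hole_filling_contraction (K1 K3 V E1 nA D : R) : 0 <= K1 -> 0 < K3 -> 0 <= D -> 0 <= V -> V <= (4 * K3)^-1 ->
  E1 + nA <= V -> E1 <= K1 * nA + K3 * V * V + 4^-1 * V + D -> E1 <= (K1 + 2^-1) / (1 + K1) * V + D.
Proof.
move=> K1p K3p D0 V0 VK sum H; have K11 : 0 < 1 + K1 by clra.
have small : K3 * V * V <= 4^-1 * V.
  apply: ler_wpM2r => //; apply: le_trans (ler_wpM2l (ltW K3p) VK) _.
  by apply: eqW; field; exact: lt0r_neq0.
have filled : E1 <= K1 * nA + (2^-1 * V + D) by clra.
apply: le_trans (absorb_annulus K1p sum filled) _.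
rewrite (_ : (K1 + 2^-1) / (1 + K1) * V = (K1 * V + 2^-1 * V) / (1 + K1)); last by ring.
by rewrite addrA mulrDl lerD2l ler_pdivrMr// ler_peMr//; clra.
Qed.

Lemma ball_energy_contraction : (0 < N)%N -> exists th e0 C, [/\ 0 <= th, th < 1, 0 < e0, 0 <= C &
  forall c rho B, 0 < rho -> `|c - x0| + 16 * rho < r0 -> truncation_bound m Mg s p rho B -> 0 <= B ->
    ball_energy c (16 * rho) <= e0 -> ball_energy c rho <= th * ball_energy c (16 * rho) + C * B].
Proof.
move=> N0; have [K1 [K3 [C [K1p K3p C0 step]]]] := ball_energy_le_annulus N0.
exists ((K1 + 2^-1) / (1 + K1)), (Num.min 1 (4 * K3)^-1), C; split => //.
- by apply: divr_ge0; clra.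
- by rewrite ltr_pdivrMr; clra.
- by rewrite lt_min ltr01/= invr_gt0 mulr_gt0.
move=> c rho B rho0 hc hM B0; rewrite le_min => /andP[V1 VK].
have hc2 : `|c - x0| + 2 * rho < r0 by clra.
have split := ball_energy_annulus hc2 rho0; have nA0 := L1le_ge0 (L1le_annulus_energy hc2).
have m2 : ball_energy c (2 * rho) <= ball_energy c (16 * rho) by apply: le_ball_energy => //; rewrite subrr normr0;
  clra.
have V0 := ball_energy_ge0 hc; have CB := mulr_ge0 C0 B0.
have [Vp|Vn] := ltP 0 (ball_energy c (16 * rho)); last first.
  have -> : ball_energy c (16 * rho) = 0 by clra.
  by rewrite mulr0 add0r; clra.
apply: hole_filling_contraction (step c rho B rho0 hc hM B0 Vp V1) => //; clra.
Qed.
End StepIneq.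
Section Growth.
Variable R : realType.
Implicit Types (th C bet d b e : R).

Lemma powRM_pos (b x t : R) : 0 < b -> 0 <= x -> (b * x) `^ t = b `^ t * x `^ t.
Proof. by move=> b0 x0; rewrite powRM// ltW. Qed.

Lemma powR_le_exponent (x s t : R) : 0 < x -> x <= 1 -> s <= t -> x `^ t <= x `^ s.
Proof. by move=> x0 x1 st; apply: ger_powR => //; rewrite x0. Qed.

Lemma powR_le_base (x y t : R) : 0 <= x -> x <= y -> 0 <= t -> x `^ t <= y `^ t.
Proof. by move=> x0 xy t0; apply: ge0_ler_powR; rewrite ?nnegrE//; exact: le_trans xy. Qed.

Lemma powR_ge1 (x t : R) : 1 <= x -> 0 <= t -> 1 <= x `^ t.
Proof. by move=> x1 t0; have := powR_le_base ler01 x1 t0; rewrite powR1. Qed.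

Lemma powR_lt1 (x e : R) : 0 < x -> x < 1 -> 0 < e -> x `^ e < 1.
Proof.
move=> x0 x1 e0; have : x `^ e < 1 `^ e by apply: gt0_ltr_powR; rewrite ?nnegrE// ltW.
by rewrite powR1.
Qed.

Lemma powR_half_itv (t : R) : 0 < t -> 0 < 2^-1 `^ t < 1.
Proof. by move=> t0; rewrite powR_gt0 ?invr_gt0//= powR_lt1 ?invr_gt0 ?invf_lt1//; clra. Qed.

Lemma exists_div_exp_lt b d x : 1 < b -> 0 < d -> 0 < x -> exists n, d / b ^+ n < x.
Proof.
move=> b1 d0 x0; have b0 : 0 < b by clra.
have bi : `|b^-1| < 1 by rewrite ger0_norm ?invr_ge0 ?invf_lt1//; exact: ltW.
have /cvgrPdist_lt /(_ (x / d)) := cvg_expr bi.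
rewrite divr_gt0// => /(_ isT) [n _ /(_ n (leqnn n))] /=.
rewrite sub0r normrN ger0_norm ?exprn_ge0 ?invr_ge0 1?ltW// => h.
by exists n; rewrite mulrC -ltr_pdivlMr// -exprVn.
Qed.

Lemma small_exponent th b bet : 0 <= th -> th < 1 -> 1 < b -> 0 < bet ->
  exists tau, [/\ 0 < tau, tau <= bet & th * b `^ tau <= (1 + th) / 2].
Proof.
move=> th0 th1 b1 bet0; have [->|thn] := eqVneq th 0.
  by exists bet; split => //; rewrite mul0r; clra.
have thp : 0 < th by rewrite lt_def thn.
pose y := (1 + th) / (2 * th).
have y1 : 1 < y by rewrite /y ltr_pdivlMr; clra.
have lb : 0 < ln b by rewrite ln_gt0.
have ly : 0 < ln y by rewrite ln_gt0.
exists (Num.min bet (ln y / ln b)); split.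
- by rewrite lt_min bet0 divr_gt0.
- by rewrite ge_min lexx.
- have -> : (1 + th) / 2 = th * y by rewrite /y; field; exact: lt0r_neq0.
  apply: ler_wpM2l => //; apply: (@le_trans _ _ (b `^ (ln y / ln b))).
    by apply: ler_powR; [exact: ltW|rewrite ge_min lexx orbT].
  have b0 : 0 < b by clra.
  rewrite /powR gt_eqF// divfK ?gt_eqF// lnK ?posrE//; clra.
Qed.

Lemma power_decay th C tau d b e0 : 0 <= th -> 0 <= C -> 0 < tau -> 0 < d -> 0 <= e0 -> 1 < b ->
  th * b `^ tau < 1 ->
  exists2 A, 0 < A & forall f : R -> R,
    (forall rho, 0 < rho -> rho <= d -> f rho <= e0) ->
    (forall rho, 0 < rho -> b * rho <= d -> f rho <= th * f (b * rho) + C * rho `^ tau) ->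
    forall rho, 0 < rho -> rho <= d -> f rho <= A * rho `^ tau.
Proof.
move=> th0 C0 t0 d0 e00 b1 ht; have b0 : 0 < b by clra.
pose A := e0 * (b / d) `^ tau + C / (1 - th * b `^ tau) + 1.
have th' : 0 < 1 - th * b `^ tau by clra.
have start_ge0 : 0 <= e0 * (b / d) `^ tau by rewrite mulr_ge0// powR_ge0.
have const_ge0 : 0 <= C / (1 - th * b `^ tau) by rewrite divr_ge0// ltW.
have Ap : 0 < A by rewrite /A; clra.
exists A => // f he hr rho rho0 rhod; have [n] := exists_div_exp_lt b1 d0 rho0.
elim: n rho rho0 rhod => [|n ih] rho r0 rd; first by rewrite expr0 divr1; clra.
  have [hb|hb] := leP (b * rho) d; last first.
    move=> _; apply: le_trans (he _ r0 rd) _.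
    have x1 : 1 <= b * rho / d by rewrite ler_pdivlMr// mul1r ltW.
    have p1 : 1 <= (b * rho / d) `^ tau by apply: powR_ge1 => //; exact: ltW.
    apply: (@le_trans _ _ (e0 * (b / d) `^ tau * rho `^ tau)).
      rewrite -mulrA -powRM; [|by rewrite divr_ge0// ltW|exact: ltW].
      by rewrite (_ : b / d * rho = b * rho / d); [exact: ler_peMr|ring].
    by apply: ler_wpM2r; [exact: powR_ge0|rewrite /A; clra].
  move=> hn; apply: le_trans (hr _ r0 hb) _.
  have br0 : 0 < b * rho by exact: mulr_gt0.
  have hbn : d / b ^+ n < b * rho.
    have bn := exprn_gt0 n b0; move: hn; rewrite exprS !ltr_pdivrMr ?mulr_gt0//.
    by rewrite mulrA (mulrC rho).
  have := ih _ br0 hb hbn; rewrite powRM_pos//; last exact: ltW.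
  move/(ler_wpM2l th0) => h1; apply: le_trans (lerD h1 (lexx _)) _.
  have -> : th * (A * (b `^ tau * rho `^ tau)) + C * rho `^ tau = (A * (th * b `^ tau) + C) * rho `^ tau by ring.
  apply: ler_wpM2r; first exact: powR_ge0.
  have : C <= (1 - th * b `^ tau) * A.
    have -> : C = (1 - th * b `^ tau) * (C / (1 - th * b `^ tau)).
      by rewrite mulrC divfK// lt0r_neq0.
    by apply: ler_wpM2l; [exact: ltW|rewrite /A; clra].
  clra.
Qed.

Lemma power_decay_exists th C bet d b e0 : 0 <= th -> th < 1 -> 0 <= C -> 0 < bet -> 0 < d -> d <= 1 -> 0 <= e0 ->
  1 < b ->
  exists tau A, [/\ 0 < tau, tau <= bet, 0 < A & forall f : R -> R,
    (forall rho, 0 < rho -> rho <= d -> f rho <= e0) ->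
    (forall rho, 0 < rho -> b * rho <= d -> f rho <= th * f (b * rho) + C * rho `^ bet) ->
    forall rho, 0 < rho -> rho <= d -> f rho <= A * rho `^ tau].
Proof.
move=> th0 th1 C0 bet0 d0 d1 e00 b1.
have [tau [t0 tb ht]] := small_exponent th0 th1 b1 bet0.
have ht' : th * b `^ tau < 1 by clra.
have [A A0 H] := power_decay th0 C0 t0 d0 e00 b1 ht'.
exists tau, A; split => // f he hr; apply: H => // rho r0 rd; apply: le_trans (hr _ r0 rd) _.
rewrite lerD2l; apply: ler_wpM2l => //; apply: powR_le_exponent => //.
by apply: le_trans d1; apply: le_trans rd; rewrite ler_peMl//; exact: ltW.
Qed.

Definition clamp (l b x : R) : R := Num.max l (Num.min b x).

Lemma clamp_lipschitz (l b x y : R) : `|clamp l b x - clamp l b y| <= `|x - y|.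
Proof.
have h1 := ler_norm (x - y); have h2 := ler_norm (y - x); rewrite (distrC y x) in h2.
have m : `|Num.min b x - Num.min b y| <= `|x - y|.
  by rewrite /Num.min /Order.min; case: ltP => ?; case: ltP => ?; rewrite ler_norml; apply/andP; split; clra.
apply: le_trans m; rewrite /clamp; move: (Num.min b x) (Num.min b y) => {h1 h2}s t.
have h1 := ler_norm (s - t); have h2 := ler_norm (t - s); rewrite (distrC t s) in h2.
by rewrite /Num.max /Order.max; case: ltP => ?; case: ltP => ?; rewrite ler_norml; apply/andP; split; clra.
Qed.

Lemma clamp_itv (l b x : R) : l <= b -> l <= clamp l b x <= b.
Proof. by move=> lb; rewrite /clamp le_max lexx/= ge_max lb ge_min lexx. Qed.

Lemma clamp_id (l b x : R) : l <= x <= b -> clamp l b x = x.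
Proof. by move=> /andP[lx xb]; rewrite /clamp min_r// max_r. Qed.

Lemma measurable_holder (v : R -> R) C t : 0 < t -> 0 <= C -> (forall x y, `|v x - v y| <= C * `|x - y| `^ t) ->
  measurable_fun setT v.
Proof.
move=> t0 C0 hv; apply: continuous_measurable_fun => x; apply/cvgrPdist_le => e e0.
have C1 : 0 < C + 1 by clra.
pose d := (e / (C + 1)) `^ t^-1; have d0 : 0 < d by apply: powR_gt0; exact: divr_gt0.
near=> y; have hxy : `|x - y| <= d by near: y; apply: cvgr_dist_le.
apply: le_trans (hv x y) _; apply: (@le_trans _ _ ((C + 1) * d `^ t)).
  by apply: ler_pM; rewrite ?powR_ge0//; [clra|apply: powR_le_base => //; exact: ltW].
rewrite /d -powRrM mulVf ?lt0r_neq0// powRr1; last by rewrite divr_ge0// ltW.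
by rewrite mulrC divfK// lt0r_neq0.
Unshelve. all: by end_near. Qed.

Lemma geometric_limit (g : nat -> R) (C q : R) : 0 <= q -> q < 1 -> (forall k, `|g k.+1 - g k| <= C * q ^+ k) ->
  exists l, forall k, `|g k - l| <= C * q ^+ k / (1 - q).
Proof.
move=> q0 q1 hg; have q' : 0 < 1 - q by clra.
have C0 : 0 <= C by have := hg 0%N; rewrite expr0 mulr1; exact: le_trans.
pose e k := C * q ^+ k / (1 - q).
have eS k : e k.+1 = e k - C * q ^+ k.
  by rewrite /e exprS; field; exact: lt0r_neq0.
have mono n k : g k - e k <= g (n + k)%N - e (n + k)%N /\ g (n + k)%N + e (n + k)%N <= g k + e k.
  elim: n => [|n [ih1 ih2]]; first by rewrite add0n.
  by rewrite addSn eS; have := hg (n + k)%N; rewrite ler_norml => /andP[]; clra.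
have e_ge0 k : 0 <= e k by rewrite /e divr_ge0 ?mulr_ge0 ?exprn_ge0// ltW.
have cross j k : g j - e j <= g k + e k.
  have [h|h] := leqP j k.
    by have [] := mono (k - j)%N j; rewrite subnK//; have := e_ge0 k; clra.
  by have [_] := mono (j - k)%N k; rewrite subnK 1?ltnW//; have := e_ge0 j; clra.
pose S := [set y | exists k, y = g k - e k].
have hS : has_sup S.
  split; first by exists (g 0%N - e 0%N), 0%N.
  by exists (g 0%N + e 0%N) => _ [k ->]; exact: cross.
exists (sup S) => k; rewrite -/(e k) ler_norml; apply/andP; split.
  have : sup S <= g k + e k by apply: ge_sup; [case: hS|move=> _ [j ->]; exact: cross].
  clra.
have : g k - e k <= sup S by apply: ub_le_sup; [case: hS|exists k].
clra.
Qed.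

Lemma exists_mul_exp_le (B q e : R) : 0 <= B -> 0 <= q -> q < 1 -> 0 < e ->
  exists n0, forall n, (n0 <= n)%N -> B * q ^+ n <= e.
Proof.
move=> B0 q0 q1 e0; have qq : `|q| < 1 by rewrite ger0_norm.
have eB : 0 < e / (B + 1) by rewrite divr_gt0//; clra.
have /cvgrPdist_lt /(_ _ eB)[n0 _ hn] := cvg_expr qq; exists n0 => n /hn /=.
rewrite sub0r normrN ger0_norm ?exprn_ge0// => h; apply: (@le_trans _ _ (B * (e / (B + 1)))).
  by apply: ler_wpM2l => //; exact: ltW.
by rewrite mulrCA ler_piMr ?(ltW e0)// ler_pdivrMr; clra.
Qed.

Lemma dist_le_of_approx (g1 g2 l1 l2 e D : R) : `|g1 - l1| <= e -> `|g2 - l2| <= e -> `|g1 - g2| <= D ->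
  `|l1 - l2| <= 2 * e + D.
Proof.
move=> h1 h2 h; have -> : l1 - l2 = (l1 - g1) + (g1 - g2) + (g2 - l2) by ring.
by rewrite (le_trans (ler_normD _ _))//; have := ler_normD (l1 - g1) (g1 - g2); rewrite (distrC l1); clra.
Qed.

Lemma geometric_limit_unique (g : nat -> R) (C q l v : R) : 0 <= C -> 0 <= q -> q < 1 ->
  (forall k, `|g k - l| <= C * q ^+ k) -> (forall e, 0 < e -> exists k0, forall k, (k0 <= k)%N -> `|g k - v| <= e) ->
  l = v.
Proof.
move=> C0 q0 q1 hl hv; apply/eqP; rewrite -subr_eq0 -normr_le0; apply/ler_addgt0Pl => e e0; rewrite addr0.
have e2 : 0 < e / 2 by clra.
have [k0 h0] := hv _ e2; have [k1 h1] := exists_mul_exp_le C0 q0 q1 e2; pose k := maxn k0 k1.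
have := h0 k (leq_maxl _ _); have := h1 k (leq_maxr _ _); have := hl k; have := ler_distD (g k) l v.
by rewrite (distrC l (g k)); clra.
Qed.
End Growth.

Section AvgAe.
Variable R : realType.
Local Notation mu := (@lebesgue_measure R).
Local Notation mu2 := (mu \x mu)%E.

Lemma avg_cvg_ae (w : R -> R) (M d : R) : measurable_fun setT w -> (forall x, `|w x| <= M) -> 0 < d ->
  {ae mu, forall x, forall e, 0 < e -> exists k0, forall k, (k0 <= k)%N -> `|avg (dyad d k) w x - w x| <= e}.
Proof.
move=> mw wM d0; have M0 : 0 <= M := le_trans (normr_ge0 _) (wM 0).
have li : locally_integrable setT w.
  split => //; first exact: openT.
  move=> K _ cK; have mK : measurable K := compact_measurable cK.
  apply: (@le_lt_trans _ _ (\int[mu]_(x in K) M%:E)%E).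
    apply: ge0_le_integral => //.
    - by apply/measurable_EFinP; apply: measurableT_comp => //; apply: measurable_funTS.
    - by move=> x _; rewrite lee_fin.
  by rewrite integral_cst// lte_mul_pinfty//; exact: compact_finite_measure.
apply: (ae_imp _ (lebesgue_differentiation li)) => x hx e e0.
have e3 : 0 < e / 3 by clra.
have [rr rrp hr] : exists2 r, 0 < r & forall t, 0 < t -> t < r -> (davg w x t <= (e / 3)%:E)%E.
  have /fine_cvgP[hfin /cvgrPdist_le/(_ _ e3) hd] := hx.
  have [r r0 H] := filterI hfin hd; exists r => // t t0 tr.
  have [] := H t _ _ => //=; first by rewrite sub0r normrN ger0_norm// ltW.
  move=> h1 h2; rewrite -(fineK h1) lee_fin; move: h2; rewrite sub0r normrN; exact: le_trans (ler_norm _).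
have r3 : 0 < rr / 3 by clra.
have [k0 hk] := dyad_small d0 r3; exists k0 => k k0k.
have dk := dyad_gt0 k d0; have lk := hk _ k0k.
set t := dyad d k in dk lk *.
have t3 : 0 < 3 * t by clra.
have := hr _ t3 _; rewrite /davg /iavg (lebesgue_measure_ball _ (ltW t3)).
rewrite inver mulrn_eq0/= gt_eqF// lee_pdivrMl ?mulrn_wgt0// -EFinM => H.
have mc : measurable_fun setT (fun z => w z - w x) by mes.
have D : L1le mu (fun z => ind (`|z - x| <= 2 * t) * `|w z - w x|) ((3 * t) *+ 2 * (e / 3)).
  split; first by mes.
  apply: le_trans (H _); last by clra.
  rewrite [leRHS]integral_mkcond; apply: ge0_le_integral => //.
  - by apply: measurable_EFin_norm; mes.
  - apply/(measurable_restrictT _ (measurable_ball x (3 * t))).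
    by apply: measurable_funTS; apply: measurable_EFin_norm; exact: mc.
  - move=> z _; rewrite patchE normrM normr_id.
    have [h|h] := leP `|z - x| (2 * t); last first.
      by rewrite /ind normr0 mul0r; case: ifP => // _; rewrite lee_fin.
    rewrite mem_set; last by rewrite /= -ball_normE /ball_/= distrC; clra.
    by rewrite /ind normr1 mul1r.
apply: le_trans (avg_sub_le mw wM dk D) _.
by rewrite ler_pdivrMr; [rewrite mulr2n; clra|clra].
Qed.

Section DyadicAverages.
Variables (w : R -> R) (M d S q x : R).
Hypotheses (mw : measurable_fun setT w) (wM : forall x, `|w x| <= M) (d0 : 0 < d) (S0 : 0 <= S) (q0 : 0 <= q)
  (hE : forall k, L1le mu2 (fun z => ind (`|z.1 - x| <= 3 * dyad d k) * en w z) ((S * q ^+ k) ^+ 2)).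

Lemma avg_dyadic_oscillation k : `|avg (dyad d k) w x - avg (dyad d k.+1) w x| <= 18 * (S * q ^+ k) /\
  forall y, `|x - y| <= dyad d k -> `|avg (dyad d k) w x - avg (dyad d k) w y| <= 6 * (S * q ^+ k).
Proof.
have dk := dyad_gt0 k d0; have Sq : 0 <= S * q ^+ k by rewrite mulr_ge0// exprn_ge0.
have [h1 h2] := avg_oscillation mw wM dk Sq (hE k); rewrite dyadS; split=> // y hy.
apply: le_trans (h2 y hy) _; apply: ler_piMr; last by rewrite ler_pdivrMr// mul1r.
exact: mulr_ge0.
Qed.

Lemma exists_avg_limit : q < 1 -> exists l, forall k, `|avg (dyad d k) w x - l| <= 18 * S / (1 - q) * q ^+ k.
Proof.
move=> q1; have [k|l hl] := geometric_limit (g := fun k => avg (dyad d k) w x) (C := 18 * S) q0 q1.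
  by have [h _] := avg_dyadic_oscillation k; rewrite distrC -mulrA.
by exists l => k; rewrite mulrAC.
Qed.

End DyadicAverages.
End AvgAe.

Section Decay.
Variables (R : realType) (N : nat).
Local Notation mu := (@lebesgue_measure R).
Local Notation mu2 := (mu \x mu)%E.
Variables (a : R -> R) (Lam : R) (u m : 'I_N -> R -> R) (x0 r0 : R).
Hypotheses (HS : solution a Lam u m x0 r0).
Implicit Types (c rho : R).

Lemma L1le_truncate (H : R * R -> R) E e : (forall z, 0 <= H z) -> L1le mu2 H E -> 0 < e ->
  exists (n : nat) F, [/\ L1le mu2 F e, forall z, 0 <= F z & forall z, H z <= F z + n%:R * ind (`|0 - z.2| <= n%:R)].
Proof.
move=> H0 hH e0; have mH := L1le_measurable hH.
pose small (n : R) z : R := ind (H z <= n) * ind (`|0 - z.2| <= n).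
have small_itv n z : 0 <= small n z <= 1.
  rewrite mulr_ge0 ?ind_ge0//= -[leRHS]mulr1; apply: ler_pM; rewrite ?ind_ge0 ?ind_le1//.
pose F (n : nat) z := H z * (1 - small n%:R z).
have F0 n z : 0 <= F n z by rewrite mulr_ge0// subr_ge0; case/andP: (small_itv n%:R z).
have [||z|n0 hn] := @L1le_cvg0 _ _ _ mu2 F H E e _ _ hH _ e0.
- by move=> n; rewrite /F /small; mes.
- move=> n z; have /andP[s0 _] := small_itv n%:R z.
  by rewrite ger0_norm// ler_piMr// gerBl.
- apply/cvgrPdist_le => t t0.
  pose k := Num.trunc (Num.max (H z) `|z.2|); exists k.+1 => // n /= kn.
  have hk : Num.max (H z) `|z.2| <= n%:R.
    by apply: (@le_trans _ _ k.+1%:R); [rewrite ltW// /k truncnS_gt|rewrite ler_nat].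
  move: hk; rewrite ge_max => /andP[h1 h2].
  by rewrite /F /small h1 !sub0r !normrN h2 /ind mulr1 subrr mulr0 normr0 ltW.
exists n0, (F n0); split=> [||z]; [exact: hn|exact: F0|].
have Fz := F0 n0 z; have ind0 := ind_ge0 R (`|0 - z.2| <= n0%:R).
rewrite /F /small; have [h1|h1] := leP (H z) n0%:R; last first.
  by rewrite [ind false]/ind mul0r subr0 mulr1 lerDl mulr_ge0.
by rewrite [ind true]/ind mul1r /ind; case: ifP => _; rewrite ?subrr ?subr0 ?mulr0 ?mulr1 ?addr0 ?add0r.
Qed.

Lemma ball_energy_small e : 0 < e -> exists2 d, 0 < d & forall c rho, 0 <= rho -> rho <= d -> `|c - x0| + rho < r0 ->
  ball_energy u c rho <= e.
Proof.
move=> e0; have [E hE] := L1le_en_total HS; have e2 : 0 < e / 2 by clra.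
have H0 z : 0 <= ind (`|z.1 - x0| < r0) * en_total u z by rewrite mulr_ge0 ?ind_ge0 ?en_total_ge0.
have [n0 [F [hF F0 hH]]] := L1le_truncate H0 hE e2; have n_ge0 : 0 <= n0%:R :> R by exact: ler0n.
pose d := e / (8 * (n0%:R + 1) ^+ 2).
have D0 : 0 < 8 * (n0%:R + 1) ^+ 2 :> R by apply: mulr_gt0 => //; apply: exprn_gt0; clra.
exists d; first exact: divr_gt0.
move=> c rho rho0 rd hc.
have hJ (x : R) : L1le mu (fun y => ind (`|0 - (x, y).2| <= n0%:R)) (2 * n0%:R) by exact: L1le_ball.
have hi : L1le mu (fun x => ind (`|c - x| <= rho)) (2 * rho) by exact: L1le_ball.
have mJ : measurable_fun setT (fun z : R * R => ind (`|0 - z.2| <= n0%:R) : R) by mes.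
have T := L1leD hF (L1leZ n0%:R (L1le_kernel_fst mJ hJ hi)).
apply: (@le_trans _ _ (e / 2 + `|n0%:R| * (2 * rho * (2 * n0%:R)))).
  apply: le_trans (Rint_le_bound T); apply: le_Rint (L1le_ball_energy HS hc) T _ => z.
  rewrite (distrC c); have [h|h] := leP `|z.1 - c| rho; last first.
    by rewrite [ind false]/ind !mul0r mulr0 addr0.
  by have := hH z; rewrite [ind (_ < r0)]indT ?[ind true]/ind ?mul1r//; exact: ball_sub_ball hc h.
rewrite ger0_norm//.
have : (n0%:R + 1) ^+ 2 * rho <= (n0%:R + 1) ^+ 2 * d by apply: ler_wpM2l => //; exact: sqr_ge0.
have -> : (n0%:R + 1) ^+ 2 * d = e / 8 by rewrite /d; field; rewrite lt0r_neq0//; clra.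
have : 0 <= n0%:R * rho by exact: mulr_ge0.
by move: rho0; clra.
Qed.

Hypothesis (S1 : forall x, \sum_(i < N) u i x ^+ 2 = 1) (N0 : (0 < N)%N).
Variables (Mg : R -> R) (s p G bet r1 : R).
Hypotheses (s0 : 0 < s) (s1 : s < 1) (s4 : s ^+ 4 = 2^-1) (p0 : 0 <= p) (p1 : p < 1)
  (Mg0 : forall x, 0 <= Mg x) (hG : L1le mu Mg G) (bet0 : 0 < bet) (r1r0 : r1 < r0)
  (hM : forall rho, 0 < rho -> truncation_bound m Mg s p rho (rho `^ bet)).

Lemma ball_energy_decay : exists tau A d, [/\ 0 < tau, tau <= bet, 0 < A, 0 < d <= 1 &
  forall c rho, `|c - x0| <= r1 -> 0 < rho -> rho <= d ->
    `|c - x0| + rho < r0 /\ ball_energy u c rho <= A * rho `^ tau].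
Proof.
have [th [e0 [C [th0 th1 e00 C0 H]]]] := ball_energy_contraction HS S1 s0 s1 s4 p0 p1 Mg0 hG N0.
have [d1 d10 h1] := ball_energy_small e00.
pose d := Num.min (Num.min d1 1) ((r0 - r1) / 2).
have d0 : 0 < d by rewrite !lt_min d10 ltr01/=; clra.
have dd1 : d <= d1 by rewrite !ge_min lexx.
have d1' : d <= 1 by rewrite !ge_min lexx !orbT.
have dr : d <= (r0 - r1) / 2 by rewrite ge_min lexx orbT.
have b1 : (1 : R) < 16 by clra.
have [tau [A [t0 tb A0 HA]]] := power_decay_exists th0 th1 C0 bet0 d0 d1' (ltW e00) b1.
exists tau, A, d; split; rewrite ?d0 ?d1'//.
move=> c rho hc rho0 rd; have hin : `|c - x0| + rho < r0 by clra.
split => //; apply: HA => // t tp td.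
  by apply: h1; [exact: ltW|clra|clra].
have e16 : ball_energy u c (16 * t) <= e0 by apply: h1; clra.
by apply: H => //; [clra|exact: hM|exact: powR_ge0].
Qed.

End Decay.

Section HolderRep.
Variable R : realType.
Local Notation mu := (@lebesgue_measure R).
Local Notation mu2 := (mu \x mu)%E.
Variables (w : R -> R) (M A d tau x0 r1 : R).
Hypotheses (mw : measurable_fun setT w) (wM : forall x, `|w x| <= M) (A0 : 0 < A) (d0 : 0 < d) (t0 : 0 < tau)
  (r10 : 0 < r1) (hE : forall c rho, `|c - x0| <= r1 -> 0 < rho -> rho <= d ->
    L1le mu2 (fun z => ind (`|z.1 - c| <= rho) * en w z) (A * rho `^ tau)).
Let scale k := dyad (d / 3) k.
Let q : R := 2^-1 `^ (tau / 2).
Let S := Num.sqrt (A * d `^ tau).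
Let K := 18 * S / (1 - q).

Lemma third_gt0 : 0 < d / 3. Proof. by clra. Qed.

Lemma scale_gt0 k : 0 < scale k. Proof. exact: dyad_gt0 third_gt0. Qed.

Lemma ratio_gt0 : 0 < q. Proof. by have /powR_half_itv/andP[] : 0 < tau / 2 by clra. Qed.

Lemma ratio_lt1 : q < 1. Proof. by have /powR_half_itv/andP[] : 0 < tau / 2 by clra. Qed.

Lemma amplitude_gt0 : 0 < S. Proof. by rewrite sqrtr_gt0 mulr_gt0// powR_gt0. Qed.

Lemma limit_rate_gt0 : 0 < K.
Proof. by rewrite divr_gt0 ?mulr_gt0 ?amplitude_gt0// subr_gt0 ratio_lt1. Qed.

Lemma bound_ge0 : 0 <= M. Proof. exact: le_trans (normr_ge0 _) (wM 0). Qed.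

Lemma ratio_expr k : q ^+ k = (2^-1 ^+ k) `^ (tau / 2).
Proof.
have h2 : 0 <= 2^-1 :> R by rewrite invr_ge0.
by rewrite /q -(powR_mulrn k (powR_ge0 _ _)) -(powR_mulrn k h2) powRAC.
Qed.

Lemma amplitude_sqr k : (S * q ^+ k) ^+ 2 = A * (3 * scale k) `^ tau.
Proof.
have Ad : 0 < A * d `^ tau by rewrite mulr_gt0// powR_gt0.
rewrite exprMn sqr_sqrtr ?ltW// /scale /dyad (_ : 3 * (d / 3 / 2 ^+ k) = 2^-1 ^+ k * d); last first.
  have h2 : 2 ^+ k != 0 :> R by rewrite expf_neq0.
  by rewrite exprVn; move: (2 ^+ k : R) h2 => X h2; field.
rewrite powRM ?exprn_ge0 ?invr_ge0 ?ltW// ratio_expr -(powR_mulrn 2) ?powR_ge0// -powRrM.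
by rewrite divfK//; ring.
Qed.

Lemma L1le_en_scale x k : `|x - x0| <= r1 ->
  L1le mu2 (fun z => ind (`|z.1 - x| <= 3 * scale k) * en w z) ((S * q ^+ k) ^+ 2).
Proof.
move=> hx; rewrite amplitude_sqr; apply: hE => //; first by have := scale_gt0 k; clra.
by have := dyad_le k third_gt0; rewrite -/(scale k); clra.
Qed.

Lemma exists_avg_limits : exists v, forall x k, `|x - x0| <= r1 -> `|avg (scale k) w x - v x| <= K * q ^+ k.
Proof.
suff lim x : exists l, `|x - x0| <= r1 -> forall k, `|avg (scale k) w x - l| <= K * q ^+ k.
  by have [v hv] := choice lim; exists v => x k /hv.
have [hx|hx] := leP `|x - x0| r1; last by exists 0.
have [l hl] := exists_avg_limit mw wM third_gt0 (ltW amplitude_gt0) (ltW ratio_gt0) (fun k => L1le_en_scale k hx)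
  ratio_lt1.
by exists l.
Qed.

Section Limit.
Variable v : R -> R.
Hypothesis hv : forall x k, `|x - x0| <= r1 -> `|avg (scale k) w x - v x| <= K * q ^+ k.
Let C1 := (2 * K + 6 * S) * (6 / d) `^ (tau / 2).
Let C2 := (2 * K + 4 * M) * (3 / d) `^ (tau / 2).

Lemma limit_dist_le k x y (D : R) : `|x - x0| <= r1 -> `|y - x0| <= r1 ->
  `|avg (scale k) w x - avg (scale k) w y| <= D -> `|v x - v y| <= 2 * (K * q ^+ k) + D.
Proof. by move=> hx hy; exact: dist_le_of_approx (hv k hx) (hv k hy). Qed.

Lemma limit_holder_far x y : `|x - x0| <= r1 -> `|y - x0| <= r1 -> d / 3 < `|x - y| ->
  `|v x - v y| <= C2 * `|x - y| `^ (tau / 2).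
Proof.
move=> hx hy hd; have M0 := bound_ge0; have K0 := limit_rate_gt0.
have far : `|v x - v y| <= 2 * K + 4 * M.
  rewrite -[K]mulr1; apply: (@limit_dist_le 0 x y) => //.
  have b1 := avg_le mw wM (scale_gt0 0) x; have b2 := avg_le mw wM (scale_gt0 0) y.
  by apply: le_trans (ler_normB _ _) _; clra.
apply: le_trans far _; rewrite /C2 -mulrA -powRM//; last by rewrite divr_ge0// ltW.
apply: ler_peMr; first by clra.
by apply: powR_ge1; [rewrite mulrAC ler_pdivlMr//; clra|clra].
Qed.

Lemma limit_holder_near x y : `|x - x0| <= r1 -> `|y - x0| <= r1 -> x != y -> `|x - y| <= d / 3 ->
  `|v x - v y| <= C1 * `|x - y| `^ (tau / 2).
Proof.
move=> hx hy xy hd; have l0 : 0 < `|x - y| by rewrite normr_gt0 subr_eq0.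
have S0 := amplitude_gt0; have K0 := limit_rate_gt0; have q0 := ratio_gt0.
have [n0 hn0] := dyad_small third_gt0 l0.
have exP : exists k, scale k < `|x - y| by exists n0; apply: hn0.
case: (ex_minnP exP) => -[|k] Pk mink; first by move: Pk; rewrite /scale dyad0; clra.
have hk : `|x - y| <= scale k by rewrite leNgt; apply/negP => /mink; rewrite ltnn.
have [_ osc] := avg_dyadic_oscillation mw wM third_gt0 (ltW S0) (ltW q0) (fun k => L1le_en_scale k hx) k.
have near : `|v x - v y| <= (2 * K + 6 * S) * q ^+ k.
  by apply: le_trans (limit_dist_le hx hy (osc y hk)) _; apply: eqW; ring.
apply: le_trans near _; rewrite /C1 -mulrA -powRM ?normr_ge0//; last by rewrite divr_ge0// ltW.
apply: ler_wpM2l; first by clra.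
rewrite ratio_expr; apply: powR_le_base; [by rewrite exprn_ge0// invr_ge0| |clra].
move: Pk; rewrite /scale dyadS /dyad -exprVn => Pk.
by rewrite mulrAC ler_pdivlMr//; clra.
Qed.

Lemma limit_holder x y : `|x - x0| <= r1 -> `|y - x0| <= r1 -> `|v x - v y| <= (C1 + C2) * `|x - y| `^ (tau / 2).
Proof.
move=> hx hy; have C10 : 0 <= C1 by rewrite mulr_ge0 ?powR_ge0//; have := limit_rate_gt0; have := amplitude_gt0; clra.
have C20 : 0 <= C2 by rewrite mulr_ge0 ?powR_ge0//; have := limit_rate_gt0; have := bound_ge0; clra.
have p0 := powR_ge0 `|x - y| (tau / 2); have P1 := mulr_ge0 C10 p0; have P2 := mulr_ge0 C20 p0.
rewrite mulrDl; have [->|xy] := eqVneq x y; first by rewrite !subrr !normr0 addr_ge0// mulr_ge0// powR_ge0.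
have [hd|hd] := leP `|x - y| (d / 3).
  by apply: le_trans (limit_holder_near hx hy xy hd) _; rewrite lerDl.
by apply: le_trans (limit_holder_far hx hy hd) _; rewrite lerDr.
Qed.

Lemma limit_eq x : `|x - x0| <= r1 ->
  (forall e, 0 < e -> exists k0, forall k, (k0 <= k)%N -> `|avg (scale k) w x - w x| <= e) -> v x = w x.
Proof.
move=> hx; exact: (geometric_limit_unique (ltW limit_rate_gt0) (ltW ratio_gt0) ratio_lt1 (fun k => hv k hx)).
Qed.
End Limit.

(* Outside the ball the representative is [w] itself; inside, clamping the argument and the values keeps the limit
   measurable and bounded by [M]. *)
Lemma holder_representative : exists v : R -> R, [/\ measurable_fun setT v, forall x, `|v x| <= M,
    {ae mu, forall x, w x = v x} &
    exists C, forall x y, `|x - x0| <= r1 -> `|y - x0| <= r1 -> `|v x - v y| <= C * `|x - y| `^ (tau / 2)].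
Proof.
have [v0 hv] := exists_avg_limits; have [C Hol] : exists C, forall x y, `|x - x0| <= r1 -> `|y - x0| <= r1 ->
    `|v0 x - v0 y| <= C * `|x - y| `^ (tau / 2) by eexists; exact: limit_holder hv.
pose arg := clamp (x0 - r1) (x0 + r1); pose val := clamp (- M) M.
have argb x : `|arg x - x0| <= r1.
  by rewrite ler_distl; apply: clamp_itv; clra.
have argid x : `|x - x0| <= r1 -> arg x = x by rewrite ler_distl; exact: clamp_id.
have valb y : `|val y| <= M by rewrite ler_norml; apply: clamp_itv; have := bound_ge0; clra.
have valid y : `|y| <= M -> val y = y by rewrite ler_norml; exact: clamp_id.
have tau2 : 0 < tau / 2 by clra.
have mv0 : measurable_fun setT (fun x => v0 (arg x)).
  apply: (measurable_holder tau2 (normr_ge0 C)) => x y.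
  apply: le_trans (Hol _ _ (argb x) (argb y)) _; apply: le_trans (ler_wpM2r (powR_ge0 _ _) (ler_norm C)) _.
  by apply: ler_wpM2l => //; apply: powR_le_base; [|exact: clamp_lipschitz|exact: ltW].
exists (fun x => if `|x - x0| <= r1 then val (v0 (arg x)) else w x); split.
- by apply: measurable_fun_ifT => //; [mes|rewrite /val /clamp; mes].
- by move=> x; case: ifP.
- apply: (ae_imp _ (avg_cvg_ae mw wM third_gt0)) => x hx; case: ifPn => // hb; rewrite argid//.
  by rewrite (limit_eq hv hb hx) valid.
- exists C => x y hx hy; rewrite hx hy !argid//.
  exact: le_trans (clamp_lipschitz _ _ _ _) (Hol _ _ hx hy).
Qed.

End HolderRep.
(** * Localization, linear theory and bootstrap *)

Section Spline.
Variable R : realType.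
Local Notation mu := (@lebesgue_measure R).
Local Notation mu2 := (mu \x mu)%E.

Definition clamp01 : R -> R := clamp 0 1.
Definition smoothstep (t : R) : R := clamp01 t ^+ 2 / 2 + clamp01 (t - 1) - clamp01 (t - 1) ^+ 2 / 2.
Definition sqpos (t : R) : R := Num.max 0 t ^+ 2.

Lemma maxE s : Num.max 0 s = if s <= 0 then 0 else s :> R.
Proof. by rewrite /Num.max /Order.max ltNge; case: (s <= 0). Qed.

Lemma smoothstepE t : smoothstep t = (sqpos t - 2 * sqpos (t - 1) + sqpos (t - 2)) / 2.
Proof.
rewrite /smoothstep /sqpos /clamp01 /clamp.
case: (clamp_cases t) => -[h1 ->]; case: (clamp_cases (t - 1)) => -[h2 ->];
rewrite !maxE; (case: ifPn => g1; case: ifPn => g2; case: ifPn => g3); rewrite ?expr0n ?expr1n/=;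
try (by field); try (exfalso; clra); try cnra.
Qed.

Lemma sqpos_second_diff t h : `|sqpos (t + h) + sqpos (t - h) - 2 * sqpos t| <= 2 * h ^+ 2.
Proof.
rewrite /sqpos !maxE; case: ifPn => h1; case: ifPn => h2; case: ifPn => h3;
rewrite ?expr0n/= ler_norml; apply/andP; split; cnra.
Qed.

Lemma smoothstep_second_diff t h : `|smoothstep (t + h) + smoothstep (t - h) - 2 * smoothstep t| <= 4 * h ^+ 2.
Proof.
have -> : smoothstep (t + h) + smoothstep (t - h) - 2 * smoothstep t =
  ((sqpos (t + h) + sqpos (t - h) - 2 * sqpos t) - 2 * (sqpos (t - 1 + h) + sqpos (t - 1 - h) - 2 * sqpos (t - 1))
   + (sqpos (t - 2 + h) + sqpos (t - 2 - h) - 2 * sqpos (t - 2))) / 2.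
  by rewrite !smoothstepE (addrAC t h (-1)) (addrAC t (-h) (-1)) (addrAC t h (-2)) (addrAC t (-h) (-2)); field.
have := sqpos_second_diff t h; rewrite ler_norml => /andP[a1 a2].
have := sqpos_second_diff (t - 1) h; rewrite ler_norml => /andP[b1 b2].
have := sqpos_second_diff (t - 2) h; rewrite ler_norml => /andP[c1 c2].
by rewrite ler_norml; apply/andP; split; clra.
Qed.

Lemma clamp01_itv t : 0 <= clamp01 t <= 1. Proof. exact: clamp_itv. Qed.
Lemma smoothstep_lipschitz t s : `|smoothstep t - smoothstep s| <= 2 * `|t - s|.
Proof.
have h1 := clamp_lipschitz 0 1 t s; have h2 := clamp_lipschitz 0 1 (t - 1) (s - 1).
rewrite (_ : t - 1 - (s - 1) = t - s) in h2; last by ring.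
have := clamp01_itv t; have := clamp01_itv s; have := clamp01_itv (t - 1); have := clamp01_itv (s - 1).
rewrite /smoothstep; rewrite -!/(clamp01 _) in h1 h2; move: h1 h2.
move: (clamp01 t) (clamp01 s) (clamp01 (t - 1)) (clamp01 (s - 1)) `|t - s| => A B C D l h1 h2 hD hC hB hA.
have -> : A ^+ 2 / 2 + C - C ^+ 2 / 2 - (B ^+ 2 / 2 + D - D ^+ 2 / 2) =
   (A - B) * ((A + B) / 2) + (C - D) * (1 - (C + D) / 2) by field.
apply: le_trans (ler_normD _ _) _; rewrite (normrM (A - B)) (normrM (C - D)).
have a1 : `|(A + B) / 2| <= 1 by rewrite ler_norml; clra.
have a2 : `|1 - (C + D) / 2| <= 1 by rewrite ler_norml; clra.
have := ler_wpM2l (normr_ge0 (A - B)) a1; have := ler_wpM2l (normr_ge0 (C - D)) a2; clra.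
Qed.

Lemma smoothstep_eq0 t : t <= 0 -> smoothstep t = 0.
Proof. by move=> h; rewrite smoothstepE /sqpos !max_l; [rewrite expr0n/=; field|clra|clra|clra]. Qed.

Lemma smoothstep_eq1 t : 2 <= t -> smoothstep t = 1.
Proof. by move=> h; rewrite smoothstepE /sqpos !max_r; [field|clra|clra|clra]. Qed.

Lemma smoothstep_itv t : 0 <= smoothstep t <= 1.
Proof.
have := clamp01_itv t; have := clamp01_itv (t - 1).
have mono : clamp01 (t - 1) = 0 \/ clamp01 t = 1.
  rewrite /clamp01 /clamp.
  by case: (clamp_cases t) => -[h1 ->]; case: (clamp_cases (t - 1)) => -[h2 ->]; (try by left); (try by right); clra.
rewrite /smoothstep; case: mono => ->; move: (clamp01 t) (clamp01 (t - 1)) => A C;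
  rewrite ?expr0n ?expr1n/= => /andP[? ?] /andP[? ?];
  apply/andP; split; cnra.
Qed.

Definition plateau (k t : R) : R := smoothstep (k + t) + smoothstep (k - t) - 1.

Lemma plateau_even k t : plateau k (- t) = plateau k t.
Proof. by rewrite /plateau opprK (addrC (smoothstep _)). Qed.

Lemma plateau_pos k t : 2 <= k -> 0 <= t -> plateau k t = smoothstep (k - t).
Proof. by move=> k2 t0; rewrite /plateau smoothstep_eq1; [rewrite addrAC subrr add0r|clra]. Qed.

Lemma plateau_norm k t : 2 <= k -> plateau k t = smoothstep (k - `|t|).
Proof.
move=> k2; have [h|h] := leP 0 t; first by rewrite ger0_norm ?plateau_pos.
by rewrite -plateau_even ltr0_norm// plateau_pos// oppr_ge0 ltW.
Qed.

Lemma plateau_lipschitz k t s : `|plateau k t - plateau k s| <= 4 * `|t - s|.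
Proof.
rewrite /plateau (_ : _ - _ = (smoothstep (k + t) - smoothstep (k + s))
  + (smoothstep (k - t) - smoothstep (k - s))); last by ring.
apply: le_trans (ler_normD _ _) _.
have := smoothstep_lipschitz (k + t) (k + s); have := smoothstep_lipschitz (k - t) (k - s).
rewrite (_ : k + t - (k + s) = t - s) 1?(_ : k - t - (k - s) = - (t - s)); [|by ring|by ring].
by rewrite normrN; clra.
Qed.

Lemma plateau_second_diff k t h : `|plateau k (t + h) + plateau k (t - h) - 2 * plateau k t| <= 8 * h ^+ 2.
Proof.
have e1 : k + (t + h) = k + t + h by ring.
have e2 : k - (t + h) = k - t - h by ring.
have e3 : k + (t - h) = k + t - h by ring.
have e4 : k - (t - h) = k - t + h by ring.
rewrite /plateau e1 e2 e3 e4 (_ : _ - 2 * _ = (smoothstep (k + t + h) + smoothstep (k + t - h) - 2 * smoothstep (k + t))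
  + (smoothstep (k - t + h) + smoothstep (k - t - h) - 2 * smoothstep (k - t))); last by ring.
apply: le_trans (ler_normD _ _) _.
by have := smoothstep_second_diff (k + t) h; have := smoothstep_second_diff (k - t) h; clra.
Qed.
Record cutoff (chi : R -> R) (x0 ra rb L : R) : Prop := Cutoff {
  cutoff_itv : forall x, 0 <= chi x <= 1;
  cutoff_eq1 : forall x, `|x - x0| <= ra -> chi x = 1;
  cutoff_eq0 : forall x, rb <= `|x - x0| -> chi x = 0;
  cutoff_lipschitz : forall x y, `|chi x - chi y| <= L * `|x - y|;
  cutoff_second_diff : forall x h, `|chi (x + h) + chi (x - h) - 2 * chi x| <= L * h ^+ 2 }.

Lemma exists_cutoff x0 ra rb : 0 < ra -> ra < rb -> exists chi L, 0 < L /\ cutoff chi x0 ra rb L.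
Proof.
move=> ra0 rab; pose w := (rb - ra) / 2; have w0 : 0 < w by rewrite /w; clra.
pose k := rb / w; have k2 : 2 <= k by rewrite /k ler_pdivlMr// /w; clra.
have iw : 0 < w^-1 by rewrite invr_gt0.
have norm_scale x : `|(x - x0) / w| = `|x - x0| / w by rewrite normrM (gtr0_norm iw).
exists (fun x => plateau k ((x - x0) / w)), (4 * w^-1 + 8 * w^-1 ^+ 2).
have p1 : 0 < 4 * w^-1 by rewrite mulr_gt0.
have p2 : 0 < 8 * w^-1 ^+ 2 by rewrite mulr_gt0// exprn_gt0.
split; first exact: addr_gt0.
split=> [x|x hx|x hx|x y|x h].
- by rewrite plateau_norm//; exact: smoothstep_itv.
- rewrite plateau_norm// smoothstep_eq1// norm_scale lerBrDr -lerBrDl ler_pdivrMr//.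
  by rewrite mulrBl /k divfK ?lt0r_neq0// /w; clra.
- by rewrite plateau_norm// smoothstep_eq0// norm_scale subr_le0 ler_pM2r.
- apply: le_trans (plateau_lipschitz _ _ _) _; rewrite -mulrBl (_ : x - x0 - (y - x0) = x - y); last by ring.
  by rewrite normrM (gtr0_norm iw) mulrDl; have := mulr_ge0 (ltW p2) (normr_ge0 (x - y)); clra.
- have -> : (x + h - x0) / w = (x - x0) / w + h / w by ring.
  have -> : (x - h - x0) / w = (x - x0) / w - h / w by ring.
  apply: le_trans (plateau_second_diff _ _ _) _.
  rewrite [leRHS]mulrDl (_ : 8 * (h / w) ^+ 2 = 8 * w^-1 ^+ 2 * h ^+ 2); last by ring.
  by rewrite lerDr mulr_ge0 ?sqr_ge0// ltW.
Qed.
End Spline.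

Section Commutator.
Variable R : realType.
Local Notation mu := (@lebesgue_measure R).
Local Notation mu2 := (mu \x mu)%E.
Implicit Types (a f psi phi chi : R -> R) (F H : R * R -> R).

Lemma L1le_form_admissible a Lam w phi : elliptic_kernel a Lam -> admissible w -> admissible phi ->
  exists c, L1le mu2 (fun z => (w z.1 - w z.2) * (phi z.1 - phi z.2) * kern a z) c.
Proof.
move=> ok [mw _ [E hE]] [mp _ [P hP]]; exists (Lam * (E + P / 2)).
have hE' : L1le mu2 (fun z => ind true * en w z) E by apply: eq_L1le hE => z; rewrite indT// mul1r.
by apply: (L1le_form (b := xpredT) ok mw mp _ _ hE' hP) => //; exact: measurable_cst.
Qed.

Lemma exists_diagonal_truncation F c e : L1le mu2 F c -> (forall x, F (x, x) = 0) -> 0 < e ->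
  exists2 d, 0 < d & L1le mu2 (fun z => ind (`|z.1 - z.2| <= d) * F z) e.
Proof.
move=> hF F0 e0; have mF := L1le_measurable hF.
have [|||n0 hn] := @L1le_cvg0 _ _ _ mu2 (fun n z => ind (`|z.1 - z.2| <= dyad 1 n) * F z) (fun z => `|F z|) c e
  _ _ (L1le_norm hF) _ e0.
- by move=> n; mes.
- by move=> n z; rewrite normrM ger0_norm ?ind_ge0// ler_piMl// ind_le1.
- move=> -[x y]; apply/cvgrPdist_le => t t0; have [->|nz] := eqVneq x y.
    by exists 0%N => // n _ /=; rewrite F0 mulr0 subrr normr0 ltW.
  have l0 : 0 < `|x - y| by rewrite normr_gt0 subr_eq0.
  have [k hk] := dyad_small (ltr01 : 0 < (1 : R)) l0; exists k => // n /= kn.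
  by rewrite indF -?ltNge ?hk// mul0r subrr normr0 ltW.
by exists (dyad 1 n0); [exact: dyad_gt0|exact: hn].
Qed.

Lemma Rint_swap_reflect H c : L1le mu2 H c ->
  \int[mu2]_z (H z + H (z.2, z.1)) = \int[mu2]_z (H z + H (z.1, 2 * z.1 - z.2)).
Proof.
move=> hH; have mH := L1le_measurable hH.
rewrite (RintD hH (L1le_swap hH)) (RintD hH (L1le_reflect hH)); congr (_ + _).
by rewrite [LHS](Rint_swap mH) -[LHS](Rint_reflect mH).
Qed.

Variables (a chi : R -> R) (Lam L x0 ra rb : R).
Hypotheses (ok : elliptic_kernel a Lam) (hchi : cutoff chi x0 ra rb L) (rb0 : 0 < rb) (L0 : 0 < L).

Lemma measurable_cutoff : measurable_fun setT chi.
Proof. exact: lipschitz_measurable (cutoff_lipschitz hchi). Qed.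

Lemma cutoff_le1 x : `|chi x| <= 1.
Proof. by rewrite ger0_norm; case/andP: (cutoff_itv hchi x). Qed.

Lemma admissible_cutoff : admissible chi.
Proof.
apply: (@admissible_lipschitz _ _ L 1 x0 rb (cutoff_lipschitz hchi) cutoff_le1 rb0) => x h.
by apply: (cutoff_eq0 hchi); exact: ltW.
Qed.

Lemma cutoff_increment_sqr_le x y : (chi x - chi y) ^+ 2 / (x - y) ^+ 2 <= L ^+ 2 * Jnear 1 (x, y) + 4 * Jfar 1 (x, y).
Proof.
rewrite (_ : 4 = 2 ^+ 2); last by ring.
apply: quotient_sqr_le; first exact: cutoff_lipschitz hchi x y.
by apply: le_trans (ler_normB _ _) _; have := cutoff_le1 x; have := cutoff_le1 y; clra.
Qed.

Definition truncated_kern d (z : R * R) : R := (1 - ind (`|z.1 - z.2| <= d)) * kern a z.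

Lemma measurable_truncated_kern d : measurable_fun setT (truncated_kern d).
Proof. by have mk := measurable_kern ok; rewrite /truncated_kern; mes. Qed.

Lemma truncated_kern_ge0 d z : 0 <= truncated_kern d z.
Proof. by apply: mulr_ge0; [rewrite subr_ge0 ind_le1|exact: kern_ge0 ok]. Qed.

Lemma truncated_kern_le d z : truncated_kern d z <= kern a z.
Proof. by rewrite ler_piMl ?(kern_ge0 _ ok)// gerBl ind_ge0. Qed.

Lemma truncated_kern_le_Jfar d x y : truncated_kern d (x, y) <= Lam * Jfar d (x, y).
Proof.
have /andP[_ k2] := kern_bounds x y ok; have [_ L1 _ _] := ok; have Lp : 0 <= Lam by clra.
rewrite /truncated_kern /Jfar/=; have [h|h] := leP `|x - y| d.
  by rewrite /ind subrr mul0r; apply: mulr_ge0 => //; apply: mulr_ge0; [case: ifP|exact: inv_sqr_ge0].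
by rewrite (ltW h) /ind subr0 !mul1r.
Qed.

Lemma truncated_kern_sym d x y : truncated_kern d (x, y) = truncated_kern d (y, x).
Proof. by rewrite /truncated_kern/= distrC (kern_sym x y ok). Qed.

Lemma truncated_kern_reflect d x y : truncated_kern d (x, 2 * x - y) = truncated_kern d (x, y).
Proof.
have e1 : x - (2 * x - y) = - (x - y) by ring.
rewrite /truncated_kern /kern/= e1 normrN sqrrN; congr (_ * (_ / _)).
by case: ok => _ _ sa _; rewrite -sa.
Qed.

Lemma second_diff_kern_le d x y : `|chi x - chi y + (chi x - chi (2 * x - y))| * truncated_kern d (x, y)
  <= Lam * (L * Jnear 1 (x, y) + 4 * Jfar 1 (x, y)).
Proof.
have [_ L1 _ _] := ok; have Lp : 0 <= Lam by clra.
have [exy|xy] := eqVneq x y.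
  rewrite exy (_ : chi y - chi y + (chi y - chi (2 * y - y)) = 0) ?normr0 ?mul0r; last first.
    by rewrite (_ : 2 * y - y = y) ?subrr ?addr0//; ring.
  by apply: mulr_ge0 => //; apply: addr_ge0; apply: mulr_ge0 => //; rewrite ?Jnear_ge0 ?Jfar_ge0// ltW.
have l2 := sqr_gt0 (_ : x - y != 0); rewrite subr_eq0 in l2; have {}l2 := l2 xy.
have kern2 : truncated_kern d (x, y) <= Lam / (x - y) ^+ 2.
  by have /andP[_ k2] := kern_bounds x y ok; exact: le_trans (truncated_kern_le _ _) k2.
set D := chi x - chi y + _; have D4 : `|D| <= 4.
  have -> : D = (chi x + chi x) - (chi y + chi (2 * x - y)) by rewrite /D; ring.
  apply: le_trans (ler_normB _ _) _; have := ler_normD (chi x) (chi x); have := ler_normD (chi y) (chi (2 * x - y)).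
  by have := cutoff_le1 x; have := cutoff_le1 y; have := cutoff_le1 (2 * x - y); clra.
have DL : `|D| <= L * (x - y) ^+ 2.
  have eD : chi (x + (y - x)) + chi (x - (y - x)) - 2 * chi x = - D.
    by rewrite (_ : x + (y - x) = y) 1?(_ : x - (y - x) = 2 * x - y); rewrite ?/D; ring.
  by have := cutoff_second_diff hchi x (y - x); rewrite eD normrN sqr_distC.
apply: le_trans (ler_wpM2l (normr_ge0 D) kern2) _; rewrite mulrCA; apply: ler_wpM2l => //.
rewrite ler_pdivrMr// /Jnear /Jfar/=; have [h|h] := leP `|x - y| 1.
  apply: le_trans DL _; apply: ler_wpM2r; first exact: ltW.
  by rewrite [ind true]/ind mulr1 lerDl; nneg.
by rewrite (ltW h) /ind mulr0 add0r mul1r divfK ?lt0r_neq0.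
Qed.

Lemma truncated_form_le d psi c : 0 < d -> L1le mu psi c ->
  `|\int[mu2]_z ((chi z.1 - chi z.2) * (psi z.1 - psi z.2) * truncated_kern d z)| <= Lam * (2 * L + 8) * c.
Proof.
move=> d0 hc; have [_ L1 _ _] := ok; have Lp : 0 <= Lam by clra.
have mk := measurable_truncated_kern d; have mc := measurable_cutoff; have mp := L1le_measurable hc.
pose H z := (chi z.1 - chi z.2) * (psi z.1 * truncated_kern d z).
have hpsi : L1le mu2 (fun z => psi z.1 * truncated_kern d z) (c * (Lam * (2 / d))).
  apply: L1le_kernel_fst => // x; have := L1leZ Lam (L1le_Jfar x d0); rewrite (ger0_norm Lp).
  apply: L1le_dom; first by exact: (measurableT_comp mk (measurable_fun_pair _ _)).
  by move=> y; rewrite ger0_norm ?truncated_kern_ge0//; exact: truncated_kern_le_Jfar.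
have hH : L1le mu2 H (2 * (c * (Lam * (2 / d)))).
  have := L1leZ 2 (L1le_norm hpsi); rewrite ger0_norm//; apply: L1le_dom2; first by rewrite /H; mes.
  move=> x y; rewrite /H normrM; apply: ler_wpM2r => //=.
  by apply: le_trans (ler_normB _ _) _; have := cutoff_le1 x; have := cutoff_le1 y; clra.
have -> : \int[mu2]_z ((chi z.1 - chi z.2) * (psi z.1 - psi z.2) * truncated_kern d z) =
    \int[mu2]_z (H z + H (z.1, 2 * z.1 - z.2)).
  rewrite -(Rint_swap_reflect hH); apply: eq_Rint => -[x y].
  by rewrite /H/= -(truncated_kern_sym d x y); ring.
have mJn := measurable_Jnear (1 : R); have mJf := measurable_Jfar (1 : R).
have mJ : measurable_fun setT (fun z : R * R => Lam * (L * Jnear 1 z + 4 * Jfar 1 z)) by mes.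
have hJ x : L1le mu (fun y => Lam * (L * Jnear 1 (x, y) + 4 * Jfar 1 (x, y))) (Lam * (2 * L + 8)).
  have := L1leZ Lam (L1leD (L1leZ L (L1le_Jnear x ltr01)) (L1leZ 4 (L1le_Jfar x ltr01))).
  by apply: L1leW; rewrite !ger0_norm ?(ltW L0)//; apply: ler_wpM2l => //; clra.
rewrite [leRHS]mulrC; apply: normr_Rint_le.
apply: L1le_dom2 (L1le_kernel_fst mJ hJ (L1le_norm hc)); first exact: L1le_measurable (L1leD hH (L1le_reflect hH)).
move=> x y; rewrite /H/= truncated_kern_reflect -mulrDl mulrCA normrM; apply: ler_wpM2l => //.
by rewrite normrM (ger0_norm (truncated_kern_ge0 _ _)); exact: second_diff_kern_le.
Qed.

(* By symmetry of [a] only second differences of [chi] enter, and they kill the singularity of the kernel. *)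
Lemma form_cutoff_le psi c : admissible psi -> L1le mu psi c -> `|form a chi psi| <= Lam * (2 * L + 8) * c.
Proof.
move=> gpsi hc; have [C hF] := L1le_form_admissible ok admissible_cutoff gpsi.
apply/ler_addgt0Pl => e e0; have [|d d0 hd] := exists_diagonal_truncation hF _ e0.
  by move=> x /=; rewrite subrr !mul0r.
rewrite /form (_ : \int[mu2]_z _ =
   \int[mu2]_z (ind (`|z.1 - z.2| <= d) * ((chi z.1 - chi z.2) * (psi z.1 - psi z.2) * kern a z))
   + \int[mu2]_z ((chi z.1 - chi z.2) * (psi z.1 - psi z.2) * truncated_kern d z)).
  by apply: le_trans (ler_normD _ _) _; apply: lerD; [exact: normr_Rint_le hd|exact: truncated_form_le].
rewrite -[LHS](addrNK (\int[mu2]_z (ind (`|z.1 - z.2| <= d) * ((chi z.1 - chi z.2) * (psi z.1 - psi z.2) * kern a z)))).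
rewrite -(RintB hF hd) addrC; congr (_ + _); apply: eq_Rint => z; rewrite /truncated_kern; ring.
Qed.
End Commutator.

Section LocalizedEquation.
Variables (R : realType) (N : nat).
Local Notation mu := (@lebesgue_measure R).
Local Notation mu2 := (mu \x mu)%E.
Variables (a chi : R -> R) (Lam L : R) (u m : 'I_N -> R -> R) (x0 r0 ra rb : R).
Hypotheses (HS : solution a Lam u m x0 r0) (hchi : cutoff chi x0 ra rb L) (rb0 : 0 < rb) (L0 : 0 < L)
  (rbr : rb <= r0).

Let J (z : R * R) := L ^+ 2 * Jnear 1 z + 4 * Jfar 1 z.

Definition cutoff_sol (i : 'I_N) x := chi x * u i x.
Definition cutoff_const : R := Lam * (2 * L ^+ 2 + 2 * L + 16).

Lemma cutoff_const_ge0 : 0 <= cutoff_const.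
Proof.
have [_ L1 _ _] := sol_kernel HS; have L00 := ltW L0; have L2 := sqr_ge0 L.
by apply: mulr_ge0; clra.
Qed.

Lemma cutoff_sol_le1 i x : `|cutoff_sol i x| <= 1.
Proof. by rewrite normrM mulr_ile1// ?(cutoff_le1 hchi)// (sol_le1 HS). Qed.

Lemma cutoff_sol_supp i x : rb < `|x - x0| -> cutoff_sol i x = 0.
Proof. by move=> h; rewrite /cutoff_sol (cutoff_eq0 hchi) ?mul0r// ltW. Qed.

Lemma admissible_cutoff_sol i : admissible (cutoff_sol i).
Proof.
apply: (admissible_mul_solution HS i (admissible_cutoff hchi rb0)) => x h.
by apply: (cutoff_eq0 hchi); exact: le_trans h.
Qed.

Lemma en_total_swap x y : en_total u (y, x) = en_total u (x, y).
Proof. by apply: eq_bigr => i _; rewrite en_swap. Qed.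

Lemma sqdist_kern_le z : sqdist u z * kern a z <= Lam * en_total u z.
Proof.
case: z => x y; have /andP[_ k2] := kern_bounds x y (sol_kernel HS).
rewrite (_ : Lam * _ = sqdist u (x, y) * (Lam / (x - y) ^+ 2)); first exact: (ler_wpM2l (sqdist_ge0 _ _) k2).
by rewrite /en_total /sqdist /en/= -mulr_suml; ring.
Qed.

Lemma cutoff_commutator_le i phi x y :
  `|(chi x - chi y) * (phi x + phi y) * (u i x - u i y) * kern a (x, y)|
    <= Lam / 2 * (`|phi x| * (en_total u (x, y) + J (x, y))) + Lam / 2 * (`|phi y| * (en_total u (y, x) + J (y, x))).
Proof.
have ok := sol_kernel HS; have [_ L1 _ _] := ok; have Lp : 0 <= Lam by clra.
have kp := inv_sqr_ge0 (x - y); set p := `|phi x| + `|phi y|; have p0 : 0 <= p by rewrite addr_ge0.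
have amgm2 : `|(chi x - chi y) * (u i x - u i y)| / (x - y) ^+ 2 <= (en_total u (x, y) + J (x, y)) / 2.
  have := cutoff_increment_sqr_le hchi x y; have := en_le_total u i (x, y); rewrite /en/= -/(J (x, y)).
  have : `|(chi x - chi y) * (u i x - u i y)| <= ((chi x - chi y) ^+ 2 + (u i x - u i y) ^+ 2) / 2.
    have := sqr_ge0 (`|chi x - chi y| - `|u i x - u i y|).
    by rewrite normrM sqrrB !sqr_normr; clra.
  by move=> /(ler_wpM2r kp); clra.
rewrite (en_total_swap x y) (_ : J (y, x) = J (x, y)); last by rewrite /J Jnear_sym Jfar_sym.
rewrite [leRHS](_ : _ = p * (Lam * ((en_total u (x, y) + J (x, y)) / 2))); last by rewrite /p; field.
rewrite (_ : _ * kern a (x, y) = (phi x + phi y) * (((chi x - chi y) * (u i x - u i y)) * kern a (x, y))); last by ring.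
rewrite normrM; apply: ler_pM => //; first exact: ler_normD.
rewrite normrM (ger0_norm (kern_ge0 _ ok)); have /andP[_ k2] := kern_bounds x y ok.
by apply: le_trans (ler_wpM2l (normr_ge0 _) k2) _; rewrite mulrCA; exact: ler_wpM2l.
Qed.

Lemma L1le_cutoff_commutator i phi c1 c3 : L1le mu2 (fun z => `|phi z.1| * en_total u z) c1 -> L1le mu phi c3 ->
  L1le mu2 (fun z => (chi z.1 - chi z.2) * (phi z.1 + phi z.2) * (u i z.1 - u i z.2) * kern a z)
    (Lam * (c1 + c3 * (2 * L ^+ 2 + 8))).
Proof.
move=> h1 h3; have ok := sol_kernel HS; have [_ L1 _ _] := ok; have mk := measurable_kern ok.
have mc := measurable_cutoff hchi; have mui := sol_measurable HS i; have mp := L1le_measurable h3.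
have mJn := measurable_Jnear (1 : R); have mJf := measurable_Jfar (1 : R).
have mJ : measurable_fun setT J by rewrite /J; mes.
have hJ x : L1le mu (fun y => J (x, y)) (2 * L ^+ 2 + 8).
  have := L1leD (L1leZ (L ^+ 2) (L1le_Jnear x ltr01)) (L1leZ 4 (L1le_Jfar x ltr01)).
  by apply: L1leW; rewrite !ger0_norm ?sqr_ge0//; clra.
have half := L1leZ (Lam / 2) (L1leD h1 (L1le_kernel_fst mJ hJ (L1le_norm h3))).
apply: L1le_domW2 (L1leD half (L1le_swap half)) _ _ _; [by rewrite ger0_norm; clra|by mes|move=> x y /=].
by rewrite -(mulrDr `|phi x|) -(mulrDr `|phi y|); exact: cutoff_commutator_le.
Qed.

Lemma form_solution_cutoff_le i phi c1 c2 : admissible phi -> (forall x, r0 <= `|x - x0| -> phi x = 0) ->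
  L1le mu2 (fun z => `|phi z.1| * en_total u z) c1 -> L1le mu (fun x => m i x * phi x) c2 ->
  `|form a (u i) (fun x => chi x * phi x)| <= Lam * c1 + c2.
Proof.
move=> gp p0 h1 h2; have ok := sol_kernel HS; have [_ L1 _ _] := ok; have Lp : 0 <= Lam by clra.
have mc := measurable_cutoff hchi; have mui := sol_measurable HS i; have mk := measurable_kern ok.
have mp : measurable_fun setT phi by case: gp.
have gcp := admissibleM (admissible_cutoff hchi rb0) gp.
rewrite (sol_weak HS i gcp) => [|x /p0 ->]; last by rewrite mulr0.
apply: le_trans (ler_normD _ _) _; apply: lerD; apply: normr_Rint_le.
  have := L1leZ Lam h1; rewrite (ger0_norm Lp); apply: L1le_dom2.
    by have mD := measurable_sqdist (sol_measurable HS); mes.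
  move=> x y /=; rewrite normrM (ger0_norm (mulr_ge0 (sqdist_ge0 _ _) (kern_ge0 _ ok))).
  rewrite [leRHS](_ : _ = Lam * en_total u (x, y) * `|phi x|); last by ring.
  apply: ler_pM => //; [by rewrite mulr_ge0 ?sqdist_ge0 ?(kern_ge0 _ ok)|exact: sqdist_kern_le|].
  rewrite normrM -[leRHS]mul1r; apply: ler_pM => //; first exact: sol_le1 HS _ _.
  by rewrite normrM ler_piMl// (cutoff_le1 hchi).
apply: L1le_dom (L1le_norm h2); first by have [c hc] := exists_L1le_source HS i gcp; exact: L1le_measurable hc.
by move=> x; rewrite !normrM; apply: ler_wpM2l => //; rewrite ler_piMl//; exact: cutoff_le1 hchi x.
Qed.

(* Leibniz: the form of [chi u_i] against [phi] is that of [u_i] against [chi phi] plus that of [chi] against [phi u_i],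
   up to a commutator. *)
Lemma form_cutoff_mul_le i phi c1 c2 c3 : admissible phi -> (forall x, r0 <= `|x - x0| -> phi x = 0) ->
  L1le mu2 (fun z => `|phi z.1| * en_total u z) c1 -> L1le mu (fun x => m i x * phi x) c2 -> L1le mu phi c3 ->
  `|form a (cutoff_sol i) phi| <= 2 * Lam * c1 + c2 + cutoff_const * c3.
Proof.
move=> gp p0 h1 h2 h3; have ok := sol_kernel HS; have gc := admissible_cutoff hchi rb0.
have [|e1 he1] := exists_L1le_form HS i (admissibleM gc gp); first by move=> x /p0 ->; rewrite mulr0.
have gup := admissible_mul_solution HS i gp p0.
have [e2 he2] := L1le_form_admissible ok gc gup.
have hX := L1le_cutoff_commutator i h1 h3.
have h3u : L1le mu (fun x => phi x * u i x) c3.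
  apply: L1le_dom (L1le_norm h3) => [|x]; first by case: gup.
  by rewrite normrM ler_piMr//; exact: sol_le1 HS _ _.
have leibniz : form a (cutoff_sol i) phi = form a (u i) (fun x => chi x * phi x)
    + form a chi (fun x => phi x * u i x)
    - \int[mu2]_z ((chi z.1 - chi z.2) * (phi z.1 + phi z.2) * (u i z.1 - u i z.2) * kern a z).
  by rewrite /form /cutoff_sol -(RintD he1 he2) -(RintB (L1leD he1 he2) hX); apply: eq_Rint => z; ring.
rewrite leibniz; apply: le_trans (ler_normB _ _) _; apply: le_trans (lerD (ler_normD _ _) (lexx _)) _.
have -> : 2 * Lam * c1 + c2 + cutoff_const * c3 =
  (Lam * c1 + c2) + Lam * (2 * L + 8) * c3 + Lam * (c1 + c3 * (2 * L ^+ 2 + 8)) by rewrite /cutoff_const; ring.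
apply: lerD (normr_Rint_le hX); apply: lerD; first exact: form_solution_cutoff_le.
exact: (form_cutoff_le ok hchi rb0 L0 gup h3u).
Qed.

Lemma L1le_bounded_support (phi : R -> R) (M c rho : R) : measurable_fun setT phi -> 0 <= rho ->
  (forall x, `|phi x| <= M) ->
  (forall x, rho < `|x - c| -> phi x = 0) -> L1le mu phi (M * (2 * rho)).
Proof.
move=> mp rho0 pM p0; have M0 : 0 <= M := le_trans (normr_ge0 _) (pM 0).
rewrite -[X in L1le _ _ (X * _)](ger0_norm M0); apply: L1le_dom (L1leZ M (L1le_ball c rho0)) => // x.
rewrite (distrC c); have [h|h] := leP `|x - c| rho; last by rewrite p0// normr0 /ind mulr0.
by rewrite /ind mulr1.
Qed.

Lemma L1le_test_energy (phi : R -> R) (M c rho : R) : measurable_fun setT phi -> `|c - x0| + rho < r0 ->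
  (forall x, `|phi x| <= M) ->
  (forall x, rho < `|x - c| -> phi x = 0) -> L1le mu2 (fun z => `|phi z.1| * en_total u z) (M * ball_energy u c rho).
Proof.
move=> mp hc pM p0; have M0 : 0 <= M := le_trans (normr_ge0 _) (pM 0); have me := measurable_en_total HS.
rewrite -[X in L1le _ _ (X * _)](ger0_norm M0); apply: L1le_dom2 (L1leZ M (L1le_ball_energy HS hc)); first by mes.
move=> x y /=; rewrite ger0_norm; last by rewrite mulr_ge0 ?en_total_ge0.
rewrite mulrA; apply: ler_wpM2r; first exact: en_total_ge0.
by have [h|h] := leP `|x - c| rho; [rewrite /ind mulr1|rewrite p0// normr0 /ind mulr0].
Qed.

Lemma form_cutoff_sol_bounded_le i (phi : R -> R) (M c rho cs : R) : admissible phi -> 0 <= rho ->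
  `|c - x0| + rho < r0 ->
  (forall x, `|phi x| <= M) -> (forall x, rho < `|x - c| -> phi x = 0) -> L1le mu (fun x => m i x * phi x) (M * cs) ->
  `|form a (cutoff_sol i) phi| <= M * (2 * Lam * ball_energy u c rho + cs + 2 * cutoff_const * rho).
Proof.
move=> gp rho0 hc pM p0 hcs; have [mp _ _] := gp.
have p0' x : r0 <= `|x - x0| -> phi x = 0 by move=> hx; apply: p0; have := ler_distD c x x0; clra.
apply: le_trans (form_cutoff_mul_le gp p0' (L1le_test_energy mp hc pM p0) hcs (L1le_bounded_support mp rho0 pM p0)) _.
by apply: eqW; ring.
Qed.
End LocalizedEquation.

Section Shift.
Variable R : realType.
Local Notation mu := (@lebesgue_measure R).
Local Notation mu2 := (mu \x mu)%E.
Implicit Types (a f w W phi : R -> R) (h : R).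

Lemma admissible_shift f h : admissible f -> admissible (fun x => f (x + h)).
Proof.
case=> mf [M hM] [P hP]; split; [by mes|by exists M => x|exists P].
apply: eq_L1le (L1le_shift2 h hP) => z; rewrite /en/=; congr (_ / _ ^+ 2); ring.
Qed.

Lemma form_increment a Lam W phi h : elliptic_kernel a Lam -> admissible W -> admissible phi ->
  form a (fun x => W (x + h) - W x) phi = form a W (fun x => phi (x - h)) - form a W phi.
Proof.
move=> ok gW gp.
have [c1 h1] := L1le_form_admissible ok (admissible_shift h gW) gp.
have [c2 h2] := L1le_form_admissible ok gW gp.
have [c3 h3] := L1le_form_admissible ok gW (admissible_shift (- h) gp).
have E3 : form a W (fun x => phi (x - h)) =
   \int[mu2]_z ((W (z.1 + h) - W (z.2 + h)) * (phi z.1 - phi z.2) * kern a z).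
  rewrite /form -(Rint_shift2 h (L1le_measurable h3)); apply: eq_Rint => z /=.
  have -> : kern a (z.1 + h, z.2 + h) = kern a z.
    by rewrite /kern/= (_ : z.1 + h - (z.2 + h) = z.1 - z.2)//; ring.
  by rewrite !addrK.
by rewrite E3 /form -(RintB h1 h2); apply: eq_Rint => z; ring.
Qed.

End Shift.

Section Energy.
Variable R : realType.
Local Notation mu := (@lebesgue_measure R).
Local Notation mu2 := (mu \x mu)%E.
Variables (a v : R -> R) (Lam m : R).
Hypotheses (ok : elliptic_kernel a Lam) (gv : admissible v) (m0 : 0 <= m) (vm : forall x, `|v x| <= m).
Implicit Types (c rho s D : R).

Lemma L1le_en_eta c rho : 0 < rho -> L1le mu2 (en (eta c rho)) 32.
Proof.
move=> r0; have me := measurable_en (measurable_eta c rho).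
have r2 : 0 <= 2 * rho by clra.
apply: L1leW (L1le_supported (c := c) me (measurable_Jmix rho) (Jmix_sym _) (fun x => L1le_Jmix x r0) r2 _ _).
- by apply: eqW; field; exact: lt0r_neq0.
- by move=> x y; rewrite ger0_norm ?en_ge0//; exact: eta_increment_le.
- by move=> x y hx hy; rewrite /en/= !eta_eq0 ?ltW// subrr expr0n mul0r.
Qed.

Lemma caccioppoli_pointwise (p q s t : R) x y :
  Lam^-1 * ((p * s - q * t) ^+ 2 / (x - y) ^+ 2)
    <= (s - t) * (p ^+ 2 * s - q ^+ 2 * t) * kern a (x, y) + Lam * (`|s * t| * ((p - q) ^+ 2 / (x - y) ^+ 2)).
Proof.
have /andP[k1 k2] := kern_bounds x y ok; have K0 := kern_ge0 (x, y) ok.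
have -> : (s - t) * (p ^+ 2 * s - q ^+ 2 * t) = (p * s - q * t) ^+ 2 - s * t * (p - q) ^+ 2 by ring.
have energy := ler_wpM2l (sqr_ge0 (p * s - q * t)) k1.
have cross : s * t * (p - q) ^+ 2 * kern a (x, y) <= `|s * t| * (p - q) ^+ 2 * (Lam / (x - y) ^+ 2).
  apply: (@le_trans _ _ (`|s * t| * (p - q) ^+ 2 * kern a (x, y))).
    by apply: ler_wpM2r => //; apply: ler_wpM2r; [exact: sqr_ge0|exact: ler_norm].
  by apply: ler_wpM2l => //; apply: mulr_ge0 => //; exact: sqr_ge0.
by move: energy cross; clra.
Qed.

Lemma caccioppoli c rho D X : 0 < rho ->
  form a v (fun x => eta c rho x ^+ 2 * v x) <= D ->
  L1le mu2 (fun z => `|v z.1 * v z.2| * en (eta c rho) z) X ->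
  L1le mu2 (en (fun x => eta c rho x * v x)) (Lam * (D + Lam * X)).
Proof.
move=> r0 hD he; have [_ L1 _ _] := ok; have Lp : 0 < Lam by clra.
have ge := admissible_eta c r0.
have gev := admissibleM ge gv; have g2 : admissible (fun x => eta c rho x ^+ 2 * v x).
  by have := admissibleM (admissibleM ge ge) gv; rewrite (_ : (fun x => _) = (fun x => eta c rho x ^+ 2 * v x)).
have [cF hF] := L1le_form_admissible ok gv g2.
have [_ _ [P hP]] := gev; have hP' := L1le_Rint hP (fun z => en_ge0 _ z).
apply: L1leW hP'.
have energy_le : Lam^-1 * (\int[mu2]_z en (fun x => eta c rho x * v x) z) <= D + Lam * X.
  have hFe := L1leD hF (L1leZ Lam he).
  rewrite -(RintZ _ hP); apply: (@le_trans _ _ (\int[mu2]_z ((v z.1 - v z.2) *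
    (eta c rho z.1 ^+ 2 * v z.1 - eta c rho z.2 ^+ 2 * v z.2) * kern a z
    + Lam * (`|v z.1 * v z.2| * en (eta c rho) z)))).
    by apply: le_Rint (L1leZ _ hP) hFe _ => -[x y]; exact: caccioppoli_pointwise.
  rewrite (RintD hF (L1leZ _ he)) (RintZ _ he); apply: lerD => //.
  by apply: ler_wpM2l; [exact: ltW|exact: Rint_le_bound].
by rewrite mulrC ler_pdivrMr// mulrC in energy_le.
Qed.

Lemma caccioppoli_ball c rho D : 0 < rho ->
  form a v (fun x => eta c rho x ^+ 2 * v x) <= D ->
  L1le mu2 (fun z => ind (`|z.1 - c| <= rho / 2) * en v z) (Lam * (D + 32 * Lam * m ^+ 2) + 16 * m ^+ 2).
Proof.
move=> r0 hD; have [mv _ _] := gv; have r2 : 0 < rho / 2 by clra.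
have X : L1le mu2 (fun z => `|v z.1 * v z.2| * en (eta c rho) z) (m ^+ 2 * 32).
  rewrite -[X in L1le _ _ (X * _)](ger0_norm (sqr_ge0 m)); apply: L1le_dom2 (L1leZ (m ^+ 2) (L1le_en_eta c r0)).
    by have := measurable_en (measurable_eta c rho) => ?; mes.
  move=> x y /=; rewrite ger0_norm; last by nneg.
  apply: ler_wpM2r; first exact: en_ge0.
  by rewrite normrM expr2; apply: ler_pM => //; exact: vm.
have H := caccioppoli r0 hD X; rewrite (_ : Lam * (D + Lam * (m ^+ 2 * 32)) = Lam * (D + 32 * Lam * m ^+ 2)) in H;
  last by ring.
have hi : L1le mu (fun x => ind (`|c - x| <= rho / 2)) (2 * (rho / 2)) by apply: L1le_ball; exact: ltW.
have F := L1leZ (4 * m ^+ 2) (L1le_kernel_fst (measurable_Jfar (rho / 2)) (fun x => L1le_Jfar x r2) hi).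
apply: L1le_domW2 (L1leD H F) _ _ _.
- rewrite lerD2l ger0_norm; last by rewrite mulr_ge0// sqr_ge0.
  by apply: eqW; field; exact: lt0r_neq0.
- by have := measurable_en mv => ?; mes.
move=> x y /=; rewrite ger0_norm; last by nneg.
have f0 : 0 <= 4 * m ^+ 2 * (ind (`|c - x| <= rho / 2) * Jfar (rho / 2) (x, y)).
  by apply: mulr_ge0; [rewrite mulr_ge0// sqr_ge0|rewrite mulr_ge0 ?ind_ge0 ?Jfar_ge0].
have e0 := en_ge0 (fun x => eta c rho x * v x) (x, y).
have [hx|hx] := leP `|x - c| (rho / 2); last by rewrite {1}/ind mul0r addr_ge0.
rewrite {1}/ind mul1r; have [hy|hy] := leP `|y - c| rho.
  rewrite {1}/en/= (_ : (v x - v y) ^+ 2 / (x - y) ^+ 2 = en (fun x => eta c rho x * v x) (x, y));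
    first by rewrite lerDl.
  by rewrite /en/= !eta_eq1 ?mul1r//; clra.
rewrite (distrC c) hx /ind mul1r /Jfar/= indT; last first.
  by have := ler_normD (y - x) (x - c); rewrite addrA subrK (distrC y x); clra.
rewrite mul1r; apply: ler_wpDl => //; rewrite /en/= ; apply: ler_wpM2r; first exact: inv_sqr_ge0.
have : `|v x - v y| <= 2 * m by apply: le_trans (ler_normB _ _) _; have := vm x; have := vm y; clra.
by move=> /norm_le_sqr; rewrite exprMn (_ : 2 ^+ 2 = 4); last by ring.
Qed.

Definition scalar_ball_energy c s : R := energy_over v (fun x => `|x - c| <= s).

Lemma L1le_energy_over (b : R -> bool) : measurable_fun setT b ->
  L1le mu2 (fun z => ind (b z.1) * en v z) (energy_over v b).
Proof.
move=> mb; have [mv _ [P hP]] := gv.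
have mb1 : measurable_fun setT (fun z : R * R => b z.1) := measurableT_comp mb measurable_fst.
apply: (@L1le_Rint _ _ _ _ _ P); last by move=> z; nneg.
apply: L1le_dom2 hP; first by have := measurable_en mv => ?; mes.
by move=> x y /=; rewrite ger0_norm; [rewrite ler_piMl ?en_ge0 ?ind_le1|nneg].
Qed.

Lemma L1le_scalar_ball_energy c s : L1le mu2 (fun z => ind (`|z.1 - c| <= s) * en v z) (scalar_ball_energy c s).
Proof. by apply: (@L1le_energy_over (fun x => `|x - c| <= s)); mes. Qed.

Lemma scalar_ball_energy_hole_filling c s D : 0 < s ->
  0 <= D -> (forall y, form a v (fun x => eta c s x * (v x - v y)) <= D) ->
  scalar_ball_energy c s <= (28 * Lam) ^+ 2 / (1 + (28 * Lam) ^+ 2) * scalar_ball_energy c (2 * s) + 4 * Lam * D.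
Proof.
move=> s0 D0 hD; have [mv _ _] := gv; have [_ L1 _ _] := ok; have L4 : 0 < 4 * Lam by clra.
have hA := L1le_energy_over (measurable_annulus c s); set nA := energy_over v (annulus c s) in hA.
have [y0 [Ay hy]] := exists_annulus_increment mv s0 hA.
have split2 : scalar_ball_energy c s + nA <= scalar_ball_energy c (2 * s).
  exact: Rint_ball_annulus s0 (en_ge0 v) (L1le_scalar_ball_energy c s) hA (L1le_scalar_ball_energy c (2 * s)).
have K0 : 0 <= (28 * Lam) ^+ 2 := sqr_ge0 _; have D4 : 0 <= 4 * Lam * D by rewrite mulr_ge0// ltW.
have H : scalar_ball_energy c s <= (28 * Lam) ^+ 2 * nA + 4 * Lam * D.
  have := hole_filling ok mv s0 Ay hy (L1le_scalar_ball_energy c (2 * s)).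
  rewrite -/nA -/(scalar_ball_energy c s) (_ : s * (nA / s) = nA); last by rewrite mulrC divfK// lt0r_neq0.
  move/le_trans/(_ (hD y0)); move=> /(ler_wpM2l (ltW L4)); rewrite mulrBr mulVKf ?lt0r_neq0//; clra.
apply: le_trans (absorb_annulus K0 split2 H) _.
rewrite mulrDl mulrAC lerD2l ler_pdivrMr ?ler_peMr//; move: K0; clra.
Qed.
End Energy.
Section Sequences.
Variable R : realType.

Lemma geometric_decay (x : nat -> R) (th q D X : R) : 0 <= th -> th < 1 -> 0 <= q -> q < 1 -> 0 <= D -> 0 <= X ->
  x 0%N <= X -> (forall k, x k.+1 <= th * x k + D * q ^+ k) ->
  let p0 := Num.max th q in let p := (1 + p0) / 2 in
  forall k, x k <= (X + D / (p - p0)) * p ^+ k.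
Proof.
move=> th0 th1 q0 q1 D0 X0 hX hx p0 p.
have a1 : th <= p0 by rewrite le_max lexx.
have a2 : q <= p0 by rewrite le_max lexx orbT.
have a3 : p0 < 1 by rewrite gt_max th1.
have pp : 0 < p - p0 by rewrite /p; clra.
have p_ge0 : 0 <= p by rewrite /p; clra.
have Dp : 0 <= D / (p - p0) by rewrite divr_ge0// ltW.
elim=> [|k ih]; first by rewrite expr0 mulr1; clra.
apply: le_trans (hx k) _; set A := X + D / (p - p0) in ih *.
have qk : q ^+ k <= p ^+ k by rewrite lerXn2r ?nnegrE//; rewrite /p; clra.
have pk : 0 <= p ^+ k by rewrite exprn_ge0.
apply: (@le_trans _ _ (th * (A * p ^+ k) + D * p ^+ k)).
  by apply: lerD; apply: ler_wpM2l.
have -> : th * (A * p ^+ k) + D * p ^+ k = (th * A + D) * p ^+ k by ring.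
rewrite exprS mulrA; apply: ler_wpM2r => //.
have A0 : 0 <= A by rewrite /A; clra.
have h1 : th * A <= p0 * A by apply: ler_wpM2r.
have h2 : D <= (p - p0) * A.
  rewrite {1}(_ : D = (p - p0) * (D / (p - p0))); last by rewrite mulrC divfK// lt0r_neq0.
  by apply: ler_wpM2l; [exact: ltW|rewrite /A; clra].
by clra.
Qed.

Local Notation mu := (@lebesgue_measure R).
Local Notation mu2 := (mu \x mu)%E.

Lemma avg_cvg_continuous (v : R -> R) M d x : measurable_fun setT v -> (forall x, `|v x| <= M) -> 0 < d ->
  (forall e, 0 < e -> exists2 del, 0 < del & forall z, `|z - x| <= del -> `|v z - v x| <= e) ->
  forall e, 0 < e -> exists k0, forall k, (k0 <= k)%N -> `|avg (dyad d k) v x - v x| <= e.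
Proof.
move=> mv vM d0 hc e e0; have e2 : 0 < e / 2 by clra.
have [del del0 H] := hc _ e2; have del2 : 0 < del / 2 by clra.
have [k0 hk0] := dyad_small d0 del2; exists k0 => k k0k.
have dk := dyad_gt0 k d0; have := hk0 _ k0k; set t := dyad d k in dk * => lt.
have hI : L1le mu (fun z => ind (`|x - z| <= 2 * t)) (2 * (2 * t)) by apply: L1le_ball; clra.
have D : L1le mu (fun z => ind (`|z - x| <= 2 * t) * `|v z - v x|) (e / 2 * (2 * (2 * t))).
  rewrite -[X in L1le _ _ (X * _)](ger0_norm (ltW e2)); apply: L1le_dom (L1leZ (e / 2) hI); first by mes.
  move=> z; rewrite ger0_norm; last by nneg.
  rewrite (distrC x); have [h|h] := leP `|z - x| (2 * t); last by rewrite /ind mul0r mulr0.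
  by rewrite /ind mul1r mulr1; apply: H; clra.
apply: le_trans (avg_sub_le mv vM dk D) _; rewrite ler_pdivrMr; clra.
Qed.

Lemma increment_le_scales (v : R -> R) M d S q n : measurable_fun setT v -> (forall x, `|v x| <= M) -> 0 < d ->
  0 < S -> 0 < q -> q < 1 ->
  (forall x e, 0 < e -> exists2 del, 0 < del & forall z, `|z - x| <= del -> `|v z - v x| <= e) ->
  forall x y, `|x - y| <= dyad d n ->
  (forall k, L1le mu2 (fun z => ind (`|z.1 - x| <= 3 * dyad d k) * en v z) ((S * q ^+ k) ^+ 2)) ->
  (forall k, L1le mu2 (fun z => ind (`|z.1 - y| <= 3 * dyad d k) * en v z) ((S * q ^+ k) ^+ 2)) ->
  `|v x - v y| <= (36 / (1 - q) + 6) * S * q ^+ n.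
Proof.
move=> mv vM d0 S0 q0 q1 cv x y xy hx hy; have [S0' q0'] := (ltW S0, ltW q0).
have K0 : 0 <= 18 * S / (1 - q) by rewrite divr_ge0 ?mulr_ge0// subr_ge0 ltW.
have avg_cvg t (ht : forall k, L1le mu2 (fun z => ind (`|z.1 - t| <= 3 * dyad d k) * en v z) ((S * q ^+ k) ^+ 2)) k :
    `|avg (dyad d k) v t - v t| <= 18 * S / (1 - q) * q ^+ k.
  have [l hl] := exists_avg_limit mv vM d0 S0' q0' ht q1.
  by rewrite -(geometric_limit_unique K0 q0' q1 hl (avg_cvg_continuous mv vM d0 (cv t))).
have [_ osc] := avg_dyadic_oscillation mv vM d0 S0' q0' hx n.
apply: le_trans (dist_le_of_approx (avg_cvg x hx n) (avg_cvg y hy n) (osc y xy)) _.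
by apply: eqW; ring.
Qed.

End Sequences.

Section Linear.
Variable R : realType.
Local Notation mu := (@lebesgue_measure R).
Local Notation mu2 := (mu \x mu)%E.
Variables (a W : R -> R) (Lam x0 rb r1 G sig d : R).
Implicit Types (phi : R -> R) (c rho h m : R).
Hypotheses (ok : elliptic_kernel a Lam) (gW : admissible W) (W1 : forall x, `|W x| <= 1)
  (Wsupp : forall x, rb < `|x - x0| -> W x = 0) (rbr : rb < r1) (rb0 : 0 < rb)
  (G0 : 0 <= G) (sig0 : 0 < sig) (sig1 : sig < 1) (d0 : 0 < d)
  (dual : forall phi m c rho, admissible phi -> 0 < rho -> rho <= d -> `|c - x0| <= r1 ->
     (forall x, `|phi x| <= m) -> (forall x, rho < `|x - c| -> phi x = 0) ->
     `|form a W phi| <= m * G * rho `^ sig)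
  (cont : forall x e, 0 < e -> exists2 del, 0 < del & forall z, `|z - x| <= del -> `|W z - W x| <= e).

Definition increment h x := W (x + h) - W x.

Lemma admissible_increment h : admissible (increment h).
Proof. by apply: admissibleB => //; exact: admissible_shift. Qed.

Lemma form_increment_le h phi m c rho : 0 < h -> `|c - x0| + h <= r1 -> admissible phi -> 0 < rho -> rho <= d ->
  (forall x, `|phi x| <= m) -> (forall x, rho < `|x - c| -> phi x = 0) ->
  `|form a (increment h) phi| <= 2 * m * G * rho `^ sig.
Proof.
move=> h0 hc gp r0 rd pm p0.
have gs : admissible (fun x => phi (x - h)) := admissible_shift (- h) gp.
have d1 : `|form a W phi| <= m * G * rho `^ sig by apply: (dual gp r0 rd _ pm p0); clra.
have d2 : `|form a W (fun x => phi (x - h))| <= m * G * rho `^ sig.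
  apply: (dual (c := c + h) gs r0 rd _ (fun x => pm (x - h))).
    by rewrite -addrA (addrC h) addrA; apply: le_trans (ler_normD _ _) _; rewrite (gtr0_norm h0).
  by move=> x; rewrite opprD addrA => hx; apply: p0; rewrite addrAC.
rewrite (form_increment h ok gW gp); apply: le_trans (ler_normB _ _) _; clra.
Qed.

Let th := (28 * Lam) ^+ 2 / (1 + (28 * Lam) ^+ 2).
Let q0 : R := 2^-1 `^ sig.
Let p0 := Num.max th q0.
Let p := (1 + p0) / 2.
Let q := Num.sqrt p.
Let A := 192 * Lam ^+ 2 + 32 * Lam / (p - p0).

Lemma hole_ratio_itv : 0 <= th < 1.
Proof.
have := sqr_ge0 (28 * Lam); rewrite /th; move: ((28 * Lam) ^+ 2) => X X0.
by apply/andP; split; [apply: divr_ge0; clra|rewrite ltr_pdivrMr; clra].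
Qed.

Lemma scale_ratio_itv : 0 <= q0 < 1.
Proof. by have /andP[h1 h2] := powR_half_itv sig0; rewrite /q0 (ltW h1) h2. Qed.

Lemma decay_base_itv : 0 <= p0 < 1.
Proof.
have /andP[t0 t1] := hole_ratio_itv; have /andP[_ q1] := scale_ratio_itv.
by rewrite /p0 le_max t0 gt_max t1.
Qed.

Lemma decay_rate_itv : p0 < p < 1.
Proof. by have := decay_base_itv; rewrite /p; clra. Qed.

Lemma sqrt_rate_itv : 0 < q < 1.
Proof.
have /andP[b0 _] := decay_base_itv; have /andP[p1 p2] := decay_rate_itv; have p0' := le_lt_trans b0 p1.
by rewrite /q sqrtr_gt0 p0'/= -(@ltr_pXn2r _ 2) ?nnegrE ?sqrtr_ge0// sqr_sqrtr ?expr1n// ltW.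
Qed.

Lemma sqrt_rate_sqr : q ^+ 2 = p.
Proof. by have := decay_base_itv; have := decay_rate_itv => h1 h2; rewrite sqr_sqrtr//; clra. Qed.

Lemma energy_const_gt0 : 0 < A.
Proof.
have [_ L1 _ _] := ok; have /andP[pp _] := decay_rate_itv; have Lp : 0 < Lam by clra.
apply: addr_gt0; first by rewrite mulr_gt0// exprn_gt0.
by rewrite divr_gt0 ?mulr_gt0// subr_gt0.
Qed.

Section OneIncrement.
Variables (h m : R).
Hypotheses (h0 : 0 < h) (m0 : 0 < m) (vm : forall x, `|increment h x| <= m).

Let v := increment h.

Section Ball.
Variables (c r0 : R).
Hypotheses (r00 : 0 < r0) (r0d : 4 * r0 <= d) (hc : `|c - x0| + h <= r1).
Let dual_bound := m * G * r0 `^ sig.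

Lemma dual_bound_ge0 : 0 <= dual_bound.
Proof. by rewrite mulr_ge0 ?powR_ge0// mulr_ge0// ltW. Qed.

Lemma scalar_ball_energy_le : scalar_ball_energy v c r0 <= 192 * Lam ^+ 2 * (m ^+ 2 + dual_bound).
Proof.
have [_ L1 _ _] := ok; have gv := admissible_increment h; have P0 := dual_bound_ge0.
have r2 : 0 < 2 * r0 by rewrite mulr_gt0.
have ge := admissible_eta c r2.
have D : form a v (fun x => eta c (2 * r0) x ^+ 2 * v x) <= 8 * dual_bound.
  have g2 : admissible (fun x => eta c (2 * r0) x ^+ 2 * v x) by exact: admissibleM (admissibleM ge ge) gv.
  apply: le_trans (ler_norm _) _.
  apply: le_trans (form_increment_le (m := m) (c := c) (rho := 4 * r0) h0 hc g2 _ r0d _ _) _.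
  - by rewrite mulr_gt0.
  - move=> x; rewrite normrM -[leRHS]mul1r; apply: ler_pM => //.
    by rewrite ger0_norm ?sqr_ge0// expr_le1//; case/andP: (eta_itv c (2 * r0) x).
  - by move=> x hx; rewrite eta_eq0 ?expr0n ?mul0r//=; clra.
  rewrite powRM_pos ?(ltW r00)//; have p4 : 4 `^ sig <= 4 :> R.
    by rewrite -[leRHS](@powRr1 _ 4)//; apply: ler_powR; clra.
  by have := ler_wpM2r P0 p4; rewrite /dual_bound; clra.
have := Rint_le_bound (caccioppoli_ball ok gv vm r2 D); rewrite (_ : 2 * r0 / 2 = r0); last by field.
move/le_trans; apply; have LL : Lam <= Lam ^+ 2 by rewrite expr2 ler_peMl//; clra.
have L2 : 1 <= Lam ^+ 2 by clra.
have z1 := ler_wpM2r P0 LL; have z2 := ler_wpM2r (sqr_ge0 m) L2.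
have z3 := mulr_ge0 (sqr_ge0 Lam) P0; have z4 := mulr_ge0 (sqr_ge0 Lam) (sqr_ge0 m).
by move: z1 z2 z3 z4; move: dual_bound => Z; clra.
Qed.

Lemma dyad_powR k : dyad r0 k `^ sig = r0 `^ sig * q0 ^+ k.
Proof.
have h2 : 0 <= 2^-1 :> R by rewrite invr_ge0.
rewrite /dyad -exprVn powRM ?exprn_ge0//; last exact: ltW.
by rewrite /q0 -(powR_mulrn k (powR_ge0 _ _)) -(powR_mulrn k h2) powRAC.
Qed.

Lemma scalar_ball_energy_step k : scalar_ball_energy v c (dyad r0 k.+1)
  <= th * scalar_ball_energy v c (dyad r0 k) + 32 * Lam * (m ^+ 2 + dual_bound) * q0 ^+ k.
Proof.
have [_ L1 _ _] := ok; have Lp : 0 < Lam by clra.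
have gv := admissible_increment h; have P0 := dual_bound_ge0.
have sp := dyad_gt0 k.+1 r00; have e2 : dyad r0 k = 2 * dyad r0 k.+1 by rewrite dyadS; field.
have ge := admissible_eta c sp; have sd : dyad r0 k <= r0 by exact: dyad_le.
have qk : 0 <= q0 ^+ k by rewrite exprn_ge0//; case/andP: scale_ratio_itv.
pose D := 4 * (dual_bound * q0 ^+ k); have D0 : 0 <= D by rewrite /D mulr_ge0// mulr_ge0.
have HD y : form a v (fun x => eta c (dyad r0 k.+1) x * (v x - v y)) <= D.
  have gk : admissible (fun x => eta c (dyad r0 k.+1) x * (v x - v y)).
    have -> : (fun x => eta c (dyad r0 k.+1) x * (v x - v y)) =
        (fun x => eta c (dyad r0 k.+1) x * v x - v y * eta c (dyad r0 k.+1) x) by apply/funext => x; ring.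
    by apply: admissibleB; [exact: admissibleM ge gv|exact: admissibleZ ge].
  apply: le_trans (ler_norm _) _.
  apply: le_trans (form_increment_le (m := 2 * m) (c := c) (rho := dyad r0 k) h0 hc gk _ _ _ _) _.
  - exact: dyad_gt0.
  - by clra.
  - move=> x; rewrite normrM -[leRHS]mul1r; apply: ler_pM => //.
      by rewrite ger0_norm; case/andP: (eta_itv c (dyad r0 k.+1) x).
    by apply: le_trans (ler_normB _ _) _; have := vm x; have := vm y; rewrite -!/(v _); clra.
  - by move=> x; rewrite e2 => hx; rewrite eta_eq0 ?mul0r// ltW.
  by rewrite dyad_powR; apply: eqW; rewrite /D /dual_bound; ring.
have := scalar_ball_energy_hole_filling ok gv sp D0 HD; rewrite -e2 -/th => /le_trans; apply; rewrite lerD2l.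
rewrite (_ : 4 * Lam * D = 16 * Lam * dual_bound * q0 ^+ k); last by rewrite /D; ring.
apply: ler_wpM2r => //; have := mulr_ge0 (ltW Lp) P0; have := mulr_ge0 (ltW Lp) (sqr_ge0 m).
by move: dual_bound => Z; clra.
Qed.

Lemma increment_energy_scales k :
  L1le mu2 (fun z => ind (`|z.1 - c| <= dyad r0 k) * en v z) (A * (m ^+ 2 + dual_bound) * p ^+ k).
Proof.
have [_ L1 _ _] := ok; have /andP[t0 t1] := hole_ratio_itv; have /andP[q00 q01] := scale_ratio_itv.
have Y0 : 0 <= m ^+ 2 + dual_bound by rewrite addr_ge0 ?sqr_ge0 ?dual_bound_ge0.
have X1 : 0 <= 192 * Lam ^+ 2 * (m ^+ 2 + dual_bound) by rewrite mulr_ge0// mulr_ge0 ?sqr_ge0.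
have D1 : 0 <= 32 * Lam * (m ^+ 2 + dual_bound) by rewrite mulr_ge0//; clra.
have start : scalar_ball_energy v c (dyad r0 0) <= 192 * Lam ^+ 2 * (m ^+ 2 + dual_bound).
  by rewrite dyad0 scalar_ball_energy_le.
have := geometric_decay t0 t1 q00 q01 D1 X1 start scalar_ball_energy_step k; rewrite -/p0 -/p.
move=> H; apply: L1leW (L1le_scalar_ball_energy (admissible_increment h) c (dyad r0 k)).
by apply: le_trans H _; apply: eqW; rewrite /A; ring.
Qed.

End Ball.

Lemma increment_continuous x e : 0 < e -> exists2 del, 0 < del & forall z, `|z - x| <= del -> `|v z - v x| <= e.
Proof.
move=> e0; have e2 : 0 < e / 2 by clra.
have [d1 d10 near_x] := cont x e2; have [d2 d20 near_xh] := cont (x + h) e2.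
exists (Num.min d1 d2); first by rewrite lt_min d10.
move=> z; rewrite le_min => /andP[z1 z2]; rewrite /v /increment.
have := near_x _ z1; have := near_xh (z + h); rewrite (_ : z + h - (x + h) = z - x); last by ring.
move=> /(_ z2) a1 a2.
have -> : W (z + h) - W z - (W (x + h) - W x) = (W (z + h) - W (x + h)) - (W z - W x) by ring.
by apply: le_trans (ler_normB _ _) _; clra.
Qed.

Lemma second_increment_le n x : 12 * (2 ^+ n * h) <= d -> `|x - x0| + 2 * h <= r1 ->
  `|increment h (x + h) - increment h x|
    <= (36 / (1 - q) + 6) * Num.sqrt A * (m + G * (3 * (2 ^+ n * h)) `^ sig) * q ^+ n.
Proof.
move=> hd hx; have /andP[qp ql] := sqrt_rate_itv; have A0 := energy_const_gt0.
pose r0 := 3 * (2 ^+ n * h); have two : 0 < 2 ^+ n :> R by rewrite exprn_gt0.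
have r00 : 0 < r0 by rewrite /r0 !mulr_gt0.
have r0d : 4 * r0 <= d by rewrite /r0; clra.
have Gr : 0 <= G * r0 `^ sig by rewrite mulr_ge0// powR_ge0.
pose S := Num.sqrt A * (m + G * r0 `^ sig).
have S0 : 0 < S by rewrite mulr_gt0 ?sqrtr_gt0// ltr_wpDr.
have hn : dyad (r0 / 3) n = h by rewrite /dyad /r0; field; exact: lt0r_neq0.
have d3 k : 3 * dyad (r0 / 3) k = dyad r0 k by rewrite /dyad; field; rewrite lt0r_neq0// exprn_gt0.
have energy c : `|c - x0| + h <= r1 ->
    forall k, L1le mu2 (fun z => ind (`|z.1 - c| <= 3 * dyad (r0 / 3) k) * en v z) ((S * q ^+ k) ^+ 2).
  move=> hc k; rewrite d3; apply: L1leW (increment_energy_scales r00 r0d hc k).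
  rewrite (exprMn _ S) (exprMn _ (Num.sqrt A)) sqr_sqrtr ?(ltW A0)// -exprM mulnC exprM sqrt_rate_sqr.
  apply: ler_wpM2r; first by rewrite exprn_ge0// -sqrt_rate_sqr sqr_ge0.
  apply: ler_wpM2l; first exact: ltW.
  have := mulr_ge0 (ltW m0) Gr; have := sqr_ge0 (G * r0 `^ sig).
  by rewrite -mulrA; move: (G * r0 `^ sig) => X; clra.
have [mv _ _] := admissible_increment h.
have hx1 : `|x - x0| + h <= r1 by clra.
have hx2 : `|x + h - x0| + h <= r1.
  have : `|x + h - x0| <= `|x - x0| + `|h| by rewrite addrAC; exact: ler_normD.
  by rewrite (gtr0_norm h0); clra.
have xy : `|x + h - x| <= dyad (r0 / 3) n by rewrite hn addrC addKr gtr0_norm.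
have r3 : 0 < r0 / 3 by rewrite divr_gt0.
have := increment_le_scales mv vm r3 S0 qp ql increment_continuous xy (energy _ hx2) (energy _ hx1).
by rewrite /S -/v -/r0 -!mulrA.
Qed.

End OneIncrement.

Lemma increment_le2 h x : `|increment h x| <= 2.
Proof. by apply: le_trans (ler_normB _ _) _; have := W1 (x + h); have := W1 x; clra. Qed.

Definition modulus h := sup [set y | exists x, y = `|increment h x|].

Lemma has_sup_increment h : has_sup [set y | exists x, y = `|increment h x|].
Proof. by split; [exists `|increment h 0|, 0|exists 2 => _ [x ->]; exact: increment_le2]. Qed.

Lemma increment_le_modulus h x : `|increment h x| <= modulus h.
Proof. by apply: ub_le_sup; [case: (has_sup_increment h)|exists x]. Qed.

Lemma modulus_le h M : (forall x, `|increment h x| <= M) -> modulus h <= M.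
Proof. by move=> H; apply: ge_sup; [case: (has_sup_increment h)|move=> _ [x ->]]. Qed.

Lemma modulus_ge0 h : 0 <= modulus h.
Proof. exact: le_trans (normr_ge0 _) (increment_le_modulus h 0). Qed.

Lemma powR2_itv : 1 <= (2 : R) `^ sig < 2.
Proof.
apply/andP; split; first by apply: powR_ge1; clra.
have l2 : 0 < ln (2 : R) by rewrite ln_gt0; clra.
by rewrite -ltr_ln ?posrE ?powR_gt0// ln_powR; cnra.
Qed.

(* Choosing [n] large makes the factor [q ^+ n] of [second_increment_le] smaller than any prescribed [del]. *)
Lemma exists_second_increment_le del : 0 < del -> exists h1 K, [/\ 0 < h1, 0 <= K &
  forall h m x, 0 < h -> h <= h1 -> 0 < m -> (forall x, `|increment h x| <= m) ->
    `|increment h (x + h) - increment h x| <= del * m + K * h `^ sig].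
Proof.
move=> del0; have /andP[qp ql] := sqrt_rate_itv.
have B0 : 0 <= (36 / (1 - q) + 6) * Num.sqrt A.
  by rewrite mulr_ge0 ?sqrtr_ge0// addr_ge0// divr_ge0// subr_ge0 ltW.
have [n /(_ n (leqnn n)) hn] := exists_mul_exp_le B0 (ltW qp) ql del0.
have two : 0 < 2 ^+ n :> R by rewrite exprn_gt0.
pose h1 := Num.min (d / (12 * 2 ^+ n)) ((r1 - rb) / 5).
pose K := del * (G * (3 * 2 ^+ n) `^ sig).
have K0 : 0 <= K by rewrite mulr_ge0 ?(ltW del0)// mulr_ge0 ?powR_ge0.
exists h1, K; split => //; first by rewrite lt_min divr_gt0 ?mulr_gt0//=; clra.
move=> h m x h0 hh m0 vm; have R0 : 0 <= del * m + K * h `^ sig.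
  by apply: addr_ge0; apply: mulr_ge0; rewrite ?powR_ge0 ?K0// ltW.
move: hh; rewrite le_min ler_pdivlMr ?mulr_gt0// => /andP[hd hr].
have [hx|hx] := leP (`|x - x0| + 2 * h) r1.
  have hd' : 12 * (2 ^+ n * h) <= d by clra.
  apply: le_trans (second_increment_le h0 m0 vm hd' hx) _.
  rewrite mulrA powRM_pos ?(ltW h0) ?mulr_gt0// mulrAC; set X := m + _.
  have X0 : 0 <= X by rewrite /X addr_ge0 ?(ltW m0)// !mulr_ge0 ?powR_ge0.
  by apply: le_trans (ler_wpM2r X0 hn) _; apply: eqW; rewrite /X /K; ring.
have far t : 0 <= t -> t <= 2 * h -> W (x + t) = 0.
  move=> t0 t2; apply: Wsupp; have := ler_normD (x + t - x0) (- t).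
  by rewrite (_ : x + t - x0 - t = x - x0); [rewrite normrN (ger0_norm t0); clra|ring].
have e0 : W x = 0 by have := far 0; rewrite addr0; apply; clra.
have e1 : W (x + h) = 0 by apply: far; clra.
have e2 : W (x + h + h) = 0 by rewrite -addrA; apply: far; clra.
by rewrite /increment e0 e1 e2 !subrr normr0.
Qed.

Lemma modulus_recursion del K h : 0 < del -> del <= 1 / 2 -> 0 <= K -> 0 < h ->
  (forall m x, 0 < m -> (forall x, `|increment h x| <= m) ->
    `|increment h (x + h) - increment h x| <= del * m + K * h `^ sig) ->
  modulus h <= (2 - del)^-1 * modulus (2 * h) + K * h `^ sig.
Proof.
move=> del0 del1 K0 h0 second; have KP := mulr_ge0 K0 (powR_ge0 h sig).
have main : modulus h <= modulus (2 * h) / 2 + (del * modulus h + K * h `^ sig) / 2.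
  apply/ler_addgt0Pl => e e0; apply: modulus_le => x.
  have fm : 0 < modulus h + e by have := modulus_ge0 h; clra.
  have vm y : `|increment h y| <= modulus h + e by have := increment_le_modulus h y; clra.
  have := second _ x fm vm => H.
  have -> : increment h x = increment (2 * h) x / 2 - (increment h (x + h) - increment h x) / 2.
    by rewrite /increment (_ : x + 2 * h = x + h + h); [field|ring].
  apply: le_trans (ler_normB _ _) _; rewrite !normrM (ger0_norm (_ : 0 <= 2^-1)) ?invr_ge0//.
  have de : del * e <= e by rewrite ler_piMl//; clra.
  by have := increment_le_modulus (2 * h) x; clra.
have d2 : 0 < 2 - del by clra.
rewrite -(ler_pM2l d2) mulrDr mulrA mulfV ?mul1r ?lt0r_neq0//.
have KP2 : K * h `^ sig <= (2 - del) * (K * h `^ sig) by rewrite ler_peMl//; clra.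
by clra.
Qed.

Lemma holder_of_modulus B h1 : 0 < B -> 0 < h1 -> (forall h, 0 < h -> h <= h1 -> modulus h <= B * h `^ sig) ->
  forall x y, `|W x - W y| <= (B + 2 / h1 `^ sig) * `|x - y| `^ sig.
Proof.
move=> B0 h10 hB x y; wlog xy : x y / x <= y.
  move=> H; have [h|h] := leP x y; first exact: H.
  by rewrite distrC (distrC x); apply: H; exact: ltW.
have far0 : 0 <= 2 / h1 `^ sig by rewrite divr_ge0// powR_ge0.
have [->|nxy] := eqVneq x y; first by rewrite !subrr normr0 mulr_ge0 ?powR_ge0// addr_ge0// ltW.
have h0 : 0 < y - x by rewrite subr_gt0 lt_neqAle nxy.
rewrite distrC (distrC x) (gtr0_norm h0) (_ : W y - W x = increment (y - x) x);
  last by rewrite /increment addrCA subrr addr0.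
have P0 := powR_ge0 (y - x) sig; apply: le_trans (increment_le_modulus _ _) _.
have [hh|hh] := leP (y - x) h1.
  by apply: le_trans (hB _ h0 hh) _; rewrite ler_wpM2r// lerDl.
apply: (@le_trans _ _ 2); first by apply: modulus_le => z; exact: increment_le2.
rewrite mulrDl; apply: ler_wpDl; first by rewrite mulr_ge0// ltW.
by rewrite mulrAC ler_pdivlMr ?powR_gt0// ler_wpM2l//; apply: powR_le_base; exact: ltW.
Qed.

Lemma linear_holder : exists C, forall x y, `|W x - W y| <= C * `|x - y| `^ sig.
Proof.
have /andP[two1 two2] := powR2_itv; pose del := (2 - 2 `^ sig) / 2.
have del0 : 0 < del by rewrite /del; clra.
have del1 : del <= 1 / 2 by rewrite /del; clra.
have [h1 [K [h10 K0 second]]] := exists_second_increment_le del0.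
have rec h : 0 < h -> 2 * h <= h1 -> modulus h <= (2 - del)^-1 * modulus (2 * h) + K * h `^ sig.
  by move=> h0 hh; apply: modulus_recursion => // m x; apply: second; clra.
have ratio : (2 - del)^-1 * 2 `^ sig < 1 by rewrite mulrC ltr_pdivrMr /del; clra.
have ratio0 : 0 <= (2 - del)^-1 by rewrite invr_ge0; clra.
have [B B0 HB] := power_decay ratio0 K0 sig0 h10 (ler0n R 2) (ltr1n R 2) ratio.
eexists; apply: (holder_of_modulus B0 h10) => h h0 hh; apply: HB => // t t0 _.
by apply: modulus_le => x; exact: increment_le2.
Qed.

End Linear.

Section Tail.
Variable R : realType.
Local Notation mu := (@lebesgue_measure R).
Local Notation mu2 := (mu \x mu)%E.
Implicit Types (s rho : R).

Definition tail_const s : R := 4 / (1 - 2 `^ (s - 1)) + 2.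

Lemma powR2_lt1 s : s < 1 -> 2 `^ (s - 1) < 1 :> R.
Proof.
move=> s1; have l2 : 0 < ln (2 : R) by rewrite ln_gt0; clra.
by rewrite -ltr_ln ?posrE ?powR_gt0// ln_powR ln1; cnra.
Qed.

Lemma tail_const_ge0 s : s < 1 -> 0 <= tail_const s.
Proof. by move=> /powR2_lt1 h; rewrite /tail_const addr_ge0// divr_ge0// subr_ge0 ltW. Qed.

Lemma powR_sub1 (x s : R) : 0 < x -> x `^ (s - 1) = x `^ s / x.
Proof.
move=> x0; rewrite powRD; last by rewrite (gt_eqF x0) implybT.
by rewrite powR_inv1// ltW.
Qed.

Definition tail_majorant s rho K (z : R * R) :=
  \sum_(0 <= k < K) (2 ^+ k.+1 * rho) `^ s * Jfar (2 ^+ k * rho) z + Jfar 1 z.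

Lemma tail_majorant_ge0 s rho K z : 0 <= tail_majorant s rho K z.
Proof.
by rewrite addr_ge0 ?Jfar_ge0//; apply: sumr_ge0 => k _; rewrite mulr_ge0 ?powR_ge0 ?Jfar_ge0.
Qed.

Lemma measurable_tail_majorant s rho K : measurable_fun setT (tail_majorant s rho K).
Proof.
apply: measurable_funD; last exact: measurable_Jfar.
by apply: measurable_sum => k; apply: measurable_funM; [exact: measurable_cst|exact: measurable_Jfar].
Qed.

Lemma tail_weight s rho k : 0 < rho -> (2 ^+ k.+1 * rho) `^ s * (2 / (2 ^+ k * rho))
  = 2 * 2 `^ s * rho `^ (s - 1) * (2 `^ (s - 1)) ^+ k.
Proof.
move=> r0; rewrite exprS -mulrA powRM_pos//; last by rewrite mulr_ge0 ?exprn_ge0// ltW.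
have -> : (2 `^ (s - 1)) ^+ k = (2 ^+ k) `^ (s - 1) :> R.
  by rewrite -(powR_mulrn k (powR_ge0 _ _)) -[X in _ = X `^ _](powR_mulrn k (ler0n _ _)) powRAC.
rewrite -(mulrA (2 * 2 `^ s)) (_ : _ `^ (s - 1) * _ = (2 ^+ k * rho) `^ s / (2 ^+ k * rho)); first by ring.
by rewrite mulrC -powRM ?exprn_ge0// ?(ltW r0)// powR_sub1// mulr_gt0// exprn_gt0.
Qed.

Lemma L1le_tail_majorant s rho K x : 0 <= s -> s < 1 -> 0 < rho -> rho <= 1 ->
  L1le mu (fun y => tail_majorant s rho K (x, y)) (tail_const s * rho `^ (s - 1)).
Proof.
move=> s0 s1 r0 r1; have t1 := powR2_lt1 s1; have t0 : 0 <= 2 `^ (s - 1) :> R by exact: powR_ge0.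
have r2 k : 0 < 2 ^+ k * rho by rewrite mulr_gt0// exprn_gt0.
have hs := @L1le_sum _ _ _ mu _ (index_iota 0 K) xpredT _ _
  (fun k _ => L1leZ ((2 ^+ k.+1 * rho) `^ s) (L1le_Jfar x (r2 k))).
apply: (@L1leW _ _ _ _ _ _ _ _ (L1leD hs (L1le_Jfar x ltr01))).
have rs : 1 <= rho `^ (s - 1) by rewrite -[leLHS](@powRr0 _ rho); apply: powR_le_exponent => //; clra.
rewrite (eq_bigr (fun k => 2 * 2 `^ s * rho `^ (s - 1) * (2 `^ (s - 1)) ^+ k)) => [|k _]; last first.
  by rewrite ger0_norm ?powR_ge0// tail_weight.
rewrite -mulr_sumr; have s2 : 2 `^ s <= 2 :> R by rewrite -[leRHS](@powRr1 _ 2)//; apply: ler_powR; clra.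
have sum0 : 0 <= \sum_(0 <= k < K) (2 `^ (s - 1)) ^+ k :> R by apply: sumr_ge0 => k _; exact: exprn_ge0.
have rs0 := powR_ge0 rho (s - 1).
rewrite /tail_const [in leRHS]mulrDl divr1; apply: lerD; last by clra.
rewrite mulrAC; apply: ler_pM => //; first by rewrite !mulr_ge0// powR_ge0.
by apply: ler_pM => //; [clra|exact: geometric_sum_le].
Qed.

Lemma tail_majorant_ge s rho K x y : 0 <= s -> 0 < rho -> 1 <= 2 ^+ K * rho -> rho <= `|x - y| ->
  Num.min 1 (`|x - y| `^ s) / (x - y) ^+ 2 <= tail_majorant s rho K (x, y).
Proof.
move=> s0 r0 hK h; have isq := inv_sqr_ge0 (x - y).
have w0 k : 0 <= (2 ^+ k.+1 * rho) `^ s * Jfar (2 ^+ k * rho) (x, y) by rewrite mulr_ge0 ?powR_ge0 ?Jfar_ge0.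
have [hl|hl] := leP 1 `|x - y|.
  apply: ler_wpDl; first exact: sumr_ge0.
  by rewrite /Jfar/= hl /ind mul1r -[leRHS]mul1r; apply: ler_wpM2r => //; rewrite ge_min lexx.
apply: ler_wpDr; first exact: Jfar_ge0.
have exP : exists n, `|x - y| < 2 ^+ n * rho by exists K; clra.
case: (ex_minnP exP) => -[|k] Pk mink; first by move: Pk; rewrite expr0 mul1r; clra.
have lk : 2 ^+ k * rho <= `|x - y| by rewrite leNgt; apply/negP => /mink; rewrite ltnn.
have kK : (k < K)%N by apply: mink; clra.
apply: le_trans (term_le_sum w0 kK); rewrite /Jfar/= lk /ind mul1r; apply: ler_wpM2r => //.
by rewrite ge_min; apply/orP; right; apply: powR_le_base => //; exact: ltW.
Qed.

Lemma tail_kernel s rho : 0 <= s -> s < 1 -> 0 < rho -> rho <= 1 ->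
  exists J : R * R -> R, [/\ measurable_fun setT J, forall z, 0 <= J z, forall x y, J (x, y) = J (y, x),
    forall x, L1le mu (fun y => J (x, y)) (tail_const s * rho `^ (s - 1)) &
    forall x y, rho <= `|x - y| -> Num.min 1 (`|x - y| `^ s) / (x - y) ^+ 2 <= J (x, y)].
Proof.
move=> s0 s1 r0 r1; have [K /(_ K (leqnn K)) hK] := dyad_small (ltr01 : 0 < (1 : R)) r0.
have {}hK : 1 <= 2 ^+ K * rho by move: hK; rewrite /dyad ltr_pdivrMr ?exprn_gt0// mulrC; exact: ltW.
exists (tail_majorant s rho K); split=> [||x y|x|x y].
- exact: measurable_tail_majorant.
- exact: tail_majorant_ge0.
- by rewrite /tail_majorant Jfar_sym; congr (_ + _); apply: eq_bigr => k _; rewrite Jfar_sym.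
- exact: L1le_tail_majorant.
- exact: tail_majorant_ge.
Qed.

End Tail.
Section HolderEnergy.
Variable R : realType.
Local Notation mu := (@lebesgue_measure R).
Local Notation mu2 := (mu \x mu)%E.
Variables (a W : R -> R) (Lam x0 r1 G sg tau d C : R).
Implicit Types (phi : R -> R) (c rho h m : R).
Hypotheses (ok : elliptic_kernel a Lam) (gW : admissible W) (W1 : forall x, `|W x| <= 1)
  (G0 : 0 <= G) (sg0 : 0 < sg) (sg1 : 2 * sg < 1) (sgt : sg <= tau) (d0 : 0 < d) (d1 : d <= 1)
  (dual : forall phi m c rho, admissible phi -> 0 < rho -> rho <= d -> `|c - x0| <= r1 ->
     (forall x, `|phi x| <= m) -> (forall x, rho < `|x - c| -> phi x = 0) ->
     `|form a W phi| <= m * G * rho `^ tau)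
  (Hol : forall x y, `|W x - W y| <= C * `|x - y| `^ sg).

Let Cosc := Num.max 2 C.

Lemma osc_const_ge2 : 2 <= Cosc. Proof. by rewrite le_max lexx. Qed.

Lemma increment_le_min x y : `|W x - W y| <= Cosc * Num.min 1 (`|x - y| `^ sg).
Proof.
have [h|h] := leP 1 (`|x - y| `^ sg).
  rewrite mulr1; apply: le_trans osc_const_ge2; apply: le_trans (ler_normB _ _) _.
  by have := W1 x; have := W1 y; clra.
by apply: le_trans (Hol x y) _; apply: ler_wpM2r; [exact: powR_ge0|rewrite le_max lexx orbT].
Qed.

Section Ball.
Variables (c rho : R).
Hypotheses (hc : `|c - x0| <= r1) (rho0 : 0 < rho) (rhod : 4 * rho <= d).

Let v x := W x - W c.
Let q := (4 * rho) `^ sg.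

Lemma radius_gt0 : 0 < 2 * rho. Proof. by clra. Qed.

Lemma sub_const_le x : `|x - c| <= 4 * rho -> `|v x| <= Cosc * q.
Proof.
move=> hx; apply: le_trans (increment_le_min x c) _; apply: ler_wpM2l; first by have := osc_const_ge2; clra.
by rewrite ge_min; apply/orP; right; apply: powR_le_base => //; exact: ltW.
Qed.

Lemma admissible_sub_const : admissible v.
Proof.
case: gW => mW [M hM] [P hP]; split; first by rewrite /v; mes.
  by exists (M + M) => x; apply: le_trans (ler_normB _ _) _; exact: lerD.
by exists P; apply: eq_L1le hP => z; rewrite /en /v; congr (_ ^+ 2 / _); ring.
Qed.

Lemma osc_factor_sqr_le : q * q <= 4 * rho `^ (2 * sg).
Proof.
rewrite /q -powRD; last by rewrite (gt_eqF (mulr_gt0 (ltr0n R 4) rho0)) implybT.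
rewrite (_ : sg + sg = 2 * sg); last by ring.
rewrite powRM_pos ?(ltW rho0)//; apply: ler_wpM2r; first exact: powR_ge0.
by rewrite -[leRHS](@powRr1 _ 4)//; apply: ler_powR; clra.
Qed.

Lemma form_sqr_eta_le : form a v (fun x => eta c (2 * rho) x ^+ 2 * v x) <= Cosc * G * (q * q).
Proof.
have ge := admissible_eta c radius_gt0; have q0 : 0 <= q := powR_ge0 _ _.
have C0 : 0 <= Cosc by have := osc_const_ge2; clra.
have rr : 2 * (2 * rho) = 4 * rho by ring.
have -> : form a v (fun x => eta c (2 * rho) x ^+ 2 * v x) = form a W (fun x => eta c (2 * rho) x ^+ 2 * v x).
  by apply: eq_Rint => z; congr (_ * _ * _); rewrite /v; ring.
have gev : admissible (fun x => eta c (2 * rho) x ^+ 2 * v x)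
  by exact: admissibleM (admissibleM ge ge) admissible_sub_const.
apply: le_trans (ler_norm _) _; apply: le_trans (dual (m := Cosc * q) (c := c) (rho := 4 * rho) gev _ _ hc _ _) _.
- by rewrite mulr_gt0.
- by [].
- move=> x; rewrite normrM; have [hx|hx] := leP `|x - c| (4 * rho); last first.
    by rewrite eta_eq0 ?rr ?expr0n/= ?normr0 ?mul0r ?mulr_ge0 ?radius_gt0// ltW.
  rewrite -[leRHS]mul1r; apply: ler_pM => //; last exact: sub_const_le.
  by rewrite ger0_norm ?sqr_ge0// expr_le1//; case/andP: (eta_itv c (2 * rho) x).
- by move=> x hx; rewrite eta_eq0 ?rr ?expr0n ?mul0r ?radius_gt0//= ltW.
rewrite (_ : Cosc * q * G * _ = Cosc * G * (q * (4 * rho) `^ tau)); last by ring.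
apply: ler_wpM2l; first exact: mulr_ge0.
by apply: ler_wpM2l => //; apply: powR_le_exponent; clra.
Qed.

Section TailMajorant.
Variable J : R * R -> R.
Hypotheses (mJ : measurable_fun setT J) (J0 : forall z, 0 <= J z) (sJ : forall x y, J (x, y) = J (y, x))
  (hJ : forall x, L1le mu (fun y => J (x, y)) (tail_const sg * (2 * rho) `^ (sg - 1)))
  (Jb : forall x y, 2 * rho <= `|x - y| -> Num.min 1 (`|x - y| `^ sg) / (x - y) ^+ 2 <= J (x, y)).

Let Q z := Cosc ^+ 2 * q * (2 * q * Jmix (2 * rho) z + J z).

Lemma min_en_eta_le x y :
  Num.min 1 (`|x - y| `^ sg) * en (eta c (2 * rho)) (x, y) <= q * Jmix (2 * rho) (x, y) + J (x, y).
Proof.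
have Jm := Jmix_ge0 (2 * rho) (x, y); have mn : 0 <= Num.min 1 (`|x - y| `^ sg) by rewrite le_min ler01 powR_ge0.
have [hl|hl] := leP `|x - y| (2 * rho).
  apply: ler_wpDr; first exact: J0.
  apply: ler_pM => //; [exact: en_ge0| |exact: eta_increment_le radius_gt0].
  by rewrite ge_min; apply/orP; right; apply: powR_le_base => //; [clra|exact: ltW].
apply: ler_wpDl; first by rewrite mulr_ge0 ?powR_ge0.
apply: le_trans (Jb (ltW hl)); apply: ler_wpM2l => //.
rewrite /en/= -[leRHS]mul1r; apply: ler_wpM2r; first exact: inv_sqr_ge0.
by have := eta_itv c (2 * rho) x; have := eta_itv c (2 * rho) y; cnra.
Qed.

Lemma product_energy_le_near x y : `|x - c| <= 4 * rho -> `|v x * v y| * en (eta c (2 * rho)) (x, y) <= Q (x, y).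
Proof.
move=> hx; have vx := sub_const_le hx; have C0 : 0 <= Cosc by have := osc_const_ge2; clra.
have q0 : 0 <= q := powR_ge0 _ _; set mn := Num.min 1 (`|x - y| `^ sg).
have vy : `|v y| <= Cosc * q + Cosc * mn.
  have -> : v y = v x - (W x - W y) by rewrite /v; ring.
  by apply: le_trans (ler_normB _ _) _; apply: lerD => //; exact: increment_le_min.
rewrite normrM; apply: (@le_trans _ _ (Cosc * q * (Cosc * q + Cosc * mn) * en (eta c (2 * rho)) (x, y))).
  by apply: ler_wpM2r; [exact: en_ge0|exact: ler_pM].
rewrite (_ : _ * en _ _ = Cosc ^+ 2 * q * (q * en (eta c (2 * rho)) (x, y) + mn * en (eta c (2 * rho)) (x, y)));
  last by ring.
apply: ler_wpM2l; first by rewrite mulr_ge0// sqr_ge0.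
have := ler_wpM2l q0 (eta_increment_le c x y radius_gt0); have := min_en_eta_le x y.
by rewrite -/mn /en/=; clra.
Qed.

Lemma L1le_product_energy :
  L1le mu2 (fun z => `|v z.1 * v z.2| * en (eta c (2 * rho)) z) (8 * Cosc ^+ 2 * (8 + tail_const sg) * (q * q)).
Proof.
have C0 : 0 <= Cosc by have := osc_const_ge2; clra.
have q0 : 0 <= q := powR_ge0 _ _; have r2 := radius_gt0; have r4 : 0 <= 4 * rho by clra.
have [mv _ _] := admissible_sub_const; have me := measurable_en (measurable_eta c (2 * rho)).
have mM := measurable_Jmix (2 * rho).
have mQ : measurable_fun setT Q by rewrite /Q; mes.
have Cq0 : 0 <= Cosc ^+ 2 * q by rewrite mulr_ge0 ?sqr_ge0.
have Q0 z : 0 <= Q z by rewrite mulr_ge0// addr_ge0// mulr_ge0 ?Jmix_ge0// mulr_ge0.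
have sQ x y : Q (x, y) = Q (y, x) by rewrite /Q Jmix_sym sJ.
have hQ x : L1le mu (fun y => Q (x, y)) (Cosc ^+ 2 * q * ((8 + tail_const sg) * (q / (2 * rho)))).
  have := L1leZ (Cosc ^+ 2 * q) (L1leD (L1leZ (2 * q) (L1le_Jmix x r2)) (hJ x)).
  apply: L1leW; rewrite !ger0_norm ?mulr_ge0//; apply: ler_wpM2l => //; rewrite [in leRHS]mulrDl; apply: lerD.
    by apply: eqW; field; exact: lt0r_neq0.
  apply: ler_wpM2l; first by apply: tail_const_ge0; clra.
  by rewrite powR_sub1//; apply: ler_wpM2r; [rewrite invr_ge0 ltW|apply: powR_le_base; clra].
apply: L1leW (L1le_supported (c := c) _ mQ sQ hQ r4 _ _) => [||x y|x y hx hy].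
- by apply: eqW; field; exact: lt0r_neq0.
- by mes.
- rewrite ger0_norm; last by nneg.
  have [hx|hx] := leP `|x - c| (4 * rho); first exact: product_energy_le_near.
  have [hy|hy] := leP `|y - c| (4 * rho).
    by have := product_energy_le_near x hy; rewrite -(sQ x y) (mulrC (v y)) en_swap.
  by rewrite /en/= !eta_eq0 ?subrr ?expr0n/= ?mul0r ?mulr0//; clra.
- by rewrite /en/= !eta_eq0 ?subrr ?expr0n/= ?mul0r ?mulr0//; clra.
Qed.

End TailMajorant.

Lemma L1le_en_eta_sub_const : L1le mu2 (en (fun x => eta c (2 * rho) x * v x))
  (Lam * (4 * (Cosc * G) + Lam * (32 * Cosc ^+ 2 * (8 + tail_const sg))) * rho `^ (2 * sg)).
Proof.
have [_ L1 _ _] := ok; have Lp : 0 <= Lam by clra.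
have C0 : 0 <= Cosc by have := osc_const_ge2; clra.
have sl1 : sg < 1 by clra.
have r21 : 2 * rho <= 1 by clra.
have t0 := tail_const_ge0 sl1.
have [J [mJ J0 sJ hJ Jb]] := tail_kernel (ltW sg0) sl1 radius_gt0 r21.
apply: L1leW (caccioppoli ok admissible_sub_const radius_gt0 form_sqr_eta_le (L1le_product_energy mJ J0 sJ hJ Jb)).
rewrite -[leRHS]mulrA; apply: ler_wpM2l => //.
have CG : 0 <= Cosc * G by exact: mulr_ge0.
have CJ : 0 <= Lam * (8 * Cosc ^+ 2 * (8 + tail_const sg)) by rewrite !mulr_ge0 ?sqr_ge0// addr_ge0.
by have := ler_wpM2l CG osc_factor_sqr_le; have := ler_wpM2l CJ osc_factor_sqr_le; clra.
Qed.

Lemma increment_sqr_le_min x y : (W x - W y) ^+ 2 <= Cosc ^+ 2 * Num.min 1 (`|x - y| `^ (2 * sg)).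
Proof.
apply: le_trans (norm_le_sqr (increment_le_min x y)) _; rewrite exprMn; apply: ler_wpM2l; first exact: sqr_ge0.
rewrite mulrC powRrM powR_mulrn ?powR_ge0//; move: (`|x - y| `^ sg) (powR_ge0 `|x - y| sg) => t t0.
have [h|h] := leP 1 t; first by rewrite expr1n le_min lexx; apply: exprn_ege1.
by rewrite le_min lexx andbT expr_le1// ltW.
Qed.

Lemma L1le_holder_energy_ball : L1le mu2 (fun z => ind (`|z.1 - c| <= rho) * en W z)
  ((Lam * (4 * (Cosc * G) + Lam * (32 * Cosc ^+ 2 * (8 + tail_const sg))) + Cosc ^+ 2 * (2 * tail_const (2 * sg)))
    * rho `^ (2 * sg)).
Proof.
have s20 : 0 <= 2 * sg by clra.
have r11 : rho <= 1 by clra.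
have [mW _ _] := gW; have [J [mJ J0 sJ hJ Jb]] := tail_kernel s20 sg1 rho0 r11.
have far := L1leZ (Cosc ^+ 2) (L1le_kernel_fst mJ hJ (L1le_ball c (ltW rho0))).
apply: L1le_domW2 (L1leD L1le_en_eta_sub_const far) _ _ _ => [||x y /=].
- rewrite (ger0_norm (sqr_ge0 Cosc)) powR_sub1// [leRHS]mulrDl lerD2l.
  by apply: eqW; field; exact: lt0r_neq0.
- by have := measurable_en mW => ?; mes.
have F0 : 0 <= Cosc ^+ 2 * (ind (`|c - x| <= rho) * J (x, y)).
  by apply: mulr_ge0; [exact: sqr_ge0|apply: mulr_ge0; [exact: ind_ge0|exact: J0]].
have E0 := en_ge0 (fun x => eta c (2 * rho) x * v x) (x, y).
rewrite ger0_norm; last by nneg.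
have [hx|hx] := leP `|x - c| rho; last by rewrite {1}/ind mul0r addr_ge0.
rewrite {1}/ind mul1r; have [hy|hy] := leP `|y - c| (2 * rho).
  apply: ler_wpDr => //; apply: eqW; rewrite /en/= !eta_eq1 ?mul1r ?radius_gt0//; last by clra.
  by rewrite /v; congr (_ ^+ 2 / _); ring.
apply: ler_wpDl => //; rewrite (distrC c) hx /ind mul1r.
have hl : rho <= `|x - y| by have := ler_distD x y c; rewrite (distrC y x); clra.
apply: le_trans (ler_wpM2l (sqr_ge0 Cosc) (Jb _ _ hl)); rewrite /en/= mulrA.
by apply: ler_wpM2r; [exact: inv_sqr_ge0|exact: increment_sqr_le_min].
Qed.

End Ball.

Lemma holder_energy : exists2 A, 0 <= A & forall c rho, `|c - x0| <= r1 -> 0 < rho -> 4 * rho <= d ->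
  L1le mu2 (fun z => ind (`|z.1 - c| <= rho) * en W z) (A * rho `^ (2 * sg)).
Proof.
have [_ L1 _ _] := ok; have C0 : 0 <= Cosc by have := osc_const_ge2; clra.
have sl1 : sg < 1 by clra.
have k1 := tail_const_ge0 sl1; have k2 := tail_const_ge0 sg1.
eexists; last by move=> c rho; exact: L1le_holder_energy_ball.
apply: addr_ge0; last by rewrite !mulr_ge0 ?sqr_ge0.
apply: mulr_ge0; first by clra.
have CG := mulr_ge0 C0 G0; apply: addr_ge0; first by clra.
apply: mulr_ge0; first by clra.
by apply: mulr_ge0; [rewrite mulr_ge0 ?sqr_ge0|rewrite addr_ge0].
Qed.

End HolderEnergy.

Section HolderExponent.
Variable R : realType.
Implicit Types (f : R -> R) (t s C : R).

Lemma holder_exponent_le f C s t : 0 < s -> s <= t -> (forall x, `|f x| <= 1) ->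
  (forall x y, `|f x - f y| <= C * `|x - y| `^ t) -> forall x y, `|f x - f y| <= (`|C| + 2) * `|x - y| `^ s.
Proof.
move=> s0 st f1 hf x y; have P0 := powR_ge0 `|x - y| s; have CP := mulr_ge0 (normr_ge0 C) P0.
have [->|xy] := eqVneq x y; first by rewrite !subrr normr0 mulr_ge0 ?powR_ge0// addr_ge0.
have [h|h] := leP `|x - y| 1.
  apply: le_trans (hf x y) _; apply: le_trans (ler_wpM2r (powR_ge0 _ _) (_ : C <= `|C| + 2)) _;
    first by have := ler_norm C; clra.
  apply: ler_wpM2l; first by rewrite addr_ge0.
  by apply: powR_le_exponent; rewrite ?normr_gt0 ?subr_eq0.
apply: (@le_trans _ _ 2).
  by apply: le_trans (ler_normB _ _) _; have := f1 x; have := f1 y; clra.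
by have := powR_ge1 (ltW h) (ltW s0); clra.
Qed.

Lemma uniform_holder_const N (v : 'I_N -> R -> R) x0 r t :
  (forall i, exists C, forall x y, `|x - x0| <= r -> `|y - x0| <= r -> `|v i x - v i y| <= C * `|x - y| `^ t) ->
  exists2 C, 0 <= C & forall i x y, `|x - x0| <= r -> `|y - x0| <= r -> `|v i x - v i y| <= C * `|x - y| `^ t.
Proof.
move=> /choice[C hC]; exists (\sum_(i < N) `|C i|); first exact: sumr_ge0.
move=> i x y hx hy; apply: le_trans (hC i x y hx hy) _; apply: ler_wpM2r; first exact: powR_ge0.
by apply: le_trans (ler_norm _) _; rewrite (bigD1 i)//= lerDl sumr_ge0.
Qed.

End HolderExponent.

Section Bootstrap.
Variables (R : realType) (N : nat).
Local Notation mu := (@lebesgue_measure R).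
Local Notation mu2 := (mu \x mu)%E.
Variables (a : R -> R) (Lam : R) (u m : 'I_N -> R -> R) (x0 r0 : R).
Variables (Mg : R -> R) (s p G bet R1 C0 al : R).
Implicit Types (c rho tau r : R) (phi : R -> R).
Hypotheses (HS : solution a Lam u m x0 r0) (Mg0 : forall x, 0 <= Mg x) (hG : L1le mu Mg G)
  (bet0 : 0 < bet) (bet1 : bet < 1) (R1r : R1 < r0)
  (hM : forall rho, 0 < rho -> truncation_bound m Mg s p rho (rho `^ bet))
  (C00 : 0 <= C0) (al0 : 0 < al)
  (cu : forall i x y, `|x - x0| <= R1 -> `|y - x0| <= R1 -> `|u i x - u i y| <= C0 * `|x - y| `^ al).

Definition energy_decay tau r := exists A d, [/\ 0 <= A, 0 < d, d <= 1 &
  forall c rho, `|c - x0| <= r -> 0 < rho -> rho <= d ->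
    `|c - x0| + rho < r0 /\ ball_energy u c rho <= A * rho `^ tau].

Section CutOff.
Variables (chi : R -> R) (L ra rb r A d tau : R).
Hypotheses (hchi : cutoff chi x0 ra rb L) (L0 : 0 < L) (ra0 : 0 < ra) (rab : ra < rb) (rbr : rb < r)
  (rR : r <= R1) (tau0 : 0 < tau) (taub : tau <= bet) (A0 : 0 <= A) (d0 : 0 < d) (d1 : d <= 1)
  (hQ : forall c rho, `|c - x0| <= r -> 0 < rho -> rho <= d ->
    `|c - x0| + rho < r0 /\ ball_energy u c rho <= A * rho `^ tau).

Definition cutoff_dual_const : R := 2 * Lam * A + (2 + G) + 2 * cutoff_const Lam L.

Lemma outer_radius_gt0 : 0 < rb. Proof. exact: lt_trans ra0 rab. Qed.

Lemma outer_radius_le : rb <= r0. Proof. by apply: ltW; apply: lt_trans rbr (le_lt_trans rR R1r). Qed.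

Lemma admissible_cutoff_solution i : admissible (cutoff_sol chi u i).
Proof. exact: admissible_cutoff_sol HS hchi outer_radius_gt0 outer_radius_le i. Qed.

Lemma cutoff_dual_const_ge0 : 0 <= cutoff_dual_const.
Proof.
have [_ L1 _ _] := sol_kernel HS; have G0 := L1le_ge0 hG; have K0 := cutoff_const_ge0 HS L0.
by apply: addr_ge0; [apply: addr_ge0; [rewrite !mulr_ge0//|]|rewrite mulr_ge0]; clra.
Qed.

Lemma form_cutoff_sol_le i phi M c rho : admissible phi -> 0 < rho -> rho <= d -> `|c - x0| <= r ->
  (forall x, `|phi x| <= M) -> (forall x, rho < `|x - c| -> phi x = 0) ->
  `|form a (cutoff_sol chi u i) phi| <= M * cutoff_dual_const * rho `^ tau.
Proof.
move=> gp rho0 rd hc pM p0; have [hin hnu] := hQ hc rho0 rd; have [mp _ _] := gp.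
have [_ L1 _ _] := sol_kernel HS; have G0 := L1le_ge0 hG; have Lp : 0 <= Lam by clra.
have h2 := L1le_source_test HS (hM rho0) rho0 (powR_ge0 _ _) Mg0 hG i mp (ltW rho0) pM p0.
apply: le_trans (form_cutoff_sol_bounded_le HS hchi outer_radius_gt0 L0 gp (ltW rho0) hin pM p0 h2) _.
rewrite divff ?lt0r_neq0// mulr1 -[leRHS]mulrA; apply: ler_wpM2l; first exact: le_trans (normr_ge0 _) (pM 0).
have r1 : rho <= 1 := le_trans rd d1.
have source_le : rho `^ bet <= rho `^ tau by exact: powR_le_exponent.
have volume_le : rho <= rho `^ tau.
  by rewrite -{1}(@powRr1 _ rho) ?(ltW rho0)//; apply: powR_le_exponent => //; clra.
have L2 : 0 <= 2 * Lam by rewrite mulr_ge0.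
have G2 : 0 <= 2 + G by rewrite addr_ge0.
have K2 := mulr_ge0 (ler0n R 2) (cutoff_const_ge0 HS L0).
rewrite [leRHS]mulrDl [X in _ <= X + _]mulrDl -(mulrA (2 * Lam)) (mulrC _ (2 + G)).
exact: lerD (lerD (ler_wpM2l L2 hnu) (ler_wpM2l G2 source_le)) (ler_wpM2l K2 volume_le).
Qed.

Lemma cutoff_sol_continuous i x e : 0 < e -> exists2 del, 0 < del & forall z, `|z - x| <= del ->
  `|cutoff_sol chi u i z - cutoff_sol chi u i x| <= e.
Proof.
move=> e0; pose gap := (r - rb) / 2; have gap0 : 0 < gap by rewrite /gap; clra.
have [hx|hx] := leP `|x - x0| (rb + gap); last first.
  exists (gap / 2) => [|z hz]; first by clra.
  by rewrite !(cutoff_sol_supp u hchi) ?subrr ?normr0 ?(ltW e0)//; have := ler_distD z x x0; rewrite (distrC x z); clra.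
have e2 : 0 < e / 2 by clra.
have [t1 t10 hL] := exists_pos_mul_le (ltW L0) e2; have [t2 t20 hC] := exists_pos_mul_le C00 e2.
exists (Num.min gap (Num.min t1 (t2 `^ al^-1))); first by rewrite !lt_min gap0 t10 powR_gt0.
move=> z; rewrite !le_min => /andP[z1 /andP[z2 z3]].
have hz : `|z - x0| <= R1 by have := ler_distD x z x0; move: hx z1; rewrite /gap; clra.
have hx' : `|x - x0| <= R1 by move: hx; rewrite /gap; clra.
have -> : cutoff_sol chi u i z - cutoff_sol chi u i x = (chi z - chi x) * u i z + chi x * (u i z - u i x).
  by rewrite /cutoff_sol; ring.
apply: le_trans (ler_normD _ _) _; rewrite !normrM (splitr e); apply: lerD.
  apply: le_trans hL; rewrite -[leRHS]mulr1; apply: ler_pM => //; last exact: sol_le1 HS _ _.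
  by apply: le_trans (cutoff_lipschitz hchi z x) _; apply: ler_wpM2l => //; exact: ltW.
apply: le_trans hC; rewrite -[leRHS]mul1r; apply: ler_pM => //; first exact: cutoff_le1 hchi x.
apply: le_trans (cu i hz hx') _; apply: ler_wpM2l => //.
have -> : t2 = (t2 `^ al^-1) `^ al by rewrite -powRrM mulVf ?lt0r_neq0// powRr1// ltW.
by apply: powR_le_base => //; exact: ltW.
Qed.

Lemma cutoff_sol_holder i : exists C, forall x y,
  `|cutoff_sol chi u i x - cutoff_sol chi u i y| <= C * `|x - y| `^ tau.
Proof.
apply: (@linear_holder _ a (cutoff_sol chi u i) Lam x0 rb r cutoff_dual_const tau d (sol_kernel HS)
  (admissible_cutoff_solution i) (cutoff_sol_le1 HS hchi i)) => //.
- by move=> x hx; exact: cutoff_sol_supp hchi i x hx.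
- exact: outer_radius_gt0.
- exact: cutoff_dual_const_ge0.
- by clra.
- by move=> phi M c rho gp h1 h2 h3 h4 h5; exact: (form_cutoff_sol_le i gp h1 h2 h3 h4 h5).
- by move=> x e e0; exact: cutoff_sol_continuous.
Qed.

Lemma cutoff_sol_energy i sg : 0 < sg -> 2 * sg < 1 -> sg <= tau ->
  exists2 A', 0 <= A' & forall c rho, `|c - x0| <= r -> 0 < rho -> 4 * rho <= d ->
    L1le mu2 (fun z => ind (`|z.1 - c| <= rho) * en (cutoff_sol chi u i) z) (A' * rho `^ (2 * sg)).
Proof.
move=> sg0 sg1 sgt; have [C hC] := cutoff_sol_holder i.
exact: (holder_energy (sol_kernel HS) (admissible_cutoff_solution i) (cutoff_sol_le1 HS hchi i) cutoff_dual_const_ge0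
  sg0 sg1 sgt d0 d1 (fun phi M c rho g1 g2 g3 g4 g5 g6 => form_cutoff_sol_le i g1 g2 g3 g4 g5 g6)
  (holder_exponent_le sg0 sgt (cutoff_sol_le1 HS hchi i) hC)).
Qed.

Lemma en_le_cutoff i x y del : 0 < del -> `|x - x0| + del <= ra ->
  en (u i) (x, y) <= en (cutoff_sol chi u i) (x, y) + 4 * Jfar del (x, y).
Proof.
move=> del0 hx; have [hy|hy] := leP `|y - x0| ra.
  apply: ler_wpDr; first by rewrite mulr_ge0 ?Jfar_ge0.
  by rewrite /en/= /cutoff_sol !(cutoff_eq1 hchi) ?mul1r//; clra.
apply: ler_wpDl; first exact: en_ge0.
rewrite /Jfar/= indT; last by have := ler_distD x y x0; rewrite (distrC y x); clra.
rewrite mul1r /en/=; apply: ler_wpM2r; first exact: inv_sqr_ge0.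
rewrite (_ : 4 = 2 ^+ 2); last by ring.
apply: norm_le_sqr; apply: le_trans (ler_normB _ _) _.
by have := sol_le1 HS i x; have := sol_le1 HS i y; clra.
Qed.

Lemma component_energy_le i sg A' c rho del : 0 < del -> `|c - x0| + rho + del <= ra -> 0 < rho -> rho <= 1 ->
  2 * sg < 1 ->
  L1le mu2 (fun z => ind (`|z.1 - c| <= rho) * en (cutoff_sol chi u i) z) (A' * rho `^ (2 * sg)) ->
  L1le mu2 (fun z => ind (`|z.1 - c| <= rho) * en (u i) z) ((A' + 16 / del) * rho `^ (2 * sg)).
Proof.
move=> del0 hc rho0 rho1 sg1 hW.
have far := L1leZ 4 (L1le_kernel_fst (measurable_Jfar del) (fun x => L1le_Jfar x del0) (L1le_ball c (ltW rho0))).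
apply: L1le_domW2 (L1leD hW far) _ _ _ => [||x y /=].
- rewrite ger0_norm// [leRHS]mulrDl lerD2l (_ : 4 * (2 * rho * (2 / del)) = 16 / del * rho);
  last by field; exact: lt0r_neq0.
  apply: ler_wpM2l; first by rewrite divr_ge0// ltW.
  by rewrite -{1}(@powRr1 _ rho) ?(ltW rho0)//; apply: powR_le_exponent => //; exact: ltW.
- by have := measurable_en (sol_measurable HS i) => ?; mes.
rewrite ger0_norm; last by nneg.
rewrite (distrC c) (mulrCA 4) -mulrDr; have [hx|hx] := leP `|x - c| rho; last by rewrite /ind !mul0r.
by apply: ler_wpM2l; [exact: ind_ge0|apply: en_le_cutoff => //; have := ler_distD c x x0; clra].
Qed.

Lemma energy_decay_cutoff r' : 0 < r' -> r' < ra -> energy_decay (Num.min (2 * tau) bet) r'.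
Proof.
move=> r'0 r'a; pose sg := Num.min tau (bet / 2).
have sg0 : 0 < sg by rewrite lt_min tau0; clra.
have sgt : sg <= tau by rewrite ge_min lexx.
have sgb : sg <= bet / 2 by rewrite ge_min lexx orbT.
have e2 : 2 * sg = Num.min (2 * tau) bet by rewrite /sg minr_pMr// (_ : 2 * (bet / 2) = bet)//; field.
have s21 : 2 * sg < 1 by clra.
have /choice[A' hA'] i : exists A', 0 <= A' /\ forall c rho, `|c - x0| <= r -> 0 < rho -> 4 * rho <= d ->
    L1le mu2 (fun z => ind (`|z.1 - c| <= rho) * en (cutoff_sol chi u i) z) (A' * rho `^ (2 * sg)).
  by have [B B0 H] := cutoff_sol_energy i sg0 s21 sgt; exists B.
pose del := (ra - r') / 2; have del0 : 0 < del by rewrite /del; clra.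
exists (\sum_(i < N) (A' i + 16 / del)), (Num.min (d / 4) del); split.
- by apply: sumr_ge0 => i _; apply: addr_ge0; [case: (hA' i)|rewrite divr_ge0// ltW].
- by rewrite lt_min del0 andbT; clra.
- by rewrite ge_min; apply/orP; left; clra.
move=> c rho hc rho0; rewrite le_min -e2 => /andP[rd rdel]; rewrite /del in rdel.
split; first by clra.
have per i : L1le mu2 (fun z => ind (`|z.1 - c| <= rho) * en (u i) z) ((A' i + 16 / del) * rho `^ (2 * sg)).
  have [_ H] := hA' i; apply: component_energy_le => //; rewrite ?/del; [by clra|by clra|].
  by apply: H => //; clra.
have := L1le_sum (index_enum 'I_N) (P := xpredT) (fun i _ => per i); rewrite -mulr_suml => /Rint_le_bound.
by apply: le_trans; apply: eqW; apply: eq_Rint => z; rewrite /en_total mulr_sumr.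
Qed.

End CutOff.

Lemma energy_decay_double tau r r' : 0 < tau -> tau <= bet -> r <= R1 -> 0 < r' -> r' < r -> energy_decay tau r ->
  energy_decay (Num.min (2 * tau) bet) r'.
Proof.
move=> t0 tb rR r'0 r'r [A [d [A0 d0 d1 H]]].
have ra0 : 0 < (2 * r' + r) / 3 by clra.
have rab : (2 * r' + r) / 3 < (r' + 2 * r) / 3 by clra.
have [chi [L [L0 hchi]]] := exists_cutoff x0 ra0 rab.
by apply: (energy_decay_cutoff hchi L0 ra0 rab _ rR t0 tb A0 d0 d1 H) => //; clra.
Qed.

Lemma energy_decay_iter tau r n : 0 < tau -> tau <= bet -> r <= R1 -> energy_decay tau r ->
  forall r', 0 < r' -> r' < r -> energy_decay (Num.min (2 ^+ n * tau) bet) r'.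
Proof.
move=> t0 tb rR hQ; elim: n => [|n ih] r' r'0 r'r.
  rewrite expr0 mul1r min_l//; case: hQ => A [d [A0 d0 d1 H]]; exists A, d; split => //.
  by move=> c rho hc; apply: H; clra.
have two : 0 < 2 ^+ n :> R by rewrite exprn_gt0.
have rm0 : 0 < (r' + r) / 2 by clra.
have rm1 : (r' + r) / 2 < r by clra.
have := ih _ rm0 rm1; set t := Num.min _ _ => hm.
have tp : 0 < t by rewrite lt_min bet0 mulr_gt0.
have tb' : t <= bet by rewrite ge_min lexx orbT.
have e : Num.min (2 * t) bet = Num.min (2 ^+ n.+1 * tau) bet.
  by rewrite /t minr_pMr// -minA (min_r (_ : bet <= 2 * bet)) ?exprS ?mulrA//; clra.
by rewrite -e; apply: (energy_decay_double tp tb' _ r'0 _ hm); clra.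
Qed.

Lemma energy_decay_improve tau r r' : 0 < tau -> tau <= bet -> r <= R1 -> energy_decay tau r -> 0 < r' ->
  r' < r -> energy_decay bet r'.
Proof.
move=> t0 tb rR hQ r'0 r'r.
have [n hn] : exists n, bet <= 2 ^+ n * tau.
  have [n0 hn] := dyad_small bet0 t0; exists n0.
  have := hn _ (leqnn n0); rewrite /dyad ltr_pdivrMr ?exprn_gt0// mulrC; exact: ltW.
by have := energy_decay_iter n t0 tb rR hQ r'0 r'r; rewrite min_r.
Qed.

Lemma energy_decay_holder tau r r' : 0 < tau -> tau <= bet -> r <= R1 -> energy_decay tau r -> 0 < r' -> r' < r ->
  exists C, forall i x y, `|x - x0| <= r' -> `|y - x0| <= r' -> `|u i x - u i y| <= C * `|x - y| `^ tau.
Proof.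
move=> t0 tb rR [A [d [A0 d0 d1 H]]] r'0 r'r.
have rab : r' < (r' + r) / 2 by clra.
have [chi [L [L0 hchi]]] := exists_cutoff x0 r'0 rab.
have rb : (r' + r) / 2 < r by clra.
have [|C C0' hC] := @uniform_holder_const _ N u x0 r' tau; last by exists C.
move=> i; have [C hC] := cutoff_sol_holder hchi L0 r'0 rab rb rR t0 tb A0 d0 d1 H i; exists C => x y hx hy.
by have := hC x y; rewrite /cutoff_sol !(cutoff_eq1 hchi) ?mul1r.
Qed.

End Bootstrap.

Section HolderSol.
Variables (R : realType) (N : nat).
Local Notation mu := (@lebesgue_measure R).
Local Notation mu2 := (mu \x mu)%E.
Variables (a : R -> R) (Lam : R) (u m : 'I_N -> R -> R) (x0 r0 : R).
Variables (Mg : R -> R) (s p G bet r1 : R).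

Lemma ae_eq_ball_energy (v : 'I_N -> R -> R) c rho : (forall i, measurable_fun setT (u i)) ->
  (forall i, measurable_fun setT (v i)) -> (forall i, {ae mu, forall x, u i x = v i x}) ->
  ball_energy u c rho = ball_energy v c rho.
Proof.
move=> hmu hmv uv.
have h (w : 'I_N -> R -> R) : (forall i, measurable_fun setT (w i)) ->
    measurable_fun setT (fun z : R * R => ind (`|z.1 - c| <= rho) * en_total w z).
  by move=> mw; apply: measurable_funM; [mes|apply: measurable_sum => j; exact: measurable_en].
apply: ae_eq_Rint; [exact: h|exact: h|].
have ae2 i : {ae mu2, forall z, u i z.1 = v i z.1 /\ u i z.2 = v i z.2}.
  by exact: ae_and (ae_fst (uv i)) (ae_snd (uv i)).
apply: (ae_imp _ (ae_forall ae2)) => z hz; congr (_ * _); apply: eq_bigr => i _.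
by rewrite /en; have [-> ->] := hz i.
Qed.

Lemma solution_holder : solution a Lam u m x0 r0 -> (forall x, \sum_(i < N) u i x ^+ 2 = 1) -> (0 < N)%N ->
  0 < s -> s < 1 -> s ^+ 4 = 2^-1 -> 0 <= p -> p < 1 -> (forall x, 0 <= Mg x) -> L1le mu Mg G ->
  0 < bet -> bet < 1 -> 0 < r1 -> r1 < r0 ->
  (forall rho, 0 < rho -> truncation_bound m Mg s p rho (rho `^ bet)) ->
  exists v, [/\ solution a Lam v m x0 r0, forall i, {ae mu, forall x, u i x = v i x}, energy_decay v x0 r0 bet r1 &
    exists C, 0 <= C /\ forall i x y, `|x - x0| <= r1 -> `|y - x0| <= r1 -> `|v i x - v i y| <= C * `|x - y| `^ bet].
Proof.
move=> HS S1 N0 s0 s1 s4 p0 p1 Mg0 hG b0 b1 r10 r1r hM.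
have Rr : (r1 + 2 * r0) / 3 < r0 by clra.
have rR2 : (2 * r1 + r0) / 3 < (r1 + 2 * r0) / 3 by clra.
have R20 : 0 < (2 * r1 + r0) / 3 by clra.
have r1R : r1 < (2 * r1 + r0) / 3 by clra.
have R10 : 0 < (r1 + 2 * r0) / 3 by clra.
move: Rr rR2 R20 r1R R10; set R1 := (r1 + 2 * r0) / 3; set R2 := (2 * r1 + r0) / 3 => Rr rR2 R20 r1R R10.
have [tau [A [d [t0 tb A0 /andP[d0 d1] H]]]] := ball_energy_decay HS S1 N0 s0 s1 s4 p0 p1 Mg0 hG b0 Rr hM.
have hE i c rho : `|c - x0| <= R1 -> 0 < rho -> rho <= d ->
    L1le mu2 (fun z => ind (`|z.1 - c| <= rho) * en (u i) z) (A * rho `^ tau).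
  move=> h1 h2 h3; have [h4 h5] := H _ _ h1 h2 h3.
  apply: (L1leW h5); apply: L1le_dom2 (L1le_ball_energy HS h4).
    by have := measurable_en (sol_measurable HS i) => ?; mes.
  move=> x y /=; rewrite ger0_norm; last by nneg.
  by apply: ler_wpM2l; [exact: ind_ge0|exact: en_le_total].
have /choice[v rep] i := holder_representative (sol_measurable HS i) (sol_le1 HS i) A0 d0 t0 R10 (hE i).
have mv i : measurable_fun setT (v i) by case: (rep i).
have uv i : {ae mu, forall x, u i x = v i x} by case: (rep i).
have [|C C0 cv] := @uniform_holder_const _ N v x0 R1 (tau / 2); first by move=> i; case: (rep i).
have HV : solution a Lam v m x0 r0 by apply: ae_eq_solution HS mv _ uv => i x; case: (rep i).
have t20 : 0 < tau / 2 by clra.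
have Q : energy_decay v x0 r0 tau R1.
  exists A, d; split => //; first exact: ltW.
  move=> c rho h1 h2 h3; have [h4 h5] := H _ _ h1 h2 h3; split => //.
  by rewrite -(ae_eq_ball_energy _ _ (sol_measurable HS) mv uv).
have Q2 := energy_decay_improve HV Mg0 hG b0 b1 Rr hM C0 t20 cv t0 tb (lexx _) Q R20 rR2.
have [K hK] := energy_decay_holder HV Mg0 hG b0 b1 Rr hM C0 t20 cv b0 (lexx _) (ltW rR2) Q2 r10 r1R.
exists v; split => //.
  case: Q2 => A' [d' [? ? ? H']]; exists A', d'; split => // c rho hc.
  by apply: H'; apply: le_trans (ltW r1R).
exists `|K|; split => // i x y hx hy; apply: le_trans (hK i x y hx hy) _.
by apply: ler_wpM2r; [exact: powR_ge0|exact: ler_norm].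
Qed.

End HolderSol.

Section Young.
Variables (R : realType) (N : nat).
Local Notation mu := (@lebesgue_measure R).

Lemma fourth_root : exists s : R, [/\ 0 < s, s < 1 & s ^+ 4 = 2^-1].
Proof.
exists (2^-1 `^ 4^-1); have h : (0 : R) < 2^-1 by rewrite invr_gt0.
split; first exact: powR_gt0.
  by apply: powR_lt1 => //; rewrite ?invr_gt0 ?invf_lt1//; clra.
rewrite -powR_mulrn ?powR_ge0// -powRrM mulVf ?powRr1 ?invr_ge0//.
Qed.

Lemma truncation_bound_Lp (m : 'I_N -> R -> R) s gam : 0 < s -> 1 < gam ->
  forall rho, 0 < rho -> truncation_bound m (fun x => \sum_(i < N) `|m i x| `^ gam) s (s `^ (gam - 1)) rho
    (rho `^ (1 - gam^-1)).
Proof.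
move=> s0 g1 rho rho0 k i x; have g0 : 0 < gam by clra.
have sk : 0 < s ^+ k by rewrite exprn_gt0.
set B := rho `^ _; have B0 : 0 < B by exact: powR_gt0.
set lam := B / (rho * s ^+ k); have l0 : 0 < lam by rewrite divr_gt0// mulr_gt0.
set Mg := \sum_(j < N) _.
have Mi : `|m i x| `^ gam <= Mg.
  by rewrite /Mg (bigD1 i)//= lerDl; apply: sumr_ge0 => j _; exact: powR_ge0.
have pk : 0 <= B * (s `^ (gam - 1)) ^+ k by rewrite mulr_ge0 ?exprn_ge0 ?powR_ge0// ltW.
have [h|h] := leP `|m i x| lam.
  by apply: le_trans h _; rewrite lerDl mulr_ge0// (le_trans _ Mi)// powR_ge0.
apply: le_trans (_ : B * s `^ (gam - 1) ^+ k * Mg <= _); last by rewrite lerDr ltW.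
apply: le_trans (ler_wpM2l pk Mi).
have t1 : 1 <= `|m i x| / lam by rewrite ler_pdivlMr// mul1r ltW.
have le1 : `|m i x| / lam <= (`|m i x| / lam) `^ gam.
  by rewrite -{1}[`|m i x| / lam]powRr1 ?(le_trans _ t1)//; apply: ler_powR => //; exact: ltW.
have -> : B * s `^ (gam - 1) ^+ k = lam `^ (1 - gam).
  have e : lam = rho `^ (- gam^-1) * s `^ (- k%:R).
    rewrite /lam /B powRD; last by apply/implyP => _; rewrite gt_eqF.
    rewrite powRr1 ?(ltW rho0)// invfM !powRN powR_mulrn ?(ltW s0)//.
    by field; rewrite !gt_eqF ?powR_gt0.
  rewrite e powRM ?powR_ge0// -!powRrM -powR_mulrn ?powR_ge0// -powRrM /B.
  congr (_ `^ _ * _ `^ _); last by ring.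
  by rewrite mulrBr mulr1 mulNr opprK mulVf ?gt_eqF// addrC.
have := le1; rewrite powRM ?invr_ge0 ?(ltW l0)// ler_pdivrMr// => /le_trans; apply; apply: eqW.
rewrite powRD; last by apply/implyP => _; rewrite gt_eqF.
rewrite powRr1 ?(ltW l0)// -(powR_inv1 (ltW l0)) -powRrM mulN1r; ring.
Qed.

End Young.

Section HolderMain.
Variables (R : realType) (N : nat).
Local Notation mu := (@lebesgue_measure R).
Variables (Lam : R) (a : R -> R) (Om : set R) (x0 r : R) (u m : R -> 'I_N -> R).
Hypotheses (N2 : (2 <= N)%N) (ok : elliptic_kernel a Lam) (oOm : open Om) (r0 : 0 < r)
  (sOm : closure (ball x0 (2 * r)) `<=` Om) (hm : Lp_on 1 Om m) (hw : weak_solution a Om u m).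

Lemma ballP (c rho x : R) : ball c rho x <-> `|x - c| < rho.
Proof. by rewrite -ball_normE /ball_/= distrC. Qed.

Lemma L1le_powR_source gam i : 0 < gam -> Lp_on gam (ball x0 (2 * r)) m ->
  exists c, L1le mu (fun x => `|source x0 r m i x| `^ gam) c.
Proof.
move=> g0 h; have [mm fm] := h i; have [c0 hc0] := L1le_source oOm sOm hm i.
have mO : measurable (ball x0 (2 * r) : set R) by exact: measurable_ball.
have mF : measurable_fun setT (fun x => `|source x0 r m i x| `^ gam).
  by have := L1le_measurable hc0 => ?; mes.
apply: L1le_exists => //; apply: le_lt_trans fm; rewrite [leRHS]integral_mkcond.
apply: ge0_le_integral => //.
- exact: measurable_EFin_norm.
- apply/(measurable_restrictT _ mO); apply/measurable_EFinP.
  by apply: (measurableT_comp (measurable_powR gam)); exact: measurableT_comp.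
- move=> x _; rewrite patchE /source ger0_norm ?powR_ge0//.
  case: ifPn => [|]; rewrite ?inE ?notin_setE ballP => hx; first by rewrite indT// mul1r.
  by rewrite indF ?mul0r ?normr0 ?powR0 ?gt_eqF//; apply/negP.
Qed.

Lemma exists_holder_representative gam r1 : 1 < gam -> Lp_on gam (ball x0 (2 * r)) m -> 0 < r1 -> r1 < 2 * r ->
  exists v, [/\ solution a Lam v (source x0 r m) x0 (2 * r), forall i, {ae mu, forall x, u x i = v i x},
    energy_decay v x0 (2 * r) (1 - gam^-1) r1 &
    exists C, 0 <= C /\ forall i x y, `|x - x0| <= r1 -> `|y - x0| <= r1 ->
      `|v i x - v i y| <= C * `|x - y| `^ (1 - gam^-1)].
Proof.
move=> g1 hg r10 r1r; have [s [s0 s1 s4]] := fourth_root R.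
have g0 : 0 < gam by clra.
have HS := weak_solution_unit_rep N2 ok oOm r0 sOm hm hw.
have [c hc] := choice (fun i => L1le_powR_source i g0 hg).
have hG := L1le_sum (index_enum 'I_N) (P := xpredT) (fun i _ => hc i).
have N0 : (0 < N)%N by exact: leq_trans N2.
have gi : gam^-1 < 1 by rewrite invf_lt1.
have gi0 : 0 < gam^-1 by rewrite invr_gt0.
have p1 : s `^ (gam - 1) < 1 by apply: powR_lt1 => //; clra.
have b0 : 0 < 1 - gam^-1 by clra.
have b1 : 1 - gam^-1 < 1 by clra.
have M0 x : 0 <= \sum_(i < N) `|source x0 r m i x| `^ gam by apply: sumr_ge0 => i _; exact: powR_ge0.
have [v [HV uv Q C]] := solution_holder HS (sum_unit_rep_sqr u N2) N0 s0 s1 s4 (powR_ge0 _ _) p1 M0 hG b0 b1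
  r10 r1r (truncation_bound_Lp _ s0 g1).
exists v; split => // i.
have := ae_and (unit_rep_ae hw i) (uv i); by apply: ae_imp => x [-> ->].
Qed.

Lemma vnorm_le (f : 'I_N -> R) K : 0 <= K -> (forall i, `|f i| <= K) -> vnorm f <= Num.sqrt N%:R * K.
Proof.
move=> K0 h; rewrite /vnorm -[X in _ <= _ * X](ger0_norm K0) -sqrtr_sqr -sqrtrM ?ler0n// ler_sqrt; last first.
  by rewrite mulr_ge0 ?sqr_ge0.
rewrite /vdot; apply: le_trans (_ : \sum_(i < N) K ^+ 2 <= _).
  apply: ler_sum => i _; rewrite -expr2 -real_normK ?num_real//.
  by rewrite ler_sqr ?nnegrE ?normr_ge0.
by rewrite sumr_const card_ord mulr_natl.
Qed.

Lemma weak_solution_holder gam : 1 < gam -> Lp_on gam (ball x0 (2 * r)) m ->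
  holder_on (1 - gam^-1) (ball x0 r) u.
Proof.
move=> g1 hg; have r12 : r < 2 * r by have := r0; clra.
have [v [_ uv _ [C [C0 hC]]]] := exists_holder_representative g1 hg r0 r12.
exists (fun x i => v i x); split.
  by have h := ae_forall uv; apply: (ae_imp _ h) => x e _ i; rewrite e.
exists (Num.sqrt N%:R * C) => x y /ballP hx /ballP hy; rewrite -mulrA.
by apply: vnorm_le => [|i]; [rewrite mulr_ge0// powR_ge0|apply: hC; exact: ltW].
Qed.

End HolderMain.
(** * Square integrability of the derivative *)

Section BoundedCompact.
Variable R : realType.
Local Notation mu := (@lebesgue_measure R).
Local Notation mu2 := (mu \x mu)%E.
Implicit Types (f g : R -> R) (h k : R).

Definition bdd_supp f := measurable_fun setT f /\
  exists M K, (forall x, `|f x| <= M) /\ forall x, K < `|x| -> f x = 0.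
Definition Int f : R := \int[mu]_x f x.

Lemma bdd_suppD f g : bdd_supp f -> bdd_supp g -> bdd_supp (fun x => f x + g x).
Proof.
move=> [mf [M [K [fM fK]]]] [mg [M' [K' [gM gK]]]]; split; first by mes.
exists (M + M'), (Num.max K K'); split => x; first by apply: le_trans (ler_normD _ _) _; exact: lerD.
by rewrite gt_max => /andP[h1 h2]; rewrite fK// gK// addr0.
Qed.

Lemma bdd_suppM f g : bdd_supp f -> bdd_supp g -> bdd_supp (fun x => f x * g x).
Proof.
move=> [mf [M [K [fM fK]]]] [mg [M' [K' [gM gK]]]]; split; first by mes.
exists (M * M'), K; split => x; first by rewrite normrM; exact: ler_pM.
by move=> h1; rewrite fK// mul0r.
Qed.

Lemma bdd_suppZ k f : bdd_supp f -> bdd_supp (fun x => k * f x).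
Proof.
move=> [mf [M [K [fM fK]]]]; split; first by mes.
exists (`|k| * M), K; split => x; first by rewrite normrM; exact: ler_wpM2l.
by move=> h1; rewrite fK// mulr0.
Qed.

Lemma bdd_suppN f : bdd_supp f -> bdd_supp (fun x => - f x).
Proof. by move=> /(bdd_suppZ (-1)); congr bdd_supp; apply/funext => x; rewrite mulN1r. Qed.

Lemma bdd_suppB f g : bdd_supp f -> bdd_supp g -> bdd_supp (fun x => f x - g x).
Proof. by move=> hf /bdd_suppN; exact: bdd_suppD. Qed.

Lemma bdd_supp_shift h f : bdd_supp f -> bdd_supp (fun x => f (x + h)).
Proof.
move=> [mf [M [K [fM fK]]]]; split; first by mes.
exists M, (K + `|h|); split => x // hx; apply: fK.
by have := ler_normB (x + h) h; rewrite addrK; clra.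
Qed.

Lemma bdd_supp_sqr f : bdd_supp f -> bdd_supp (fun x => f x ^+ 2).
Proof. by move=> h; exact: bdd_suppM. Qed.

Lemma bdd_supp0 : bdd_supp (fun=> 0).
Proof. by split; [mes|exists 0, 0; split => // x; rewrite normr0]. Qed.

Lemma bdd_supp_sum (s : seq nat) (F : nat -> R -> R) : (forall i, bdd_supp (F i)) ->
  bdd_supp (fun x => \sum_(i <- s) F i x).
Proof.
move=> h; elim: s => [|i s ih].
  by have := bdd_supp0; congr bdd_supp; apply/funext => x; rewrite big_nil.
by have := bdd_suppD (h i) ih; congr bdd_supp; apply/funext => x; rewrite big_cons.
Qed.

Lemma bdd_supp_L1le f : bdd_supp f -> exists c, L1le mu f c.
Proof.
move=> [mf [M [K [fM fK]]]].
have hi : L1le mu (fun x => ind (`|0 - x| <= `|K|)) (2 * `|K|) by apply: L1le_ball.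
eexists; apply: L1le_dom (L1leZ M hi) => // x; rewrite sub0r normrN.
have [h|h] := leP `|x| `|K|; first by rewrite indT// mulr1.
by rewrite fK ?normr0 ?indF -?ltNge ?mulr0//; apply: le_lt_trans h; exact: ler_norm.
Qed.

Lemma IntD f g : bdd_supp f -> bdd_supp g -> Int (fun x => f x + g x) = Int f + Int g.
Proof. by move=> /bdd_supp_L1le[? h1] /bdd_supp_L1le[? h2]; exact: RintD h1 h2. Qed.

Lemma IntB f g : bdd_supp f -> bdd_supp g -> Int (fun x => f x - g x) = Int f - Int g.
Proof. by move=> /bdd_supp_L1le[? h1] /bdd_supp_L1le[? h2]; exact: RintB h1 h2. Qed.

Lemma IntZ k f : bdd_supp f -> Int (fun x => k * f x) = k * Int f.
Proof. by move=> /bdd_supp_L1le[? h1]; exact: RintZ h1. Qed.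

Lemma eq_Int f g : f =1 g -> Int f = Int g. Proof. by move=> e; apply: eq_Rint. Qed.
Lemma Int_shift h f : bdd_supp f -> Int (fun x => f (x + h)) = Int f.
Proof. by move=> [mf _]; exact: Rint_shift. Qed.

Lemma le_Int f g : bdd_supp f -> bdd_supp g -> (forall x, f x <= g x) -> Int f <= Int g.
Proof. by move=> /bdd_supp_L1le[? h1] /bdd_supp_L1le[? h2]; exact: le_Rint h1 h2. Qed.

Lemma Int_ge0 f : (forall x, 0 <= f x) -> 0 <= Int f.
Proof. by move=> h; exact: Rintegral_ge0. Qed.

Lemma Int_sum (s : seq nat) (F : nat -> R -> R) : (forall i, bdd_supp (F i)) ->
  Int (fun x => \sum_(i <- s) F i x) = \sum_(i <- s) Int (F i).
Proof. by move=> h; have [c hc] := choice (fun i => bdd_supp_L1le (h i)); exact: (Rint_sum _ hc). Qed.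

Lemma Int_increment_swap f g h k : bdd_supp f -> bdd_supp g ->
  Int (fun x => (f (x - h) - f x) * (g (x - k) - g x)) = Int (fun x => (f (x + k) - f x) * (g (x + h) - g x)).
Proof.
move=> bf bg; have b s t := bdd_suppM (bdd_supp_shift s bf) (bdd_supp_shift t bg).
have b0 s := bdd_suppM (bdd_supp_shift s bf) bg; have b1 s := bdd_suppM bf (bdd_supp_shift s bg);
  have b2 := bdd_suppM bf bg.
have ex s t : Int (fun x => (f (x + s) - f x) * (g (x + t) - g x)) =
    Int (fun x => f (x + s) * g (x + t)) - Int (fun x => f (x + s) * g x) - (Int (fun x => f x * g (x + t))
      - Int (fun x => f x * g x)).
  rewrite -IntB// -IntB//  -IntB//; [|exact: bdd_suppB|exact: bdd_suppB].
  by apply: eq_Int => x; ring.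
rewrite !ex -(Int_shift (- (h + k)) (b k h)) -(Int_shift (- k) (b0 k)) -(Int_shift (- h) (b1 h)).
have -> : Int (fun x => f (x - (h + k) + k) * g (x - (h + k) + h)) = Int (fun x => f (x - h) * g (x - k)).
  by apply: eq_Int => x; congr (f _ * g _); ring.
have -> : Int (fun x => f (x - k + k) * g (x - k)) = Int (fun x => f x * g (x - k)).
  by apply: eq_Int => x; rewrite subrK.
have -> : Int (fun x => f (x - h) * g (x - h + h)) = Int (fun x => f (x - h) * g x).
  by apply: eq_Int => x; rewrite subrK.
by ring.
Qed.

Lemma parallelogram f h : bdd_supp f ->
  Int (fun x => (f (x + h) - f x) ^+ 2) + Int (fun x => (f (x + h) + f x) ^+ 2) = 4 * Int (fun x => f x ^+ 2).
Proof.
move=> bf; have bh := bdd_supp_shift h bf; have b2 := bdd_supp_sqr bf; have bh2 := bdd_supp_sqr bh.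
rewrite -IntD; [|by apply: bdd_supp_sqr; exact: bdd_suppB|by apply: bdd_supp_sqr; exact: bdd_suppD].
have -> : 4 * Int (fun x => f x ^+ 2) = 2 * Int (fun x => f (x + h) ^+ 2) + 2 * Int (fun x => f x ^+ 2).
  by rewrite (Int_shift h b2); ring.
rewrite -!IntZ// -IntD; [|exact: bdd_suppZ|exact: bdd_suppZ]; apply: eq_Int => x; ring.
Qed.

Definition translate_average f h n x := n%:R^-1 * \sum_(0 <= i < n) f (x + h * i%:R).

Lemma sum_even_le (d : nat -> R) n : (forall i, 0 <= d i) ->
  \sum_(0 <= i < n) d (2 * i)%N <= \sum_(0 <= i < 2 * n) d i.
Proof.
move=> d0; elim: n => [|n ih]; first by rewrite muln0 !big_geq.
by rewrite mulnS add2n !big_nat_recr//= -addrA lerD// lerDl.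
Qed.

Section TranslateAverage.
Variables (f : R -> R) (h : R) (n : nat).
Hypotheses (bf : bdd_supp f) (n0 : (0 < n)%N).
Let g := translate_average f h n.
Let d i := Int (fun x => (f (x + h * i%:R) - g x) ^+ 2).

Lemma translate_average_bdd_supp : bdd_supp g.
Proof. by apply: bdd_suppZ; apply: bdd_supp_sum => i; exact: bdd_supp_shift. Qed.

Lemma translate_dist_bdd_supp i : bdd_supp (fun x => (f (x + h * i%:R) - g x) ^+ 2).
Proof. by apply: bdd_supp_sqr; apply: bdd_suppB; [exact: bdd_supp_shift|exact: translate_average_bdd_supp]. Qed.

Lemma translate_dist_ge0 i : 0 <= d i. Proof. by apply: Int_ge0 => x; exact: sqr_ge0. Qed.

Lemma translate_variance :
  \sum_(0 <= i < n) d i = n%:R * (Int (fun x => f x ^+ 2) - Int (fun x => g x ^+ 2)).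
Proof.
have np : 0 < n%:R :> R by rewrite ltr0n.
have bs i := bdd_supp_sqr (bdd_supp_shift (h * i%:R) bf).
have bg := bdd_supp_sqr translate_average_bdd_supp.
rewrite -Int_sum => [|i]; last exact: translate_dist_bdd_supp.
rewrite mulrBr -(IntZ _ bg).
have -> : n%:R * Int (fun x => f x ^+ 2) = Int (fun x => \sum_(0 <= i < n) f (x + h * i%:R) ^+ 2).
  rewrite Int_sum// (eq_bigr (fun=> Int (fun x => f x ^+ 2))) => [|i _].
    by rewrite sumr_const_nat subn0 mulr_natl.
  exact: (Int_shift _ (bdd_supp_sqr bf)).
rewrite -IntB; [|exact: bdd_supp_sum|exact: bdd_suppZ].
apply: eq_Int => x.
have E : \sum_(0 <= i < n) f (x + h * i%:R) = n%:R * g x by rewrite /g /translate_average mulrA divff ?mul1r// gt_eqF.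
rewrite (eq_bigr (fun i => f (x + h * i%:R) ^+ 2 - 2 * g x * f (x + h * i%:R) + g x ^+ 2)) => [|i _]; last by ring.
by rewrite big_split/= sumrB -mulr_sumr E sumr_const_nat subn0 -mulr_natl; ring.
Qed.

(* [f] and its [i]-th translate are as far apart as the [i]-th and the [2i]-th translates. Averaging
   over [i] turns the variance identity into a bound on [d 0]. *)
Lemma translate_dist_doubling i : d 0%N <= 6 * d i + 4 * d (2 * i)%N.
Proof.
have bd := translate_dist_bdd_supp.
have b1 : bdd_supp (fun x => (f (x + h * i%:R) - f x) ^+ 2).
  by apply: bdd_supp_sqr; apply: bdd_suppB => //; exact: bdd_supp_shift.
have h1 : d 0%N <= 2 * d i + 2 * Int (fun x => (f (x + h * i%:R) - f x) ^+ 2).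
  rewrite -!IntZ// -IntD; [|exact: bdd_suppZ|exact: bdd_suppZ].
  apply: le_Int => //; first by apply: bdd_suppD; exact: bdd_suppZ.
  by move=> x; rewrite mulr0 addr0; move: (f _) (g x) (f x) => p q r; apply: (@le_sub_sqr _ (2 * p - q - r)); ring.
have h2 : Int (fun x => (f (x + h * i%:R) - f x) ^+ 2) <= 2 * d (2 * i)%N + 2 * d i.
  rewrite -(Int_shift (h * i%:R) b1) -!IntZ// -IntD; [|exact: bdd_suppZ|exact: bdd_suppZ].
  apply: le_Int; [exact: bdd_supp_shift b1|by apply: bdd_suppD; exact: bdd_suppZ|].
  move=> x; rewrite -addrA -mulr2n (_ : h * i%:R *+ 2 = h * (2 * i)%:R); last by rewrite natrM; ring.
  by move: (f _) (g x) (f _) => p q r; apply: (@le_sub_sqr _ (p + r - 2 * q)); ring.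
by clra.
Qed.

End TranslateAverage.

Lemma translate_average_dist f h n : bdd_supp f -> (0 < n)%N ->
  Int (fun x => (f x - translate_average f h (2 * n) x) ^+ 2)
    <= 20 * (Int (fun x => f x ^+ 2) - Int (fun x => translate_average f h (2 * n) x ^+ 2)).
Proof.
move=> bf n0; have np : 0 < n%:R :> R by rewrite ltr0n.
have n2 : (0 < 2 * n)%N by rewrite muln_gt0.
pose d i := Int (fun x => (f (x + h * i%:R) - translate_average f h (2 * n) x) ^+ 2).
have d0 i : 0 <= d i by exact: translate_dist_ge0.
have half : \sum_(0 <= i < n) d i <= \sum_(0 <= i < 2 * n) d i.
  by rewrite [leRHS](big_cat_nat _ (n := n)) ?leq_pmull//= lerDl; apply: sumr_ge0.
have : \sum_(0 <= i < n) d 0%N <= \sum_(0 <= i < n) (6 * d i + 4 * d (2 * i)%N).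
  by apply: ler_sum => i _; exact: translate_dist_doubling.
have even := sum_even_le n d0.
rewrite sumr_const_nat subn0 -mulr_natl big_split/= -!mulr_sumr => tot.
have -> : Int (fun x => (f x - translate_average f h (2 * n) x) ^+ 2) = d 0%N.
  by apply: eq_Int => x; rewrite mulr0 addr0.
have var : \sum_(0 <= i < 2 * n) d i = _ := translate_variance h bf n2; rewrite natrM in var.
by rewrite -(ler_pM2l np); clra.
Qed.

Lemma increment_sqr_le_near v h c : bdd_supp v -> 0 < h ->
  L1le mu2 (fun z => ind (`|z.1 - z.2| <= 2 * h) * (v z.1 - v z.2) ^+ 2) c ->
  Int (fun x => (v (x + h) - v x) ^+ 2) <= 2 / h * c.
Proof.
move=> bv h0 hc; have mv : measurable_fun setT v by case: bv.
have H := L1leZ 2 (L1leD (L1le_shift_fst h hc) hc).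
have : L1le mu2 (fun z => (v (z.1 + h) - v z.1) ^+ 2 * ind (`|z.1 - z.2| <= h)) (`|2| * (c + c)).
  apply: L1le_dom2 H; first by mes.
  move=> x z /=; rewrite ger0_norm; last by nneg.
  have [l|l] := leP `|x - z| h; last by rewrite mulr0; nneg.
  have -> : `|x - z| <= 2 * h by clra.
  have -> : `|x + h - z| <= 2 * h.
    by rewrite -addrA [h - z]addrC addrA; have := ler_normD (x - z) h; rewrite (ger0_norm (ltW h0)); clra.
  rewrite /ind !mul1r mulr1; move: (v (x + h)) (v x) (v z) => p q r; apply: (@le_sub_sqr _ (p + q - 2 * r)); ring.
move/L1le_Rint_snd; case.
- by mes.
- by move=> z; nneg.
- by move=> x; eexists; exact: (L1leZ ((v (x + h) - v x) ^+ 2) (L1le_ball x (ltW h0))).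
move=> m1 m2; have K : L1le mu (fun x => 2 * h * (v (x + h) - v x) ^+ 2) (`|2| * (c + c)).
  split; first by mes.
  apply: le_trans m2; apply: ge0_le_integral => //; first by apply: measurable_EFin_norm; mes.
    exact: measurable_EFin_norm.
  move=> x _; rewrite /= (RintZ _ (c := 2 * h)); last by apply: L1le_ball; exact: ltW.
  by rewrite Rint_ball ?(ltW h0)// mulrC.
have b2 : bdd_supp (fun x => (v (x + h) - v x) ^+ 2) by apply: bdd_supp_sqr; apply: bdd_suppB => //;
  exact: bdd_supp_shift.
have e := IntZ (2 * h) b2; have := Rint_le_bound K; rewrite -/(Int _) e (ger0_norm (ler0n R 2)) => hh.
have h20 : 0 < 2 * h by clra.
rewrite -(ler_pM2l h20); apply: le_trans hh _; apply: eqW; field; exact: lt0r_neq0.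
Qed.

Lemma sum_increment_sqr_le v h0 E n : bdd_supp v -> 0 < h0 -> L1le mu2 (en v) E ->
  \sum_(0 <= j < n) (dyad h0 j)^-1 * Int (fun x => (v (x + dyad h0 j) - v x) ^+ 2) <= 24 * E.
Proof.
move=> bv h00 hE; have mv : measurable_fun setT v by case: bv.
have me := measurable_en mv.
pose psi j (z : R * R) := ind (`|z.1 - z.2| <= 3 * dyad h0 j) * (`|z.1 - z.2| / dyad h0 j) ^+ 2 * en v z.
have mpsi j : measurable_fun setT (psi j) by rewrite /psi; mes.
have psi0 j z : 0 <= psi j z by rewrite /psi; nneg.
have L j : L1le mu2 (psi j) (\int[mu2]_z psi j z).
  apply: (@L1le_Rint _ _ _ _ _ (`|9| * E)) => //; apply: L1le_dom2 (L1leZ 9 hE) => // x y.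
  rewrite ger0_norm// /psi/=; apply: ler_wpM2r; first exact: en_ge0.
  have dj := dyad_gt0 j h00; have [l|l] := leP `|x - y| (3 * dyad h0 j); last by rewrite mul0r.
  have t3 : `|x - y| / dyad h0 j <= 3 by rewrite ler_pdivrMr.
  have t0 : 0 <= `|x - y| / dyad h0 j by rewrite divr_ge0 ?(ltW dj).
  by rewrite mul1r; move: (_ / _) t3 t0 => t; cnra.
have S : \sum_(0 <= j < n) \int[mu2]_z psi j z <= 12 * E.
  rewrite -(Rint_sum _ L).
  have hs : L1le mu2 (fun z => \sum_(0 <= j < n) psi j z) (`|12| * E).
    apply: L1le_dom2 (L1leZ 12 hE); first by apply: measurable_sum.
    move=> x y; rewrite ger0_norm; last by apply: sumr_ge0.
    rewrite /psi -mulr_suml; apply: ler_wpM2r; first exact: en_ge0.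
    exact: sum_dyad_ratio_sqr_le.
  by have := Rint_le_bound hs; rewrite (ger0_norm (ler0n R 12)).
apply: le_trans (_ : \sum_(0 <= j < n) 2 * \int[mu2]_z psi j z <= _); last by rewrite -mulr_sumr; clra.
apply: ler_sum => j _; have dj := dyad_gt0 j h00.
rewrite mulrC ler_pdivrMr//.
have : L1le mu2 (fun z => ind (`|z.1 - z.2| <= 2 * dyad h0 j) * (v z.1 - v z.2) ^+ 2)
  (`|dyad h0 j ^+ 2| * \int[mu2]_z psi j z).
  apply: L1le_dom2 (L1leZ (dyad h0 j ^+ 2) (L j)); first by mes.
  move=> x y; rewrite ger0_norm; last by nneg.
  rewrite /psi /en /=; have [l|l] := leP `|x - y| (2 * dyad h0 j); last by rewrite mul0r; nneg;
    rewrite ?invr_ge0 ?(ltW dj).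
  have l3 : `|x - y| <= 3 * dyad h0 j by clra.
  rewrite l3 /ind !mul1r.
  have [->|ne] := eqVneq x y; first by rewrite subrr expr0n/= !mul0r !mulr0.
  have e : `|x - y| ^+ 2 = (x - y) ^+ 2 by rewrite real_normK ?num_real.
  apply: eqW; rewrite [(`|x - y| / _) ^+ 2]expr_div_n e; field; rewrite subr_eq0 ne gt_eqF//.
move=> /(increment_sqr_le_near bv dj); rewrite (ger0_norm (sqr_ge0 _)); congr (_ <= _); field; exact: lt0r_neq0.
Qed.

End BoundedCompact.

Section Kernel.
Variable R : realType.
Local Notation mu := (@lebesgue_measure R).
Local Notation mu2 := (mu \x mu)%E.

Definition weight (t : R) : R := t `^ (- (3 / 4)).
Definition Jweight (d : R) (z : R * R) : R := ind (`|z.1 - z.2| <= d) * weight `|z.1 - z.2|.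

Lemma weight_ge0 t : 0 <= weight t. Proof. exact: powR_ge0. Qed.
Lemma measurable_weight : measurable_fun setT weight. Proof. by rewrite /weight; mes. Qed.
Lemma le_weight (s t : R) : 0 < s -> s <= t -> weight t <= weight s.
Proof.
move=> s0 st; rewrite /weight !powRN lef_pV2 ?posrE ?powR_gt0 ?(lt_le_trans s0)//.
by apply: powR_le_base; clra.
Qed.

Lemma dyad_weight d k : 0 < d ->
  dyad d k * weight (dyad d k.+1) = 2 * d `^ 4^-1 * ((2^-1 : R) `^ 4^-1) ^+ k.+1.
Proof.
move=> d0; have dk := dyad_gt0 k.+1 d0.
have -> : dyad d k = 2 * dyad d k.+1 by rewrite dyadS; field.
rewrite -mulrA /weight -{1}[dyad d k.+1](powRr1 (ltW dk)) -powRD; last by apply/implyP => _; rewrite gt_eqF.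
rewrite -mulrA (_ : 1 + _ = 4^-1); last by field.
have -> : dyad d k.+1 = d * 2^-1 ^+ k.+1 by rewrite /dyad exprVn.
by rewrite powRM ?exprn_ge0 ?invr_ge0 ?(ltW d0)// -powR_mulrn ?invr_ge0// powRAC powR_mulrn ?powR_ge0.
Qed.

Lemma Jweight_ge0 d z : 0 <= Jweight d z. Proof. by rewrite mulr_ge0 ?ind_ge0 ?weight_ge0. Qed.

Lemma Jweight_le_dyadic d n x y : 0 < d -> ind (dyad d n < `|x - y|) * Jweight d (x, y)
  <= \sum_(0 <= k < n) weight (dyad d k.+1) * ind (`|x - y| <= dyad d k).
Proof.
move=> d0; elim: n => [|n ih].
  rewrite big_geq// /Jweight dyad0/=; have [h|h] := ltP d `|x - y|; last by rewrite mul0r.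
  by rewrite !mul0r mulr0.
rewrite big_nat_recr//=; have dn := dyad_gt0 n.+1 d0.
have [h|h] := leP `|x - y| (dyad d n); last first.
  rewrite mulr0 addr0; apply: le_trans ih; rewrite indT ?indT//.
  by rewrite dyadS; have := dyad_gt0 n d0; clra.
have J0 := Jweight_ge0 d (x, y).
rewrite mulr1 -[leLHS]add0r; apply: lerD; first by apply: le_trans ih; rewrite mulr_ge0 ?ind_ge0.
have [h'|h'] := ltP (dyad d n.+1) `|x - y|; last by rewrite mul0r weight_ge0.
rewrite mul1r /Jweight/=; apply: le_trans (le_weight dn (ltW h')).
by rewrite ler_piMl ?weight_ge0 ?ind_le1.
Qed.

Lemma L1le_Jweight d : 0 < d -> exists c, forall x, L1le mu (fun y => Jweight d (x, y)) c.
Proof.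
move=> d0; pose q : R := 2^-1 `^ 4^-1; have d4 : 0 <= d `^ 4^-1 := powR_ge0 _ _.
have /andP[q0 q1] : 0 < q < 1 by apply: powR_half_itv; rewrite invr_gt0.
have mk := measurable_weight; have J0 := Jweight_ge0 d.
exists (2 * (2 * d `^ 4^-1 * (q * (1 - q)^-1))) => x.
have mJ : measurable_fun setT (fun y => Jweight d (x, y)) by rewrite /Jweight/=; mes.
apply: (@L1le_monotone_limit _ _ R mu (fun n y => ind (dyad d n < `|x - y|) * Jweight d (x, y)) _ _ mJ)
  => [n|n y|n y|y].
- have H : L1le mu (fun y => \sum_(0 <= k < n) weight (dyad d k.+1) * ind (`|x - y| <= dyad d k))
     (\sum_(0 <= k < n) `|weight (dyad d k.+1)| * (2 * dyad d k)).
    by apply: L1le_sum => k _; apply: L1leZ; apply: L1le_ball; apply: ltW; exact: dyad_gt0.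
  have F0 y : 0 <= ind (dyad d n < `|x - y|) * Jweight d (x, y) by rewrite mulr_ge0 ?ind_ge0.
  apply: L1le_domW H _ _ _ => [||y]; last by rewrite (ger0_norm (F0 y)); exact: (Jweight_le_dyadic n x y d0).
    rewrite (eq_bigr (fun k => 2 * (2 * d `^ 4^-1 * (q * q ^+ k)))) => [|k _]; last first.
      by rewrite ger0_norm ?weight_ge0// -exprS -dyad_weight//; ring.
    rewrite -!mulr_sumr; do 3! (apply: ler_wpM2l; first by rewrite ?mulr_ge0 ?(ltW q0)).
    exact: geometric_sum_le (ltW q0) q1.
  by mes.
- by rewrite mulr_ge0 ?ind_ge0.
- apply: ler_wpM2r; first exact: J0.
  by apply: le_ind; apply: le_lt_trans; rewrite dyadS; have := dyad_gt0 n d0; clra.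
- have [xy|ne] := eqVneq x y.
    have e : - (3 / 4) != 0 :> R by apply/eqP; clra.
    by exists 0%N; rewrite /Jweight xy /weight/= subrr normr0 (powR0 e) ?mulr0 ?mul0r ?mulr0.
  have l0 : 0 < `|x - y| by rewrite normr_gt0 subr_eq0.
  have [n hn] := dyad_small d0 l0; exists n.
  by rewrite indT ?mul1r//; exact: hn.
Qed.

Lemma L1le_en_form a Lam (v : R -> R) : elliptic_kernel a Lam -> admissible v -> L1le mu2 (en v) (Lam * form a v v).
Proof.
move=> ok gv; have [mv _ _] := gv; have [c hc] := L1le_form_admissible ok gv gv.
have [_ L1 _ _] := ok; have Lp : 0 < Lam by clra.
have hs := L1le_Rint hc (fun z => mulr_ge0 (mulr_ge0 _ _) (kern_ge0 z ok)).
have {}hs : L1le mu2 (fun z => (v z.1 - v z.2) * (v z.1 - v z.2) * kern a z) (form a v v).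
  by apply: L1le_Rint hc _ => z; rewrite -expr2 mulr_ge0 ?sqr_ge0//; exact: kern_ge0 ok.
have := L1leZ Lam hs; rewrite (ger0_norm (ltW Lp)); apply: L1le_dom2; first exact: measurable_en.
move=> x y; rewrite ger0_norm ?en_ge0// /en/=; have /andP[h _] := kern_bounds x y ok.
rewrite -expr2 mulrCA; apply: ler_wpM2l; first exact: sqr_ge0.
by rewrite -(ler_pM2l (_ : 0 < Lam^-1)) ?invr_gt0// mulrA mulVf ?mul1r// gt_eqF.
Qed.

Section IncrementDecay.
Variables (a W : R -> R) (Lam K Cd x0 rb rc : R).
Hypotheses (ok : elliptic_kernel a Lam) (gW : admissible W) (bW : bdd_supp W) (K0 : 0 <= K) (Cd0 : 0 <= Cd)
  (hK : forall x y, (W x - W y) ^+ 2 <= K * `|x - y|) (Ws : forall x, rb < `|x - x0| -> W x = 0) (rbc : rb < rc)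
  (dual : forall phi M, admissible phi -> (forall x, `|phi x| <= M) -> (forall x, rc < `|x - x0| -> phi x = 0) ->
    `|form a W phi| <= M * Cd).

Lemma increment_supp h x : 0 < h -> rb + h < `|x - x0| -> increment W h x = 0.
Proof.
move=> h0 hx; rewrite /increment !Ws ?subrr//; first by clra.
by have := ler_normB (x + h - x0) h; rewrite (ger0_norm (ltW h0)) addrAC addrK; clra.
Qed.

Lemma increment_supp_back h x : 0 < h -> rb + h < `|x - x0| -> increment W h (x - h) = 0.
Proof.
move=> h0 hx; rewrite /increment subrK !Ws ?subrr//; last by clra.
by have := ler_normD (x - h - x0) h; rewrite (ger0_norm (ltW h0)) addrAC subrK; clra.
Qed.

Lemma form_increment_self_le h : 0 < h -> h <= rc - rb ->
  form a (increment W h) (increment W h) <= 2 * (Num.sqrt (K * h) * Cd).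
Proof.
move=> h0 hd; have ginc := admissible_increment gW h.
have vm x : `|increment W h x| <= Num.sqrt (K * h).
  rewrite -sqrtr_sqr ler_wsqrtr//; apply: le_trans (hK _ _) _.
  by rewrite [x + h]addrC addrK ger0_norm ?(ltW h0).
apply: le_trans (ler_norm _) _; rewrite {1}/increment (form_increment h ok gW ginc).
have q1 : `|form a W (increment W h)| <= Num.sqrt (K * h) * Cd.
  by apply: dual => // x hx; apply: increment_supp => //; clra.
have q2 : `|form a W (fun x => increment W h (x - h))| <= Num.sqrt (K * h) * Cd.
  apply: dual (admissible_shift (- h) ginc) (fun x => vm (x - h)) _ => x hx.
  by apply: increment_supp_back => //; clra.
by apply: le_trans (ler_normB _ _) _; clra.
Qed.

Lemma second_increment_sqr_le h : 0 < h -> h <= rc - rb ->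
  Int (fun x => (increment W h (x + h) - increment W h x) ^+ 2) <= 4 * (12 * Lam * Cd * Num.sqrt K * h `^ (3 / 2)).
Proof.
move=> h0 hd; have [_ L1 _ _] := ok; have Lp : 0 <= Lam by clra.
have binc : bdd_supp (increment W h) by apply: bdd_suppB => //; exact: bdd_supp_shift.
have := sum_increment_sqr_le 1 binc h0 (L1le_en_form ok (admissible_increment gW h)); rewrite big_nat1 dyad0.
rewrite ler_pdivrMl// => /le_trans; apply.
have h24 : 0 <= h * (24 * Lam) by rewrite mulr_ge0 ?(ltW h0)// mulr_ge0.
have := ler_wpM2l h24 (form_increment_self_le h0 hd); rewrite sqrtrM//.
have -> : h `^ (3 / 2) = h * Num.sqrt h.
  rewrite (_ : 3 / 2 = 1 + 2^-1); last by field.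
  rewrite powRD; last by apply/implyP => _; rewrite gt_eqF.
  by rewrite powRr1 ?(ltW h0)// powR12_sqrt// ltW.
by move: (form _ _ _) => X H; apply: le_trans (le_trans _ H) _; apply: eqW; ring.
Qed.

(* [4 N(h) = N(2h) + |D_h D_h W|^2] for [N(h) = |D_h W|^2], and testing with [D_h W] gains the extra half power of [h]
   in the last term. *)
Lemma increment_sqr_decay : exists A d, [/\ 0 < A, 0 < d & forall h, 0 < h -> h <= d ->
  Int (fun x => (W (x + h) - W x) ^+ 2) <= A * h `^ (3 / 2)].
Proof.
have [_ L1 _ _] := ok; have d0 : 0 < rc - rb by clra.
have C0 : 0 <= 12 * Lam * Cd * Num.sqrt K by rewrite !mulr_ge0 ?sqrtr_ge0//; clra.
have e0 : 0 <= 4 * Int (fun x => W x ^+ 2) by rewrite mulr_ge0//; apply: Int_ge0 => x; exact: sqr_ge0.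
have ratio : 4^-1 * (2 : R) `^ (3 / 2) < 1.
  have : (2 : R) `^ (3 / 2) < 2 `^ 2.
    by rewrite /powR !gt_eqF// ltr_expR ltr_pM2r ?ln_gt0; clra.
  by rewrite (powR_mulrn 2)// => h; clra.
have t0 : (0 : R) < 3 / 2 by clra.
have [|A A0 HA] := power_decay _ C0 t0 d0 e0 (ltr1n R 2) ratio; first by rewrite invr_ge0.
exists A, (rc - rb); split => //; apply: (HA (fun h => Int (fun x => increment W h x ^+ 2))) => h h0 hd.
  by rewrite -(parallelogram h bW) lerDl; apply: Int_ge0 => x; exact: sqr_ge0.
have binc : bdd_supp (increment W h) by apply: bdd_suppB => //; exact: bdd_supp_shift.
have hd1 : h <= rc - rb by clra.
have := second_increment_sqr_le h0 hd1; have := parallelogram h binc.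
have -> : Int (fun x => (increment W h (x + h) + increment W h x) ^+ 2) = Int (fun x => increment W (2 * h) x ^+ 2).
  apply: eq_Int => x; congr (_ ^+ 2); rewrite /increment.
  by rewrite (_ : x + h + h = x + 2 * h); ring.
by clra.
Qed.

End IncrementDecay.
End Kernel.
Ltac nneg_weight := repeat first [ exact: weight_ge0 | exact: Jfar_ge0 | progress nneg | rewrite invr_ge0 ].

Section Support.
Variable R : realType.
Local Notation mu := (@lebesgue_measure R).
Implicit Types (phi : R -> R) (c rho lam : R).

Lemma admissible_bdd_supp phi c rho : admissible phi -> (forall x, rho < `|x - c| -> phi x = 0) -> bdd_supp phi.
Proof.
move=> [mp [M hM] _] p0; split => //; exists M, (`|c| + rho); split => // x hx.
by apply: p0; have := ler_normD (x - c) c; rewrite subrK; clra.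
Qed.

Lemma L1le_sqr phi : bdd_supp phi -> L1le mu (fun x => phi x ^+ 2) (Int (fun x => phi x ^+ 2)).
Proof.
by move=> /bdd_supp_sqr/bdd_supp_L1le[c hc]; apply: (L1le_Rint hc) => x; exact: sqr_ge0.
Qed.

Lemma L1le_of_sqr phi x0 rc lam : 0 < rc -> 0 < lam -> bdd_supp phi -> (forall x, rc < `|x - x0| -> phi x = 0) ->
  L1le mu (fun x => phi x) (2^-1 * (lam * Int (fun x => phi x ^+ 2)) + rc / lam).
Proof.
move=> rc0 l0 bp p0; have [mp _] := bp; have hp := L1le_sqr bp.
have hi := L1le_ball x0 (ltW rc0).
have := L1leD (L1leZ (2^-1 * lam) hp) (L1leZ (2^-1 / lam) hi).
rewrite !ger0_norm; [|by rewrite divr_ge0 ?(ltW l0)//; clra|by rewrite mulr_ge0 ?(ltW l0)//; clra] => H.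
apply: (L1le_domW (H)) => //.
  by apply: eqW; field; exact: lt0r_neq0.
move=> x; rewrite -[(phi x) ^+ 2]real_normK ?num_real// distrC.
have [h|h] := leP `|x - x0| rc; last by rewrite p0// normr0; nneg; rewrite ?invr_ge0 ?(ltW l0)//; clra.
have := @amgm _ `|phi x| 1 (lam / 2) (divr_gt0 l0 (ltr0Sn _ _)); rewrite !mulr1 => /le_trans; apply.
by rewrite /ind; apply: eqW; field; exact: lt0r_neq0.
Qed.

End Support.

(* [W] agrees with [w] near the support of the test functions; its increments are square integrable with rate [h^(3/2)]
   and bounded by [sqrt h]. *)
Section SqrtHolder.
Variable R : realType.
Local Notation mu := (@lebesgue_measure R).
Local Notation mu2 := (mu \x mu)%E.
Variables (w W : R -> R) (x0 ra rc K A d cJ : R).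
Hypotheses (mw : measurable_fun setT w) (w1 : forall x, `|w x| <= 1) (bW : bdd_supp W) (K0 : 0 <= K) (A0 : 0 < A)
  (d0 : 0 < d) (rc0 : 0 < rc) (rcd : rc + d <= ra) (hK : forall x y, (W x - W y) ^+ 2 <= K * `|x - y|)
  (hA : forall h, 0 < h -> h <= d -> Int (fun x => (W (x + h) - W x) ^+ 2) <= A * h `^ (3 / 2))
  (eW : forall x, `|x - x0| <= ra -> W x = w x) (hJ : forall x, L1le mu (fun y => Jweight d (x, y)) cJ).
Implicit Types (x y t lam : R) (phi : R -> R).

Definition weighted_increment (z : R * R) : R :=
  ind (`|z.1 - z.2| <= d) * ((W z.1 - W z.2) ^+ 2 / (`|z.1 - z.2| ^+ 3 * weight `|z.1 - z.2|)).

Lemma weighted_increment_ge0 z : 0 <= weighted_increment z.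
Proof. by rewrite /weighted_increment; nneg_weight. Qed.

Lemma measurable_weighted_increment : measurable_fun setT weighted_increment.
Proof. by have [mW _] := bW; have mk := @measurable_weight R; rewrite /weighted_increment; mes. Qed.

Lemma powR_weight t : 0 < t -> t `^ (3 / 2) = t ^+ 3 * (weight t * weight t).
Proof.
move=> t0; rewrite /weight -powRD; last by apply/implyP => _; rewrite gt_eqF.
rewrite -powR_mulrn ?(ltW t0)// -powRD; last by apply/implyP => _; rewrite gt_eqF.
by congr (_ `^ _); field.
Qed.

Lemma Int_increment_le t : t != 0 -> `|t| <= d -> Int (fun x => (W (x + t) - W x) ^+ 2) <= A * `|t| `^ (3 / 2).
Proof.
move=> t0 td; have tp : 0 < `|t| by rewrite normr_gt0.
apply: le_trans (hA tp td); have [tt|tt] := leP 0 t; first by rewrite ger0_norm.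
have bt : bdd_supp (fun x => W (x + t) - W x) by apply: bdd_suppB => //; exact: bdd_supp_shift.
rewrite ltr0_norm// -(Int_shift (- t) (bdd_supp_sqr bt)); apply: eqW; apply: eq_Int => x.
by rewrite subrK sqr_distC.
Qed.

Lemma L1le_weighted_increment : L1le mu2 weighted_increment (A * cJ).
Proof.
have mF := measurable_weighted_increment; apply: L1le_shearE => //.
have hg : L1le mu (fun t => A * Jweight d (0, t)) (A * cJ).
  by rewrite -[X in L1le _ _ (X * _)](ger0_norm (ltW A0)); apply: L1leZ; exact: hJ.
have mk := @measurable_weight R; have [mW _] := bW.
apply: (L1le_tonelli_snd _ _ hg) => [|t]; first by rewrite /weighted_increment/=; mes.
rewrite /weighted_increment/=; pose k := ind (`|t| <= d) / (`|t| ^+ 3 * weight `|t|).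
have k0 : 0 <= k by rewrite /k divr_ge0 ?ind_ge0 ?mulr_ge0 ?weight_ge0 ?exprn_ge0.
have bt : bdd_supp (fun x => W (x + t) - W x) by apply: bdd_suppB => //; exact: bdd_supp_shift.
have [_] := L1leZ k (L1le_sqr bt); rewrite (ger0_norm k0) => h.
apply: le_trans (_ : (k * Int (fun x => (W (x + t) - W x) ^+ 2))%:E <= _)%E.
  apply: le_trans h; apply: eqW; apply: eq_integral => x _; congr (`|_|)%:E; rewrite /k [t + x]addrC.
  by rewrite (_ : x - (x + t) = - t) ?normrN 1?(sqr_distC (W x)); ring.
rewrite lee_fin /Jweight/= sub0r normrN /k.
have [td|td] := leP `|t| d; last by rewrite !mul0r mulr0.
rewrite !mul1r; have [->|t0] := eqVneq t 0.
  by rewrite normr0 expr0n/= mul0r invr0 mul0r mulr_ge0 ?weight_ge0// ltW.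
have tp : 0 < `|t| by rewrite normr_gt0.
have kp : 0 < weight `|t| by rewrite /weight powR_gt0.
rewrite ler_pdivrMl; last by rewrite mulr_gt0 ?exprn_gt0.
by apply: le_trans (Int_increment_le t0 td) _; rewrite powR_weight//; apply: eqW; ring.
Qed.

Lemma en_le_far x y : d < `|x - y| -> en w (x, y) <= 4 * Jfar d (x, y).
Proof.
move=> l; rewrite /en /Jfar/= (ltW l) /ind mul1r; apply: ler_wpM2r; first exact: inv_sqr_ge0.
rewrite (_ : 4 = 2 ^+ 2); last by ring.
by apply: norm_le_sqr; apply: le_trans (ler_normB _ _) _; have := w1 x; have := w1 y; clra.
Qed.

Lemma test_en_le_near lam phi x y : 0 < lam -> `|x - x0| <= rc -> `|x - y| <= d ->
  `|phi x| * en w (x, y) <= lam / 2 * (phi x ^+ 2 * Jweight d (x, y)) + K / (2 * lam) * weighted_increment (x, y).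
Proof.
move=> l0 hx hy; have eu : w x - w y = W x - W y.
  by rewrite !eW//; have := ler_distD x y x0; rewrite (distrC y x); clra.
rewrite /en /Jweight /weighted_increment/= hy /ind !mul1r eu.
have [->|ne] := eqVneq x y.
  by rewrite subrr expr0n/= !mul0r !mulr0 addr0; have l00 := ltW l0; nneg_weight.
have tp : 0 < `|x - y| by rewrite normr_gt0 subr_eq0.
have kp : 0 < weight `|x - y| by rewrite /weight powR_gt0.
rewrite -[(x - y) ^+ 2]sqr_normr -[phi x ^+ 2]sqr_normr.
have hD := hK x y; have D0 := sqr_ge0 (W x - W y).
move: ((W x - W y) ^+ 2) `|x - y| (weight _) `|phi x| hD D0 tp kp => D t k P hD D0 tp kp.
have t1 : 0 < lam * k / 2 by rewrite divr_gt0// mulr_gt0.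
apply: le_trans (amgm P (D / t ^+ 2) t1) _; apply: lerD; first by apply: eqW; ring.
have -> : (D / t ^+ 2) ^+ 2 / (4 * (lam * k / 2)) = D * (D / (2 * lam * t ^+ 4 * k)) by field; rewrite !gt_eqF.
have -> : K / (2 * lam) * (D / (t ^+ 3 * k)) = K * t * (D / (2 * lam * t ^+ 4 * k)) by field; rewrite !gt_eqF.
by apply: ler_wpM2r => //; rewrite divr_ge0// !mulr_ge0 ?exprn_ge0// ltW.
Qed.

Lemma L1le_test_en lam phi : 0 < lam -> bdd_supp phi -> (forall x, rc < `|x - x0| -> phi x = 0) ->
  L1le mu2 (fun z => `|phi z.1| * en w z)
    ((cJ / 2 * (1 + K * A) + (4 + 8 * rc) / d) * (lam * Int (fun x => phi x ^+ 2) + lam^-1)).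
Proof.
move=> l0 bp p0; have [mp _] := bp; have cJ0 := L1le_ge0 (hJ 0).
have hp := L1le_sqr bp; have ha := L1le_of_sqr rc0 l0 bp p0; set I := Int _ in hp ha *.
have I0 : 0 <= I := L1le_ge0 hp.
have mJ : measurable_fun setT (Jweight d) by have mk := @measurable_weight R; rewrite /Jweight; mes.
have e1 : 0 <= lam / 2 by rewrite divr_ge0 // ltW.
have e2 : 0 <= K / (2 * lam) by rewrite divr_ge0 // mulr_ge0// ltW.
have near := L1leD (L1leZ (lam / 2) (L1le_kernel_fst mJ hJ hp)) (L1leZ (K / (2 * lam)) L1le_weighted_increment).
have far := L1leZ 4 (L1le_kernel_fst (measurable_Jfar d) (fun x => L1le_Jfar x d0) (L1le_norm ha)).
apply: L1le_domW2 (L1leD near far) _ _ _ => [||x y /=].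
- rewrite (ger0_norm e1) (ger0_norm e2) (ger0_norm (ler0n R 4)).
  have li : 0 < lam^-1 by rewrite invr_gt0.
  have di : 0 < d^-1 by rewrite invr_gt0.
  have [A0' rc0'] := (ltW A0, ltW rc0).
  rewrite -subr_ge0 (_ : _ - _ = cJ / 2 / lam + cJ / 2 * K * A * (lam * I) + 8 * rc / d * (lam * I) + 4 / d / lam).
    by nneg_weight.
  by field; rewrite !gt_eqF.
- by have me := measurable_en mw; mes.
have far0 : 0 <= 4 * (`|phi x| * Jfar d (x, y)) by nneg_weight.
have near1 : 0 <= lam / 2 * (phi x ^+ 2 * Jweight d (x, y)).
  by apply: mulr_ge0 => //; rewrite mulr_ge0 ?sqr_ge0 ?Jweight_ge0.
have near2 : 0 <= K / (2 * lam) * weighted_increment (x, y) by rewrite mulr_ge0 ?weighted_increment_ge0.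
rewrite ger0_norm; last by nneg.
have [px|px] := leP `|x - x0| rc; last by rewrite {1}p0// normr0 mul0r; apply: addr_ge0 => //; exact: addr_ge0.
have [l|l] := leP `|x - y| d.
  by apply: le_trans (test_en_le_near phi l0 px l) _; rewrite lerDl.
apply: le_trans (_ : 4 * (`|phi x| * Jfar d (x, y)) <= _); last by rewrite lerDr addr_ge0.
by rewrite [leRHS]mulrCA; apply: ler_wpM2l => //; exact: en_le_far.
Qed.

End SqrtHolder.

Section SquareDual.
Variables (R : realType) (N : nat).
Local Notation mu := (@lebesgue_measure R).
Local Notation mu2 := (mu \x mu)%E.
Variables (a : R -> R) (Lam : R) (u m : 'I_N -> R -> R) (x0 r0 r1 K : R) (M2 : 'I_N -> R).
Hypotheses (HS : solution a Lam u m x0 r0) (r1r : r1 < r0) (K0 : 0 <= K)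
  (hu : forall i x y, `|x - x0| <= r1 -> `|y - x0| <= r1 -> (u i x - u i y) ^+ 2 <= K * `|x - y|)
  (hm2 : forall i, L1le mu (fun x => m i x ^+ 2) (M2 i)).
Implicit Types (phi : R -> R) (i j : 'I_N).

Section Cut.
Variables (chi : R -> R) (L ra rb : R).
Hypotheses (hchi : cutoff chi x0 ra rb L) (L0 : 0 < L) (ra0 : 0 < ra) (rab : ra < rb) (rbr : rb < r1).

Let rb0 : 0 < rb. Proof. exact: lt_trans rab. Qed.
Let rbr0 : rb <= r0. Proof. by apply: ltW; exact: lt_trans r1r. Qed.
Let sqr_const := 4 * K + 4 * L ^+ 2 * r1 + (r1 - rb)^-1.

Lemma sqr_const_ge0 : 0 <= sqr_const.
Proof.
have iv : 0 < (r1 - rb)^-1 by rewrite invr_gt0 subr_gt0.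
have LL : 0 <= L ^+ 2 * r1 by rewrite mulr_ge0 ?sqr_ge0// ltW// (lt_trans rb0).
by rewrite /sqr_const; clra.
Qed.

Lemma cutoff_sol_sqr_le_ball i x y : `|x - x0| <= r1 ->
  (cutoff_sol chi u i x - cutoff_sol chi u i y) ^+ 2 <= sqr_const * `|x - y|.
Proof.
move=> hx; have l0 := normr_ge0 (x - y); have iv : 0 < (r1 - rb)^-1 by rewrite invr_gt0 subr_gt0.
have K0l := mulr_ge0 K0 l0; have Ll : 0 <= L ^+ 2 * r1 * `|x - y|.
  by rewrite !mulr_ge0 ?sqr_ge0// ltW// (lt_trans rb0).
have gap0 : 0 <= (r1 - rb)^-1 * `|x - y| by rewrite mulr_ge0// ltW.
rewrite /sqr_const (mulrDl _ _ `|x - y|) (mulrDl (4 * K)).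
have [hy|hy] := leP `|y - x0| r1.
  have l2 : `|x - y| <= 2 * r1 by have := ler_distD x0 x y; rewrite (distrC x0 y); clra.
  rewrite /cutoff_sol [X in X ^+ 2](_ : _ = chi x * (u i x - u i y) + u i y * (chi x - chi y)); last by ring.
  have value : (chi x * (u i x - u i y)) ^+ 2 <= K * `|x - y|.
    apply: le_trans (hu i hx hy); rewrite -(sqr_normr (u i x - u i y)); apply: norm_le_sqr.
    by rewrite normrM ler_piMl//; exact: cutoff_le1 hchi x.
  have slope : (u i y * (chi x - chi y)) ^+ 2 <= L ^+ 2 * (2 * r1 * `|x - y|).
    apply: le_trans (_ : (L * `|x - y|) ^+ 2 <= _).
      apply: norm_le_sqr; rewrite normrM; apply: le_trans (cutoff_lipschitz hchi x y).
      by rewrite ler_piMl//; exact: sol_le1 HS i y.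
    by rewrite exprMn; apply: ler_wpM2l; [exact: sqr_ge0|rewrite expr2; exact: ler_wpM2r].
  by apply: le_trans (sqrD2_le _ _) _; move: value slope gap0 Ll K0l; clra.
rewrite (cutoff_sol_supp u hchi i (x := y)) ?subr0; last by clra.
apply: le_trans (_ : (r1 - rb)^-1 * `|x - y| <= _); last by move: Ll K0l; clra.
have [h|h] := ltP rb `|x - x0|; first by rewrite (cutoff_sol_supp u hchi i h) expr0n.
have l1 : r1 - rb <= `|x - y| by have := ler_distD x y x0; rewrite (distrC y x); clra.
apply: (@le_trans _ _ 1); last by rewrite mulrC ler_pdivlMr ?mul1r ?subr_gt0.
by rewrite -(expr1n _ 2); apply: norm_le_sqr; exact: cutoff_sol_le1 HS hchi i x.
Qed.

Lemma cutoff_sol_sqr_le i x y : (cutoff_sol chi u i x - cutoff_sol chi u i y) ^+ 2 <= sqr_const * `|x - y|.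
Proof.
have [hx|hx] := leP `|x - x0| r1; first exact: cutoff_sol_sqr_le_ball.
have [hy|hy] := leP `|y - x0| r1; first by rewrite sqr_distC distrC; exact: cutoff_sol_sqr_le_ball.
by rewrite !(cutoff_sol_supp u hchi) ?(lt_trans rbr)// subrr expr0n/= mulr_ge0// sqr_const_ge0.
Qed.

Lemma cutoff_sol_bdd_supp i : bdd_supp (cutoff_sol chi u i).
Proof. exact: admissible_bdd_supp (admissible_cutoff_sol HS hchi rb0 rbr0 i) (cutoff_sol_supp u hchi i). Qed.

Lemma form_cutoff_sol_sup_le i rc : 0 < rc -> rc < r0 -> exists2 Cd, 0 <= Cd & forall phi M, admissible phi ->
  (forall x, `|phi x| <= M) -> (forall x, rc < `|x - x0| -> phi x = 0) ->
  `|form a (cutoff_sol chi u i) phi| <= M * Cd.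
Proof.
move=> rc0 rcr; have [cm hcm] := sol_source HS i; have [mm _] := hcm.
have hb : `|x0 - x0| + rc < r0 by rewrite subrr normr0 add0r.
have [_ L1 _ _] := sol_kernel HS; have Lp : 0 <= Lam by clra.
exists (2 * Lam * ball_energy u x0 rc + cm + 2 * cutoff_const Lam L * rc) => [|phi M gp hM p0].
  rewrite !addr_ge0//; [|exact: L1le_ge0 hcm|by rewrite mulr_ge0 ?(ltW rc0)// mulr_ge0// (cutoff_const_ge0 HS L0)].
  by rewrite !mulr_ge0//; exact: L1le_ge0 (L1le_ball_energy HS hb).
have M0 : 0 <= M := le_trans (normr_ge0 _) (hM 0); have [mp _ _] := gp.
apply: (form_cutoff_sol_bounded_le HS hchi rb0 L0 gp (ltW rc0) hb hM p0).
rewrite -[X in L1le _ _ (X * _)](ger0_norm M0); apply: L1le_dom (L1leZ M (L1le_norm hcm)); first by mes.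
by move=> x; rewrite normrM mulrC; apply: ler_wpM2r.
Qed.

Lemma cutoff_sol_increment_decay i : exists A d, [/\ 0 < A, 0 < d & forall h, 0 < h -> h <= d ->
    Int (fun x => (cutoff_sol chi u i (x + h) - cutoff_sol chi u i x) ^+ 2) <= A * h `^ (3 / 2)].
Proof.
have [Cd Cd0 hF] := form_cutoff_sol_sup_le i (lt_trans rb0 rbr) r1r.
exact: (increment_sqr_decay (sol_kernel HS) (admissible_cutoff_sol HS hchi rb0 rbr0 i) (cutoff_sol_bdd_supp i)
  sqr_const_ge0 Cd0 (cutoff_sol_sqr_le i) (cutoff_sol_supp u hchi i) rbr hF).
Qed.

End Cut.

Lemma en_test_le j rc : 0 < rc -> rc < r1 -> exists C, 0 <= C /\ forall lam phi, 0 < lam -> admissible phi ->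
  (forall x, rc < `|x - x0| -> phi x = 0) ->
  L1le mu2 (fun z => `|phi z.1| * en (u j) z) (C * (lam * Int (fun x => phi x ^+ 2) + lam^-1)).
Proof.
move=> rc0 rcr.
have ra0 : 0 < (2 * rc + r1) / 3 by clra.
have rab : (2 * rc + r1) / 3 < (rc + 2 * r1) / 3 by clra.
have rbr : (rc + 2 * r1) / 3 < r1 by clra.
have [chi [L [L0 hchi]]] := exists_cutoff x0 ra0 rab.
have bW := cutoff_sol_bdd_supp hchi ra0 rab rbr j.
have [A [d [A0 d0 hA]]] := cutoff_sol_increment_decay hchi L0 ra0 rab rbr j.
pose de := Num.min d ((r1 - rc) / 3).
have de0 : 0 < de by rewrite lt_min d0 divr_gt0//; clra.
have ded : de <= d by rewrite ge_min lexx.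
have der : rc + de <= (2 * rc + r1) / 3 by have : de <= (r1 - rc) / 3 by [rewrite ge_min lexx orbT]; clra.
have [cJ hJ] := L1le_Jweight de0; have cJ0 := L1le_ge0 (hJ 0).
have hA' h : 0 < h -> h <= de -> _ := fun h0 hh => hA h h0 (le_trans hh ded).
have eW x : `|x - x0| <= (2 * rc + r1) / 3 -> cutoff_sol chi u j x = u j x.
  by move=> hx; rewrite /cutoff_sol (cutoff_eq1 hchi hx) mul1r.
eexists; split; last first.
  move=> lam phi l0 gp p0; exact: (L1le_test_en (sol_measurable HS j) (sol_le1 HS j) bW
    (sqr_const_ge0 L0 ra0 rab rbr) A0 de0 rc0 der
    (cutoff_sol_sqr_le hchi L0 ra0 rab rbr j) hA' eW hJ l0 (admissible_bdd_supp gp p0) p0).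
by rewrite addr_ge0 ?mulr_ge0 ?addr_ge0 ?mulr_ge0 ?invr_ge0 ?(ltW A0) ?(ltW de0) ?(ltW rc0)
  ?(sqr_const_ge0 L0 ra0 rab rbr).
Qed.

Lemma form_cutoff_sol_L2_le i chi L ra rb rc : cutoff chi x0 ra rb L -> 0 < L -> 0 < ra -> ra < rb -> rb < r1 ->
  0 < rc -> rc < r1 ->
  exists C, 0 < C /\ forall lam phi, 0 < lam -> admissible phi -> (forall x, rc < `|x - x0| -> phi x = 0) ->
  `|form a (cutoff_sol chi u i) phi| <= C * (lam * Int (fun x => phi x ^+ 2) + lam^-1).
Proof.
move=> hchi L0 ra0 rab rbr rc0 rcr.
have [_ L1 _ _] := sol_kernel HS; have Lp : 0 < Lam by clra.
have [Cj hCj] := choice (fun j => en_test_le j rc0 rcr).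
have C0 : 0 <= \sum_j Cj j by apply: sumr_ge0 => j _; case: (hCj j).
have M20 := L1le_ge0 (hm2 i).
have LL0 := cutoff_const_ge0 HS L0; set LL := cutoff_const Lam L in LL0.
pose C := 2 * Lam * (\sum_j Cj j) + (1 + M2 i) + LL * (1 + rc).
have Cp : 0 < C.
  have q1 : 0 <= 2 * Lam * (\sum_j Cj j) by rewrite !mulr_ge0// ltW.
  have q2 : 0 <= LL * (1 + rc) by rewrite mulr_ge0//; clra.
  by rewrite /C; clra.
exists C; split => // lam phi l0 gp p0; have bp := admissible_bdd_supp gp p0; have [mp _ _] := gp.
have hp := L1le_sqr bp; set I := Int _ in hp *.
have I0 : 0 <= I by apply: Int_ge0 => x; exact: sqr_ge0.
have li : 0 < lam^-1 by rewrite invr_gt0.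
have lI : 0 <= lam * I by rewrite mulr_ge0// ltW.
have h3 := L1le_of_sqr rc0 l0 bp p0; rewrite -/I in h3.
have h1 : L1le mu2 (fun z => `|phi z.1| * en_total u z) (\sum_j Cj j * (lam * I + lam^-1)).
  apply: eq_L1le (L1le_sum (index_enum 'I_N) (P := xpredT) (fun j _ => (hCj j).2 lam phi l0 gp p0)) => z.
  by rewrite -mulr_sumr.
have h2 : L1le mu (fun x => m i x * phi x) (lam / 2 * I + (2 * lam)^-1 * M2 i).
  have e1 : 0 <= lam / 2 by rewrite divr_ge0// ltW.
  have e2 : 0 <= (2 * lam)^-1 by rewrite invr_ge0 mulr_ge0// ltW.
  have := L1leD (L1leZ (lam / 2) hp) (L1leZ (2 * lam)^-1 (hm2 i)); rewrite (ger0_norm e1) (ger0_norm e2).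
  have [cm hcm] := sol_source HS i; have [mm _] := hcm.
  apply: L1le_dom; first by mes.
  move=> x; have := amgm `|phi x| `|m i x| (divr_gt0 l0 (ltr0Sn R 1)).
  rewrite normrM mulrC !real_normK ?num_real// => /le_trans; apply; apply: eqW; field; exact: lt0r_neq0.
have rb0 : 0 < rb by clra.
apply: le_trans (form_cutoff_mul_le HS hchi rb0 L0 gp _ h1 h2 h3) _.
  by move=> x hx; apply: p0; have := r1r; clra.
rewrite -/LL -mulr_suml /C -subr_ge0.
rewrite (_ : _ - _ = 2^-1 * (lam * I) + lam * I * M2 i + lam^-1 + M2 i / 2 * lam^-1
   + LL * (lam * I / 2 + rc * (lam * I) + lam^-1)).
  by nneg_weight.
by field; exact: lt0r_neq0.
Qed.

End SquareDual.

Section DifferenceQuotients.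
Variable R : realType.
Local Notation mu := (@lebesgue_measure R).
Local Notation mu2 := (mu \x mu)%E.
Variables (a W : R -> R) (Lam x0 rb rc h0 C : R).
Hypotheses (ok : elliptic_kernel a Lam) (gW : admissible W) (bW : bdd_supp W) (Ws : forall x, rb < `|x - x0| -> W x = 0)
  (h00 : 0 < h0) (rbc : rb + h0 <= rc) (C0 : 0 < C)
  (dual : forall lam phi, 0 < lam -> admissible phi -> (forall x, rc < `|x - x0| -> phi x = 0) ->
    `|form a W phi| <= C * (lam * Int (fun x => phi x ^+ 2) + lam^-1)).

Lemma form_scale_diff k f g : admissible f -> admissible g ->
  form a W (fun x => k * (f x - g x)) = k * (form a W f - form a W g).
Proof.
move=> gf gg; have [c1 h1] := L1le_form_admissible ok gW gf; have [c2 h2] := L1le_form_admissible ok gW gg.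
rewrite /form -(RintB h1 h2) -(RintZ _ (L1leB h1 h2)); apply: eq_Rint => z /=; ring.
Qed.

Lemma form_sum (s : seq nat) (f : nat -> R -> R) : (forall j, admissible (f j)) ->
  form a W (fun x => \sum_(j <- s) f j x) = \sum_(j <- s) form a W (f j).
Proof.
move=> gf; have [c hc] := choice (fun j => L1le_form_admissible ok gW (gf j)).
rewrite /form -(Rint_sum _ hc); apply: eq_Rint => z /=.
by rewrite -mulr_suml -mulr_sumr -sumrB.
Qed.

Let hh j := dyad h0 j.
Let v j := increment W (hh j).
Let E j := form a (v j) (v j).

Let hh0 j : 0 < hh j. Proof. exact: dyad_gt0. Qed.
Let Lp : 0 < Lam. Proof. by case: ok => _ L1 _ _; clra. Qed.
Let bv j : bdd_supp (v j). Proof. by apply: bdd_suppB => //; exact: bdd_supp_shift. Qed.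
Let gv j : admissible (v j). Proof. exact: admissible_increment. Qed.
Let pow_h j : 2 ^+ j = h0 * (hh j)^-1 :> R.
Proof. by rewrite /hh /dyad; field; rewrite !gt_eqF ?exprn_gt0. Qed.

Let E0 j : 0 <= E j.
Proof. by have := L1le_ge0 (L1le_en_form ok (gv j)); rewrite pmulr_rge0. Qed.

Let v_supp j x : rc < `|x - x0| -> v j x = 0 /\ v j (x - hh j) = 0.
Proof.
move=> hx; have hj := dyad_le j h00; have hx' : rb + hh j < `|x - x0| by rewrite /hh; clra.
by rewrite /v (increment_supp Ws (hh0 j) hx') (increment_supp_back Ws (hh0 j) hx').
Qed.

Let back_incr j x := v j (x - hh j) - v j x.
Let test n x := \sum_(0 <= j < n) 2 ^+ j * back_incr j x.
Let weighted_sum n := \sum_(0 <= j < n) 2 ^+ j * E j.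

Lemma admissible_back_incr j : admissible (back_incr j).
Proof. by apply: admissibleB => //; exact: admissible_shift (- hh j) (gv j). Qed.

Lemma admissible_test n : admissible (test n).
Proof. by apply: admissible_sum => j; apply: admissibleZ; exact: admissible_back_incr. Qed.

Lemma test_supp n x : rc < `|x - x0| -> test n x = 0.
Proof. by move=> hx; apply: big1 => j _; have [e1 e2] := v_supp j hx; rewrite /back_incr e1 e2 subrr mulr0. Qed.

Lemma form_test n : form a W (test n) = weighted_sum n.
Proof.
rewrite form_sum => [|j]; last by apply: admissibleZ; exact: admissible_back_incr.
apply: eq_bigr => j _; rewrite form_scale_diff//; last exact: admissible_shift (- hh j) (gv j).
by rewrite /E {2}/v /increment (form_increment (hh j) ok gW (gv j)).
Qed.

Lemma Int_test_sqr n : Int (fun x => test n x ^+ 2) = \sum_(0 <= j < n) 2 ^+ j *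
    (\sum_(0 <= i < n) 2 ^+ i * Int (fun x => (v j (x + hh i) - v j x) ^+ 2)).
Proof.
have bt j : bdd_supp (back_incr j) by apply: bdd_suppB => //; exact: bdd_supp_shift.
have -> : Int (fun x => test n x ^+ 2) = Int (fun x => \sum_(0 <= j < n) \sum_(0 <= i < n)
   2 ^+ j * 2 ^+ i * (back_incr i x * back_incr j x)).
  apply: eq_Int => x; rewrite expr2 {2}/test mulr_sumr; apply: eq_bigr => j _.
  by rewrite /test mulr_suml; apply: eq_bigr => i _; ring.
rewrite Int_sum => [|j]; last by apply: bdd_supp_sum => i; apply: bdd_suppZ; exact: bdd_suppM.
apply: eq_bigr => j _; rewrite Int_sum => [|i]; last by apply: bdd_suppZ; exact: bdd_suppM.
rewrite mulr_sumr; apply: eq_bigr => i _; rewrite IntZ; last exact: bdd_suppM.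
rewrite -mulrA Int_increment_swap//; congr (_ * (_ * _)); apply: eq_Int => x.
by rewrite expr2; congr (_ * _); rewrite /v /increment (addrAC x (hh j)); ring.
Qed.

Lemma Int_test_sqr_le n : Int (fun x => test n x ^+ 2) <= 24 * h0 * Lam * weighted_sum n.
Proof.
rewrite Int_test_sqr mulr_sumr; apply: ler_sum => j _.
rewrite mulrCA; apply: ler_wpM2l; first exact: exprn_ge0.
have := sum_increment_sqr_le n (bv j) h00 (L1le_en_form ok (gv j)); rewrite -/(E j) => H.
apply: le_trans (_ : h0 * (24 * (Lam * E j)) <= _); last by apply: eqW; ring.
apply: le_trans (ler_wpM2l (ltW h00) H); apply: eqW; rewrite mulr_sumr; apply: eq_bigr => i _.
by rewrite pow_h mulrA.
Qed.

(* Test with [sum_j 2^j D_(-h_j) D_(h_j) W]: its L2 norm is controlled by the sum to be bounded. *)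
Lemma weighted_energy n : weighted_sum n <= 96 * C ^+ 2 * h0 * Lam.
Proof.
have l0 : 0 < (48 * C * h0 * Lam)^-1 by rewrite invr_gt0 !mulr_gt0.
have Q0 : 0 <= weighted_sum n by apply: sumr_ge0 => j _; rewrite mulr_ge0 ?exprn_ge0.
have := dual l0 (admissible_test n) (test_supp n); rewrite form_test ger0_norm// invrK => D.
have hl : C * ((48 * C * h0 * Lam)^-1 * Int (fun x => test n x ^+ 2)) <= weighted_sum n / 2.
  apply: le_trans (_ : C * ((48 * C * h0 * Lam)^-1 * (24 * h0 * Lam * weighted_sum n)) <= _).
    by apply: ler_wpM2l; [exact: ltW|apply: ler_wpM2l; [exact: ltW|exact: Int_test_sqr_le]].
  by apply: eqW; field; rewrite !gt_eqF.
have : weighted_sum n <= weighted_sum n / 2 + C * (48 * C * h0 * Lam) by apply: le_trans D _; rewrite mulrDr lerD2r.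
rewrite (_ : C * (48 * C * h0 * Lam) = 96 * C ^+ 2 * h0 * Lam / 2); last by field.
by move: (96 * _ * _ * _) => X; clra.
Qed.

Definition quot j x := (dyad h0 j)^-1 * increment W (dyad h0 j) x.
Let quot_sqr j := Int (fun x => quot j x ^+ 2).

Lemma quot_bdd_supp j : bdd_supp (quot j). Proof. by apply: bdd_suppZ; exact: bv. Qed.

Lemma quot_step k : quot_sqr k.+1 = quot_sqr k + (hh k ^+ 2)^-1 * Int (fun x => (v k.+1 (x + hh k.+1) - v k.+1 x) ^+ 2).
Proof.
have sc j : quot_sqr j = (hh j ^+ 2)^-1 * Int (fun x => v j x ^+ 2).
  rewrite -IntZ; last exact: bdd_supp_sqr; apply: eq_Int => x.
  by rewrite /quot exprMn exprVn.
have h2 : hh k = 2 * hh k.+1 by rewrite /hh dyadS; field.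
have pl := parallelogram (hh k.+1) (bv k.+1).
have e : Int (fun x => (v k.+1 (x + hh k.+1) + v k.+1 x) ^+ 2) = Int (fun x => v k x ^+ 2).
  apply: eq_Int => x; congr (_ ^+ 2); rewrite /v /increment h2.
  by rewrite (_ : x + hh k.+1 + hh k.+1 = x + 2 * hh k.+1); ring.
rewrite e in pl; rewrite !sc.
have -> : Int (fun x => v k.+1 x ^+ 2) = 4^-1 * (4 * Int (fun x => v k.+1 x ^+ 2)) by rewrite mulrA mulVf ?mul1r.
by rewrite -pl h2; field; rewrite gt_eqF.
Qed.

Lemma le_quot_sqr j k : (j <= k)%N -> quot_sqr j <= quot_sqr k.
Proof.
move=> /subnK <-; elim: (k - j)%N => // n ih; apply: le_trans ih _; rewrite addSn quot_step lerDl.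
by rewrite mulr_ge0 ?inv_sqr_ge0//; apply: Int_ge0 => x; exact: sqr_ge0.
Qed.

Lemma quot_sqr_bounded : exists S, forall k, quot_sqr k <= S.
Proof.
exists (quot_sqr 0 + 6 * Lam / h0 * (96 * C ^+ 2 * h0 * Lam)) => k.
apply: le_trans (_ : quot_sqr 0 + 6 * Lam / h0 * (weighted_sum k.+1) <= _); last first.
  rewrite lerD2l; apply: ler_wpM2l; last exact: weighted_energy.
  by rewrite divr_ge0 ?mulr_ge0 ?(ltW Lp) ?(ltW h00).
elim: k => [|k ih].
  rewrite lerDl mulr_ge0 ?divr_ge0 ?mulr_ge0 ?(ltW Lp) ?(ltW h00)//.
  by apply: sumr_ge0 => j _; rewrite mulr_ge0 ?exprn_ge0.
rewrite quot_step /weighted_sum big_nat_recr//= mulrDr addrA; apply: lerD => //.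
have := sum_increment_sqr_le 1 (bv k.+1) (hh0 k.+1) (L1le_en_form ok (gv k.+1)); rewrite big_nat1 dyad0 -/(E k.+1).
have i0 : 0 <= 4^-1 / hh k.+1 by rewrite divr_ge0 ?invr_ge0 ?(ltW (hh0 _)).
move=> /(ler_wpM2l i0) H.
have e : (hh k ^+ 2)^-1 = 4^-1 / hh k.+1 * (hh k.+1)^-1.
  by rewrite (_ : hh k = 2 * hh k.+1); [field; rewrite gt_eqF|rewrite /hh dyadS; field].
rewrite e -mulrA; apply: le_trans H _; apply: eqW; rewrite pow_h; field; rewrite !gt_eqF//.
Qed.

Lemma quot_cauchy j k : (j <= k)%N -> Int (fun x => (quot k x - quot j x) ^+ 2) <= 20 * (quot_sqr k - quot_sqr j).
Proof.
rewrite leq_eqVlt => /orP[/eqP ->|jk].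
  rewrite subrr mulr0 (_ : Int _ = Int (fun=> 0)); first exact: Rint_le_bound (L1le0 _).
  by apply: eq_Int => x; rewrite subrr expr0n.
pose P := (2 ^ (k - j).-1)%N.
have P2 : (2 * P = 2 ^ (k - j))%N by rewrite /P -expnS prednK// subn_gt0.
have P0 : (0 < P)%N by rewrite /P expn_gt0.
have ek : hh j = (2 * P)%:R * hh k.
  rewrite P2 natrX /hh /dyad -{2}(subnK (ltnW jk)) exprD; field; rewrite !gt_eqF ?exprn_gt0//.
have tel n x : \sum_(0 <= i < n) quot k (x + hh k * i%:R) = (hh k)^-1 * (W (x + hh k * n%:R) - W x).
  elim: n => [|n ih]; first by rewrite big_geq// mulr0 addr0 subrr mulr0.
  rewrite big_nat_recr//= ih /quot /increment -mulrDr; congr (_ * _).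
  rewrite (_ : x + hh k * n%:R + dyad h0 k = x + hh k * n.+1%:R); first by ring.
  by rewrite -natr1 mulrDr mulr1 addrA.
have avg : quot j = translate_average (quot k) (hh k) (2 * P); last first.
  by rewrite /quot_sqr avg; exact: (translate_average_dist (hh k) (quot_bdd_supp k) P0).
apply/funext => x; rewrite /translate_average tel /quot /increment -/(hh j) ek invfM [hh k * _]mulrC -mulrA;
  congr (_ * (_ * (W _ - _))); ring.
Qed.

End DifferenceQuotients.

Section L2Limit.
Variable R : realType.
Local Notation mu := (@lebesgue_measure R).

Section Sequence.
Variable f : nat -> R -> R.
Hypotheses (bf : forall j, bdd_supp (f j)) (hf : forall j, Int (fun x => (f j.+1 x - f j x) ^+ 2) <= 16^-1 ^+ j).

Lemma measurable_term j : measurable_fun setT (f j). Proof. by case: (bf j). Qed.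

Lemma quarter_itv : 0 <= (4^-1 : R) < 1. Proof. by rewrite invr_ge0 invf_lt1//; clra. Qed.

Lemma exists_increment_majorant : exists F, [/\ L1le mu F (1 - 4^-1)^-1, forall x, 0 <= F x &
  {ae mu, forall x, forall j, 4 ^+ j * (f j.+1 x - f j x) ^+ 2 <= F x}].
Proof.
have /andP[q0 q1] := quarter_itv; pose S n x := \sum_(0 <= j < n) 4 ^+ j * (f j.+1 x - f j x) ^+ 2.
have hS n : L1le mu (S n) (1 - 4^-1)^-1.
  have h j : L1le mu (fun x => 4 ^+ j * (f j.+1 x - f j x) ^+ 2) (4^-1 ^+ j).
    have := L1leZ (4 ^+ j) (L1le_sqr (bdd_suppB (bf j.+1) (bf j))); rewrite ger0_norm ?exprn_ge0//; apply: L1leW.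
    apply: le_trans (ler_wpM2l (exprn_ge0 _ (ler0n R 4)) (hf j)) _; apply: eqW.
    by rewrite -exprMn; congr (_ ^+ _); field.
  exact: (L1leW (geometric_sum_le n q0 q1) (L1le_sum _ (fun j _ => h j))).
have t0 j x : 0 <= 4 ^+ j * (f j.+1 x - f j x) ^+ 2 by apply: mulr_ge0; [exact: exprn_ge0|exact: sqr_ge0].
have S0 n x : 0 <= S n x by exact: sumr_ge0.
have [|F [hF F0 FS]] := L1le_levi hS S0; first by move=> n x; rewrite /S big_nat_recr//= lerDl.
exists F; split => //; apply: ae_imp FS => x hx j; apply: le_trans (hx j.+1).
by rewrite /S big_nat_recr//= lerDr; exact: S0.
Qed.

Section Majorant.
Variable F : R -> R.
Hypotheses (hF : L1le mu F (1 - 4^-1)^-1) (F0 : forall x, 0 <= F x)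
  (FS : {ae mu, forall x, forall j, 4 ^+ j * (f j.+1 x - f j x) ^+ 2 <= F x}).
Let rt x := F x `^ 2^-1.
Let step j x := clamp (- (2^-1 ^+ j * rt x)) (2^-1 ^+ j * rt x) (f j.+1 x - f j x).
Let partial n x := f 0%N x + \sum_(0 <= j < n) step j x.

Lemma root_sqr x : rt x ^+ 2 = F x. Proof. by rewrite /rt powR12_sqrt// sqr_sqrtr. Qed.

Lemma root_ge0 x : 0 <= rt x. Proof. exact: powR_ge0. Qed.

Lemma half_root_ge0 j x : 0 <= 2^-1 ^+ j * rt x.
Proof. by rewrite mulr_ge0 ?root_ge0// exprn_ge0// invr_ge0. Qed.

Lemma step_le j x : `|step j x| <= rt x * 2^-1 ^+ j.
Proof. by rewrite [leRHS]mulrC ler_norml; apply: clamp_itv; have := half_root_ge0 j x; clra. Qed.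

Lemma measurable_root : measurable_fun setT rt.
Proof. by have mF := L1le_measurable hF; rewrite /rt; mes. Qed.

Lemma measurable_partial n : measurable_fun setT (partial n).
Proof.
have mrt := measurable_root; apply: measurable_funD; first exact: measurable_term.
by apply: measurable_sum => j; have := measurable_term j; have := measurable_term j.+1 => ? ?; rewrite /step /clamp;
  mes.
Qed.

Lemma exists_partial_limit : exists g, forall x n, `|partial n x - g x| <= rt x * 2^-1 ^+ n / (1 - 2^-1).
Proof.
suff lim x : exists l, forall n, `|partial n x - l| <= rt x * 2^-1 ^+ n / (1 - 2^-1).
  by have [g hg] := choice lim; exists g.
apply: geometric_limit => [||n]; [by rewrite invr_ge0|by rewrite invf_lt1; clra|].
by rewrite /partial big_nat_recr//= addrA [_ + step n x]addrC addrK; exact: step_le.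
Qed.

Lemma measurable_partial_limit g : (forall x n, `|partial n x - g x| <= rt x * 2^-1 ^+ n / (1 - 2^-1)) ->
  measurable_fun setT g.
Proof.
move=> hg; apply: (@measurable_fun_cvg _ _ _ _ (fun n => partial n)) => [n|x _]; first exact: measurable_partial.
apply/cvgrPdist_le => e e0.
have B0 : 0 <= rt x * 2 by rewrite mulr_ge0 ?root_ge0.
have h2 : (0 : R) <= 2^-1 by rewrite invr_ge0.
have h21 : (2^-1 : R) < 1 by rewrite invf_lt1; clra.
have [n0 hn0] := exists_mul_exp_le B0 h2 h21 e0; exists n0 => // n /= n0n.
rewrite distrC; apply: le_trans (hg x n) _; apply: le_trans (hn0 n n0n).
by apply: eqW; field.
Qed.

Lemma partial_eq_ae : {ae mu, forall x, forall n, partial n x = f n x}.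
Proof.
apply: ae_imp FS => x hx n; rewrite /partial (eq_bigr (fun j => f j.+1 x - f j x)) => [|j _].
  by rewrite telescope_sumr// addrC subrK.
apply: clamp_id; rewrite -ler_norml -[leRHS](ger0_norm (half_root_ge0 j x)).
rewrite -ler_sqr ?nnegrE// !sqr_normr exprMn root_sqr.
have p4 : 0 < 4 ^+ j :> R by rewrite exprn_gt0.
rewrite -(ler_pM2l p4); apply: le_trans (hx j) _.
apply: eqW; rewrite mulrA -exprM mulnC exprM -exprMn.
by rewrite (_ : 4 * 2^-1 ^+ 2 = 1) ?expr1n ?mul1r//; field.
Qed.

Lemma L1le_limit_dist g n : (forall x n, `|partial n x - g x| <= rt x * 2^-1 ^+ n / (1 - 2^-1)) ->
  L1le mu (fun x => (g x - f n x) ^+ 2) (4 * (1 - 4^-1)^-1 * 4^-1 ^+ n).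
Proof.
move=> hg; have mg := measurable_partial_limit hg; have mn := measurable_term n.
have := L1leZ (4 * 4^-1 ^+ n) hF; rewrite ger0_norm ?mulr_ge0 ?exprn_ge0 ?invr_ge0// mulrAC.
apply: L1le_ae_dom; first by mes.
apply: ae_imp partial_eq_ae => x hx; rewrite ger0_norm ?sqr_ge0// -hx sqr_distC -[in leRHS]root_sqr.
apply: le_trans (norm_le_sqr (hg x n)) _.
apply: eqW; rewrite (_ : 4^-1 = 2^-1 ^+ 2); last by field.
by rewrite -exprM mulnC exprM; field.
Qed.

End Majorant.

Lemma L2_limit : exists (g : R -> R) c, [/\ measurable_fun setT g, 0 <= c &
  forall n, L1le mu (fun x => (g x - f n x) ^+ 2) (c * 4^-1 ^+ n)].
Proof.
have [F [hF F0 FS]] := exists_increment_majorant; have [g hg] := exists_partial_limit F.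
have /andP[_ q1] := quarter_itv.
exists g, (4 * (1 - 4^-1)^-1); split; first exact: measurable_partial_limit hF _ hg.
  by rewrite mulr_ge0// invr_ge0 subr_ge0 ltW.
by move=> n; exact: L1le_limit_dist hF F0 FS _ n hg.
Qed.

End Sequence.

Lemma fast_subsequence (N : nat -> R) S : (forall j k, (j <= k)%N -> N j <= N k) -> (forall k, N k <= S) ->
  exists s : nat -> nat, forall j, [/\ (j <= s j)%N, (s j <= s j.+1)%N & N (s j.+1) - N (s j) <= 20^-1 * 16^-1 ^+ j].
Proof.
move=> mono bnd.
have hs : has_sup (range N) by split; [exists (N 0%N), 0%N|exists S => _ [k _ <-]].
have pick j : exists k0, forall k, N k - N k0 <= 20^-1 * 16^-1 ^+ j.
  have e0 : 0 < 20^-1 * 16^-1 ^+ j :> R by rewrite mulr_gt0 ?exprn_gt0 ?invr_gt0.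
  have [_ [k0 _ <-] h] := sup_adherent e0 hs; exists k0 => k.
  have : N k <= sup (range N) by apply: ub_le_sup; [case: hs|exists k].
  by move: (20^-1 * _) h => t; clra.
have [p hp] := choice pick.
pose s := fix s j := if j is i.+1 then maxn (s i).+1 (p i.+1) else p 0%N.
have ps j : (p j <= s j)%N by case: j => //= j; rewrite leq_maxr.
have inc_s j : (s j < s j.+1)%N by rewrite /= leq_maxl.
exists s => j; split; [|exact: ltnW|].
  by elim: j => // j ih; apply: leq_ltn_trans ih (inc_s j).
by apply: le_trans (hp j (s j.+1)); rewrite lerD2l lerN2; apply: mono.
Qed.

End L2Limit.

Section WeakDerivative.
Variable R : realType.
Local Notation mu := (@lebesgue_measure R).

Lemma derive1_eq0_off (K : set R) (f : R -> R) x : closed K -> (forall y, ~ K y -> f y = 0) -> ~ K x -> derive1 f x = 0.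
Proof.
move=> cK f0 Kx; rewrite derive1E (near_eq_derive (g := cst 0)) ?derive_cst//.
have : nbhs x (~` K) by apply: open_nbhs_nbhs; split => //; exact: closed_openC.
by apply: filterS => y /f0.
Qed.

Lemma mean_value (f : R -> R) x y : (forall z, derivable f z 1) -> x <= y ->
  exists2 z, x <= z <= y & f y - f x = derive1 f z * (y - x).
Proof.
move=> df xy; have [| |z] := @MVT_segment _ f (derive1 f) x y xy.
- by move=> z _; rewrite derive1E; exact: derivableP.
- apply: continuous_subspaceT => z; apply: differentiable_continuous; exact/derivable1_diffP.
by rewrite in_itv/= => hz e; exists z.
Qed.

Lemma test_fun_taylor D (phi : R -> R) : test_fun D phi ->
  [/\ bdd_supp phi, bdd_supp (derive1 phi), (forall x, ~ D x -> phi x = 0 /\ derive1 phi x = 0) &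
   exists B, forall x h, 0 <= h -> `|phi (x - h) - phi x + h * derive1 phi x| <= B * h ^+ 2].
Proof.
move=> [df [K [cK [KD phi0]]]].
have clK : closed K by apply: compact_closed => //; exact: Rhausdorff.
have d0 x : derivable phi x 1 := df 0%N x.
have d1 x : derivable (derive1 phi) x 1 := df 1%N x.
have d2 x : derivable (derive1 (derive1 phi)) x 1 := df 2%N x.
have p1 x : ~ K x -> derive1 phi x = 0 by exact: derive1_eq0_off.
have p2 x : ~ K x -> derive1 (derive1 phi) x = 0 by exact: derive1_eq0_off.
have cont (f : R -> R) : (forall x, derivable f x 1) -> continuous f.
  by move=> h x; apply: differentiable_continuous; exact/derivable1_diffP.
have bnd (f : R -> R) : continuous f -> (forall x, ~ K x -> f x = 0) ->
    exists2 B, 0 <= B & forall x, `|f x| <= B.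
  move=> cf f0; have := compact_bounded (continuous_compact (continuous_subspaceT cf) cK).
  move=> [M [Mr hM]]; exists (`|M| + 1); first by apply: addr_ge0.
  move=> x; have [Kx|Kx] := pselect (K x); last by rewrite f0// normr0; apply: addr_ge0.
  by apply: (hM (`|M| + 1)) => /=; [have := ler_norm M; clra|exists x].
have [K1 hK1] : exists K1, forall x, K1 < `|x| -> ~ K x.
  have [M [Mr hM]] := compact_bounded cK; exists (`|M| + 1) => x hx Kx.
  have : `|x| <= `|M| + 1 by apply: (hM (`|M| + 1)) => //; have := ler_norm M; clra.
  by clra.
have bc (f : R -> R) : continuous f -> (forall x, ~ K x -> f x = 0) -> bdd_supp f.
  move=> cf f0; have [B B0 hB] := bnd f cf f0; split; first exact: continuous_measurable_fun.
  by exists B, K1; split => // x /hK1; exact: f0.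
split; [exact: bc (cont _ d0) phi0|exact: bc (cont _ d1) p1| |].
  by move=> x Dx; split; [apply: phi0 => /KD|apply: p1 => /KD].
have [B B0 hB] := bnd _ (cont _ d2) p2; exists B => x h h0.
have xh : x - h <= x by clra.
have [c /andP[c1 c2] e1] := mean_value d0 xh.
have [d _ e2] := mean_value d1 c2.
have -> : phi (x - h) - phi x + h * derive1 phi x = derive1 (derive1 phi) d * ((x - c) * h).
  rewrite mulrA -e2; have -> : phi (x - h) = phi x - derive1 phi c * (x - (x - h)) by rewrite -e1; ring.
  ring.
rewrite normrM; apply: ler_pM => //.
rewrite ger0_norm ?mulr_ge0//; last by clra.
by rewrite expr2; apply: ler_wpM2r => //; clra.
Qed.

Section QuotientLimit.
Variables (W phi : R -> R) (D : set R) (h0 : R).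
Hypotheses (bW : bdd_supp W) (h00 : 0 < h0) (tf : test_fun D phi).

Lemma Int_quot_mul j : let h := dyad h0 j in
  Int (fun x => quot W h0 j x * phi x) + Int (fun x => W x * derive1 phi x)
    = Int (fun x => h^-1 * (W x * (phi (x - h) - phi x + h * derive1 phi x))).
Proof.
move=> h; have [bp bp' _ _] := test_fun_taylor tf; have hp : 0 < h by exact: dyad_gt0.
have b1 : bdd_supp (fun x => W (x + h) * phi x) by apply: bdd_suppM => //; exact: bdd_supp_shift.
have b2 := bdd_suppM bW bp; have b4 := bdd_suppM bW bp'.
have b3 : bdd_supp (fun x => W x * phi (x - h)) by apply: bdd_suppM => //; exact: bdd_supp_shift.
have -> : Int (fun x => quot W h0 j x * phi x) = h^-1 * (Int (fun x => W x * phi (x - h)) - Int (fun x => W x * phi x)).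
  have -> : Int (fun x => W x * phi (x - h)) = Int (fun x => W (x + h) * phi x).
    by rewrite -(Int_shift h b3); apply: eq_Int => x; rewrite addrK.
  rewrite -IntB// -IntZ; last exact: bdd_suppB.
  by apply: eq_Int => x; rewrite /quot /increment -/h; ring.
rewrite -[X in _ + X]mul1r -(mulVf (lt0r_neq0 hp)) -mulrA -mulrDr -IntZ// -IntB// -IntD;
  [|exact: bdd_suppB|exact: bdd_suppZ].
by rewrite -IntZ; [apply: eq_Int => x; ring|apply: bdd_suppD; [exact: bdd_suppB|exact: bdd_suppZ]].
Qed.

Lemma exists_quot_mul_le : exists2 C, 0 <= C & forall j,
  `|Int (fun x => quot W h0 j x * phi x) + Int (fun x => W x * derive1 phi x)| <= C * 2^-1 ^+ j.
Proof.
have [[mp _] [mp' _] _ [B hB]] := test_fun_taylor tf; have [mW _] := bW.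
have [cW hW] := bdd_supp_L1le bW; have cW0 := L1le_ge0 hW.
exists (`|B| * h0 * cW) => [|j]; first by rewrite !mulr_ge0// ltW.
rewrite Int_quot_mul; set h := dyad h0 j; have hp : 0 < h by exact: dyad_gt0.
have bB : 0 <= `|B| * h by rewrite mulr_ge0// ltW.
have := L1leZ (`|B| * h) (L1le_norm hW); rewrite (ger0_norm bB) => H.
rewrite (_ : `|B| * h0 * cW * 2^-1 ^+ j = `|B| * h * cW); last by rewrite /h /dyad exprVn; ring.
apply: (normr_Rint_le (L1le_dom _ _ H)); first by mes.
move=> x; rewrite !normrM normfV (gtr0_norm hp) mulrCA mulrC; apply: ler_wpM2r => //.
rewrite ler_pdivrMl//; apply: le_trans (hB x h (ltW hp)) _.
by apply: le_trans (ler_wpM2r (sqr_ge0 h) (ler_norm B)) _; apply: eqW; ring.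
Qed.

Lemma quot_limit_weak (s : nat -> nat) (g : R -> R) c : (forall n, (n <= s n)%N) ->
  measurable_fun setT g -> (forall n, L1le mu (fun x => (g x - quot W h0 (s n) x) ^+ 2) (c * 4^-1 ^+ n)) ->
  Int (fun x => W x * derive1 phi x) = - Int (fun x => g x * phi x).
Proof.
move=> hs mg hg; have [bp _ _ _] := test_fun_taylor tf; have [mp _] := bp.
have bq n := quot_bdd_supp h0 bW (s n); have [C C0 hC] := exists_quot_mul_le.
have hp := L1le_sqr bp; set P := Int _ in hp; have P0 : 0 <= P := L1le_ge0 hp.
have c0 : 0 <= c by have := L1le_ge0 (hg 0%N); rewrite expr0 mulr1.
have h2 : (0 : R) <= 2^-1 by rewrite invr_ge0.
have h21 : (2^-1 : R) < 1 by rewrite invf_lt1; clra.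
have near n : L1le mu (fun x => (g x - quot W h0 (s n) x) * phi x) ((c + P) * 2^-1 ^+ n).
  have [mq _] := bq n; apply: (L1le_cauchy_schwarz _ _ _ _ (hg n) hp); [by mes|exact: mp| |].
    by rewrite mulr_ge0 ?exprn_ge0// addr_ge0.
  rewrite exprMn -exprM mulnC exprM (_ : 2^-1 ^+ 2 = 4^-1); last by field.
  rewrite mulrAC; apply: ler_wpM2r; first by rewrite exprn_ge0// invr_ge0.
  by have := sqr_ge0 c; have := sqr_ge0 P; have := mulr_ge0 c0 P0; clra.
apply/eqP; rewrite -addr_eq0 -normr_le0; apply/ler_addgt0Pl => e e0; rewrite addr0.
have CP0 : 0 <= C + (c + P) by rewrite !addr_ge0.
have [n /(_ n (leqnn n)) hn] := exists_mul_exp_le CP0 h2 h21 e0; apply: le_trans hn.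
have [cq hq] := bdd_supp_L1le (bdd_suppM (bq n) bp).
rewrite (_ : Int (fun x => g x * phi x) = Int (fun x => quot W h0 (s n) x * phi x)
  + Int (fun x => (g x - quot W h0 (s n) x) * phi x)); last first.
  by rewrite /Int -(RintD hq (near n)); apply: eq_Rint => x /=; ring.
rewrite addrA (addrC (Int (fun x => W x * _))) mulrDl; apply: le_trans (ler_normD _ _) _; apply: lerD.
  apply: le_trans (hC (s n)) _; apply: ler_wpM2l => //; rewrite !exprVn lef_pV2 ?posrE ?exprn_gt0//.
  by rewrite ler_weXn2l// ler1n.
exact: normr_Rint_le (near n).
Qed.

End QuotientLimit.

End WeakDerivative.

Section SolutionDerivative.
Variables (R : realType) (N : nat).
Local Notation mu := (@lebesgue_measure R).
Variables (a chi : R -> R) (Lam L : R) (u m : 'I_N -> R -> R) (x0 r0 r1 ra rb K : R) (M2 : 'I_N -> R).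
Hypotheses (HS : solution a Lam u m x0 r0) (r1r : r1 < r0) (K0 : 0 <= K)
  (hu : forall i x y, `|x - x0| <= r1 -> `|y - x0| <= r1 -> (u i x - u i y) ^+ 2 <= K * `|x - y|)
  (hm2 : forall i, L1le mu (fun x => m i x ^+ 2) (M2 i))
  (hchi : cutoff chi x0 ra rb L) (L0 : 0 < L) (ra0 : 0 < ra) (rab : ra < rb) (rbr : rb < r1).

Lemma exists_weak_derivative i : exists g : R -> R, [/\ measurable_fun setT g, exists c, L1le mu (fun x => g x ^+ 2) c &
  forall D phi, test_fun D phi -> Int (fun x => cutoff_sol chi u i x * derive1 phi x) = - Int (fun x => g x * phi x)].
Proof.
have gW := admissible_cutoff_sol HS hchi (lt_trans ra0 rab) (ltW (lt_trans rbr r1r)) i.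
have bW := cutoff_sol_bdd_supp HS r1r hchi ra0 rab rbr i.
pose h0 := (r1 - rb) / 2; pose rc := (rb + r1) / 2.
have h00 : 0 < h0 by rewrite /h0; clra.
have rc0 : 0 < rc by rewrite /rc; clra.
have rcr : rc < r1 by rewrite /rc; clra.
have bc : rb + h0 <= rc by rewrite /rc /h0; clra.
have [C [C0 hC]] := form_cutoff_sol_L2_le HS r1r K0 hu hm2 i hchi L0 ra0 rab rbr rc0 rcr.
have [S hS] := quot_sqr_bounded (sol_kernel HS) gW bW (cutoff_sol_supp u hchi i) h00 bc C0 hC.
have [s hs] := fast_subsequence (le_quot_sqr bW h00) hS.
have bq j := quot_bdd_supp h0 bW (s j).
have [|g [c [mg _ hg]]] := L2_limit bq.
  move=> j; have [_ s1 s2] := hs j.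
  by apply: le_trans (quot_cauchy _ bW s1) _; move: (16^-1 ^+ j) s2 => t; clra.
exists g; split => // [|D phi tf]; last by apply: (quot_limit_weak bW h00 tf _ mg hg) => j; case: (hs j).
eexists; apply: L1le_dom (L1leD (L1leZ 2 (hg 0%N)) (L1leZ 2 (L1le_sqr (bq 0%N)))); first by mes.
move=> x; rewrite ger0_norm ?sqr_ge0// -mulrDr.
by apply: le_trans (sqrD2_le _ _); rewrite subrK.
Qed.

Lemma weak_derivative_integral (w W g phi : R -> R) r c : measurable_fun setT w -> bdd_supp W ->
  measurable_fun setT g -> L1le mu (fun x => g x ^+ 2) c -> test_fun (ball x0 r) phi ->
  {ae mu, forall x, ball x0 r x -> w x = W x} ->
  Int (fun x => W x * derive1 phi x) = - Int (fun x => g x * phi x) ->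
  (\int[mu]_(x in ball x0 r) (w x * derive1 phi x)%:E = - \int[mu]_(x in ball x0 r) (g x * phi x)%:E)%E.
Proof.
move=> mw bW mg hc tp wW weak; have [bp bp' off _] := test_fun_taylor tp.
have [mp _] := bp; have [mp' _] := bp'; have [mW _] := bW.
have supp (F : R -> R) : (forall x, ~ ball x0 r x -> F x = 0) ->
    (\int[mu]_(x in ball x0 r) (F x)%:E = \int[mu]_x (F x)%:E)%E.
  by move=> h; apply: integral_supp => x /h ->.
rewrite (supp (fun x => w x * _)) => [|x /off[_ ->]]; last by rewrite mulr0.
rewrite (supp (fun x => g x * _)) => [|x /off[-> _]]; last by rewrite mulr0.
have [c1 hc1] := bdd_supp_L1le (bdd_suppM bW bp').
have hgp : L1le mu (fun x => g x * phi x) (c + Int (fun x => phi x ^+ 2)).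
  apply: L1le_dom (L1leD hc (L1le_sqr bp)) => [|x]; first by mes.
  by have := amgm_norm (g x) (phi x) (ltr01 : 0 < (1 : R)); rewrite mul1r divr1.
rewrite (EFin_Rintegral hgp) -EFinN -weak -(EFin_Rintegral hc1).
apply: ae_eq_integral => //; [by apply/measurable_EFinP; mes|by apply/measurable_EFinP; mes|].
apply: ae_imp wW => x wx _; congr EFin.
by have [/wx ->//|/off[_ ->]] := pselect (ball x0 r x); rewrite !mulr0.
Qed.

End SolutionDerivative.

Section W12Main.
Variables (R : realType) (N : nat).
Local Notation mu := (@lebesgue_measure R).
Variables (Lam : R) (a : R -> R) (Om : set R) (x0 r : R) (u m : R -> 'I_N -> R).
Hypotheses (N2 : (2 <= N)%N) (ok : elliptic_kernel a Lam) (oOm : open Om) (r0 : 0 < r)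
  (sOm : closure (ball x0 (2 * r)) `<=` Om) (hm : Lp_on 1 Om m) (hw : weak_solution a Om u m).

Lemma measurable_weak_solution i : measurable_fun setT (fun x => u x i).
Proof. by case: hw => [[h _] _]; exact: h. Qed.

Lemma weak_solution_Lp2 : Lp_on 2 (ball x0 r) u.
Proof.
move=> i; have mui := measurable_weak_solution i; split; first exact: measurable_funTS.
case: hw => [[_ [/(_ i)[_ h] _]] _]; apply: le_lt_trans h; apply: ge0_subset_integral => //.
- exact: measurable_ball.
- exact: open_measurable.
- by apply/measurable_EFinP; apply: measurable_funTS; mes.
- by move=> x /ballP hx; apply: sOm; apply: subset_closure; apply/ballP; clra.
Qed.

Lemma Lp2_of_L1le_sqr (D : set R) (g : 'I_N -> R -> R) : measurable D ->
  (forall i, measurable_fun setT (g i) /\ exists c, L1le mu (fun x => g i x ^+ 2) c) -> Lp_on 2 D (fun x i => g i x).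
Proof.
move=> mD hg i; have [mg [c [_ hc]]] := hg i; split; first exact: measurable_funTS.
apply: le_lt_trans (ltry c); apply: le_trans hc.
apply: (@le_trans _ _ (\int[mu]_x (`|g i x| `^ 2)%:E)%E).
  by apply: ge0_subset_integral => //; apply/measurable_EFinP; mes.
by apply: eqW; apply: eq_integral => x _; rewrite powR_mulrn// normrX.
Qed.

Lemma weak_solution_W12 : Lp_on 2 (ball x0 (2 * r)) m -> W12_on (ball x0 r) u.
Proof.
move=> h2; have q0 : 0 < r * (7 / 4) by clra.
have q1 : r * (7 / 4) < 2 * r by clra.
have [v [HV uv _ [C [C0 hC]]]] := exists_holder_representative N2 ok oOm r0 sOm hm hw (ltr1n R 2) h2 q0 q1.
have hv i x y : `|x - x0| <= r * (7 / 4) -> `|y - x0| <= r * (7 / 4) -> (v i x - v i y) ^+ 2 <= C ^+ 2 * `|x - y|.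
  move=> hx hy; apply: le_trans (norm_le_sqr (hC i x y hx hy)) _.
  rewrite (_ : 1 - 2^-1 = 2^-1); last by field.
  by rewrite powR12_sqrt// exprMn sqr_sqrtr.
have [M2 hM2] := choice (fun i => L1le_powR_source oOm sOm hm i (ltr0n R 2) h2).
have hm2 i : L1le mu (fun x => source x0 r m i x ^+ 2) (M2 i).
  by apply: eq_L1le (hM2 i) => x; rewrite powR_mulrn// sqr_normr.
have a0 : 0 < r * (5 / 4) by clra.
have ab : r * (5 / 4) < r * (3 / 2) by clra.
have br : r * (3 / 2) < r * (7 / 4) by clra.
have [chi [L [L0 hchi]]] := exists_cutoff x0 a0 ab.
have [g hg] := choice (exists_weak_derivative HV q1 (sqr_ge0 C) hv hm2 hchi L0 a0 ab br).
split; first exact: weak_solution_Lp2.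
exists (fun x i => g i x); split=> [|i phi tp].
  by apply: Lp2_of_L1le_sqr => [|i]; [exact: measurable_ball|case: (hg i)].
have [mg [c hc] weak] := hg i; have bW := cutoff_sol_bdd_supp HV q1 hchi a0 ab br i.
apply: (weak_derivative_integral (measurable_weak_solution i) bW mg hc tp _ (weak _ _ tp)).
apply: ae_imp (uv i) => x ux /ballP hx; rewrite ux /cutoff_sol (cutoff_eq1 hchi) ?mul1r//; clra.
Qed.

End W12Main.

Theorem mainTheorem3 (R : realType) (N : nat) (Lam : R) (a : R -> R)
    (Om : set R) (x0 r : R) (u mu : R -> 'I_N -> R) :
  (2 <= N)%N -> 1 <= Lam ->
  measurable_fun setT a ->
  (forall xi, a xi = a (- xi)) ->
  (forall xi, Lam^-1 <= a xi <= Lam) ->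
  open Om -> 0 < r ->
  compact (closure (ball x0 (2 * r))) -> closure (ball x0 (2 * r)) `<=` Om ->
  Lp_on 1 Om mu ->
  weak_solution a Om u mu ->
  (forall gam : R, 1 < gam -> Lp_on gam (ball x0 (2 * r)) mu ->
     holder_on (1 - gam^-1) (ball x0 r) u) /\
  ((forall xi, a xi = 1) -> Lp_on 2 (ball x0 (2 * r)) mu ->
     W12_on (ball x0 r) u).
Proof.
move=> N2 L1 ma sa ab oOm r0 _ sOm hm hw; have ok : elliptic_kernel a Lam by split.
split; first by move=> gam; exact: weak_solution_holder N2 ok oOm r0 sOm hm hw gam.
by move=> _; exact: weak_solution_W12 N2 ok oOm r0 sOm hm hw.
Qed.
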